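(* Let $m\ge1$ be an integer, $r>0$, and let $\mathcal{E}:\ z''=\frac{P(w)}{w^m}z'+\frac{Q(w)}{w^{2m}}z$ be an $m$-admissible ODE with $w\in\Delta_r$ (i.e. $P,Q$ are holomorphic in the disc $\Delta_r=\{|w|<r\}$). Then $\mathcal{E}$ has a positive real structure if and only if $P$ and $Q$ have the form $$P(w)=2i\,a(w)-m\,w^{m-1},\qquad Q(w)=b(w)+i\,w^m a'(w),$$ where $a(w)=\sum_{j\ge0}a_jw^j$ and $b(w)=\sum_{j\ge0}b_jw^j$ are power series convergent in $\Delta_r$ with real coefficients $a_j,b_j\in\mathbb{R}$. Moreover, if $\mathcal{E}$ has a positive real structure, then the associated real hypersurface $M\subset\mathbb{C}^2$ is Levi nondegenerate and spherical outside the complex locus $X=\{w=0\}$.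
   Context: Notation: $\Delta_\varepsilon=\{|w|<\varepsilon\}\subset\mathbb{C}$; coordinates in $\mathbb{C}^2$ are $(z,w)$, $w=u+iv$. An $m$-admissible ODE ($m\ge1$) is a linear ODE $z''=\frac{P(w)}{w^m}z'+\frac{Q(w)}{w^{2m}}z$ for $z=z(w)$, with $P,Q$ holomorphic in some disc centred at $0$. Its inverse ODE (satisfied by inverse functions $w(z)$ of solutions $z(w)$) is $w''=-\frac{P(w)}{w^m}(w')^2-\frac{Q(w)}{w^{2m}}(w')^3z$. A positive (resp. negative) $m$-admissible Segre family is a family of curves in a polydisc $\Delta_\delta\times\Delta_\varepsilon$, depending antiholomorphically on parameters $(\xi,\eta)\in\Delta_\delta\times\Delta_\varepsilon$, of the form $w=\bar\eta\,e^{\pm i\bar\eta^{m-1}\psi(z\bar\xi,\bar\eta)}$ with sign $+$ (resp. $-$), where $\psi(x,y)=x+\sum_{k\ge2}\psi_k(y)x^k$ is holomorphic in $\Delta_{\delta^2}\times\Delta_\varepsilon$. The curve with parameters $p=(\xi,\eta)$ is the Segre variety $Q_p$; $X=\{w=0\}$ is the singular locus. The family is associated with an $m$-admissible ODE $\mathcal{E}$ if, after shrinking the polydisc, all $Q_p$ with $p\notin X$, considered as graphs $w=w(z)$, satisfy the inverse ODE of $\mathcal{E}$. Every $m$-admissible ODE $\mathcal{E}$ has a unique (up to shrinking the polydisc) associated positive $m$-admissible Segre family $\mathcal{S}^+_{\mathcal{E}}$. An $m$-admissible real hypersurface is a real-analytic hypersurface through $0$ of the form $v=u^m\big(\pm\frac12|z|^2+\sum_{k\ge2}h_k(u)|z|^{2k}\big)$.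 Solving its equation for $w$ as $w=\rho(z,\bar z,\bar w)$ with $\rho$ holomorphic, its Segre family is $\{w=\rho(z,\bar\xi,\bar\eta)\}$. $\mathcal{E}$ has a positive real structure if $\mathcal{S}^+_{\mathcal{E}}$ is (near the origin) the Segre family of an $m$-admissible real hypersurface $M$; this $M$ (a germ at $0$) is called associated with $\mathcal{E}$. A real hypersurface in $\mathbb{C}^2$ is spherical at a point if near that point it is biholomorphic to an open piece of the standard sphere $S^3\subset\mathbb{C}^2$. *)

(* Defs.v *)
From Stdlib Require Import Reals.
From Coquelicot Require Import Coquelicot.
Local Open Scope R_scope.
Local Open Scope C_scope.

Definition cdisc (r : R) (w : C) : Prop := (Cmod w < r)%R.

Definition Cexp (z : C) : C :=
  ((exp (Re z) * cos (Im z))%R, (exp (Re z) * sin (Im z))%R).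

(* Complex Frechet differentiability at every point of the set [U], which is
   open wherever this is used. *)
Definition holomorphic_on {V W : NormedModule C_AbsRing}
    (U : V -> Prop) (f : V -> W) : Prop :=
  forall x, U x -> ex_filterdiff (K := C_AbsRing) f (locally x).

(** * Admissible ODEs and Segre families *)

(* The [m]-admissible ODE z'' = P(w)/w^m z' + Q(w)/w^(2m) z is represented by
   [m], the radius [r] of a disc on which P and Q are holomorphic, and the
   functions [P] and [Q], whose values outside that disc are irrelevant. *)
Definition admissible_ODE (r : R) (P Q : C -> C) : Prop :=
  forall w, cdisc r w ->
    ex_derive (K := C_AbsRing) (V := C_NormedModule) P w /\
    ex_derive (K := C_AbsRing) (V := C_NormedModule) Q w.

Definition solves_inverse_ODE (m : nat) (P Q : C -> C)
    (D : C -> Prop) (w : C -> C) : Prop :=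
  exists w' w'' : C -> C, forall z, D z ->
    is_derive (K := C_AbsRing) (V := C_NormedModule) w z (w' z) /\
    is_derive (K := C_AbsRing) (V := C_NormedModule) w' z (w'' z) /\
    w'' z = - (P (w z) / w z ^ m) * w' z ^ 2
            - Q (w z) / w z ^ (2 * m) * w' z ^ 3 * z.

Record positive_segre_family := {
  sf_delta : R;
  sf_eps : R;
  sf_psi : C * C -> C;
  sf_psi_coef : nat -> C -> C;
  sf_delta_pos : (0 < sf_delta)%R;
  sf_eps_pos : (0 < sf_eps)%R;
  sf_psi_holomorphic :
    holomorphic_on (V := prod_NormedModule C_AbsRing C_NormedModule C_NormedModule)
                   (W := C_NormedModule)
      (fun q => cdisc (sf_delta ^ 2)%R (fst q) /\ cdisc sf_eps (snd q)) sf_psi;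
  sf_psi_expansion : forall x y : C,
    cdisc (sf_delta ^ 2)%R x -> cdisc sf_eps y ->
    is_pseries (K := C_AbsRing) (V := C_NormedModule)
      (fun k => match k with
                | O => RtoC 0
                | S O => RtoC 1
                | _ => sf_psi_coef k y
                end) x (sf_psi (x, y))
}.

Definition segre_graph (m : nat) (S : positive_segre_family)
    (p : C * C) (z : C) : C :=
  Cconj (snd p) *
  Cexp (Ci * Cconj (snd p) ^ (m - 1) *
        sf_psi S (z * Cconj (fst p), Cconj (snd p))).

Definition segre_variety (m : nat) (S : positive_segre_family)
    (p q : C * C) : Prop :=
  cdisc (sf_delta S) (fst p) /\ cdisc (sf_eps S) (snd p) /\
  cdisc (sf_delta S) (fst q) /\ cdisc (sf_eps S) (snd q) /\
  snd q = segre_graph m S p (fst q).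

(* [d] and [e] are the radii of the shrunken polydisc; [e <= r] keeps the
   curves inside the domain of the ODE. *)
Definition associated_segre_family (m : nat) (r : R) (P Q : C -> C)
    (S : positive_segre_family) : Prop :=
  exists d e : R,
    (0 < d <= sf_delta S)%R /\ (0 < e <= sf_eps S)%R /\ (e <= r)%R /\
    forall p : C * C,
      cdisc d (fst p) -> cdisc e (snd p) -> snd p <> RtoC 0 ->
      solves_inverse_ODE m P Q
        (fun z => cdisc d z /\ cdisc e (segre_graph m S p z))
        (segre_graph m S p).

(** * Admissible real hypersurfaces *)

(* A set [M] represents its germ at the origin.  Here
   h_k(u) = sum_j c_(k,j) u^j for k >= 2, and real analyticity of the defining
   function near 0 is the absolute convergence of the double power series
   sum_(k,j) c_(k,j) x^k u^j near 0, to be evaluated at x = |z|^2. *)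
Definition admissible_hypersurface (m : nat) (M : C * C -> Prop) : Prop :=
  exists (s : R) (c : nat -> nat -> R) (rho : R),
    (s = 1 \/ s = -1)%R /\ (0 < rho)%R /\
    (forall x u : R, (Rabs x < rho)%R -> (Rabs u < rho)%R ->
       (forall k, (2 <= k)%nat -> ex_series (fun j => Rabs (c k j * u ^ j)%R)) /\
       ex_series (fun k =>
         (Series (fun j => Rabs (c (k + 2)%nat j * u ^ j)) * Rabs x ^ (k + 2))%R)) /\
    forall z w : C, (Cmod z ^ 2 < rho)%R -> (Cmod w < rho)%R ->
      (M (z, w) <->
       Im w = (Re w ^ m *
               (s / 2 * Cmod z ^ 2 +
                Series (fun k => PSeries (c (k + 2)%nat) (Re w)
                                 * Cmod z ^ (2 * (k + 2)))))%R).

(* Near the origin [M] is {w = rho (z, conj z, conj w)} with [rho] holomorphic,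
   and the curves {w = rho (z, conj xi, conj eta)} are the [F (xi, eta)].
   Such a [rho] is unique as a germ, because the points (z, conj z, conj w)
   with (z, w) in [M] form a maximally totally real set. *)
Definition is_segre_family_of (M : C * C -> Prop)
    (F : C * C -> C * C -> Prop) : Prop :=
  exists (rho : C * C * C -> C) (e : R),
    (0 < e)%R /\
    holomorphic_on
      (V := prod_NormedModule C_AbsRing
              (prod_NormedModule C_AbsRing C_NormedModule C_NormedModule)
              C_NormedModule)
      (W := C_NormedModule)
      (fun q => cdisc e (fst (fst q)) /\ cdisc e (snd (fst q)) /\ cdisc e (snd q))
      rho /\
    (forall z w : C, cdisc e z -> cdisc e w ->
       (M (z, w) <-> w = rho (z, Cconj z, Cconj w))) /\
    (forall z w xi eta : C, cdisc e z -> cdisc e w -> cdisc e xi -> cdisc e eta ->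
       (F (xi, eta) (z, w) <-> w = rho (z, Cconj xi, Cconj eta))).

(* Since the associated positive Segre family of an ODE is unique up to
   shrinking, it is captured by an existential quantifier. *)
Definition associated_hypersurface (m : nat) (r : R) (P Q : C -> C)
    (M : C * C -> Prop) : Prop :=
  admissible_hypersurface m M /\
  exists S : positive_segre_family,
    associated_segre_family m r P Q S /\
    is_segre_family_of M (segre_variety m S).

Definition has_positive_real_structure (m : nat) (r : R) (P Q : C -> C) : Prop :=
  exists M : C * C -> Prop, associated_hypersurface m r P Q M.

(** * Levi nondegeneracy and sphericity *)

Definition line (p v : C * C) (t : R) : C * C :=
  (fst p + t * fst v, snd p + t * snd v).

Definition Ddir (v : C * C) (f : C * C -> R) (p : C * C) : R :=
  Derive (fun t : R => f (line p v t)) 0.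

Definition C2_on (U : C * C -> Prop) (f : C * C -> R) : Prop :=
  forall (u v p : C * C), U p ->
    continuous f p /\
    ex_derive (fun t : R => f (line p u t)) 0 /\
    continuous (Ddir u f) p /\
    ex_derive (fun t : R => Ddir u f (line p v t)) 0 /\
    continuous (Ddir v (Ddir u f)) p.

Definition CDdir (v : C * C) (f : C * C -> C) (p : C * C) : C :=
  (Ddir v (fun q => Re (f q)) p, Ddir v (fun q => Im (f q)) p).

Definition imul (v : C * C) : C * C := (Ci * fst v, Ci * snd v).

(* For f of class C^1, [del v f] = sum_j v_j df/dz_j and
   [delbar v f] = sum_j (conj v_j) df/d(conj z_j). *)
Definition del (v : C * C) (f : C * C -> C) (p : C * C) : C :=
  (CDdir v f p - Ci * CDdir (imul v) f p) / 2.

Definition delbar (v : C * C) (f : C * C -> C) (p : C * C) : C :=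
  (CDdir v f p + Ci * CDdir (imul v) f p) / 2.

(* sum_(j,k) d^2 phi / (dz_j d(conj z_k)) t_j (conj s_k) *)
Definition levi_form (phi : C * C -> C) (p t s : C * C) : C :=
  del t (delbar s phi) p.

Definition levi_nondegenerate_at (M : C * C -> Prop) (p : C * C) : Prop :=
  exists (U : C * C -> Prop) (phi : C * C -> R),
    let phiC := fun q => RtoC (phi q) in
    open U /\ U p /\ C2_on U phi /\
    (forall q, U q -> (M q <-> phi q = 0%R)) /\
    (exists v, Ddir v phi p <> 0%R) /\
    M p /\
    forall t : C * C, t <> (RtoC 0, RtoC 0) -> del t phiC p = RtoC 0 ->
      exists s : C * C, del s phiC p = RtoC 0 /\ levi_form phiC p t s <> RtoC 0.

Definition unit_sphere (q : C * C) : Prop :=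
  (Cmod (fst q) ^ 2 + Cmod (snd q) ^ 2 = 1)%R.

Definition spherical_at (M : C * C -> Prop) (p : C * C) : Prop :=
  exists (U V : C * C -> Prop) (f g : C * C -> C * C),
    let C2 := prod_NormedModule C_AbsRing C_NormedModule C_NormedModule in
    open U /\ open V /\ U p /\ M p /\
    holomorphic_on (V := C2) (W := C2) U f /\
    holomorphic_on (V := C2) (W := C2) V g /\
    (forall q, U q -> V (f q) /\ g (f q) = q) /\
    (forall q, V q -> U (g q) /\ f (g q) = q) /\
    (forall q, U q -> (M q <-> unit_sphere (f q))).

(* Main.v *)
(* Idea.  A Segre curve off X is the graph of an inverse function of a solution of
   the linear equation: with a basis of solutions (l, k), each curve is
   {z = a l(w) + b k(w)}, a complex line in the coordinates (z / l, k / l).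

   If P and Q have the stated form, then
     E(f, g) = w^m (f g~' - f' g~) + 2 i a f g~,   g~(w) = conj (g (conj w)),
   is constant in w for all solutions f, g.  Up to a factor it is a hermitian form of
   signature (1, 1) on the solution space, and in a basis with E diagonal the condition
   w = rho(z, conj z, conj w) becomes |z|^2 + |k(w)|^2 = |l(w)|^2.  This is the sphere
   in the coordinates (z / l, k / l), whence sphericity and Levi nondegeneracy; the same
   invariance makes the solution h of v = u^m h(|z|^2, u) real, whence the existence
   of M.  Uniformity near w = 0 comes from the coordinate w = y + i y^m s, in which
   the equation is nonsingular.

   Conversely, let M exist, fix u > 0 and take points of M with Re w = u, Im w = v -> 0.
   By variation of constants |z|^2 is a holomorphic function g of v, which must be real
   for real v; the reality of its second and third derivatives at v = 0 gives
   Re P(u) = - m u^(m-1) and 2 Im Q(u) = u^m Im P'(u). *)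

Require Import Defs.
From Stdlib Require Import Reals Lra Lia Psatz ClassicalChoice.
From Coquelicot Require Import Coquelicot.
Local Open Scope R_scope.
Local Open Scope C_scope.

(** The singularity at w = 0 shapes the work. Off X the equation is regular, but M and its Segre
    family must be holomorphic across w = 0, so solutions are needed on discs of radius tau |y|^m
    with bounds uniform in y. In the variable s of w = y + i y^m s the coefficients are holomorphic
    in (s, y) with y = 0 included. Separate holomorphy with a common bound ([shol2]) is the working
    notion, because power series with holomorphic coefficients and uniform limits of iterations
    deliver exactly that; joint differentiability is derived from it when a composition asks for it.
    Origin of E: if f solves the equation, its reflection f~ solves the one with P, Q replaced by -2
    i a - m w^(m-1) and b - i w^m a'. The derivative of w^m (f g~' - f' g~) is then minus that of 2
    i a f g~, and E is the sum of the two. In the converse nothing singular occurs, u > 0 being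
    fixed; the reality of a and b on a short interval of positive u passes to all Taylor
    coefficients at 0 by uniqueness of power series. *)

(** * Complex differentiability with explicit moduli *)

Definition cder (f : C -> C) (z l : C) : Prop :=
  forall eps : R, (0 < eps)%R -> exists del : R, (0 < del)%R /\
    forall w, (Cmod (w - z) < del)%R ->
      (Cmod (f w - f z - l * (w - z)) <= eps * Cmod (w - z))%R.

Lemma C_eq (x y : C) : Re x = Re y -> Im x = Im y -> x = y.
Proof. destruct x, y; simpl; intros; subst; auto. Qed.

Lemma Cmod_sub_triangle (x y : C) : (Cmod (x - y) <= Cmod x + Cmod y)%R.
Proof. unfold Cminus. rewrite <- (Cmod_opp y). apply Cmod_triangle. Qed.

Lemma Cmod_ge_sub (x y : C) : (Cmod x - Cmod y <= Cmod (x - y))%R.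
Proof.
  assert (H := Cmod_triangle (x - y) y).
  replace (x - y + y) with x in H by ring. lra.
Qed.

Lemma Cmod_sym (x y : C) : Cmod (x - y) = Cmod (y - x).
Proof. rewrite <- Cmod_opp. f_equal. ring. Qed.

(** The theorem differentiates through filters on normed modules, the proof through explicit moduli;
    the passage between balls and norm neighbourhoods is made here once. *)
Lemma is_derive_cder (f : C -> C) (z l : C) :
  is_derive (K := C_AbsRing) (V := C_NormedModule) f z l <-> cder f z l.
Proof.
  split.
  - intros [_ H] eps Heps.
    specialize (H z (fun P HP => HP) (mkposreal eps Heps)).
    apply (locally_le_locally_norm (V := AbsRing_NormedModule C_AbsRing)) in H.
    destruct H as [d Hd].
    exists d; split; [apply cond_pos|].
    intros w Hw.
    specialize (Hd w Hw).
    simpl in Hd. unfold norm, minus, plus, opp, scal in Hd; simpl in Hd.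
    unfold mult in Hd; simpl in Hd.
    unfold Cminus. rewrite (Cmult_comm l). exact Hd.
  - intros H. split.
    + apply is_linear_scal_l.
    + intros x Hx eps.
      apply (is_filter_lim_locally_unique (V := AbsRing_NormedModule C_AbsRing)) in Hx.
      subst x.
      destruct (H eps (cond_pos eps)) as [d [Hd0 Hd]].
      apply (locally_norm_le_locally (V := AbsRing_NormedModule C_AbsRing)).
      exists (mkposreal d Hd0). intros w Hw.
      specialize (Hd w Hw).
      unfold norm, minus, plus, opp, scal; simpl.
      unfold mult; simpl.
      unfold Cminus in Hd. rewrite (Cmult_comm l) in Hd. exact Hd.
Qed.

Lemma cder_ext_loc (f g : C -> C) (z l : C) (d : R) :
  (0 < d)%R -> (forall w, (Cmod (w - z) < d)%R -> f w = g w) ->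
  cder f z l -> cder g z l.
Proof.
  intros Hd E H eps He. destruct (H eps He) as [d1 [H1 H2]].
  exists (Rmin d d1). split; [apply Rmin_pos; auto|].
  intros w Hw. rewrite <- !E.
  - apply H2. eapply Rlt_le_trans; [exact Hw|apply Rmin_r].
  - replace (z - z) with (RtoC 0) by ring. rewrite Cmod_0. auto.
  - eapply Rlt_le_trans; [exact Hw|apply Rmin_l].
Qed.

Lemma cder_ext (f g : C -> C) (z l : C) :
  (forall w, f w = g w) -> cder f z l -> cder g z l.
Proof. intros E. apply (cder_ext_loc f g z l 1); [lra|auto]. Qed.

Lemma cder_eq (f : C -> C) (z l l' : C) : cder f z l -> l = l' -> cder f z l'.
Proof. intros; subst; auto. Qed.

Lemma cder_unique (f : C -> C) (z l l' : C) : cder f z l -> cder f z l' -> l = l'.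
Proof.
  intros H H'. destruct (Ceq_dec l l') as [|Hn]; auto. exfalso.
  assert (Hp : (0 < Cmod (l - l'))%R).
  { apply Cmod_gt_0. intro E. apply Hn. replace l with (l - l' + l') by ring. rewrite E. ring. }
  destruct (H (Cmod (l - l') / 4)%R) as [d [Hd H1]]; [lra|].
  destruct (H' (Cmod (l - l') / 4)%R) as [d' [Hd' H2]]; [lra|].
  set (e := (Rmin d d' / 2)%R).
  assert (He : (0 < e)%R) by (unfold e; assert (0 < Rmin d d')%R by (apply Rmin_pos; auto); lra).
  assert (Hm : Cmod (z + e - z) = e).
  { replace (z + e - z) with (RtoC e) by ring. rewrite Cmod_R, Rabs_pos_eq; lra. }
  assert (Hl : (e < d /\ e < d')%R).
  { unfold e. assert (Rmin d d' <= d)%R by apply Rmin_l. assert (Rmin d d' <= d')%R by apply Rmin_r.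
    assert (0 < Rmin d d')%R by (apply Rmin_pos; auto). lra. }
  specialize (H1 (z + e)). specialize (H2 (z + e)). rewrite Hm in H1, H2.
  assert (A1 := H1 (proj1 Hl)). assert (A2 := H2 (proj2 Hl)).
  assert (A3 : (Cmod ((l - l') * e) <= Cmod (l - l') / 4 * e + Cmod (l - l') / 4 * e)%R).
  { eapply Rle_trans; [|apply Rplus_le_compat; [exact A2|exact A1]].
    replace ((l - l') * e) with ((f (z + e) - f z - l' * (z + e - z)) - (f (z + e) - f z - l * (z + e - z))) by ring.
    apply Cmod_sub_triangle. }
  rewrite Cmod_mult, Cmod_R, (Rabs_pos_eq e) in A3; nra.
Qed.

(* Caratheodory's form of differentiability: algebra of derivatives becomes algebra of continuous slopes. *)
Definition ccont (f : C -> C) (z : C) : Prop :=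
  forall eps : R, (0 < eps)%R -> exists del : R, (0 < del)%R /\
    forall w, (Cmod (w - z) < del)%R -> (Cmod (f w - f z) < eps)%R.

Lemma ccont_const (c z : C) : ccont (fun _ => c) z.
Proof.
  intros eps He. exists 1%R. split; [lra|]. intros.
  replace (c - c) with (RtoC 0) by ring. rewrite Cmod_0; auto.
Qed.

Lemma ccont_id (z : C) : ccont (fun w => w) z.
Proof. intros eps He. exists eps. auto. Qed.

Lemma ccont_plus (f g : C -> C) (z : C) :
  ccont f z -> ccont g z -> ccont (fun w => f w + g w) z.
Proof.
  intros Hf Hg eps He.
  destruct (Hf (eps / 2)%R) as [d [Hd H1]]; [lra|].
  destruct (Hg (eps / 2)%R) as [d' [Hd' H2]]; [lra|].
  exists (Rmin d d'). split; [apply Rmin_pos; auto|]. intros w Hw.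
  assert (A := H1 w (Rlt_le_trans _ _ _ Hw (Rmin_l _ _))).
  assert (B := H2 w (Rlt_le_trans _ _ _ Hw (Rmin_r _ _))).
  replace (f w + g w - (f z + g z)) with ((f w - f z) + (g w - g z)) by ring.
  eapply Rle_lt_trans; [apply Cmod_triangle|lra].
Qed.

Lemma ccont_bounded (f : C -> C) (z : C) : ccont f z ->
  exists del M : R, (0 < del)%R /\ (0 < M)%R /\ forall w, (Cmod (w - z) < del)%R -> (Cmod (f w) <= M)%R.
Proof.
  intros H. destruct (H 1%R) as [d [Hd H1]]; [lra|].
  exists d, (Cmod (f z) + 1)%R. assert (0 <= Cmod (f z))%R by apply Cmod_ge_0.
  split; [auto|split; [lra|]]. intros w Hw. specialize (H1 w Hw).
  assert (A := Cmod_ge_sub (f w) (f z)). lra.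
Qed.

Lemma ccont_mult (f g : C -> C) (z : C) :
  ccont f z -> ccont g z -> ccont (fun w => f w * g w) z.
Proof.
  intros Hf Hg eps He.
  destruct (ccont_bounded g z Hg) as [d0 [M [Hd0 [HM Hb]]]].
  set (N := (Cmod (f z) + 1)%R).
  assert (0 <= Cmod (f z))%R by apply Cmod_ge_0.
  destruct (Hf (eps / 2 / M)%R) as [d [Hd H1]]; [apply Rdiv_lt_0_compat; lra|].
  destruct (Hg (eps / 2 / N)%R) as [d' [Hd' H2]]; [apply Rdiv_lt_0_compat; unfold N; lra|].
  exists (Rmin d0 (Rmin d d')). split; [repeat apply Rmin_pos; auto|]. intros w Hw.
  assert (B0 := Hb w (Rlt_le_trans _ _ _ Hw (Rmin_l _ _))).
  assert (Hw' := Rlt_le_trans _ _ _ Hw (Rmin_r _ _)).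
  assert (A := H1 w (Rlt_le_trans _ _ _ Hw' (Rmin_l _ _))).
  assert (B := H2 w (Rlt_le_trans _ _ _ Hw' (Rmin_r _ _))).
  replace (f w * g w - f z * g z) with ((f w - f z) * g w + f z * (g w - g z)) by ring.
  eapply Rle_lt_trans; [apply Cmod_triangle|]. rewrite !Cmod_mult.
  assert (Cmod (f w - f z) * Cmod (g w) <= eps / 2 / M * M)%R.
  { apply Rmult_le_compat; try apply Cmod_ge_0; lra. }
  assert (Cmod (f z) * Cmod (g w - g z) <= Cmod (f z) * (eps / 2 / N))%R.
  { apply Rmult_le_compat_l; lra. }
  assert (Cmod (f z) * (eps / 2 / N) < N * (eps / 2 / N))%R.
  { apply Rmult_lt_compat_r; [apply Rdiv_lt_0_compat; unfold N; lra|unfold N; lra]. }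
  replace (eps / 2 / M * M)%R with (eps / 2)%R in * by (field; lra).
  replace (N * (eps / 2 / N))%R with (eps / 2)%R in * by (field; unfold N; lra).
  lra.
Qed.

Lemma ccont_comp (f g : C -> C) (z : C) :
  ccont g z -> ccont f (g z) -> ccont (fun w => f (g w)) z.
Proof.
  intros Hg Hf eps He. destruct (Hf eps He) as [d [Hd H]].
  destruct (Hg d Hd) as [d' [Hd' H']]. exists d'. split; auto.
Qed.

Lemma ccont_inv (f : C -> C) (z : C) : ccont f z -> f z <> 0 -> ccont (fun w => / f w) z.
Proof.
  intros Hf Hz. assert (Hp := proj1 (Cmod_gt_0 _) Hz). intros eps He.
  set (m := Cmod (f z)) in *.
  (* The bound m / 2 keeps |f w| above m / 2, so the difference of the inverses is below (eps m^2 /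
     4) / (m^2 / 2). *)
  destruct (Hf (Rmin (m / 2) (eps * m * m / 4))%R) as [d [Hd H]].
  { apply Rmin_pos; [lra|]. apply Rdiv_lt_0_compat; [|lra]. repeat apply Rmult_lt_0_compat; auto. }
  exists d. split; auto. intros w Hw. specialize (H w Hw).
  assert (H1 := Rlt_le_trans _ _ _ H (Rmin_l _ _)).
  assert (H2 := Rlt_le_trans _ _ _ H (Rmin_r _ _)).
  assert (H3 := Cmod_ge_sub (f z) (f w)). rewrite Cmod_sym in H3. fold m in H3.
  assert (H4 : (m / 2 < Cmod (f w))%R) by lra.
  assert (Hw0 : f w <> 0). { intro E. rewrite E, Cmod_0 in H4. lra. }
  replace (/ f w - / f z) with (- (f w - f z) / (f w * f z)) by (field; auto).
  rewrite Cmod_div, Cmod_opp, Cmod_mult by (apply Cmult_neq_0; auto). fold m.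
  apply (Rmult_lt_reg_r (Cmod (f w) * m)%R); [nra|].
  unfold Rdiv. rewrite Rmult_assoc, Rinv_l by nra.
  rewrite Rmult_1_r. eapply Rlt_le_trans; [exact H2|].
  assert (m / 2 <= Cmod (f w))%R by lra.
  assert (eps * m * (m / 2) <= eps * m * Cmod (f w))%R by (apply Rmult_le_compat_l; nra).
  nra.
Qed.

(** The slope is the difference quotient, completed by the value l at z itself. *)
Lemma cder_slope (f : C -> C) (z l : C) :
  cder f z l <-> exists s : C -> C, ccont s z /\ s z = l /\ forall w, f w = f z + s w * (w - z).
Proof.
  split.
  - intros H.
    exists (fun w => if Ceq_dec w z then l else (f w - f z) / (w - z)).
    split; [|split].
    + intros eps He. destruct (H (eps / 2)%R) as [d [Hd H1]]; [lra|].
      exists d. split; auto. intros w Hw.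
      destruct (Ceq_dec z z) as [_|n]; [|congruence].
      destruct (Ceq_dec w z) as [E|Hn].
      * replace (l - l) with (RtoC 0) by ring. rewrite Cmod_0; auto.
      * assert (Hwz : w - z <> 0) by (intro E; apply Hn; replace w with (w - z + z) by ring; rewrite E; ring).
        assert (Hp := proj1 (Cmod_gt_0 _) Hwz).
        specialize (H1 w Hw).
        replace ((f w - f z) / (w - z) - l) with ((f w - f z - l * (w - z)) / (w - z)) by (field; auto).
        rewrite Cmod_div by auto.
        apply (Rmult_lt_reg_r (Cmod (w - z))); auto.
        unfold Rdiv. rewrite Rmult_assoc, Rinv_l by lra. nra.
    + destruct (Ceq_dec z z); congruence.
    + intros w. destruct (Ceq_dec w z) as [E|Hn].
      * subst. ring.
      * assert (Hwz : w - z <> 0) by (intro E; apply Hn; replace w with (w - z + z) by ring; rewrite E; ring).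
        field; auto.
  - intros [s [Hs [E H]]] eps He.
    destruct (Hs eps He) as [d [Hd H1]]. exists d. split; auto. intros w Hw.
    rewrite (H w). replace (f z + s w * (w - z) - f z - l * (w - z)) with ((s w - s z) * (w - z)) by (rewrite E; ring).
    rewrite Cmod_mult. apply Rmult_le_compat_r; [apply Cmod_ge_0|]. left. auto.
Qed.

Lemma cder_cont (f : C -> C) (z l : C) : cder f z l -> ccont f z.
Proof.
  intros H. apply cder_slope in H. destruct H as [s [Hs [_ H]]].
  assert (K : ccont (fun w => f z + s w * (w - z)) z).
  { apply ccont_plus; [apply ccont_const|]. apply ccont_mult; auto.
    apply (ccont_plus (fun w => w) (fun _ => - z)); [apply ccont_id|apply ccont_const]. }
  intros eps He. destruct (K eps He) as [d [Hd H1]]. exists d; split; auto.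
  intros w Hw. specialize (H1 w Hw). cbv beta in H1. rewrite <- !H in H1. auto.
Qed.

Lemma cder_const (c z : C) : cder (fun _ => c) z 0.
Proof. apply cder_slope. exists (fun _ => 0). split; [apply ccont_const|split; auto]. intros; ring. Qed.

Lemma cder_id (z : C) : cder (fun w => w) z 1.
Proof. apply cder_slope. exists (fun _ => 1). split; [apply ccont_const|split; auto]. intros; ring. Qed.

Lemma cder_plus (f g : C -> C) (z a b : C) :
  cder f z a -> cder g z b -> cder (fun w => f w + g w) z (a + b).
Proof.
  rewrite !cder_slope. intros [s [Hs [Es H]]] [t [Ht [Et H']]].
  exists (fun w => s w + t w). split; [apply ccont_plus; auto|]. split; [congruence|].
  intros w. rewrite (H w), (H' w). ring.
Qed.

Lemma cder_mult (f g : C -> C) (z a b : C) :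
  cder f z a -> cder g z b -> cder (fun w => f w * g w) z (a * g z + f z * b).
Proof.
  intros Hf Hg. assert (Cg := cder_cont _ _ _ Hg). revert Hf Hg.
  rewrite !cder_slope. intros [s [Hs [Es H]]] [t [Ht [Et H']]].
  exists (fun w => s w * g w + f z * t w). split; [|split].
  - apply ccont_plus; apply ccont_mult; auto. apply ccont_const.
  - congruence.
  - intros w. rewrite (H w), (H' w). ring.
Qed.

Lemma cder_scal (c : C) (f : C -> C) (z a : C) :
  cder f z a -> cder (fun w => c * f w) z (c * a).
Proof.
  intros H. eapply cder_eq; [apply cder_mult; [apply cder_const|apply H]|]. cbv beta. ring.
Qed.

Lemma cder_opp (f : C -> C) (z a : C) : cder f z a -> cder (fun w => - f w) z (- a).
Proof.
  intros H. apply (cder_ext (fun w => - (1) * f w)); [intros; ring|].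
  eapply cder_eq; [apply cder_scal, H|cbv beta; ring].
Qed.

Lemma cder_minus (f g : C -> C) (z a b : C) :
  cder f z a -> cder g z b -> cder (fun w => f w - g w) z (a - b).
Proof. intros. apply cder_plus; auto. apply cder_opp; auto. Qed.

Lemma cder_inv (f : C -> C) (z a : C) :
  cder f z a -> f z <> 0 -> cder (fun w => / f w) z (- a / (f z * f z)).
Proof.
  intros Hf Hz. assert (Cf := cder_cont _ _ _ Hf). 
  assert (Hd : exists d, (0 < d)%R /\ forall w, (Cmod (w - z) < d)%R -> f w <> 0).
  { assert (Hp := proj1 (Cmod_gt_0 _) Hz). destruct (Cf _ Hp) as [d [Hd H]].
    exists d; split; auto. intros w Hw E. specialize (H w Hw). rewrite E in H.
    replace (0 - f z) with (- f z) in H by ring. rewrite Cmod_opp in H. lra. }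
  destruct Hd as [d [Hd Hnz]].
  revert Hf. rewrite cder_slope. intros [s [Hs [Es H]]].
  (* The slope of 1 / f at z is - s / (f w f z); the identity behind it requires f w <> 0, hence the
     restriction to a neighbourhood of z. *)
  apply (cder_ext_loc (fun w => / f z + (- s w * (/ f w * / f z)) * (w - z)) _ z _ d Hd).
  - intros w Hw. assert (Hw0 := Hnz w Hw). 
    assert (s w * (w - z) = f w - f z) by (rewrite (H w); ring).
    replace (- s w * (/ f w * / f z) * (w - z)) with (- (s w * (w - z)) * (/ f w * / f z)) by ring.
    rewrite H0. field; auto.
  - apply cder_slope. exists (fun w => - s w * (/ f w * / f z)). split; [|split].
    + apply ccont_mult.
      * intros eps He. destruct (Hs eps He) as [d1 [Hd1 H1]]. exists d1; split; auto. intros w Hw.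
        replace (- s w - - s z) with (- (s w - s z)) by ring. rewrite Cmod_opp; auto.
      * apply ccont_mult; [apply ccont_inv; auto|apply ccont_const].
    + rewrite Es. field; auto.
    + intros w. ring.
Qed.

Lemma cder_div (f g : C -> C) (z a b : C) :
  cder f z a -> cder g z b -> g z <> 0 ->
  cder (fun w => f w / g w) z ((a * g z - f z * b) / (g z * g z)).
Proof.
  intros Hf Hg Hz. eapply cder_eq; [apply cder_mult; [exact Hf|apply cder_inv; eassumption]|].
  cbv beta. field; auto.
Qed.

Lemma cder_comp (f g : C -> C) (z a b : C) :
  cder f (g z) a -> cder g z b -> cder (fun w => f (g w)) z (a * b).
Proof.
  intros Hf Hg. assert (Cg := cder_cont _ _ _ Hg). revert Hf Hg.
  rewrite !cder_slope. intros [s [Hs [Es H]]] [t [Ht [Et H']]].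
  exists (fun w => s (g w) * t w). split; [|split].
  - apply ccont_mult; auto. apply ccont_comp; auto.
  - congruence.
  - intros w. rewrite (H (g w)).
    replace (g w - g z) with (t w * (w - z)) by (rewrite (H' w); ring). ring.
Qed.

Lemma cder_pow (f : C -> C) (z a : C) (n : nat) :
  cder f z a -> cder (fun w => f w ^ n) z (INR n * f z ^ (n - 1) * a).
Proof.
  intros H. induction n as [|n IH].
  - apply (cder_ext (fun _ => 1)); [intros; simpl; auto|]. eapply cder_eq; [apply cder_const|].
    simpl. ring.
  - eapply cder_eq; [apply (cder_mult f (fun w => f w ^ n)); [exact H|exact IH]|].
    rewrite S_INR, RtoC_plus. replace (S n - 1)%nat with n by lia.
    destruct n as [|n].
    + simpl. ring.
    + replace (S n - 1)%nat with n by lia. rewrite !Cpow_S. ring.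
Qed.

Lemma cder_Cpow (n : nat) (z : C) : cder (fun w => w ^ n) z (INR n * z ^ (n - 1)).
Proof. eapply cder_eq; [apply (cder_pow (fun w => w)), cder_id|cbv beta; ring]. Qed.

Lemma Cconj_RtoC (x : R) : Cconj x = x.
Proof. apply C_eq; simpl; ring. Qed.

(** Conjugation is an isometry, so the estimate for f at conj z is the estimate for the reflected
    function at z. This Schwarz reflection is later applied to [ctilde]. *)
Lemma cder_conj (f : C -> C) (z l : C) :
  cder f (Cconj z) l -> cder (fun w => Cconj (f (Cconj w))) z (Cconj l).
Proof.
  intros H eps He. destruct (H eps He) as [d [Hd H1]]. exists d; split; auto.
  intros w Hw. rewrite <- Cmod_conj, Cminus_conj in Hw. specialize (H1 (Cconj w) Hw).
  rewrite <- Cminus_conj in H1. rewrite <- (Cmod_conj (w - z)).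
  eapply Rle_trans; [|exact H1]. rewrite <- Cmod_conj.
  rewrite !Cminus_conj, Cmult_conj, !Cminus_conj, !Cconj_conj. apply Rle_refl.
Qed.

(** * Curves *)

(** Componentwise, so that the real mean value theorem and [RInt] apply directly. *)
Definition rder (f : R -> C) (t : R) (l : C) : Prop :=
  is_derive (fun s => Re (f s)) t (Re l) /\ is_derive (fun s => Im (f s)) t (Im l).

Lemma Cmod_le_abs (x : C) : (Cmod x <= Rabs (Re x) + Rabs (Im x))%R.
Proof.
  replace x with (RtoC (Re x) + Ci * RtoC (Im x)) at 1 by (apply C_eq; destruct x; simpl; ring).
  eapply Rle_trans; [apply Cmod_triangle|].
  rewrite Cmod_mult, !Cmod_R, Cmod_Ci. lra.
Qed.

Lemma im_le_Cmod (c : C) : (Rabs (Im c) <= Cmod c)%R.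
Proof. apply (Rle_trans _ (Rmax (Rabs (fst c)) (Rabs (snd c)))); [apply Rmax_r|apply Rmax_Cmod]. Qed.

Lemma is_derive_R_eps (f : R -> R) (t l : R) :
  is_derive f t l <-> forall eps : R, (0 < eps)%R -> exists del : R, (0 < del)%R /\
    forall s, (Rabs (s - t) < del)%R -> (Rabs (f s - f t - l * (s - t)) <= eps * Rabs (s - t))%R.
Proof.
  split.
  - intros [_ H] eps He.
    destruct (H t (fun P HP => HP) (mkposreal eps He)) as [d Hd].
    exists d; split; [apply cond_pos|]. intros s Hs. specialize (Hd s Hs).
    unfold norm, minus, plus, opp, scal in Hd; simpl in Hd. unfold mult, abs in Hd; simpl in Hd.
    replace (f s - f t - l * (s - t))%R with (f s + - f t + - ((s + - t) * l))%R by ring.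
    exact Hd.
  - intros H. split; [apply is_linear_scal_l|].
    intros x Hx eps. apply (is_filter_lim_locally_unique (V := R_NormedModule)) in Hx. subst x.
    destruct (H eps (cond_pos eps)) as [d [Hd H1]]. exists (mkposreal d Hd). intros s Hs.
    specialize (H1 s Hs).
    unfold norm, minus, plus, opp, scal; simpl. unfold mult, abs; simpl.
    replace (f s + - f t + - ((s + - t) * l))%R with (f s - f t - l * (s - t))%R by ring.
    exact H1.
Qed.

Lemma rder_eps (f : R -> C) (t : R) (l : C) :
  rder f t l <-> forall eps : R, (0 < eps)%R -> exists del : R, (0 < del)%R /\
    forall s, (Rabs (s - t) < del)%R -> (Cmod (f s - f t - l * (s - t)%R) <= eps * Rabs (s - t))%R.
Proof.
  unfold rder. rewrite !is_derive_R_eps. split.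
  - intros [H1 H2] eps He.
    destruct (H1 (eps / 2)%R) as [d [Hd A]]; [lra|]. destruct (H2 (eps / 2)%R) as [d' [Hd' B]]; [lra|].
    exists (Rmin d d'). split; [apply Rmin_pos; auto|]. intros s Hs.
    specialize (A s (Rlt_le_trans _ _ _ Hs (Rmin_l _ _))). specialize (B s (Rlt_le_trans _ _ _ Hs (Rmin_r _ _))).
    eapply Rle_trans; [apply Cmod_le_abs|].
    replace (eps * Rabs (s - t))%R with (eps / 2 * Rabs (s - t) + eps / 2 * Rabs (s - t))%R by field.
    apply Rplus_le_compat; [eapply Rle_trans; [right|exact A]|eapply Rle_trans; [right|exact B]];
    f_equal; destruct (f s), (f t), l; simpl; ring.
  - intros H; split; intros eps He; destruct (H eps He) as [d [Hd A]]; exists d; split; auto; intros s Hs;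
    specialize (A s Hs); eapply Rle_trans; try exact A.
    + eapply Rle_trans; [|apply re_le_Cmod]. right. f_equal. destruct (f s), (f t), l; simpl; ring.
    + eapply Rle_trans; [|apply im_le_Cmod]. right. f_equal. destruct (f s), (f t), l; simpl; ring.
Qed.

Lemma rder_eq (f : R -> C) (t : R) (l l' : C) : rder f t l -> l = l' -> rder f t l'.
Proof. intros; subst; auto. Qed.

Lemma rder_const (c : C) (t : R) : rder (fun _ => c) t 0.
Proof. split; simpl; apply @is_derive_const. Qed.

Lemma rder_id (t : R) : rder RtoC t 1.
Proof. split; simpl; [apply @is_derive_id|apply @is_derive_const]. Qed.

Lemma rder_plus (f g : R -> C) (t : R) (a b : C) :
  rder f t a -> rder g t b -> rder (fun s => f s + g s) t (a + b).
Proof.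
  intros [A B] [A' B']. split; simpl; [exact (is_derive_plus _ _ _ _ _ A A')|exact (is_derive_plus _ _ _ _ _ B B')].
Qed.

Lemma rder_mult (f g : R -> C) (t : R) (a b : C) :
  rder f t a -> rder g t b -> rder (fun s => f s * g s) t (a * g t + f t * b).
Proof.
  intros [A B] [A' B']. split; simpl.
  - evar_last.
    { apply (is_derive_minus (V := R_NormedModule) (fun s => fst (f s) * fst (g s))%R (fun s => snd (f s) * snd (g s))%R).
      - apply (is_derive_mult (K := R_AbsRing) (fun s => fst (f s)) (fun s => fst (g s)) t _ _ A A'); intros; apply Rmult_comm.
      - apply (is_derive_mult (K := R_AbsRing) (fun s => snd (f s)) (fun s => snd (g s)) t _ _ B B'); intros; apply Rmult_comm. }
    unfold minus, plus, opp, mult; simpl. unfold Re, Im. ring.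
  - evar_last.
    { apply (is_derive_plus (V := R_NormedModule) (fun s => fst (f s) * snd (g s))%R (fun s => snd (f s) * fst (g s))%R).
      - apply (is_derive_mult (K := R_AbsRing) (fun s => fst (f s)) (fun s => snd (g s)) t _ _ A B'); intros; apply Rmult_comm.
      - apply (is_derive_mult (K := R_AbsRing) (fun s => snd (f s)) (fun s => fst (g s)) t _ _ B A'); intros; apply Rmult_comm. }
    unfold minus, plus, opp, mult; simpl. unfold Re, Im. ring.
Qed.

Lemma rder_comp (f : C -> C) (g : R -> C) (t : R) (a b : C) :
  cder f (g t) a -> rder g t b -> rder (fun s => f (g s)) t (a * b).
Proof.
  intros Hf. rewrite !rder_eps. intros Hg eps He.
  (* Capping by 1 gives |g s - g t| <= (|b| + 1) |s - t|; the denominators |a| + 1 and |b| + 1 then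
     give half of eps to each of the two errors. *)
  set (e1 := Rmin 1 (eps / 2 / (Cmod a + 1))).
  assert (Ha := Cmod_ge_0 a). assert (Hb := Cmod_ge_0 b).
  assert (He1 : (0 < e1)%R) by (apply Rmin_pos; [lra|]; repeat apply Rdiv_lt_0_compat; lra).
  set (e2 := (eps / 2 / (Cmod b + 1))%R).
  assert (He2 : (0 < e2)%R) by (repeat apply Rdiv_lt_0_compat; lra).
  destruct (Hf e2 He2) as [d [Hd A]]. destruct (Hg e1 He1) as [d' [Hd' B]].
  exists (Rmin d' (d / (Cmod b + 1))). split; [apply Rmin_pos; auto; apply Rdiv_lt_0_compat; lra|].
  intros s Hs. specialize (B s (Rlt_le_trans _ _ _ Hs (Rmin_l _ _))).
  assert (Hs2 := Rlt_le_trans _ _ _ Hs (Rmin_r _ _)).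
  assert (Hs0 := Rabs_pos (s - t)).
  assert (He11 : (e1 <= 1)%R) by apply Rmin_l.
  assert (G : (Cmod (g s - g t) <= (Cmod b + 1) * Rabs (s - t))%R).
  { replace (g s - g t) with ((g s - g t - b * (s - t)%R) + b * (s - t)%R) by ring.
    eapply Rle_trans; [apply Cmod_triangle|]. rewrite Cmod_mult, Cmod_R. nra. }
  assert (G2 : (Cmod (g s - g t) < d)%R).
  { eapply Rle_lt_trans; [exact G|].
    apply (Rmult_lt_compat_l (Cmod b + 1)) in Hs2; [|lra].
    replace ((Cmod b + 1) * (d / (Cmod b + 1)))%R with d in Hs2 by (field; lra). auto. }
  specialize (A _ G2).
  replace (f (g s) - f (g t) - a * b * (s - t)%R) with
    ((f (g s) - f (g t) - a * (g s - g t)) + a * (g s - g t - b * (s - t)%R)) by ring.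
  eapply Rle_trans; [apply Cmod_triangle|]. rewrite Cmod_mult.
  assert (e2 * Cmod (g s - g t) <= e2 * ((Cmod b + 1) * Rabs (s - t)))%R by (apply Rmult_le_compat_l; lra).
  replace (e2 * ((Cmod b + 1) * Rabs (s - t)))%R with (eps / 2 * Rabs (s - t))%R in * by (unfold e2; field; lra).
  assert (Cmod a * (e1 * Rabs (s - t)) <= eps / 2 * Rabs (s - t))%R.
  { rewrite <- Rmult_assoc. apply Rmult_le_compat_r; auto.
    assert (e1 <= eps / 2 / (Cmod a + 1))%R by apply Rmin_r.
    assert ((Cmod a + 1) * e1 <= eps / 2)%R.
    { apply (Rmult_le_compat_l (Cmod a + 1)) in H0; [|lra].
      replace ((Cmod a + 1) * (eps / 2 / (Cmod a + 1)))%R with (eps / 2)%R in H0 by (field; lra). auto. }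
    nra. }
  assert (Cmod a * Cmod (g s - g t - b * (s - t)%R) <= Cmod a * (e1 * Rabs (s - t)))%R by (apply Rmult_le_compat_l; auto).
  lra.
Qed.

Lemma rder_affine (a b : C) (t : R) : rder (fun s => a + b * s) t b.
Proof.
  eapply rder_eq; [apply rder_plus; [apply rder_const|apply rder_mult; [apply rder_const|apply rder_id]]|]. cbv beta. ring.
Qed.

(** The mean value theorem fails for complex values, so it is applied to the real and imaginary
    parts separately. *)
Lemma rder_zero_const (f : R -> C) (a b : R) :
  (a <= b)%R -> (forall t, (a <= t <= b)%R -> rder f t 0) -> f a = f b.
Proof.
  intros Hab H.
  assert (K : forall (h : R -> R), (forall t, (a <= t <= b)%R -> is_derive h t 0%R) -> h a = h b).
  { intros h Hh. destruct (MVT_gen h a b (fun _ => 0%R)) as [c [_ Hc]].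
    - intros x. rewrite Rmin_left, Rmax_right by auto. intros Hx. apply Hh; lra.
    - intros x. rewrite Rmin_left, Rmax_right by auto. intros Hx.
      apply derivable_continuous_pt. exists 0%R. apply is_derive_Reals. apply Hh; lra.
    - lra. }
  apply C_eq; [apply (K (fun t => Re (f t)))|apply (K (fun t => Im (f t)))]; intros t Ht; apply (H t Ht).
Qed.

(** All constancy arguments (for E, for the coefficients in variation of constants, for the
    logarithm) compare two given points, so the segment joining them is all that has to lie in the
    domain. *)
Lemma cder_zero_segment (f : C -> C) (a b : C) :
  (forall t : R, (0 <= t <= 1)%R -> cder f (a + (b - a) * t) 0) -> f a = f b.
Proof.
  intros H.
  assert (K := rder_zero_const (fun t => f (a + (b - a) * t)) 0 1).
  cbv beta in K. replace (a + (b - a) * RtoC 0) with a in K by ring.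
  replace (a + (b - a) * RtoC 1) with b in K by ring. apply K; [lra|].
  intros t Ht. eapply rder_eq; [apply (rder_comp f (fun s => a + (b - a) * s)); [apply H; auto|apply rder_affine]|]. cbv beta. ring.
Qed.

(** * Series of complex numbers *)

Fixpoint csum (a : nat -> C) (n : nat) : C :=
  match n with O => 0 | S n => csum a n + a n end.

Fixpoint rsum (a : nat -> R) (n : nat) : R :=
  match n with O => 0%R | S n => (rsum a n + a n)%R end.

(** [csum a n] adds the terms of index below n, one term fewer than [sum_n a n]; the shift is
    settled in [sum_n_rsum]. *)
Definition cser (a : nat -> C) (l : C) : Prop :=
  forall eps : R, (0 < eps)%R -> exists N, forall n, (N <= n)%nat -> (Cmod (csum a n - l) < eps)%R.

Lemma csum_ext (a b : nat -> C) (n : nat) : (forall k, (k < n)%nat -> a k = b k) -> csum a n = csum b n.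
Proof. induction n; simpl; intros H; auto. rewrite IHn, H; auto. Qed.

Lemma csum_plus (a b : nat -> C) (n : nat) : csum (fun k => a k + b k) n = csum a n + csum b n.
Proof. induction n; simpl; [ring|]. rewrite IHn. ring. Qed.

Lemma csum_scal (c : C) (a : nat -> C) (n : nat) : csum (fun k => c * a k) n = c * csum a n.
Proof. induction n; simpl; [ring|]. rewrite IHn. ring. Qed.

Lemma csum_conj (a : nat -> C) (n : nat) : csum (fun k => Cconj (a k)) n = Cconj (csum a n).
Proof. induction n; simpl; [apply C_eq; simpl; ring|]. rewrite IHn. apply C_eq; simpl; ring. Qed.

Lemma csum_Sl (a : nat -> C) (n : nat) : csum a (S n) = a O + csum (fun k => a (S k)) n.
Proof. induction n; simpl in *; [ring|]. rewrite IHn. ring. Qed.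

Lemma csum_bound (a : nat -> C) (b : nat -> R) (n : nat) :
  (forall k, (k < n)%nat -> (Cmod (a k) <= b k)%R) -> (Cmod (csum a n) <= rsum b n)%R.
Proof.
  induction n; simpl; intros H; [rewrite Cmod_0; lra|].
  eapply Rle_trans; [apply Cmod_triangle|]. apply Rplus_le_compat; auto.
Qed.

Lemma rsum_scal (c : R) (a : nat -> R) (n : nat) : rsum (fun k => c * a k)%R n = (c * rsum a n)%R.
Proof. induction n; simpl; [ring|]. rewrite IHn. ring. Qed.

Lemma rsum_geom (q : R) (n : nat) : (0 <= q < 1)%R -> (rsum (fun k => q ^ k)%R n <= / (1 - q))%R.
Proof.
  intros Hq. assert (H : rsum (fun k => q ^ k)%R n = ((1 - q ^ n) / (1 - q))%R).
  { induction n; simpl; [field; lra|]. rewrite IHn. field; lra. }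
  rewrite H. unfold Rdiv. rewrite <- (Rmult_1_l (/ (1 - q))) at 2.
  apply Rmult_le_compat_r; [left; apply Rinv_0_lt_compat; lra|].
  assert (0 <= q ^ n)%R by (apply pow_le; lra). lra.
Qed.

(** Multiplication by 1 - q lowers the weight k + 1 to 1, up to a boundary term of the right sign.
    This bound and the next one control the first and second order remainders of power series. *)
Lemma rsum_geom1 (q : R) (n : nat) : (0 <= q < 1)%R ->
  (rsum (fun k => INR (S k) * q ^ k)%R n <= / (1 - q) * / (1 - q))%R.
Proof.
  intros Hq.
  assert (H : forall n, ((1 - q) * rsum (fun k => INR (S k) * q ^ k) n = rsum (fun k => q ^ k) n - INR n * q ^ n)%R).
  { clear n. induction n; [simpl; ring|].
    cbn [rsum]. rewrite Rmult_plus_distr_l, IHn. rewrite !S_INR. simpl pow. ring. }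
  specialize (H n). assert (G := rsum_geom q n Hq).
  assert (0 <= INR n * q ^ n)%R by (apply Rmult_le_pos; [apply pos_INR|apply pow_le; lra]).
  apply (Rmult_le_reg_l (1 - q)); [lra|]. rewrite H.
  rewrite <- Rmult_assoc, Rinv_r, Rmult_1_l by lra. lra.
Qed.

Lemma rsum_geom2 (q : R) (n : nat) : (0 <= q < 1)%R ->
  (rsum (fun k => INR (S k) * INR (S (S k)) / 2 * q ^ k)%R n <= / (1 - q) * / (1 - q) * / (1 - q))%R.
Proof.
  intros Hq.
  assert (H : forall n, ((1 - q) * rsum (fun k => INR (S k) * INR (S (S k)) / 2 * q ^ k) n
    = rsum (fun k => INR (S k) * q ^ k) n - INR n * INR (S n) / 2 * q ^ n)%R).
  { clear n. induction n; [simpl; field|].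
    cbn [rsum]. rewrite Rmult_plus_distr_l, IHn. rewrite !S_INR. simpl pow. field. }
  specialize (H n). assert (G := rsum_geom1 q n Hq).
  assert (0 <= INR n * INR (S n) / 2 * q ^ n)%R.
  { apply Rmult_le_pos; [|apply pow_le; lra]. assert (A := pos_INR n). assert (B := pos_INR (S n)).
    assert (0 <= INR n * INR (S n))%R by (apply Rmult_le_pos; auto). lra. }
  apply (Rmult_le_reg_l (1 - q)); [lra|]. rewrite H.
  replace ((1 - q) * (/ (1 - q) * / (1 - q) * / (1 - q)))%R with (/ (1 - q) * / (1 - q))%R by (field; lra). lra.
Qed.

Lemma pow_q_bound (q : R) (k : nat) : (0 <= q < 1)%R -> (INR (S k) * q ^ k <= / (1 - q) * / (1 - q))%R.
Proof.
  intros Hq. eapply Rle_trans; [|apply (rsum_geom1 q (S k) Hq)]. cbn [rsum].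
  assert (A : forall n, (0 <= rsum (fun k0 => INR (S k0) * q ^ k0) n)%R).
  { induction n; cbn [rsum]; [lra|]. apply Rplus_le_le_0_compat; auto.
    apply Rmult_le_pos; [apply pos_INR|apply pow_le; lra]. }
  specialize (A k). lra.
Qed.

Lemma small_pow (q eps : R) : (0 <= q < 1)%R -> (0 < eps)%R -> exists N, forall n, (N <= n)%nat -> (q ^ n < eps)%R.
Proof.
  intros Hq He. destruct (pow_lt_1_zero q) with (y := eps) as [N HN]; auto.
  - rewrite Rabs_pos_eq; lra.
  - exists N. intros n Hn. specialize (HN n Hn). rewrite Rabs_pos_eq in HN; auto. apply pow_le; lra.
Qed.

Lemma cser_unique (a : nat -> C) (l l' : C) : cser a l -> cser a l' -> l = l'.
Proof.
  intros H H'. destruct (Ceq_dec l l') as [|Hn]; auto. exfalso.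
  assert (Hp : (0 < Cmod (l - l'))%R).
  { apply Cmod_gt_0. intro E. apply Hn. replace l with (l - l' + l') by ring. rewrite E. ring. }
  destruct (H (Cmod (l - l') / 2)%R) as [N HN]; [lra|]. destruct (H' (Cmod (l - l') / 2)%R) as [N' HN']; [lra|].
  specialize (HN (max N N')). specialize (HN' (max N N')).
  assert (A := HN ltac:(lia)). assert (B := HN' ltac:(lia)).
  assert (T := Cmod_sub_triangle (csum a (max N N') - l') (csum a (max N N') - l)).
  replace (csum a (Nat.max N N') - l' - (csum a (Nat.max N N') - l)) with (l - l') in T by ring. lra.
Qed.

Lemma cser_plus (a b : nat -> C) (l l' : C) : cser a l -> cser b l' -> cser (fun k => a k + b k) (l + l').
Proof.
  intros H H' eps He. destruct (H (eps / 2)%R) as [N HN]; [lra|]. destruct (H' (eps / 2)%R) as [N' HN']; [lra|].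
  exists (max N N'). intros n Hn. rewrite csum_plus.
  replace (csum a n + csum b n - (l + l')) with ((csum a n - l) + (csum b n - l')) by ring.
  eapply Rle_lt_trans; [apply Cmod_triangle|]. specialize (HN n ltac:(lia)). specialize (HN' n ltac:(lia)). lra.
Qed.

Lemma cser_scal (c : C) (a : nat -> C) (l : C) : cser a l -> cser (fun k => c * a k) (c * l).
Proof.
  intros H eps He. assert (Hc := Cmod_ge_0 c).
  destruct (H (eps / (Cmod c + 1))%R) as [N HN]; [apply Rdiv_lt_0_compat; lra|].
  exists N. intros n Hn. rewrite csum_scal. replace (c * csum a n - c * l) with (c * (csum a n - l)) by ring.
  rewrite Cmod_mult. specialize (HN n Hn). 
  apply (Rmult_lt_compat_l (Cmod c + 1)) in HN; [|lra].
  replace ((Cmod c + 1) * (eps / (Cmod c + 1)))%R with eps in HN by (field; lra).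
  assert (0 <= Cmod (csum a n - l))%R by apply Cmod_ge_0. nra.
Qed.

Lemma cser_conj (a : nat -> C) (l : C) : cser a l -> cser (fun k => Cconj (a k)) (Cconj l).
Proof.
  intros H eps He. destruct (H eps He) as [N HN]. exists N. intros n Hn.
  rewrite csum_conj, <- Cminus_conj, Cmod_conj. auto.
Qed.

Lemma cser_ext (a b : nat -> C) (l : C) : (forall k, a k = b k) -> cser a l -> cser b l.
Proof.
  intros E H eps He. destruct (H eps He) as [N HN]. exists N. intros n Hn.
  rewrite <- (csum_ext a b) by auto. auto.
Qed.

Lemma cser_eq (a : nat -> C) (l l' : C) : cser a l -> l = l' -> cser a l'.
Proof. intros; subst; auto. Qed.

Lemma cser_Sl (a : nat -> C) (l : C) : cser (fun k => a (S k)) l -> cser a (a O + l).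
Proof.
  intros H eps He. destruct (H eps He) as [N HN]. exists (S N). intros n Hn.
  destruct n; [lia|]. rewrite csum_Sl.
  replace (a O + csum (fun k => a (S k)) n - (a O + l)) with (csum (fun k => a (S k)) n - l) by ring.
  apply HN. lia.
Qed.

Lemma cser_Sl_inv (a : nat -> C) (l : C) : cser a l -> cser (fun k => a (S k)) (l - a O).
Proof.
  intros H eps He. destruct (H eps He) as [N HN]. exists N. intros n Hn.
  specialize (HN (S n) ltac:(lia)). rewrite csum_Sl in HN.
  replace (csum (fun k => a (S k)) n - (l - a O)) with (a O + csum (fun k => a (S k)) n - l) by ring. auto.
Qed.

Lemma cser_le (a : nat -> C) (l : C) (B : R) :
  cser a l -> (forall n, (Cmod (csum a n) <= B)%R) -> (Cmod l <= B)%R.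
Proof.
  intros H Hb. apply Rnot_lt_le. intros Hlt.
  destruct (H (Cmod l - B)%R) as [N HN]; [lra|]. specialize (HN N (Nat.le_refl _)). specialize (Hb N).
  rewrite Cmod_sym in HN. assert (A := Cmod_ge_sub l (csum a N)). lra.
Qed.

Lemma cser_terms_bounded (a : nat -> C) (l : C) : cser a l -> exists M, forall k, (Cmod (a k) <= M)%R.
Proof.
  intros H. destruct (H 1%R) as [N HN]; [lra|].
  assert (B : exists M, forall k, (k < N)%nat -> (Cmod (a k) <= M)%R).
  { clear. induction N; [exists 0%R; intros; lia|]. destruct IHN as [M HM].
    exists (Rmax M (Cmod (a N))). intros k Hk. destruct (Nat.eq_dec k N); [subst; apply Rmax_r|].
    eapply Rle_trans; [apply HM; lia|apply Rmax_l]. }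
  destruct B as [M HM]. exists (Rmax M 2). intros k. destruct (Nat.lt_ge_cases k N) as [Hk|Hk].
  - eapply Rle_trans; [apply HM; auto|apply Rmax_l].
  - eapply Rle_trans; [|apply Rmax_r].
    assert (A := HN k Hk). assert (A' := HN (S k) ltac:(lia)). simpl in A'.
    assert (T := Cmod_sub_triangle (csum a k + a k - l) (csum a k - l)).
    replace (csum a k + a k - l - (csum a k - l)) with (a k) in T by ring. lra.
Qed.

(** [Series] is total, so this is always defined; it is the sum only once convergence is known,
    which [cser_geom_ex] provides. *)
Definition csum_val (a : nat -> C) : C := (Series (fun k => Re (a k)), Series (fun k => Im (a k))).

Lemma sum_n_rsum (a : nat -> R) (n : nat) : sum_n a n = rsum a (S n).
Proof.
  induction n; [rewrite sum_O; simpl; ring|]. rewrite sum_Sn, IHn. reflexivity.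
Qed.

Lemma csum_Re_Im (a : nat -> C) (n : nat) : csum a n = (rsum (fun k => Re (a k)) n, rsum (fun k => Im (a k)) n).
Proof.
  induction n; simpl; [reflexivity|]. rewrite IHn. apply C_eq; simpl; reflexivity.
Qed.

Lemma is_series_eps (a : nat -> R) (l : R) :
  is_series a l <-> forall eps : R, (0 < eps)%R -> exists N, forall n, (N <= n)%nat -> (Rabs (rsum a n - l) < eps)%R.
Proof.
  split.
  - intros H eps He. apply (is_lim_seq_spec (sum_n a) (Finite l)) in H. destruct (H (mkposreal eps He)) as [N HN].
    exists (S N). intros n Hn. destruct n; [lia|]. specialize (HN n ltac:(lia)). rewrite sum_n_rsum in HN. exact HN.
  - intros H. apply (is_lim_seq_spec (sum_n a) (Finite l)). intros eps.
    destruct (H eps (cond_pos eps)) as [N HN]. exists N. intros n Hn. rewrite sum_n_rsum. apply HN. lia.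
Qed.

Lemma cser_Re_Im (a : nat -> C) (l : C) :
  cser a l <-> is_series (fun k => Re (a k)) (Re l) /\ is_series (fun k => Im (a k)) (Im l).
Proof.
  rewrite !is_series_eps. split.
  - intros H. split; intros eps He; destruct (H eps He) as [N HN]; exists N; intros n Hn; specialize (HN n Hn);
    eapply Rle_lt_trans; try exact HN; rewrite csum_Re_Im.
    + eapply Rle_trans; [|apply re_le_Cmod]. right. f_equal.
    + eapply Rle_trans; [|apply im_le_Cmod]. right. f_equal.
  - intros [H1 H2] eps He. destruct (H1 (eps / 2)%R) as [N HN]; [lra|]. destruct (H2 (eps / 2)%R) as [N' HN']; [lra|].
    exists (max N N'). intros n Hn. specialize (HN n ltac:(lia)). specialize (HN' n ltac:(lia)).
    eapply Rle_lt_trans; [apply Cmod_le_abs|]. rewrite csum_Re_Im. 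
    unfold Re, Im in *; simpl. unfold Rminus in *. lra.
Qed.

Lemma cser_geom_ex (a : nat -> C) (K q : R) : (0 <= q < 1)%R ->
  (forall k, (Cmod (a k) <= K * q ^ k)%R) -> cser a (csum_val a).
Proof.
  intros Hq H. apply cser_Re_Im.
  assert (G : ex_series (fun k => K * q ^ k)%R).
  { apply (ex_series_scal (V := R_NormedModule) K (fun k => q ^ k)%R). apply ex_series_geom. rewrite Rabs_pos_eq; lra. }
  split; simpl; apply Series_correct; apply (ex_series_le (V := R_CompleteNormedModule) _ _) with (2 := G); intros k.
  - eapply Rle_trans; [|apply H]. apply re_le_Cmod.
  - eapply Rle_trans; [|apply H]. apply im_le_Cmod.
Qed.

Lemma cser_geom_le (a : nat -> C) (K q : R) (l : C) : (0 <= q < 1)%R ->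
  (forall k, (Cmod (a k) <= K * q ^ k)%R) -> cser a l -> (Cmod l <= K / (1 - q))%R.
Proof.
  intros Hq H Hl. apply (cser_le a); auto. intros n.
  eapply Rle_trans; [apply (csum_bound a (fun k => K * q ^ k)%R); auto|].
  rewrite rsum_scal. apply Rmult_le_compat_l; [|apply rsum_geom; auto].
  specialize (H O). simpl in H. assert (A := Cmod_ge_0 (a O)). lra.
Qed.

Lemma csum_add (a : nat -> C) (n m : nat) : csum a (n + m) = csum a n + csum (fun k => a (n + k)%nat) m.
Proof.
  induction m; simpl; [rewrite Nat.add_0_r; ring|]. rewrite Nat.add_succ_r. simpl. rewrite IHm. ring.
Qed.

Lemma cser_drop (a : nat -> C) (n : nat) (l : C) : cser a l -> cser (fun k => a (n + k)%nat) (l - csum a n).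
Proof.
  intros H eps He. destruct (H eps He) as [N HN]. exists N. intros k Hk.
  specialize (HN (n + k)%nat ltac:(lia)). rewrite csum_add in HN.
  replace (csum (fun k => a (n + k)%nat) k - (l - csum a n)) with (csum a n + csum (fun k => a (n + k)%nat) k - l) by ring.
  auto.
Qed.

Lemma cser_geom_tail (a : nat -> C) (K q : R) (l : C) (n : nat) : (0 <= q < 1)%R ->
  (forall k, (Cmod (a k) <= K * q ^ k)%R) -> cser a l -> (Cmod (l - csum a n) <= K * q ^ n / (1 - q))%R.
Proof.
  intros Hq H Hl. apply (cser_geom_le (fun k => a (n + k)%nat)); auto.
  - intros k. eapply Rle_trans; [apply H|]. rewrite pow_add. right; ring.
  - apply cser_drop; auto.
Qed.

Lemma pow_n_Cpow (x : C) (k : nat) : pow_n (K := C_AbsRing) x k = x ^ k.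
Proof. induction k; [reflexivity|]. cbn [pow_n Cpow]. rewrite IHk. reflexivity. Qed.

(** Translates the power series of the statement and of [positive_segre_family] into [cser]; the
    scalar stands on the other side and the partial sums are shifted by one. *)
Lemma is_pseries_cser (a : nat -> C) (x l : C) :
  is_pseries (K := C_AbsRing) (V := C_NormedModule) a x l <-> cser (fun k => a k * x ^ k) l.
Proof.
  assert (E : forall n, sum_n (G := C_NormedModule) (fun k => scal (K := C_AbsRing) (V := C_NormedModule) (pow_n (K := C_AbsRing) x k) (a k)) n = csum (fun k => a k * x ^ k) (S n)).
  { induction n.
    - rewrite sum_O. cbn [csum pow_n Cpow]. change (1 * a O = 0 + a O * 1). ring.
    - rewrite sum_Sn, IHn. change (csum (fun k => a k * x ^ k) (S (S n))) with (csum (fun k => a k * x ^ k) (S n) + a (S n) * x ^ (S n)).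
      change (csum (fun k => a k * x ^ k) (S n) + pow_n (K := C_AbsRing) x (S n) * a (S n) = csum (fun k => a k * x ^ k) (S n) + a (S n) * x ^ (S n)).
      rewrite (pow_n_Cpow x (S n)). ring. }
  unfold is_pseries, is_series. split.
  - intros H eps He.
    assert (Hloc : locally (T := C_NormedModule) l (fun w => Cmod (w - l) < eps)%R).
    { apply (locally_le_locally_norm (V := C_NormedModule)). exists (mkposreal eps He). intros w Hw. exact Hw. }
    destruct (H _ Hloc) as [N HN]. exists (S N). intros n Hn. destruct n; [lia|].
    specialize (HN n ltac:(lia)). rewrite E in HN. exact HN.
  - intros H P HP. apply (locally_norm_le_locally (V := C_NormedModule)) in HP. destruct HP as [d Hd].
    destruct (H d (cond_pos d)) as [N HN]. exists N. intros n Hn. rewrite E. apply Hd. apply HN. lia.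
Qed.

(** * Power series *)

(** The shape of Cauchy's estimates: it gives convergence for |w| < R with ratio |w| / R, and the
    explicit constant M makes uniformity in a parameter visible. *)
Definition pbound (c : nat -> C) (R M : R) : Prop := forall k, (Cmod (c k) * R ^ k <= M)%R.

Definition psum (c : nat -> C) (w : C) : C := csum_val (fun k => c k * w ^ k).

Lemma pbound_pos (c : nat -> C) (R M : R) : pbound c R M -> (0 <= M)%R.
Proof. intros H. specialize (H O). simpl in H. assert (A := Cmod_ge_0 (c O)). lra. Qed.

Lemma pbound_mono (c : nat -> C) (R R' M : R) : (0 <= R' <= R)%R -> pbound c R M -> pbound c R' M.
Proof.
  intros HR H k. eapply Rle_trans; [|apply (H k)].
  apply Rmult_le_compat_l; [apply Cmod_ge_0|]. apply pow_incr. lra.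
Qed.

Lemma pbound_term (c : nat -> C) (R M : R) (w : C) : (0 < R)%R -> pbound c R M ->
  forall k, (Cmod (c k * w ^ k) <= M * (Cmod w / R) ^ k)%R.
Proof.
  intros HR H k. rewrite Cmod_mult, Cmod_pow. specialize (H k).
  replace (Cmod w / R)%R with (Cmod w * / R)%R by reflexivity. rewrite Rpow_mult_distr, pow_inv.
  assert (0 < R ^ k)%R by (apply pow_lt; auto).
  replace (Cmod (c k) * Cmod w ^ k)%R with (Cmod (c k) * R ^ k * (Cmod w ^ k * / R ^ k))%R by (field; lra).
  apply Rmult_le_compat_r; auto. apply Rmult_le_pos; [apply pow_le, Cmod_ge_0|].
  left; apply Rinv_0_lt_compat; auto.
Qed.

Lemma ratio_lt1 (R x : R) : (0 <= x < R)%R -> (0 <= x / R < 1)%R.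
Proof.
  intros H. split.
  - apply Rmult_le_pos; [lra|]. left; apply Rinv_0_lt_compat; lra.
  - apply (Rmult_lt_reg_r R); [lra|]. unfold Rdiv. rewrite Rmult_assoc, Rinv_l by lra. lra.
Qed.

Lemma psum_cser (c : nat -> C) (R M : R) (w : C) :
  pbound c R M -> (Cmod w < R)%R -> cser (fun k => c k * w ^ k) (psum c w).
Proof.
  intros H Hw. assert (A := Cmod_ge_0 w).
  apply cser_geom_ex with M (Cmod w / R)%R; [apply ratio_lt1; lra|]. apply pbound_term; auto. lra.
Qed.

Lemma psum_tail (c : nat -> C) (R M : R) (w : C) (n : nat) :
  pbound c R M -> (Cmod w < R)%R ->
  (Cmod (psum c w - csum (fun k => c k * w ^ k)%C n) <= M * (Cmod w / R) ^ n / (1 - Cmod w / R))%R.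
Proof.
  intros H Hw. assert (A := Cmod_ge_0 w).
  apply cser_geom_tail; [apply ratio_lt1; lra|apply pbound_term; auto; lra|eapply psum_cser; eauto].
Qed.

Lemma psum_le (c : nat -> C) (R M : R) (w : C) :
  pbound c R M -> (Cmod w < R)%R -> (Cmod (psum c w) <= M / (1 - Cmod w / R))%R.
Proof.
  intros H Hw. assert (A := psum_tail c R M w O H Hw). simpl in A.
  replace (psum c w - 0) with (psum c w) in A by ring. rewrite Rmult_1_r in A. auto.
Qed.

Lemma psum_0 (c : nat -> C) (R M : R) : (0 < R)%R -> pbound c R M -> psum c 0 = c O.
Proof.
  intros HR H. assert (A := psum_tail c R M 0 1 H). rewrite Cmod_0 in A. specialize (A HR).
  unfold Rdiv in A. rewrite Rmult_0_l in A. simpl in A.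
  rewrite !Rmult_0_l, Rmult_0_r, Rmult_0_l in A.
  assert (B : psum c 0 - (0 + c O * 1) = 0) by (apply Cmod_eq_0; apply Rle_antisym; [auto|apply Cmod_ge_0]).
  replace (psum c 0) with (psum c 0 - (0 + c O * 1) + c O) by ring. rewrite B. ring.
Qed.

Definition pderiv (c : nat -> C) (k : nat) : C := INR (S k) * c (S k).

(** The factor k + 1 is absorbed by (R' / R)^k, which is why the radius has to shrink strictly. *)
Lemma pbound_deriv (c : nat -> C) (R R' M : R) : (0 <= R' < R)%R -> pbound c R M ->
  pbound (pderiv c) R' (M / R * (/ (1 - R' / R) * / (1 - R' / R))).
Proof.
  intros HR H k. unfold pderiv. rewrite Cmod_mult, Cmod_R, Rabs_pos_eq by apply pos_INR.
  assert (HM := pbound_pos _ _ _ H).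
  specialize (H (S k)). simpl in H.
  assert (Hq := ratio_lt1 R R' HR). assert (B := pow_q_bound (R' / R) k Hq).
  assert (0 < R ^ k)%R by (apply pow_lt; lra).
  replace (INR (S k) * Cmod (c (S k)) * R' ^ k)%R with
    ((Cmod (c (S k)) * (R * R ^ k)) / R * (INR (S k) * (R' / R) ^ k))%R.
  2:{ unfold Rdiv. rewrite Rpow_mult_distr, pow_inv. field. lra. }
  apply Rmult_le_compat; auto.
  - apply Rmult_le_pos; [apply Rmult_le_pos; [apply Cmod_ge_0|nra]|left; apply Rinv_0_lt_compat; lra].
  - apply Rmult_le_pos; [apply pos_INR|apply pow_le; lra].
  - apply Rmult_le_compat_r; auto. left; apply Rinv_0_lt_compat; lra.
Qed.

(** Both sides carry an extra factor rho so that the exponent k - 1 never appears; the same device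
    serves in the second order estimate below. *)
Lemma pow_diff1 (a b : C) (rho : R) (k : nat) : (0 <= rho)%R -> (Cmod a <= rho)%R -> (Cmod b <= rho)%R ->
  (Cmod (b ^ k - a ^ k) * rho <= INR k * rho ^ k * Cmod (b - a))%R.
Proof.
  intros Hr Ha Hb. induction k; [simpl; replace (1 - 1) with (RtoC 0) by ring; rewrite Cmod_0; lra|].
  rewrite !Cpow_S. replace (b * b ^ k - a * a ^ k) with (b * (b ^ k - a ^ k) + a ^ k * (b - a)) by ring.
  assert (Hd := Cmod_ge_0 (b - a)).
  assert (Cmod (b * (b ^ k - a ^ k) + a ^ k * (b - a)) <= rho * Cmod (b ^ k - a ^ k) + rho ^ k * Cmod (b - a))%R.
  { eapply Rle_trans; [apply Cmod_triangle|]. rewrite !Cmod_mult, Cmod_pow. apply Rplus_le_compat.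
    - apply Rmult_le_compat_r; [apply Cmod_ge_0|auto].
    - apply Rmult_le_compat_r; auto. apply pow_incr. split; [apply Cmod_ge_0|auto]. }
  rewrite S_INR. simpl pow.
  assert (rho * (Cmod (b ^ k - a ^ k) * rho) <= rho * (INR k * rho ^ k * Cmod (b - a)))%R by (apply Rmult_le_compat_l; auto).
  apply (Rmult_le_compat_r rho) in H; auto.
  lra.
Qed.

Lemma pow_diff2 (a b : C) (rho : R) (k : nat) : (0 <= rho)%R -> (Cmod a <= rho)%R -> (Cmod b <= rho)%R ->
  (Cmod (b ^ S k - a ^ S k - INR (S k) * a ^ k * (b - a)) * rho <=
   INR k * INR (S k) / 2 * rho ^ k * (Cmod (b - a) * Cmod (b - a)))%R.
Proof.
  intros Hr Ha Hb. induction k.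
  - simpl. replace (b * 1 - a * 1 - 1 * 1 * (b - a)) with (RtoC 0) by ring. rewrite Cmod_0. lra.
  - set (D := b ^ S k - a ^ S k - INR (S k) * a ^ k * (b - a)) in *.
    replace (b ^ S (S k) - a ^ S (S k) - INR (S (S k)) * a ^ S k * (b - a)) with
      (b * D + INR (S k) * a ^ k * ((b - a) * (b - a))).
    2:{ unfold D. rewrite (S_INR (S k)), RtoC_plus, !Cpow_S. ring. }
    assert (Hd := Cmod_ge_0 (b - a)). assert (HD := Cmod_ge_0 D). assert (HS := pos_INR (S k)).
    set (h := (Cmod (b - a) * Cmod (b - a))%R) in *. assert (Hh : (0 <= h)%R) by (unfold h; nra).
    assert (A : (Cmod (b * D + INR (S k) * a ^ k * ((b - a) * (b - a))) <= rho * Cmod D + INR (S k) * rho ^ k * h)%R).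
    { eapply Rle_trans; [apply Cmod_triangle|]. rewrite !Cmod_mult, Cmod_pow, Cmod_R, Rabs_pos_eq by auto.
      fold h. apply Rplus_le_compat.
      - apply Rmult_le_compat_r; auto.
      - apply Rmult_le_compat_r; auto. apply Rmult_le_compat_l; auto. apply pow_incr. split; [apply Cmod_ge_0|auto]. }
    rewrite (S_INR (S k)). simpl pow.
    apply (Rmult_le_compat_r rho) in A; auto.
    assert (rho * (Cmod D * rho) <= rho * (INR k * INR (S k) / 2 * rho ^ k * h))%R by (apply Rmult_le_compat_l; auto).
    rewrite S_INR in *. nra.
Qed.

Lemma psum_lip (c : nat -> C) (R rho M : R) (a b : C) :
  pbound c R M -> (0 < rho < R)%R -> (Cmod a <= rho)%R -> (Cmod b <= rho)%R ->
  (Cmod (psum c b - psum c a) <= M / R * (/ (1 - rho / R) * / (1 - rho / R)) * Cmod (b - a))%R.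
Proof.
  intros H Hr Ha Hb. assert (HM := pbound_pos _ _ _ H).
  assert (S1 := psum_cser c R M b H ltac:(lra)). assert (S2 := psum_cser c R M a H ltac:(lra)).
  apply (cser_scal (- (1))) in S2. assert (S3 := cser_plus _ _ _ _ S1 S2). cbv beta in S3.
  replace (psum c b + - (1) * psum c a) with (psum c b - psum c a) in S3 by ring.
  assert (Hq := ratio_lt1 R rho ltac:(lra)).
  assert (S4 := cser_Sl_inv _ _ S3). cbv beta in S4.
  replace (psum c b - psum c a - (c O * b ^ 0 + - (1) * (c O * a ^ 0))) with (psum c b - psum c a) in S4 by (simpl; ring).
  apply (cser_le _ _ _ S4). intros n.
  assert (Hd := Cmod_ge_0 (b - a)).
  eapply Rle_trans; [apply (csum_bound _ (fun k => (M / R * Cmod (b - a)) * (INR (S k) * (rho / R) ^ k))%R)|].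
  - intros k _.
    replace (c (S k) * b ^ S k + - (1) * (c (S k) * a ^ S k)) with (c (S k) * (b ^ S k - a ^ S k)) by ring.
    rewrite Cmod_mult. assert (P := pow_diff1 a b rho (S k) ltac:(lra) Ha Hb).
    specialize (H (S k)). assert (0 < R ^ k)%R by (apply pow_lt; lra).
    assert (0 < rho ^ k)%R by (apply pow_lt; lra).
    assert (Q : (Cmod (b ^ S k - a ^ S k) <= INR (S k) * rho ^ k * Cmod (b - a))%R).
    { apply (Rmult_le_reg_r rho); [lra|]. eapply Rle_trans; [exact P|]. simpl pow. right; ring. }
    replace (M / R * Cmod (b - a) * (INR (S k) * (rho / R) ^ k))%R with
      (M / (R ^ S k) * (INR (S k) * rho ^ k * Cmod (b - a)))%R.
    2:{ unfold Rdiv. rewrite Rpow_mult_distr, pow_inv. simpl pow. field. lra. }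
    apply Rmult_le_compat; try apply Cmod_ge_0; auto.
    assert (0 < R ^ S k)%R by (apply pow_lt; lra).
    apply (Rmult_le_reg_r (R ^ S k)); auto. unfold Rdiv. rewrite Rmult_assoc, Rinv_l; lra.
  - rewrite rsum_scal. assert (G := rsum_geom1 (rho / R) n Hq).
    replace (M / R * (/ (1 - rho / R) * / (1 - rho / R)) * Cmod (b - a))%R with
     (M / R * Cmod (b - a) * (/ (1 - rho / R) * / (1 - rho / R)))%R by ring.
    apply Rmult_le_compat_l; auto. apply Rmult_le_pos; auto.
    apply Rmult_le_pos; auto. left; apply Rinv_0_lt_compat; lra.
Qed.

(** Termwise second order remainders, summed by [rsum_geom2]. The constant depends on c only through
    M, so the estimate holds uniformly for a family of series; this is what makes functions of two
    variables jointly differentiable in [shol2_cder2]. *)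
Lemma psum_quad (c : nat -> C) (R rho M : R) (a b : C) :
  pbound c R M -> (0 < rho < R)%R -> (Cmod a <= rho)%R -> (Cmod b <= rho)%R ->
  (Cmod (psum c b - psum c a - psum (pderiv c) a * (b - a)) <=
   M / R / rho * (/ (1 - rho / R) * / (1 - rho / R) * / (1 - rho / R)) * (Cmod (b - a) * Cmod (b - a)))%R.
Proof.
  intros H Hr Ha Hb. assert (HM := pbound_pos _ _ _ H).
  assert (S1 := psum_cser c R M b H ltac:(lra)). assert (S2 := psum_cser c R M a H ltac:(lra)).
  apply (cser_scal (- (1))) in S2. assert (S3 := cser_plus _ _ _ _ S1 S2). cbv beta in S3.
  assert (Hq := ratio_lt1 R rho ltac:(lra)).
  assert (S4 := cser_Sl_inv _ _ S3). cbv beta in S4.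
  set (R' := ((rho + R) / 2)%R).
  assert (S5 := psum_cser _ _ _ a (pbound_deriv c R R' M ltac:(unfold R'; lra) H) ltac:(unfold R'; lra)).
  apply (cser_scal (- (b - a))) in S5. assert (S6 := cser_plus _ _ _ _ S4 S5). cbv beta in S6.
  apply (cser_eq _ _ (psum c b - psum c a - psum (pderiv c) a * (b - a))) in S6; [|simpl; ring].
  apply (cser_le _ _ _ S6). intros n.
  set (h := (Cmod (b - a) * Cmod (b - a))%R) in *.
  assert (Hh : (0 <= h)%R) by (unfold h; assert (Hd := Cmod_ge_0 (b - a)); nra).
  eapply Rle_trans; [apply (csum_bound _ (fun k => (M / R / rho * h) * (INR (S k) * INR (S (S k)) / 2 * (rho / R) ^ k))%R)|].
  - intros k _. unfold pderiv.
    replace (c (S k) * b ^ S k + - (1) * (c (S k) * a ^ S k) + - (b - a) * (INR (S k) * c (S k) * a ^ k)) with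
     (c (S k) * (b ^ S k - a ^ S k - INR (S k) * a ^ k * (b - a))) by ring.
    rewrite Cmod_mult. assert (P := pow_diff2 a b rho k ltac:(lra) Ha Hb). fold h in P.
    specialize (H (S k)). assert (0 < R ^ k)%R by (apply pow_lt; lra).
    assert (0 < rho ^ k)%R by (apply pow_lt; lra).
    assert (Q : (Cmod (b ^ S k - a ^ S k - INR (S k) * a ^ k * (b - a)) <= INR (S k) * INR (S (S k)) / 2 * rho ^ k * h / rho)%R).
    { apply (Rmult_le_reg_r rho); [lra|]. eapply Rle_trans; [exact P|].
      unfold Rdiv. rewrite (Rmult_assoc _ (/ rho) rho), Rinv_l by lra. rewrite Rmult_1_r.
      apply Rmult_le_compat_r; auto. apply Rmult_le_compat_r; [lra|].
      assert (HS := pos_INR (S k)). rewrite (S_INR (S k)). rewrite (S_INR k) in *. nra. }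
    replace (M / R / rho * h * (INR (S k) * INR (S (S k)) / 2 * (rho / R) ^ k))%R with
      (M / (R ^ S k) * (INR (S k) * INR (S (S k)) / 2 * rho ^ k * h / rho))%R.
    2:{ unfold Rdiv. rewrite Rpow_mult_distr, pow_inv. simpl pow. field. lra. }
    apply Rmult_le_compat; try apply Cmod_ge_0; auto.
    assert (0 < R ^ S k)%R by (apply pow_lt; lra).
    apply (Rmult_le_reg_r (R ^ S k)); auto. unfold Rdiv. rewrite Rmult_assoc, Rinv_l; lra.
  - rewrite rsum_scal. assert (G := rsum_geom2 (rho / R) n Hq).
    match goal with |- (_ <= ?x * ?y * h)%R => replace (x * y * h)%R with (x * h * y)%R by ring end.
    apply Rmult_le_compat_l; auto. apply Rmult_le_pos; auto.
    apply Rmult_le_pos; [apply Rmult_le_pos; auto|]; left; apply Rinv_0_lt_compat; lra.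
Qed.

Lemma cder_quad (f : C -> C) (z l : C) (d K : R) : (0 < d)%R ->
  (forall w, (Cmod (w - z) < d)%R -> (Cmod (f w - f z - l * (w - z)) <= K * (Cmod (w - z) * Cmod (w - z)))%R) ->
  cder f z l.
Proof.
  intros Hd H eps He. set (K' := (Rabs K + 1)%R). assert (HK : (K <= K')%R) by (unfold K'; assert (A := Rle_abs K); lra).
  assert (HK0 : (0 < K')%R) by (unfold K'; assert (A := Rabs_pos K); lra).
  exists (Rmin d (eps / K')). split; [apply Rmin_pos; auto; apply Rdiv_lt_0_compat; auto|].
  intros w Hw. eapply Rle_trans; [apply H; eapply Rlt_le_trans; [exact Hw|apply Rmin_l]|].
  assert (Hw2 := Rlt_le_trans _ _ _ Hw (Rmin_r _ _)). assert (A := Cmod_ge_0 (w - z)).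
  rewrite <- Rmult_assoc. apply Rmult_le_compat_r; auto.
  apply (Rmult_lt_compat_l K') in Hw2; auto. replace (K' * (eps / K'))%R with eps in Hw2 by (field; lra). nra.
Qed.

Lemma cder_psum (c : nat -> C) (R M : R) (w : C) :
  pbound c R M -> (Cmod w < R)%R -> cder (psum c) w (psum (pderiv c) w).
Proof.
  intros H Hw. assert (A := Cmod_ge_0 w). set (rho := ((Cmod w + R) / 2)%R).
  eapply (cder_quad _ _ _ (rho - Cmod w)); [unfold rho; lra|]. intros v Hv.
  apply (psum_quad c R rho M); auto; unfold rho in *; try lra.
  assert (T := Cmod_triangle (v - w) w). replace (v - w + w) with v in T by ring. lra.
Qed.

(** If the earlier coefficients vanish, c_k t^k has to balance a tail of order t^(k+1), which is
    impossible for small t. Only small positive t are tested, because reality will only be known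
    there. *)
Lemma psum_zero_coef (c : nat -> C) (rho M d : R) : (0 < rho)%R -> (0 < d)%R -> pbound c rho M ->
  (forall t : R, (0 < t < d)%R -> psum c t = 0) -> forall k, c k = 0.
Proof.
  intros HR Hd H H0 k. assert (HM := pbound_pos _ _ _ H).
  induction k as [k IH] using Wf_nat.lt_wf_ind.
  assert (Z : csum (fun j => 0) k = 0) by (clear; induction k; simpl; [auto|rewrite IHk; ring]).
  apply Cmod_eq_0. apply Rle_antisym; [|apply Cmod_ge_0]. apply Rnot_lt_le. intros Hlt.
  assert (HRk : (0 < rho ^ S k)%R) by (apply pow_lt; auto).
  (* For t <= rho / 2 the tail beyond c_k t^k is at most 2 M (t / rho)^(k+1) = B t t^k. *)
  set (B := (2 * M / rho ^ S k)%R). assert (HB : (0 <= B)%R).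
  { unfold B. apply Rmult_le_pos; [lra|]. left; apply Rinv_0_lt_compat; auto. }
  set (t := (Rmin (Rmin (rho / 2) (d / 2)) (Cmod (c k) / 2 / (B + 1)))%R).
  assert (Ht : (0 < t)%R).
  { unfold t. repeat apply Rmin_pos; try lra. apply Rdiv_lt_0_compat; lra. }
  assert (Ht1 : (t <= rho / 2)%R) by (eapply Rle_trans; [apply Rmin_l|apply Rmin_l]).
  assert (Ht2 : (t <= d / 2)%R) by (eapply Rle_trans; [apply Rmin_l|apply Rmin_r]).
  assert (Ht3 : (t <= Cmod (c k) / 2 / (B + 1))%R) by apply Rmin_r.
  assert (Hm : Cmod t = t) by (rewrite Cmod_R, Rabs_pos_eq; lra).
  assert (A := psum_tail c rho M t (S k) H ltac:(lra)). rewrite H0 in A by lra.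
  cbn [csum] in A.
  rewrite (csum_ext _ (fun j => 0)) in A by (intros j Hj; rewrite (IH j Hj); ring).
  rewrite Z in A.
  replace (0 - (0 + c k * RtoC t ^ k)) with (- (c k * RtoC t ^ k)) in A by ring.
  rewrite Cmod_opp, Cmod_mult, Cmod_pow, Hm in A.
  assert (Hq : (t / rho <= 1 / 2)%R).
  { apply (Rmult_le_reg_r rho); auto. unfold Rdiv at 1. rewrite Rmult_assoc, Rinv_l; lra. }
  assert (Htk : (0 < t ^ k)%R) by (apply pow_lt; auto).
  assert (A2 : (M * (t / rho) ^ S k / (1 - t / rho) <= M * (t / rho) ^ S k * 2)%R).
  { apply Rmult_le_compat_l.
    - apply Rmult_le_pos; auto. apply pow_le. apply Rmult_le_pos; [lra|left; apply Rinv_0_lt_compat; auto].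
    - rewrite <- (Rinv_inv 2). apply Rinv_le_contravar; lra. }
  assert (A3 : (M * (t / rho) ^ S k * 2 = B * t * t ^ k)%R).
  { unfold B, Rdiv. rewrite Rpow_mult_distr, pow_inv. simpl. field. split; [|lra]. assert (0 < rho ^ k)%R by (apply pow_lt; auto). lra. }
  assert (A4 : (Cmod (c k) <= B * t)%R) by (apply (Rmult_le_reg_r (t ^ k)); auto; lra).
  apply (Rmult_le_compat_l (B + 1)) in Ht3; [|lra].
  replace ((B + 1) * (Cmod (c k) / 2 / (B + 1)))%R with (Cmod (c k) / 2)%R in Ht3 by (field; lra).
  lra.
Qed.

Lemma pbound_plus (c c' : nat -> C) (R M M' : R) : (0 <= R)%R -> pbound c R M -> pbound c' R M' ->
  pbound (fun k => c k + c' k) R (M + M').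
Proof.
  intros HR H H' k. assert (0 <= R ^ k)%R by (apply pow_le; auto).
  assert (A := Cmod_triangle (c k) (c' k)). specialize (H k). specialize (H' k). nra.
Qed.

Lemma pbound_scal (a : C) (c : nat -> C) (R M : R) : pbound c R M -> pbound (fun k => a * c k) R (Cmod a * M).
Proof.
  intros H k. rewrite Cmod_mult, Rmult_assoc. apply Rmult_le_compat_l; [apply Cmod_ge_0|apply H].
Qed.

Lemma pbound_conj (c : nat -> C) (R M : R) : pbound c R M -> pbound (fun k => Cconj (c k)) R M.
Proof. intros H k. rewrite Cmod_conj. apply H. Qed.

Lemma psum_plus (c c' : nat -> C) (R M M' : R) (w : C) : pbound c R M -> pbound c' R M' -> (Cmod w < R)%R ->
  psum (fun k => c k + c' k) w = psum c w + psum c' w.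
Proof.
  intros H H' Hw. assert (0 <= Cmod w)%R by apply Cmod_ge_0.
  eapply cser_unique; [eapply psum_cser; [apply (pbound_plus c c' R M M'); auto; lra|auto]|].
  eapply cser_ext; [|apply cser_plus; [eapply psum_cser; eauto|eapply psum_cser; eauto]]. intros k; cbv beta; ring.
Qed.

Lemma psum_scal (a : C) (c : nat -> C) (R M : R) (w : C) : pbound c R M -> (Cmod w < R)%R ->
  psum (fun k => a * c k) w = a * psum c w.
Proof.
  intros H Hw.
  eapply cser_unique; [eapply psum_cser; [apply pbound_scal; eauto|auto]|].
  eapply cser_ext; [|apply cser_scal; eapply psum_cser; eauto]. intros k; cbv beta; ring.
Qed.

Lemma psum_conj (c : nat -> C) (R M : R) (w : C) : pbound c R M -> (Cmod w < R)%R ->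
  psum (fun k => Cconj (c k)) (Cconj w) = Cconj (psum c w).
Proof.
  intros H Hw.
  eapply cser_unique; [eapply psum_cser; [apply pbound_conj; eauto|rewrite Cmod_conj; auto]|].
  eapply cser_ext; [|apply cser_conj; eapply psum_cser; eauto]. intros k; cbv beta.
  rewrite Cmult_conj, Cpow_conj. auto.
Qed.

Lemma psum_unique (c c' : nat -> C) (rho M M' d : R) : (0 < rho)%R -> (0 < d)%R -> pbound c rho M -> pbound c' rho M' ->
  (forall t : R, (0 < t < d)%R -> psum c t = psum c' t) -> forall k, c k = c' k.
Proof.
  intros HR Hd H H' E k.
  assert (B := pbound_scal (- (1)) _ _ _ H').
  assert (Z := psum_zero_coef (fun k => c k + - (1) * c' k) rho _ (Rmin d rho) HR (Rmin_pos _ _ Hd HR) (pbound_plus _ _ _ _ _ (Rlt_le _ _ HR) H B)).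
  assert (Y : c k + - (1) * c' k = 0).
  { apply Z. intros t Ht. assert (t < d)%R by (eapply Rlt_le_trans; [apply Ht|apply Rmin_l]).
    assert (t < rho)%R by (eapply Rlt_le_trans; [apply Ht|apply Rmin_r]).
    assert (Hm : Cmod t = t) by (rewrite Cmod_R, Rabs_pos_eq; lra).
    rewrite (psum_plus c (fun k => - (1) * c' k) rho _ _ _ H B) by lra.
    rewrite (psum_scal _ _ rho M') by (auto; lra). rewrite E by lra. ring. }
  replace (c k) with (c k + - (1) * c' k + c' k) by ring. rewrite Y. ring.
Qed.

(** The series with conjugated coefficients takes the same values on the real interval, and
    coefficients are unique. *)
Lemma psum_real_coef (c : nat -> C) (rho M d : R) : (0 < rho)%R -> (0 < d)%R -> pbound c rho M ->
  (forall t : R, (0 < t < d)%R -> Im (psum c t) = 0%R) -> forall k, Im (c k) = 0%R.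
Proof.
  intros HR Hd H E k.
  assert (Y : Cconj (c k) = c k).
  { apply (psum_unique (fun k => Cconj (c k)) c rho M M (Rmin d rho)); auto.
    - apply Rmin_pos; auto.
    - apply pbound_conj; auto.
    - intros t Ht. assert (t < d)%R by (eapply Rlt_le_trans; [apply Ht|apply Rmin_l]).
      assert (t < rho)%R by (eapply Rlt_le_trans; [apply Ht|apply Rmin_r]).
      assert (Hm : Cmod t = t) by (rewrite Cmod_R, Rabs_pos_eq; lra).
      rewrite <- (Cconj_RtoC t) at 1. rewrite (psum_conj _ rho M) by (auto; lra).
      specialize (E t ltac:(lra)). revert E. generalize (psum c t). intros v E. apply C_eq; destruct v; simpl in *; lra. }
  apply (f_equal Im) in Y. destruct (c k); simpl in *. lra.
Qed.

(** * Complex exponential and polar coordinates *)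

Lemma Cexp_plus (a b : C) : Cexp (a + b) = Cexp a * Cexp b.
Proof.
  destruct a as [x y], b as [u v]. unfold Cexp. apply C_eq; simpl;
  rewrite exp_plus, ?cos_plus, ?sin_plus; ring.
Qed.

Lemma Cexp_0 : Cexp 0 = 1.
Proof. unfold Cexp; apply C_eq; simpl; rewrite exp_0, ?cos_0, ?sin_0; ring. Qed.

Lemma Cmod_Cexp (a : C) : Cmod (Cexp a) = exp (Re a).
Proof.
  unfold Cmod, Cexp; simpl.
  replace (exp (Re a) * cos (Im a) * (exp (Re a) * cos (Im a) * 1) + exp (Re a) * sin (Im a) * (exp (Re a) * sin (Im a) * 1))%R
   with (Rsqr (exp (Re a)) * (Rsqr (sin (Im a)) + Rsqr (cos (Im a))))%R by (unfold Rsqr; ring).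
  rewrite sin2_cos2, Rmult_1_r. apply sqrt_Rsqr. left; apply exp_pos.
Qed.

Lemma Cexp_neq_0 (a : C) : Cexp a <> 0.
Proof. apply Cmod_gt_0. rewrite Cmod_Cexp. apply exp_pos. Qed.

Lemma Cexp_der0 : forall eps, (0 < eps)%R -> exists d, (0 < d)%R /\
  forall h, (Cmod h < d)%R -> (Cmod (Cexp h - 1 - h) <= eps * Cmod h)%R.
Proof.
  intros eps He.
  assert (De : is_derive exp 0%R 1%R) by (evar_last; [apply is_derive_exp|apply exp_0]).
  assert (Dc : is_derive cos 0%R 0%R) by (evar_last; [apply is_derive_cos|rewrite sin_0; ring]).
  assert (Ds : is_derive sin 0%R 1%R) by (evar_last; [apply is_derive_sin|rewrite cos_0; ring]).
  (* The five errors below weigh 1, 2, 2, 1, 1 times e |h|, in all 7 < 8. The cap 1 / 2 keeps |1 +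
     x| below 2. *)
  set (e := (Rmin (eps / 8) (1 / 2))%R). assert (He' : (0 < e)%R) by (apply Rmin_pos; lra).
  assert (E1 : (e <= eps / 8)%R) by apply Rmin_l. assert (E2 : (e <= 1 / 2)%R) by apply Rmin_r.
  rewrite is_derive_R_eps in De, Dc, Ds.
  destruct (De e He') as [d1 [P1 D1]]. destruct (Dc e He') as [d2 [P2 D2]]. destruct (Ds e He') as [d3 [P3 D3]].
  exists (Rmin (Rmin d1 d2) (Rmin d3 e)). split; [apply Rmin_pos; apply Rmin_pos; assumption|].
  intros h Hh. assert (H1 := Rlt_le_trans _ _ _ Hh (Rmin_l _ _)). assert (H2 := Rlt_le_trans _ _ _ Hh (Rmin_r _ _)).
  assert (H3 := Rlt_le_trans _ _ _ H1 (Rmin_l _ _)). assert (H4 := Rlt_le_trans _ _ _ H1 (Rmin_r _ _)).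
  assert (H5 := Rlt_le_trans _ _ _ H2 (Rmin_l _ _)). assert (H6 := Rlt_le_trans _ _ _ H2 (Rmin_r _ _)).
  assert (Rx := re_le_Cmod h). assert (Ry := im_le_Cmod h).
  set (x := Re h) in *. set (y := Im h) in *. set (m := Cmod h) in *.
  specialize (D1 x). specialize (D2 y). specialize (D3 y). rewrite Rminus_0_r in D1, D2, D3.
  rewrite exp_0 in D1. rewrite cos_0 in D2. rewrite sin_0 in D3.
  specialize (D1 ltac:(lra)). specialize (D2 ltac:(lra)). specialize (D3 ltac:(lra)).
  eapply Rle_trans; [apply Cmod_le_abs|].
  replace (Re (Cexp h - 1 - h)) with ((exp x - 1 - 1 * x) * cos y + (1 + x) * (cos y - 1 - 0 * y))%R
    by (unfold Cexp, Re, Im, x, y; simpl; unfold Re, Im; ring).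
  replace (Im (Cexp h - 1 - h)) with ((1 + x) * (sin y - 0 - 1 * y) + (exp x - 1 - 1 * x) * sin y + x * y)%R
    by (unfold Cexp, Re, Im, x, y; simpl; unfold Re, Im; ring).
  assert (C1 : (Rabs (cos y) <= 1)%R) by (apply Rabs_le, COS_bound).
  assert (S1 : (Rabs (sin y) <= 1)%R) by (apply Rabs_le, SIN_bound).
  assert (X1 : (Rabs (1 + x) <= 2)%R) by (eapply Rle_trans; [apply Rabs_triang|rewrite Rabs_R1; lra]).
  assert (Hm : (0 <= m)%R) by apply Cmod_ge_0.
  assert (T1 : (Rabs ((exp x - 1 - 1 * x) * cos y) <= e * m)%R).
  { rewrite Rabs_mult. rewrite <- (Rmult_1_r (e * m)). apply Rmult_le_compat; try apply Rabs_pos; auto.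
    eapply Rle_trans; [exact D1|]. apply Rmult_le_compat_l; lra. }
  assert (T2 : (Rabs ((1 + x) * (cos y - 1 - 0 * y)) <= 2 * (e * m))%R).
  { rewrite Rabs_mult. apply Rmult_le_compat; try apply Rabs_pos; auto.
    eapply Rle_trans; [exact D2|]. apply Rmult_le_compat_l; lra. }
  assert (T3 : (Rabs ((1 + x) * (sin y - 0 - 1 * y)) <= 2 * (e * m))%R).
  { rewrite Rabs_mult. apply Rmult_le_compat; try apply Rabs_pos; auto.
    eapply Rle_trans; [exact D3|]. apply Rmult_le_compat_l; lra. }
  assert (T4 : (Rabs ((exp x - 1 - 1 * x) * sin y) <= e * m)%R).
  { rewrite Rabs_mult. rewrite <- (Rmult_1_r (e * m)). apply Rmult_le_compat; try apply Rabs_pos; auto.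
    eapply Rle_trans; [exact D1|]. apply Rmult_le_compat_l; lra. }
  assert (T5 : (Rabs (x * y) <= e * m)%R).
  { rewrite Rabs_mult. apply Rmult_le_compat; try apply Rabs_pos; lra. }
  assert (A1 := Rabs_triang ((exp x - 1 - 1 * x) * cos y) ((1 + x) * (cos y - 1 - 0 * y))).
  assert (A2 := Rabs_triang ((1 + x) * (sin y - 0 - 1 * y) + (exp x - 1 - 1 * x) * sin y) (x * y)).
  assert (A3 := Rabs_triang ((1 + x) * (sin y - 0 - 1 * y)) ((exp x - 1 - 1 * x) * sin y)).
  assert (e * m <= eps / 8 * m)%R by (apply Rmult_le_compat_r; auto).
  assert (0 <= eps * m)%R by (apply Rmult_le_pos; lra). lra.
Qed.

Lemma cder_Cexp (z : C) : cder Cexp z (Cexp z).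
Proof.
  intros eps He. assert (Hp := proj1 (Cmod_gt_0 _) (Cexp_neq_0 z)).
  destruct (Cexp_der0 (eps / Cmod (Cexp z))%R) as [d [Hd H]]; [apply Rdiv_lt_0_compat; auto|].
  exists d. split; auto. intros w Hw. specialize (H _ Hw).
  replace (Cexp w - Cexp z - Cexp z * (w - z)) with (Cexp z * (Cexp (w - z) - 1 - (w - z))).
  - rewrite Cmod_mult. apply (Rmult_le_compat_l (Cmod (Cexp z))) in H; [|lra].
    eapply Rle_trans; [exact H|]. right. field. lra.
  - replace (Cexp w) with (Cexp z * Cexp (w - z)) by (rewrite <- Cexp_plus; f_equal; ring). ring.
Qed.

Lemma polar (w : C) : w <> 0 -> exists z, w = Cexp z.
Proof.
  intros Hw. assert (Hp := proj1 (Cmod_gt_0 _) Hw). set (m := Cmod w) in *.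
  set (x := (Re w / m)%R). set (y := (Im w / m)%R).
  assert (Hm : (m * m = Re w * Re w + Im w * Im w)%R).
  { assert (A := Cmod2_alt w). fold m in A. simpl in A. lra. }
  assert (Hxy : (x * x + y * y = 1)%R).
  { unfold x, y. replace (Re w / m * (Re w / m) + Im w / m * (Im w / m))%R with ((Re w * Re w + Im w * Im w) / (m * m))%R by (field; lra).
    rewrite <- Hm. field; lra. }
  assert (Hx : (-1 <= x <= 1)%R) by nra.
  set (t := acos x). assert (Ct : cos t = x) by (apply cos_acos; auto).
  assert (St : sin t = Rabs y).
  { unfold t. rewrite sin_acos by auto. replace (1 - x²)%R with (Rsqr y) by (unfold Rsqr; lra). apply sqrt_Rsqr_abs. }
  (* [acos] returns an angle in [0, PI]; the sign of the imaginary part decides between this angle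
     and its opposite. *)
  exists (ln m, if Rle_dec 0 y then t else (- t)%R).
  unfold Cexp. simpl. rewrite exp_ln by auto.
  destruct (Rle_dec 0 y) as [Hy|Hy]; [|rewrite cos_neg, sin_neg]; rewrite Ct, St;
  [rewrite Rabs_pos_eq by auto|rewrite Rabs_left by lra]; apply C_eq; simpl; unfold x, y; field; lra.
Qed.

(** The quotient is 1, so with t the difference of the imaginary parts sin (t / 2) = 0, and |t / 2|
    <= PI / 2 leaves only t = 0. The closed bound is enough to compare any point of a strip of
    height 2 PI with a point on its middle line. *)
Lemma Cexp_inj_strip (a b : C) : Cexp a = Cexp b -> (Rabs (Im a - Im b) <= PI)%R -> a = b.
Proof.
  intros H Hi.
  assert (HR : Re a = Re b).
  { apply exp_inv. rewrite <- !Cmod_Cexp. congruence. }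
  assert (H1 : Cexp (a - b) = 1).
  { replace (Cexp (a - b)) with (Cexp (a - b) * Cexp b / Cexp b) by (field; apply Cexp_neq_0).
    rewrite <- Cexp_plus. replace (a - b + b) with a by ring. rewrite H. field. apply Cexp_neq_0. }
  set (t := (Im a - Im b)%R) in *.
  assert (Hc : cos t = 1%R).
  { apply (f_equal Re) in H1. unfold Cexp in H1. simpl in H1.
    replace (fst a + - fst b)%R with 0%R in H1 by (unfold Re in HR; lra). rewrite exp_0, Rmult_1_l in H1. exact H1. }
  assert (Hs : sin (t / 2) = 0%R).
  { assert (A := cos_2a_sin (t / 2)). replace (2 * (t / 2))%R with t in A by field. rewrite Hc in A. nra. }
  assert (Ht : t = 0%R).
  { assert (HPI := PI_RGT_0). destruct (Rtotal_order t 0) as [Hlt|[E|Hgt]]; auto.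
    - exfalso. assert (P : (0 < sin (- (t / 2)))%R). { apply sin_gt_0; [lra|]. rewrite Rabs_left in Hi by lra. lra. }
      rewrite sin_neg in P. lra.
    - exfalso. assert (P : (0 < sin (t / 2))%R). { apply sin_gt_0; [lra|]. rewrite Rabs_pos_eq in Hi by lra. lra. } lra. }
  apply C_eq; auto. unfold t in Ht. lra.
Qed.

(** * Integrals of complex functions of a real variable *)

Definition rcont (f : R -> C) (t : R) : Prop :=
  continuous (fun s => Re (f s)) t /\ continuous (fun s => Im (f s)) t.

Definition CInt (f : R -> C) (a b : R) : C :=
  (RInt (fun t => Re (f t)) a b, RInt (fun t => Im (f t)) a b).

Lemma continuous_R_eps (f : R -> R) (t : R) :
  continuous f t <-> forall eps, (0 < eps)%R -> exists d, (0 < d)%R /\ forall s, (Rabs (s - t) < d)%R -> (Rabs (f s - f t) < eps)%R.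
Proof.
  split.
  - intros H eps He. destruct (H (fun y => Rabs (y - f t) < eps)%R) as [d Hd].
    + exists (mkposreal eps He). intros y Hy. exact Hy.
    + exists d. split; [apply cond_pos|]. intros s Hs. apply Hd. exact Hs.
  - intros H P [e He]. destruct (H e (cond_pos e)) as [d [Hd H1]]. exists (mkposreal d Hd). intros s Hs. apply He.
    apply H1. exact Hs.
Qed.

Lemma rcont_eps (f : R -> C) (t : R) :
  rcont f t <-> forall eps, (0 < eps)%R -> exists d, (0 < d)%R /\ forall s, (Rabs (s - t) < d)%R -> (Cmod (f s - f t) < eps)%R.
Proof.
  unfold rcont. rewrite !continuous_R_eps. split.
  - intros [H1 H2] eps He. destruct (H1 (eps / 2)%R) as [d [Hd A]]; [lra|]. destruct (H2 (eps / 2)%R) as [d' [Hd' B]]; [lra|].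
    exists (Rmin d d'). split; [apply Rmin_pos; auto|]. intros s Hs.
    specialize (A s (Rlt_le_trans _ _ _ Hs (Rmin_l _ _))). specialize (B s (Rlt_le_trans _ _ _ Hs (Rmin_r _ _))).
    eapply Rle_lt_trans; [apply Cmod_le_abs|]. unfold Re, Im in *. simpl. unfold Rminus in *. lra.
  - intros H; split; intros eps He; destruct (H eps He) as [d [Hd A]]; exists d; split; auto; intros s Hs;
    specialize (A s Hs); eapply Rle_lt_trans; try exact A.
    + eapply Rle_trans; [|apply re_le_Cmod]. right; reflexivity.
    + eapply Rle_trans; [|apply im_le_Cmod]. right; reflexivity.
Qed.

Lemma rcont_comp (f : C -> C) (g : R -> C) (t : R) : ccont f (g t) -> rcont g t -> rcont (fun s => f (g s)) t.
Proof.
  rewrite !rcont_eps. intros Hf Hg eps He. destruct (Hf eps He) as [d [Hd H]].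
  destruct (Hg d Hd) as [d' [Hd' H']]. exists d'; split; auto.
Qed.

Lemma rder_rcont (f : R -> C) (t : R) (l : C) : rder f t l -> rcont f t.
Proof.
  intros [A B]. split; [apply (ex_derive_continuous (V := R_NormedModule)); exists (Re l)|apply (ex_derive_continuous (V := R_NormedModule)); exists (Im l)]; auto.
Qed.

Lemma rcont_const (c : C) (t : R) : rcont (fun _ => c) t.
Proof. eapply rder_rcont, rder_const. Qed.

Lemma rcont_mult (f g : R -> C) (t : R) : rcont f t -> rcont g t -> rcont (fun s => f s * g s) t.
Proof.
  intros [A B] [A' B']. split; simpl.
  - apply (continuous_minus (V := R_NormedModule)); apply (continuous_mult (K := R_AbsRing)); auto.
  - apply (continuous_plus (V := R_NormedModule)); apply (continuous_mult (K := R_AbsRing)); auto.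
Qed.

Lemma rcont_plus (f g : R -> C) (t : R) : rcont f t -> rcont g t -> rcont (fun s => f s + g s) t.
Proof. intros [A B] [A' B']. split; simpl; apply (continuous_plus (V := R_NormedModule)); auto. Qed.

Lemma rcont_ex_RInt (f : R -> C) (a b : R) : (a <= b)%R -> (forall t, (a <= t <= b)%R -> rcont f t) ->
  ex_RInt (fun t => Re (f t)) a b /\ ex_RInt (fun t => Im (f t)) a b.
Proof.
  intros Hab H. split; apply (ex_RInt_continuous (V := R_CompleteNormedModule)); intros t;
  rewrite Rmin_left, Rmax_right by auto; intros Ht; destruct (H t Ht); assumption.
Qed.

Lemma CInt_Chasles (f : R -> C) (a b c : R) : (a <= b <= c)%R -> (forall t, (a <= t <= c)%R -> rcont f t) ->
  CInt f a c = CInt f a b + CInt f b c.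
Proof.
  intros Hab H.
  destruct (rcont_ex_RInt f a b ltac:(lra)) as [A1 A2]; [intros; apply H; lra|].
  destruct (rcont_ex_RInt f b c ltac:(lra)) as [B1 B2]; [intros; apply H; lra|].
  unfold CInt. apply C_eq; simpl; symmetry; apply (RInt_Chasles (V := R_CompleteNormedModule)); auto.
Qed.

Lemma CInt_plus (f g : R -> C) (a b : R) : (a <= b)%R -> (forall t, (a <= t <= b)%R -> rcont f t) ->
  (forall t, (a <= t <= b)%R -> rcont g t) -> CInt (fun t => f t + g t) a b = CInt f a b + CInt g a b.
Proof.
  intros Hab H H'. destruct (rcont_ex_RInt f a b Hab H) as [A1 A2]. destruct (rcont_ex_RInt g a b Hab H') as [B1 B2].
  unfold CInt. apply C_eq; simpl; [apply (RInt_plus (V := R_CompleteNormedModule) (fun t => Re (f t)) (fun t => Re (g t))) |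
   apply (RInt_plus (V := R_CompleteNormedModule) (fun t => Im (f t)) (fun t => Im (g t)))]; auto.
Qed.

Lemma CInt_scal (c : C) (f : R -> C) (a b : R) : (a <= b)%R -> (forall t, (a <= t <= b)%R -> rcont f t) ->
  CInt (fun t => c * f t) a b = c * CInt f a b.
Proof.
  intros Hab H. destruct (rcont_ex_RInt f a b Hab H) as [A1 A2].
  assert (S : forall k h, ex_RInt h a b -> RInt (fun t => k * h t)%R a b = (k * RInt h a b)%R).
  { intros k h Hh. apply (RInt_scal (V := R_CompleteNormedModule) h a b k); auto. }
  assert (X : forall k h, ex_RInt h a b -> ex_RInt (fun t => k * h t)%R a b).
  { intros k h Hh. apply (ex_RInt_scal (V := R_CompleteNormedModule) h a b k); auto. }
  unfold CInt. apply C_eq; simpl.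
  - rewrite <- !S by auto. apply (RInt_minus (V := R_CompleteNormedModule) (fun t => fst c * Re (f t))%R (fun t => snd c * Im (f t))%R); apply X; auto.
  - rewrite <- !S by auto. apply (RInt_plus (V := R_CompleteNormedModule) (fun t => fst c * Im (f t))%R (fun t => snd c * Re (f t))%R); apply X; auto.
Qed.

Lemma CInt_ext (f g : R -> C) (a b : R) : (a <= b)%R -> (forall t, (a <= t <= b)%R -> f t = g t) -> CInt f a b = CInt g a b.
Proof.
  intros Hab H. unfold CInt. f_equal; apply RInt_ext; intros t; rewrite Rmin_left, Rmax_right by auto; intros Ht;
  rewrite H by lra; auto.
Qed.

Lemma CInt_const (c : C) (a b : R) : CInt (fun _ => c) a b = c * (b - a)%R.
Proof. unfold CInt. rewrite !RInt_const. unfold scal; simpl; unfold mult; simpl. apply C_eq; simpl; unfold Re, Im; ring. Qed.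

(** The factor 2 is the price of bounding the real and imaginary parts separately; it reappears as
    the 2 M of all the Cauchy estimates below. *)
Lemma CInt_bound (f : R -> C) (a b K : R) : (a <= b)%R -> (forall t, (a <= t <= b)%R -> rcont f t) ->
  (forall t, (a <= t <= b)%R -> (Cmod (f t) <= K)%R) -> (Cmod (CInt f a b) <= 2 * K * (b - a))%R.
Proof.
  intros Hab H HK. destruct (rcont_ex_RInt f a b Hab H) as [A1 A2].
  eapply Rle_trans; [apply Cmod_le_abs|]. simpl.
  assert (B1 : (Rabs (RInt (fun t => Re (f t)) a b) <= (b - a) * K)%R).
  { apply abs_RInt_le_const; auto. intros t Ht. eapply Rle_trans; [apply re_le_Cmod|auto]. }
  assert (B2 : (Rabs (RInt (fun t => Im (f t)) a b) <= (b - a) * K)%R).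
  { apply abs_RInt_le_const; auto. intros t Ht. eapply Rle_trans; [apply im_le_Cmod|auto]. }
  lra.
Qed.

Lemma CInt_FTC (F f : R -> C) (a b : R) : (a <= b)%R -> (forall t, (a <= t <= b)%R -> rder F t (f t)) ->
  (forall t, (a <= t <= b)%R -> rcont f t) -> CInt f a b = F b - F a.
Proof.
  intros Hab HF Hf. unfold CInt. apply C_eq; simpl.
  - apply (is_RInt_unique (V := R_CompleteNormedModule)). apply (is_RInt_derive (V := R_CompleteNormedModule) (fun t => Re (F t)));
    intros t; rewrite Rmin_left, Rmax_right by auto; intros Ht; destruct (HF t Ht), (Hf t Ht); assumption.
  - apply (is_RInt_unique (V := R_CompleteNormedModule)). apply (is_RInt_derive (V := R_CompleteNormedModule) (fun t => Im (F t)));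
    intros t; rewrite Rmin_left, Rmax_right by auto; intros Ht; destruct (HF t Ht), (Hf t Ht); assumption.
Qed.

(** The logarithmic rectangle used for annuli starts at an angle adapted to the exceptional point,
    so its integrals have to be moved back to [0, 2 PI]. *)
Lemma CInt_periodic (f : R -> C) (a T : R) : (0 <= T)%R -> (forall t, rcont f t) -> (forall t, f (t + T)%R = f t) ->
  CInt f a (a + T) = CInt f 0 T.
Proof.
  intros HT H Hp.
  assert (X1 : forall a b, ex_RInt (fun t => Re (f t)) a b) by (intros; apply (ex_RInt_continuous (V := R_CompleteNormedModule)); intros t _; exact (proj1 (H t))).
  assert (X2 : forall a b, ex_RInt (fun t => Im (f t)) a b) by (intros; apply (ex_RInt_continuous (V := R_CompleteNormedModule)); intros t _; exact (proj2 (H t))).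
  assert (G : forall h : R -> R, (forall a b, ex_RInt h a b) -> (forall t, h (t + T)%R = h t) -> RInt h a (a + T) = RInt h 0 T).
  { intros h Hx Hh.
    assert (C1 := RInt_Chasles (V := R_CompleteNormedModule) h a 0 T (Hx _ _) (Hx _ _)).
    assert (C2 := RInt_Chasles (V := R_CompleteNormedModule) h a T (a + T) (Hx _ _) (Hx _ _)).
    assert (L : RInt h T (a + T) = RInt h 0 a).
    { assert (A := RInt_comp_lin (V := R_CompleteNormedModule) h 1 T 0 a).
      replace (1 * 0 + T)%R with T in A by ring. replace (1 * a + T)%R with (a + T)%R in A by ring.
      rewrite <- A by apply Hx. apply RInt_ext. intros t _. unfold scal; simpl; unfold mult; simpl.
      rewrite Rmult_1_l. rewrite <- (Hh t). f_equal; ring. }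
    assert (S := opp_RInt_swap (V := R_CompleteNormedModule) h 0 a (Hx _ _)).
    unfold plus, opp in *; simpl in *. lra. }
  unfold CInt. f_equal; apply G; auto; intros; rewrite Hp; auto.
Qed.

(** * Goursat's theorem on rectangles *)

(** The counterclockwise integral of g dz along the boundary of [a, b] x [c, d]: bottom, right side,
    top reversed, left side reversed. The factors [Ci] come from dz = i dy. *)
Definition rint (g : C -> C) (a b c d : R) : C :=
  CInt (fun x => g (x, c)) a b + Ci * CInt (fun y => g (b, y)) c d
  - CInt (fun x => g (x, d)) a b - Ci * CInt (fun y => g (a, y)) c d.

Lemma rcont_hor (g : C -> C) (x y : R) : ccont g (x, y) -> rcont (fun s => g (s, y)) x.
Proof.
  intros H. apply (rcont_comp g (fun s => (s, y))); auto. split; simpl; [apply continuous_id|apply continuous_const].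
Qed.

Lemma rcont_ver (g : C -> C) (x y : R) : ccont g (x, y) -> rcont (fun s => g (x, s)) y.
Proof.
  intros H. apply (rcont_comp g (fun s => (x, s))); auto. split; simpl; [apply continuous_const|apply continuous_id].
Qed.

Lemma rint_cut_x (g : C -> C) (a m b c d : R) : (a <= m <= b)%R ->
  (forall x, (a <= x <= b)%R -> ccont g (x, c)) -> (forall x, (a <= x <= b)%R -> ccont g (x, d)) ->
  rint g a b c d = rint g a m c d + rint g m b c d.
Proof.
  intros Hm Hc Hd. unfold rint.
  rewrite (CInt_Chasles (fun x => g (x, c)) a m b) by (auto; intros; apply rcont_hor; auto).
  rewrite (CInt_Chasles (fun x => g (x, d)) a m b) by (auto; intros; apply rcont_hor; auto). ring.
Qed.

Lemma rint_cut_y (g : C -> C) (a b c m d : R) : (c <= m <= d)%R ->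
  (forall y, (c <= y <= d)%R -> ccont g (a, y)) -> (forall y, (c <= y <= d)%R -> ccont g (b, y)) ->
  rint g a b c d = rint g a b c m + rint g a b m d.
Proof.
  intros Hm Hc Hd. unfold rint.
  rewrite (CInt_Chasles (fun y => g (a, y)) c m d) by (auto; intros; apply rcont_ver; auto).
  rewrite (CInt_Chasles (fun y => g (b, y)) c m d) by (auto; intros; apply rcont_ver; auto). ring.
Qed.

Definition inrect (a b c d : R) (z : C) : Prop := (a <= Re z <= b)%R /\ (c <= Im z <= d)%R.

Lemma rint_plus (g h : C -> C) (a b c d : R) : (a <= b)%R -> (c <= d)%R ->
  (forall z, inrect a b c d z -> ccont g z) -> (forall z, inrect a b c d z -> ccont h z) ->
  rint (fun z => g z + h z) a b c d = rint g a b c d + rint h a b c d.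
Proof.
  intros Hab Hcd Hg Hh. unfold rint, inrect in *.
  rewrite !CInt_plus; auto; try ring; intros; try apply rcont_hor; try apply rcont_ver; try apply Hg; try apply Hh; simpl; lra.
Qed.

Lemma rint_bound (g : C -> C) (a b c d K : R) : (a <= b)%R -> (c <= d)%R ->
  (forall x, (a <= x <= b)%R -> ccont g (x, c) /\ ccont g (x, d) /\ (Cmod (g (x, c)) <= K)%R /\ (Cmod (g (x, d)) <= K)%R) ->
  (forall y, (c <= y <= d)%R -> ccont g (a, y) /\ ccont g (b, y) /\ (Cmod (g (a, y)) <= K)%R /\ (Cmod (g (b, y)) <= K)%R) ->
  (Cmod (rint g a b c d) <= 4 * K * (b - a + (d - c)))%R.
Proof.
  intros Hab Hcd Hx Hy. unfold rint.
  assert (B1 := CInt_bound (fun x => g (x, c)) a b K Hab ltac:(intros; apply rcont_hor, Hx; auto) ltac:(intros; apply Hx; auto)).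
  assert (B2 := CInt_bound (fun x => g (x, d)) a b K Hab ltac:(intros; apply rcont_hor, Hx; auto) ltac:(intros; apply Hx; auto)).
  assert (B3 := CInt_bound (fun y => g (a, y)) c d K Hcd ltac:(intros; apply rcont_ver, Hy; auto) ltac:(intros; apply Hy; auto)).
  assert (B4 := CInt_bound (fun y => g (b, y)) c d K Hcd ltac:(intros; apply rcont_ver, Hy; auto) ltac:(intros; apply Hy; auto)).
  eapply Rle_trans; [apply Cmod_sub_triangle|]. rewrite Cmod_mult, Cmod_Ci.
  match goal with |- (Cmod ?X + _ <= _)%R => assert (T1 := Cmod_sub_triangle (CInt (fun x => g (x, c)) a b + Ci * CInt (fun y => g (b, y)) c d) (CInt (fun x => g (x, d)) a b)) end.
  assert (T2 := Cmod_triangle (CInt (fun x => g (x, c)) a b) (Ci * CInt (fun y => g (b, y)) c d)).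
  rewrite Cmod_mult, Cmod_Ci in T2. lra.
Qed.

Lemma rint_primitive (F g : C -> C) (a b c d : R) : (a <= b)%R -> (c <= d)%R ->
  (forall z, cder F z (g z)) -> (forall z, ccont g z) -> rint g a b c d = 0.
Proof.
  intros Hab Hcd HF Hg. unfold rint.
  assert (Hh : forall y, CInt (fun x => g (x, y)) a b = F (b, y) - F (a, y)).
  { intros y. apply (CInt_FTC (fun x => F (x, y))); auto; intros t _; [|apply rcont_hor, Hg].
    eapply rder_eq; [apply (rder_comp F (fun s => (s, y)) t (g (t, y)) 1); [apply HF|]|].
    - split; simpl; [apply @is_derive_id|apply @is_derive_const].
    - ring. }
  assert (Hv : forall x, Ci * CInt (fun y => g (x, y)) c d = F (x, d) - F (x, c)).
  { intros x. rewrite <- CInt_scal by (auto; intros; apply rcont_ver, Hg).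
    apply (CInt_FTC (fun y => F (x, y))); auto; intros t _.
    - eapply rder_eq; [apply (rder_comp F (fun s => (x, s)) t (g (x, t)) Ci); [apply HF|]|].
      + split; simpl; [apply @is_derive_const|apply @is_derive_id].
      + ring.
    - apply rcont_mult; [apply rcont_const|]. apply rcont_ver, Hg. }
  rewrite !Hh, !Hv. ring.
Qed.

Section Goursat.
Variables (g : C -> C) (a0 b0 c0 d0 : R).
Hypothesis (Hab : (a0 <= b0)%R) (Hcd : (c0 <= d0)%R).
Hypothesis Hg : forall z, inrect a0 b0 c0 d0 z -> exists l, cder g z l.
Variable eps : R.

Let hw (n : nat) : R := ((b0 - a0) / 2 ^ n)%R.
Let hh (n : nat) : R := ((d0 - c0) / 2 ^ n)%R.
Let bad (n : nat) (p : R * R) : Prop :=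
  (eps * ((hw n + hh n) * (hw n + hh n)) < Cmod (rint g (fst p) (fst p + hw n) (snd p) (snd p + hh n)))%R.

(** Bisection that looks for a quarter whose integral is still too large. The fourth quarter is
    taken by default; [step_bad] shows that it is bad if the other three are not. *)
Let step (n : nat) (p : R * R) : R * R :=
  let a := fst p in let c := snd p in let h := hw (S n) in let k := hh (S n) in
  let B := (eps * ((h + k) * (h + k)))%R in
  if Rlt_dec B (Cmod (rint g a (a + h) c (c + k))) then (a, c)
  else if Rlt_dec B (Cmod (rint g (a + h) (a + h + h) c (c + k))) then ((a + h)%R, c)
  else if Rlt_dec B (Cmod (rint g a (a + h) (c + k) (c + k + k))) then (a, (c + k)%R)
  else ((a + h)%R, (c + k)%R).

Let pt (n : nat) : R * R := nat_rect (fun _ => (R * R)%type) (a0, c0) step n.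

Lemma hw_S n : hw n = (hw (S n) + hw (S n))%R.
Proof. unfold hw. simpl. field. apply pow_nonzero; lra. Qed.
Lemma hh_S n : hh n = (hh (S n) + hh (S n))%R.
Proof. unfold hh. simpl. field. apply pow_nonzero; lra. Qed.
Lemma hw_pos n : (0 <= hw n)%R.
Proof. unfold hw. apply Rmult_le_pos; [lra|]. left. apply Rinv_0_lt_compat, pow_lt; lra. Qed.
Lemma hh_pos n : (0 <= hh n)%R.
Proof. unfold hh. apply Rmult_le_pos; [lra|]. left. apply Rinv_0_lt_compat, pow_lt; lra. Qed.

Lemma step_cases n p : (fst (step n p) = fst p \/ fst (step n p) = fst p + hw (S n))%R /\
   (snd (step n p) = snd p \/ snd (step n p) = snd p + hh (S n))%R.
Proof. unfold step. destruct Rlt_dec; simpl; auto. destruct Rlt_dec; simpl; auto. destruct Rlt_dec; simpl; auto. Qed.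

Lemma pt_in n : (a0 <= fst (pt n) /\ fst (pt n) + hw n <= b0 /\ c0 <= snd (pt n) /\ snd (pt n) + hh n <= d0)%R.
Proof.
  induction n.
  - simpl. unfold hw, hh. simpl. unfold Rdiv. rewrite Rinv_1. lra.
  - change (pt (S n)) with (step n (pt n)). rewrite hw_S, hh_S in IHn.
    assert (A := hw_pos (S n)). assert (B := hh_pos (S n)).
    destruct (step_cases n (pt n)) as [[H1|H1] [H2|H2]]; rewrite H1, H2; lra.
Qed.

(** The allowance is quadratic in the half perimeter, so four quarters at level n + 1 together allow
    exactly what the parent allows, and one of them must exceed its share. *)
Lemma step_bad n : bad n (pt n) -> bad (S n) (pt (S n)).
Proof.
  intros Hb. change (pt (S n)) with (step n (pt n)). assert (I := pt_in n). unfold bad in *.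
  rewrite hw_S, hh_S in Hb, I.
  assert (A := hw_pos (S n)). assert (B := hh_pos (S n)).
  revert Hb I. destruct (pt n) as [a c]. simpl fst; simpl snd. set (h := hw (S n)) in *. set (k := hh (S n)) in *. intros Hb I.
  assert (Hc : forall x y, (a <= x <= a + h + h)%R -> (c <= y <= c + k + k)%R -> ccont g (x, y)).
  { intros x y Hx Hy. destruct (Hg (x, y)) as [l Hl]; [split; simpl; lra|]. eapply cder_cont; eauto. }
  rewrite (rint_cut_x g a (a + h)) in Hb by (try lra; intros; apply Hc; lra).
  rewrite (rint_cut_y g a (a + h) c (c + k)) in Hb by (try lra; intros; apply Hc; lra).
  rewrite (rint_cut_y g (a + h) (a + (h + h)) c (c + k)) in Hb by (try lra; intros; apply Hc; lra).
  rewrite <- !Rplus_assoc in Hb.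
  unfold step. simpl fst; simpl snd. fold h k.
  destruct Rlt_dec as [H1|H1]; [exact H1|].
  destruct Rlt_dec as [H2|H2]; [exact H2|].
  destruct Rlt_dec as [H3|H3]; [exact H3|].
  simpl fst; simpl snd. apply Rnot_lt_le in H1, H2, H3.
  match type of Hb with (_ < Cmod (?u + ?v + (?x + ?y)))%R =>
    assert (T1 := Cmod_triangle (u + v) (x + y)); assert (T2 := Cmod_triangle u v); assert (T3 := Cmod_triangle x y) end.
  unfold h, k in *. rewrite !Rplus_assoc in *. lra.
Qed.

Lemma pt_mono n j : (fst (pt n) <= fst (pt (n + j)) /\ fst (pt (n + j)) + hw (n + j) <= fst (pt n) + hw n /\
   snd (pt n) <= snd (pt (n + j)) /\ snd (pt (n + j)) + hh (n + j) <= snd (pt n) + hh n)%R.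
Proof.
  induction j; [rewrite Nat.add_0_r; lra|]. rewrite Nat.add_succ_r. change (pt (S (n + j))) with (step (n + j) (pt (n + j))).
  assert (E1 := hw_S (n + j)). assert (E2 := hh_S (n + j)).
  assert (A := hw_pos (S (n + j))). assert (B := hh_pos (S (n + j))).
  destruct (step_cases (n + j) (pt (n + j))) as [[H1|H1] [H2|H2]]; rewrite H1, H2; lra.
Qed.

Lemma nested_lim (u v : nat -> R) : (forall n j, (u n <= u (n + j)%nat /\ v (n + j)%nat <= v n)%R) -> (forall n, (u n <= v n)%R) ->
  exists x, forall n, (u n <= x <= v n)%R.
Proof.
  intros Hm Huv.
  assert (K : forall n m, (u n <= v m)%R).
  { intros n m. destruct (Hm n m) as [A _]. destruct (Hm m n) as [_ B]. rewrite Nat.add_comm in B. specialize (Huv (n + m)%nat). lra. }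
  destruct (completeness (fun x => exists n, x = u n)) as [x [Hx1 Hx2]].
  - exists (v O). intros y [n ->]. apply K.
  - exists (u O). exists O. auto.
  - exists x. intros n. split; [apply Hx1; exists n; auto|]. apply Hx2. intros y [k ->]. apply K.
Qed.

Lemma goursat_bound : (0 < eps)%R -> (Cmod (rint g a0 b0 c0 d0) <= eps * ((b0 - a0 + (d0 - c0)) * (b0 - a0 + (d0 - c0))))%R.
Proof.
  intros He. apply Rnot_lt_le. intros Hlt.
  assert (B0 : forall n, bad n (pt n)).
  { induction n; [|apply step_bad; auto]. unfold bad, hw, hh. simpl. unfold Rdiv. rewrite Rinv_1, !Rmult_1_r.
    replace (a0 + (b0 - a0))%R with b0 by ring. replace (c0 + (d0 - c0))%R with d0 by ring. auto. }
  destruct (nested_lim (fun n => fst (pt n)) (fun n => fst (pt n) + hw n)%R) as [x Hx].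
  { intros n j. assert (A := pt_mono n j). lra. } { intros n. assert (A := hw_pos n). lra. }
  destruct (nested_lim (fun n => snd (pt n)) (fun n => snd (pt n) + hh n)%R) as [y Hy].
  { intros n j. assert (A := pt_mono n j). lra. } { intros n. assert (A := hh_pos n). lra. }
  assert (Hp : inrect a0 b0 c0 d0 (x, y)).
  { specialize (Hx O). specialize (Hy O). assert (A := pt_in O). split; simpl; lra. }
  (* With error at most eps / 4 times the half perimeter on the boundary, [rint_bound] (constant 4)
     gives eps times its square, which contradicts badness. *)
  destruct (Hg _ Hp) as [l Hl]. destruct (Hl (eps / 4)%R) as [del [Hdel Hd]]; [lra|].
  destruct (small_pow (1 / 2) (del / (b0 - a0 + (d0 - c0) + 1))) as [n Hn]; [lra|apply Rdiv_lt_0_compat; lra|].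
  specialize (Hn n (Nat.le_refl _)).
  assert (Hs : (hw n + hh n < del)%R).
  { replace (hw n + hh n)%R with ((b0 - a0 + (d0 - c0)) * (1 / 2) ^ n)%R.
    - apply (Rmult_lt_compat_l (b0 - a0 + (d0 - c0) + 1)) in Hn; [|lra].
      replace ((b0 - a0 + (d0 - c0) + 1) * (del / (b0 - a0 + (d0 - c0) + 1)))%R with del in Hn by (field; lra).
      assert (0 <= (1 / 2) ^ n)%R by (apply pow_le; lra). nra.
    - unfold hw, hh, Rdiv. rewrite Rmult_1_l, pow_inv. ring. }
  specialize (B0 n). unfold bad in B0. specialize (Hx n). specialize (Hy n). cbv beta in Hx, Hy.
  assert (I := pt_in n). assert (A := hw_pos n). assert (B := hh_pos n).
  set (a := fst (pt n)) in *. set (c := snd (pt n)) in *. set (h := hw n) in *. set (k := hh n) in *.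
  set (p := (x, y) : C) in *.
  (* The first order Taylor polynomial at p has a primitive, so subtracting it does not change the
     integral. *)
  set (e := fun z => g z + (- g p + - l * (z - p))).
  assert (Aff : forall z, ccont (fun z => - g p + - l * (z - p)) z).
  { intros z. apply ccont_plus; [apply ccont_const|]. apply ccont_mult; [apply ccont_const|].
    apply ccont_plus; [apply ccont_id|apply ccont_const]. }
  assert (Gc : forall z, inrect a (a + h) c (c + k) z -> ccont g z).
  { intros z [Hz1 Hz2]. destruct (Hg z) as [l' Hl']; [split; lra|]. eapply cder_cont; eauto. }
  assert (E : rint g a (a + h) c (c + k) = rint e a (a + h) c (c + k)).
  { unfold e. rewrite (rint_plus g) by (auto; lra).
    rewrite (rint_primitive (fun z => - g p * z + - l * ((z - p) * (z - p) * / 2)) (fun z => - g p + - l * (z - p))).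
    - ring.
    - lra.
    - lra.
    - intros z. eapply cder_eq.
      + apply cder_plus; [apply cder_scal, cder_id|]. apply cder_scal. apply cder_mult; [|apply cder_const].
        apply cder_mult; (apply cder_minus; [apply cder_id|apply cder_const]).
      + cbv beta. field. 
    - exact Aff. }
  assert (Hin : forall z, inrect a (a + h) c (c + k) z -> ccont e z /\ (Cmod (e z) <= eps / 4 * (h + k))%R).
  { intros z Hz. split; [apply ccont_plus; auto|].
    assert (Hzp : (Cmod (z - p) <= h + k)%R).
    { eapply Rle_trans; [apply Cmod_le_abs|]. destruct Hz as [Hz1 Hz2].
      apply Rplus_le_compat; apply Rabs_le; unfold p, Re, Im in *; simpl; lra. }
    unfold e. replace (g z + (- g p + - l * (z - p))) with (g z - g p - l * (z - p)) by ring.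
    eapply Rle_trans; [apply Hd; lra|]. apply Rmult_le_compat_l; lra. }
  rewrite E in B0.
  assert (F := rint_bound e a (a + h) c (c + k) (eps / 4 * (h + k)) ltac:(lra) ltac:(lra)).
  assert (F' : (Cmod (rint e a (a + h) c (c + k)) <= 4 * (eps / 4 * (h + k)) * (a + h - a + (c + k - c)))%R).
  { apply F.
    - intros s Hs1. assert (Y1 := Hin (s, c)). assert (Y2 := Hin (s, (c + k)%R)). unfold inrect in *; simpl in *. split; [apply Y1; lra|split; [apply Y2; lra|split; [apply Y1; lra|apply Y2; lra]]].
    - intros s Hs1. assert (Y1 := Hin (a, s)). assert (Y2 := Hin ((a + h)%R, s)). unfold inrect in *; simpl in *. split; [apply Y1; lra|split; [apply Y2; lra|split; [apply Y1; lra|apply Y2; lra]]]. }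
  nra.
Qed.
End Goursat.

Lemma goursat (g : C -> C) (a b c d : R) : (a <= b)%R -> (c <= d)%R ->
  (forall z, inrect a b c d z -> exists l, cder g z l) -> rint g a b c d = 0.
Proof.
  intros Hab Hcd Hg. apply Cmod_eq_0, Rle_antisym; [|apply Cmod_ge_0].
  set (S := ((b - a + (d - c)) * (b - a + (d - c)))%R). assert (HS : (0 <= S)%R) by (unfold S; nra).
  apply le_epsilon. intros e He. rewrite Rplus_0_l.
  assert (B := goursat_bound g a b c d Hab Hcd Hg (e / (S + 1)) ltac:(apply Rdiv_lt_0_compat; lra)). fold S in B.
  eapply Rle_trans; [exact B|]. apply (Rmult_le_reg_r (S + 1)); [lra|].
  replace (e / (S + 1) * S * (S + 1))%R with (e * S)%R by (field; lra). nra.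
Qed.

(** Cutting away four rectangles leaves a square of half side h around p, whose boundary avoids p
    and contributes at most 16 K' h; this is the origin of e / (16 K') in the choice of h. *)
Lemma goursat_except (g : C -> C) (a b c d del K : R) (p : C) :
  (a < Re p < b)%R -> (c < Im p < d)%R ->
  (forall z, inrect a b c d z -> z <> p -> exists l, cder g z l) ->
  (0 < del)%R -> (forall z, z <> p -> (Cmod (z - p) < del)%R -> (Cmod (g z) <= K)%R) -> rint g a b c d = 0.
Proof.
  intros Hx Hy Hg Hdel HK. apply Cmod_eq_0, Rle_antisym; [|apply Cmod_ge_0].
  apply le_epsilon. intros e He. rewrite Rplus_0_l.
  destruct p as [x y]. simpl in Hx, Hy.
  set (K' := (Rabs K + 1)%R). assert (HKK : (K <= K')%R) by (unfold K'; assert (A := Rle_abs K); lra).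
  assert (HK0 : (0 < K')%R) by (unfold K'; assert (A := Rabs_pos K); lra).
  set (h := (Rmin (Rmin (Rmin (x - a) (b - x)) (Rmin (y - c) (d - y))) (Rmin (del / 4) (e / (16 * K'))))%R).
  assert (Hh : (0 < h)%R). { unfold h. repeat apply Rmin_pos; try lra. apply Rdiv_lt_0_compat; lra. }
  assert (Hl1 : (h <= Rmin (Rmin (x - a) (b - x)) (Rmin (y - c) (d - y)))%R) by apply Rmin_l.
  assert (Hl2 : (h <= Rmin (del / 4) (e / (16 * K')))%R) by apply Rmin_r.
  assert (L1 := Rmin_l (Rmin (x - a) (b - x)) (Rmin (y - c) (d - y))). assert (L2 := Rmin_r (Rmin (x - a) (b - x)) (Rmin (y - c) (d - y))).
  assert (L3 := Rmin_l (x - a) (b - x)). assert (L4 := Rmin_r (x - a) (b - x)).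
  assert (L5 := Rmin_l (y - c) (d - y)). assert (L6 := Rmin_r (y - c) (d - y)).
  assert (L7 := Rmin_l (del / 4) (e / (16 * K'))). assert (L8 := Rmin_r (del / 4) (e / (16 * K'))).
  assert (Gc : forall s t, (a <= s <= b)%R -> (c <= t <= d)%R -> (s <> x \/ t <> y) -> ccont g (s, t)).
  { intros s t Hs Ht Hst. destruct (Hg (s, t)) as [l Hl].
    - split; simpl; lra. - intros E. inversion E. destruct Hst; contradiction. - eapply cder_cont; eauto. }
  assert (Z : forall a' b' c' d', (a <= a')%R -> (a' <= b')%R -> (b' <= b)%R -> (c <= c')%R -> (c' <= d')%R -> (d' <= d)%R ->
     (x < a' \/ b' < x \/ y < c' \/ d' < y)%R -> rint g a' b' c' d' = 0).
  { intros a' b' c' d' H1 H2 H3 H4 H5 H6 H7. apply goursat; auto. intros z [Hz1 Hz2]. apply Hg.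
    - split; lra. - intros E. subst z. simpl in Hz1, Hz2. lra. }
  rewrite (rint_cut_x g a (x - h) b c d); [|lra|intros; apply Gc; lra|intros; apply Gc; lra].
  rewrite (rint_cut_x g (x - h) (x + h) b c d); [|lra|intros; apply Gc; lra|intros; apply Gc; lra].
  rewrite (rint_cut_y g (x - h) (x + h) c (y - h) d); [|lra|intros; apply Gc; lra|intros; apply Gc; lra].
  rewrite (rint_cut_y g (x - h) (x + h) (y - h) (y + h) d); [|lra|intros; apply Gc; lra|intros; apply Gc; lra].
  rewrite (Z a (x - h)%R c d) by lra. rewrite (Z (x + h)%R b c d) by lra.
  rewrite (Z (x - h)%R (x + h)%R c (y - h)%R) by lra. rewrite (Z (x - h)%R (x + h)%R (y + h)%R d) by lra.
  match goal with |- (Cmod ?X <= _)%R => replace X with (rint g (x - h) (x + h) (y - h) (y + h)) by ring end.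
  assert (Bd : forall s t, (x - h <= s <= x + h)%R -> (y - h <= t <= y + h)%R -> (s <> x \/ t <> y) -> (Cmod (g (s, t)) <= K')%R).
  { intros s t Hs Ht Hst. eapply Rle_trans; [apply HK|auto].
    - intros E. inversion E. destruct Hst; contradiction.
    - eapply Rle_lt_trans; [apply Cmod_le_abs|]. simpl.
      assert (Rabs (s + - x) <= h)%R by (apply Rabs_le; lra). assert (Rabs (t + - y) <= h)%R by (apply Rabs_le; lra). lra. }
  eapply Rle_trans; [apply (rint_bound g (x - h) (x + h) (y - h) (y + h) K'); try lra|].
  - intros s Hs. repeat split; try (apply Gc; lra); apply Bd; lra.
  - intros s Hs. repeat split; try (apply Gc; lra); apply Bd; lra.
  - assert (h * (16 * K') <= e)%R; [|nra].
    assert (Q : (h <= e / (16 * K'))%R) by lra. apply (Rmult_le_compat_r (16 * K')) in Q; [|lra].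
    replace (e / (16 * K') * (16 * K'))%R with e in Q by (field; lra). auto.
Qed.

(** * Cauchy's formula and Taylor expansion *)

Definition circ (rho t : R) : C := rho * Cexp (0, t).

Lemma Cmod_circ (rho t : R) : (0 <= rho)%R -> Cmod (circ rho t) = rho.
Proof. intros H. unfold circ. rewrite Cmod_mult, Cmod_R, Cmod_Cexp, Rabs_pos_eq by auto. simpl. rewrite exp_0. ring. Qed.

Lemma circ_exp (s t : R) : circ (exp s) t = Cexp (s, t).
Proof. unfold circ, Cexp. apply C_eq; simpl; rewrite exp_0; ring. Qed.

Lemma circ_periodic (rho t : R) : circ rho (t + 2 * PI) = circ rho t.
Proof. unfold circ, Cexp; simpl. rewrite cos_plus, sin_plus, cos_2PI, sin_2PI. f_equal. f_equal; ring. Qed.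

Lemma rcont_circ (rho t : R) : rcont (circ rho) t.
Proof.
  apply (rcont_mult (fun _ => RtoC rho) (fun t => Cexp (0, t))); [apply rcont_const|].
  apply (rcont_comp Cexp (fun t => (0%R, t))); [eapply cder_cont, cder_Cexp|].
  split; simpl; [apply continuous_const|apply continuous_id].
Qed.

Lemma rcont_circ_comp (k : C -> C) (rho t : R) : ccont k (circ rho t) -> rcont (fun t => k (circ rho t)) t.
Proof. intros H. apply (rcont_comp k (circ rho)); auto. apply rcont_circ. Qed.

(** The pull-back by exp turns the annulus into a rectangle of height 2 PI with a logarithm of w0 on
    its middle line. The horizontal sides cancel by periodicity and the vertical ones are the two
    circle integrals with respect to the angle, so no weight 1 / w appears. *)
Lemma circle_const (k : C -> C) (s r : R) (w0 : C) (del K : R) :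
  (0 < s < Cmod w0)%R -> (Cmod w0 < r)%R ->
  (forall w, (s <= Cmod w <= r)%R -> w <> w0 -> exists l, cder k w l) ->
  (0 < del)%R -> (forall w, w <> w0 -> (Cmod (w - w0) < del)%R -> (Cmod (k w) <= K)%R) ->
  CInt (fun t => k (circ s t)) 0 (2 * PI) = CInt (fun t => k (circ r t)) 0 (2 * PI).
Proof.
  intros Hs Hr Hk Hdel HK. assert (HPI := PI_RGT_0).
  destruct (polar w0) as [z0 Hz0]. { intros E. rewrite E, Cmod_0 in Hs. lra. }
  assert (Hm : Cmod w0 = exp (Re z0)) by (rewrite Hz0; apply Cmod_Cexp).
  set (a := ln s). set (b := ln r).
  assert (Ea : exp a = s) by (apply exp_ln; lra). assert (Eb : exp b = r) by (apply exp_ln; lra).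
  assert (Ha : (a < Re z0)%R). { apply exp_lt_inv. lra. }
  assert (Hb : (Re z0 < b)%R). { apply exp_lt_inv. lra. }
  set (c := (Im z0 - PI)%R). set (d := (c + 2 * PI)%R).
  set (g := fun z => k (Cexp z)).
  assert (Hne : forall z, inrect a b c d z -> z <> z0 -> Cexp z <> w0).
  { intros z [Hz1 Hz2] Hn E. apply Hn. apply Cexp_inj_strip; [congruence|].
    apply Rabs_le. unfold c, d, c in *. lra. }
  assert (Hrect : forall z, (a <= Re z <= b)%R -> (s <= Cmod (Cexp z) <= r)%R).
  { intros z Hz. rewrite Cmod_Cexp, <- Ea, <- Eb.
    split; [destruct (proj1 Hz) as [H|H]|destruct (proj2 Hz) as [H|H]]; try (rewrite H; lra); left; apply exp_increasing; auto. }
  assert (Hg : forall z, inrect a b c d z -> z <> z0 -> exists l, cder g z l).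
  { intros z Hz Hn. destruct (Hk (Cexp z)) as [l Hl]; [apply Hrect, Hz|apply Hne; auto|].
    exists (l * Cexp z). apply (cder_comp k Cexp); auto. apply cder_Cexp. }
  assert (Z : rint g a b c d = 0).
  { destruct (cder_cont _ _ _ (cder_Cexp z0) del Hdel) as [d1 [Hd1 Hc]].
    apply (goursat_except g a b c d (Rmin d1 PI) K z0); auto.
    - unfold d, c. lra.
    - apply Rmin_pos; auto.
    - intros z Hn Hz. apply HK.
      + intros E. apply Hn. apply Cexp_inj_strip; [congruence|].
        eapply Rle_trans; [|left; eapply Rlt_le_trans; [exact Hz|apply Rmin_r]].
        eapply Rle_trans; [|apply im_le_Cmod]. right. f_equal.
      + rewrite Hz0. apply Hc. eapply Rlt_le_trans; [exact Hz|apply Rmin_l]. }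
  unfold rint in Z.
  assert (Eh : CInt (fun x => g (x, d)) a b = CInt (fun x => g (x, c)) a b).
  { apply CInt_ext; [lra|]. intros x _. unfold g. f_equal. rewrite <- !circ_exp. unfold d. apply circ_periodic. }
  rewrite Eh in Z.
  assert (Cc : forall x t, (x = s \/ x = r) -> rcont (fun t => k (circ x t)) t).
  { intros x t Hx. apply rcont_circ_comp. destruct (Hk (circ x t)) as [l Hl].
    - rewrite Cmod_circ; destruct Hx; lra.
    - intros E. apply (f_equal Cmod) in E. rewrite Cmod_circ in E; destruct Hx; lra.
    - eapply cder_cont; eauto. }
  assert (Per : forall x, (x = s \/ x = r) -> CInt (fun t => k (circ x t)) c d = CInt (fun t => k (circ x t)) 0 (2 * PI)).
  { intros x Hx. apply CInt_periodic; [lra|auto|]. intros t. rewrite circ_periodic. auto. }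
  assert (Q : Ci * CInt (fun y => g (b, y)) c d = Ci * CInt (fun y => g (a, y)) c d).
  { revert Z. generalize (Ci * CInt (fun y => g (b, y)) c d), (Ci * CInt (fun y => g (a, y)) c d), (CInt (fun x => g (x, c)) a b).
    intros u v x Z. replace u with (x + u - x - v + v) by ring. rewrite Z. ring. }
  assert (Q' : CInt (fun y => g (b, y)) c d = CInt (fun y => g (a, y)) c d).
  { replace (CInt (fun y => g (b, y)) c d) with (- Ci * (Ci * CInt (fun y => g (b, y)) c d)).
    rewrite Q. all: apply C_eq; destruct (CInt (fun y : R => g (a, y)) c d), (CInt (fun y : R => g (b, y)) c d); simpl; ring. }
  unfold g in Q'.
  rewrite <- (Per s), <- (Per r) by auto. rewrite <- Ea, <- Eb.
  transitivity (CInt (fun y => k (Cexp (a, y))) c d).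
  { apply CInt_ext; [unfold d; lra|]. intros t _. rewrite circ_exp. auto. }
  rewrite <- Q'. apply CInt_ext; [unfold d; lra|]. intros t _. rewrite circ_exp. auto.
Qed.

Lemma cder_bounded_near (f : C -> C) (z l : C) : cder f z l ->
  exists d K, (0 < d)%R /\ forall w, (Cmod (w - z) < d)%R -> (Cmod (f w) <= K)%R.
Proof.
  intros H. destruct (ccont_bounded f z (cder_cont _ _ _ H)) as [d [K [H1 [_ H2]]]]. exists d, K. auto.
Qed.

(** Without a singularity, any interior point of the annulus can play the exceptional one, since k
    is bounded near it. *)
Lemma circle_const_reg (k : C -> C) (s r : R) : (0 < s < r)%R ->
  (forall w, (s <= Cmod w <= r)%R -> exists l, cder k w l) ->
  CInt (fun t => k (circ s t)) 0 (2 * PI) = CInt (fun t => k (circ r t)) 0 (2 * PI).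
Proof.
  intros Hs Hk. set (w0 := RtoC ((s + r) / 2)).
  assert (Hw : Cmod w0 = ((s + r) / 2)%R) by (unfold w0; rewrite Cmod_R, Rabs_pos_eq; lra).
  destruct (Hk w0) as [l Hl]; [lra|]. destruct (cder_bounded_near _ _ _ Hl) as [d [K [Hd HK]]].
  apply (circle_const k s r w0 d K); auto; lra.
Qed.

Definition hol (r : R) (f : C -> C) : Prop := forall w, (Cmod w < r)%R -> exists l, cder f w l.

Lemma hol_ccont (f : C -> C) (r : R) (w : C) : hol r f -> (Cmod w < r)%R -> ccont f w.
Proof. intros H Hw. destruct (H w Hw) as [l Hl]. eapply cder_cont; eauto. Qed.

Lemma minus_neq0 (a b : C) : a <> b -> a - b <> 0.
Proof. intros H E. apply H. replace a with (a - b + b) by ring. rewrite E. ring. Qed.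

Lemma circ_minus_neq0 (rho t : R) (w0 : C) : (Cmod w0 < rho)%R -> circ rho t - w0 <> 0.
Proof.
  intros H. assert (0 <= Cmod w0)%R by apply Cmod_ge_0. apply minus_neq0. intros E. apply (f_equal Cmod) in E.
  rewrite Cmod_circ in E; lra.
Qed.

(** The kernel is 1 + w0 / (w - w0). The second term has the same mean on all larger circles, and
    this mean tends to 0 as the radius grows. *)
Lemma circ_kernel (rho : R) (w0 : C) : (Cmod w0 < rho)%R ->
  CInt (fun t => circ rho t / (circ rho t - w0)) 0 (2 * PI) = RtoC (2 * PI).
Proof.
  intros H. assert (Hw0 := Cmod_ge_0 w0). assert (HPI := PI_RGT_0).
  set (k := fun w : C => w0 / (w - w0)).
  assert (Hk : forall w, (rho <= Cmod w)%R -> exists l, cder k w l).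
  { intros w Hw. assert (Hn : w - w0 <> 0). { apply minus_neq0. intros E. subst. lra. }
    eexists. apply cder_div; [apply cder_const|apply cder_minus; [apply cder_id|apply cder_const]|exact Hn]. }
  assert (Ck : forall x t, (rho <= x)%R -> rcont (fun t => k (circ x t)) t).
  { intros x t Hx. apply rcont_circ_comp. destruct (Hk (circ x t)) as [l Hl]; [rewrite Cmod_circ; lra|]. eapply cder_cont; eauto. }
  assert (Z : CInt (fun t => k (circ rho t)) 0 (2 * PI) = 0).
  { apply Cmod_eq_0, Rle_antisym; [|apply Cmod_ge_0]. apply le_epsilon. intros e He. rewrite Rplus_0_l.
    set (x := (rho + Cmod w0 + 4 * PI * Cmod w0 / e + 1)%R).
    assert (Hx : (rho < x)%R). { unfold x. assert (0 <= 4 * PI * Cmod w0 / e)%R; [|lra]. apply Rmult_le_pos; [nra|left; apply Rinv_0_lt_compat; auto]. }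
    rewrite (circle_const_reg k rho x); [|lra|intros; apply Hk; lra].
    eapply Rle_trans; [apply (CInt_bound _ _ _ (Cmod w0 / (x - Cmod w0))); [lra|intros; apply Ck; lra|]|].
    - intros t _. unfold k. rewrite Cmod_div by (apply circ_minus_neq0; lra).
      apply Rmult_le_compat_l; auto. apply Rinv_le_contravar; [lra|].
      assert (A := Cmod_ge_sub (circ x t) w0). rewrite Cmod_circ in A by lra. auto.
    - assert (Hxx : (4 * PI * Cmod w0 / e <= x - Cmod w0)%R) by (unfold x; lra).
      assert (Hp : (0 < x - Cmod w0)%R) by lra.
      apply (Rmult_le_reg_r (x - Cmod w0)); auto.
      replace (2 * (Cmod w0 / (x - Cmod w0)) * (2 * PI - 0) * (x - Cmod w0))%R with (4 * PI * Cmod w0)%R by (field; lra).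
      apply (Rmult_le_compat_l e) in Hxx; [|lra]. replace (e * (4 * PI * Cmod w0 / e))%R with (4 * PI * Cmod w0)%R in Hxx by (field; lra). auto. }
  rewrite (CInt_ext _ (fun t => 1 + k (circ rho t))).
  - rewrite CInt_plus; [|lra|intros; apply rcont_const|intros; apply Ck; lra]. rewrite CInt_const, Z, Rminus_0_r. ring.
  - lra.
  - intros t _. unfold k. field. apply circ_minus_neq0; auto.
Qed.

(** Isolated as a property because it survives uniform limits, and together with a bound on the
    circle it already implies a power series expansion. Holomorphy of limits is obtained in this
    way. *)
Definition cauchy_formula (f : C -> C) (rho : R) : Prop :=
  (forall t, rcont (fun t => f (circ rho t)) t) /\
  forall w0, (Cmod w0 < rho)%R ->
    CInt (fun t => f (circ rho t) * (circ rho t / (circ rho t - w0))) 0 (2 * PI) = RtoC (2 * PI) * f w0.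

Lemma rcont_kernel (rho t : R) (w0 : C) : (Cmod w0 < rho)%R -> rcont (fun t => circ rho t / (circ rho t - w0)) t.
Proof.
  intros H. apply (rcont_circ_comp (fun w => w / (w - w0))).
  eapply cder_cont. apply cder_div; [apply cder_id|apply cder_minus; [apply cder_id|apply cder_const]|].
  apply circ_minus_neq0; auto.
Qed.

(** The function k = (f w - f w0) w / (w - w0) stays bounded near w0, so its mean does not depend on
    the circle; on small circles around 0 it tends to 0, by the factor w if w0 <> 0 and by
    continuity of f if w0 = 0. *)
Lemma hol_cauchy (f : C -> C) (r rho : R) : hol r f -> (0 < rho < r)%R -> cauchy_formula f rho.
Proof.
  intros Hf Hr. assert (HPI := PI_RGT_0).
  assert (Cf : forall x t, (0 < x < r)%R -> rcont (fun t => f (circ x t)) t).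
  { intros x t Hx. apply rcont_circ_comp. eapply hol_ccont; eauto. rewrite Cmod_circ; lra. }
  split; [intros; apply Cf; auto|]. intros w0 Hw0. assert (Hw00 := Cmod_ge_0 w0).
  set (k := fun w => (f w - f w0) * (w / (w - w0))).
  assert (Hk : forall w, (Cmod w < r)%R -> w <> w0 -> exists l, cder k w l).
  { intros w Hw Hn. destruct (Hf w Hw) as [l Hl]. eexists. apply cder_mult.
    - apply cder_minus; [exact Hl|apply cder_const].
    - apply cder_div; [apply cder_id|apply cder_minus; [apply cder_id|apply cder_const]|apply minus_neq0; auto]. }
  assert (Ck : forall x t, (0 < x < r)%R -> x <> Cmod w0 -> rcont (fun t => k (circ x t)) t).
  { intros x t Hx Hn. apply rcont_circ_comp. destruct (Hk (circ x t)) as [l Hl].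
    - rewrite Cmod_circ; lra. - intros E. apply Hn. rewrite <- E, Cmod_circ; lra. - eapply cder_cont; eauto. }
  assert (Z : CInt (fun t => k (circ rho t)) 0 (2 * PI) = 0).
  { apply Cmod_eq_0, Rle_antisym; [|apply Cmod_ge_0]. apply le_epsilon. intros e He. rewrite Rplus_0_l.
    assert (Hsm : exists d, (0 < d)%R /\ forall s, (0 < s < d)%R -> (s < r)%R -> s <> Cmod w0 ->
       (Cmod (CInt (fun t => k (circ s t)) 0 (2 * PI)) <= e)%R).
    { assert (Hb : exists d, (0 < d)%R /\ forall w, (Cmod w < d)%R -> w <> w0 -> (Cmod w < r)%R -> (Cmod (k w) <= e / (4 * PI))%R).
      { assert (Hep : (0 < e / (4 * PI))%R) by (apply Rdiv_lt_0_compat; lra).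
        destruct (Ceq_dec w0 0) as [E|Hn0].
        - destruct (hol_ccont f r 0 Hf ltac:(rewrite Cmod_0; lra) (e / (4 * PI))%R Hep) as [d [Hd H]].
          exists d. split; auto. intros w Hw Hww _. unfold k. subst w0.
          replace (w / (w - 0)) with (RtoC 1) by (field; auto). rewrite Cmult_1_r. left. apply H.
          replace (w - 0) with w by ring. auto.
        - assert (H0 := proj1 (Cmod_gt_0 _) Hn0).
          destruct (ccont_bounded f 0 (hol_ccont f r 0 Hf ltac:(rewrite Cmod_0; lra))) as [d [M [Hd [HM H]]]].
          set (B := (M + Cmod (f w0))%R). assert (HB : (0 < B)%R) by (unfold B; assert (A := Cmod_ge_0 (f w0)); lra).
          exists (Rmin d (Rmin (Cmod w0 / 2) (e / (4 * PI) * (Cmod w0 / 2) / B))).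
          split. { apply Rmin_pos; auto. apply Rmin_pos; [lra|]. apply Rdiv_lt_0_compat; auto. apply Rmult_lt_0_compat; lra. }
          intros w Hw Hww _. assert (L1 := Rlt_le_trans _ _ _ Hw (Rmin_l _ _)). assert (L2 := Rlt_le_trans _ _ _ Hw (Rmin_r _ _)).
          assert (L3 := Rlt_le_trans _ _ _ L2 (Rmin_l _ _)). assert (L4 := Rlt_le_trans _ _ _ L2 (Rmin_r _ _)).
          unfold k. rewrite Cmod_mult, Cmod_div by (apply minus_neq0; auto).
          assert (G : (Cmod w0 / 2 <= Cmod (w - w0))%R). { rewrite Cmod_sym. assert (A := Cmod_ge_sub w0 w). lra. }
          assert (F : (Cmod (f w - f w0) <= B)%R).
          { eapply Rle_trans; [apply Cmod_sub_triangle|]. unfold B. apply Rplus_le_compat_r. apply H. replace (w - 0) with w by ring. auto. }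
          apply (Rmult_le_reg_r (Cmod (w - w0))); [lra|].
          replace (Cmod (f w - f w0) * (Cmod w / Cmod (w - w0)) * Cmod (w - w0))%R with (Cmod (f w - f w0) * Cmod w)%R by (field; lra).
          apply (Rmult_lt_compat_l B) in L4; auto. replace (B * (e / (4 * PI) * (Cmod w0 / 2) / B))%R with (e / (4 * PI) * (Cmod w0 / 2))%R in L4 by (field; lra).
          assert (Cmod (f w - f w0) * Cmod w <= B * Cmod w)%R by (apply Rmult_le_compat_r; auto; apply Cmod_ge_0).
          assert (e / (4 * PI) * (Cmod w0 / 2) <= e / (4 * PI) * Cmod (w - w0))%R by (apply Rmult_le_compat_l; lra). lra. }
      destruct Hb as [d [Hd Hb]]. exists d. split; auto. intros s Hs Hsr Hsn.
      eapply Rle_trans; [apply (CInt_bound _ _ _ (e / (4 * PI))); [lra|intros; apply Ck; lra|]|].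
      - intros t _. apply Hb; rewrite ?Cmod_circ; try lra. intros E. apply Hsn. rewrite <- E, Cmod_circ; lra.
      - right. field. lra. }
    destruct Hsm as [d [Hd Hsm]].
    destruct (Hf w0 ltac:(lra)) as [l Hl].
    assert (Hbk : exists del K, (0 < del)%R /\ forall w, w <> w0 -> (Cmod (w - w0) < del)%R -> (Cmod (k w) <= K)%R).
    { destruct (Hl 1%R) as [del [Hdel H]]; [lra|]. exists (Rmin del 1), ((Cmod l + 1) * (Cmod w0 + 1))%R.
      split; [apply Rmin_pos; lra|]. intros w Hn Hw. assert (L1 := Rlt_le_trans _ _ _ Hw (Rmin_l _ _)). assert (L2 := Rlt_le_trans _ _ _ Hw (Rmin_r _ _)).
      specialize (H w L1). assert (Hp := proj1 (Cmod_gt_0 _) (minus_neq0 _ _ Hn)).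
      unfold k. rewrite Cmod_mult, Cmod_div by (apply minus_neq0; auto).
      assert (F : (Cmod (f w - f w0) <= (Cmod l + 1) * Cmod (w - w0))%R).
      { replace (f w - f w0) with ((f w - f w0 - l * (w - w0)) + l * (w - w0)) by ring.
        eapply Rle_trans; [apply Cmod_triangle|]. rewrite Cmod_mult. lra. }
      assert (Hwm : (Cmod w <= Cmod w0 + 1)%R). { assert (A := Cmod_triangle (w - w0) w0). replace (w - w0 + w0) with w in A by ring. lra. }
      replace (Cmod (f w - f w0) * (Cmod w / Cmod (w - w0)))%R with (Cmod (f w - f w0) / Cmod (w - w0) * Cmod w)%R by (field; lra).
      apply Rmult_le_compat; auto; try apply Cmod_ge_0.
      - apply Rmult_le_pos; [apply Cmod_ge_0|left; apply Rinv_0_lt_compat; auto].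
      - apply (Rmult_le_reg_r (Cmod (w - w0))); auto. unfold Rdiv. rewrite Rmult_assoc, Rinv_l; lra. }
    destruct Hbk as [del [K [Hdel HK]]].
    (* For w0 = 0 the annulus between s and rho avoids w0. Otherwise s < |w0| < rho, and the version
       with an exceptional point is required. *)
    destruct (Ceq_dec w0 0) as [E|Hn0].
    - assert (E0 : Cmod w0 = 0%R) by (rewrite E; apply Cmod_0).
      set (s := (Rmin d rho / 2)%R). assert (Hs : (0 < s)%R) by (unfold s; assert (0 < Rmin d rho)%R by (apply Rmin_pos; lra); lra).
      assert (Hsd : (s < d)%R) by (unfold s in *; assert (A := Rmin_l d rho); lra).
      assert (Hsr : (s < rho)%R) by (unfold s in *; assert (A := Rmin_r d rho); lra).
      rewrite <- (circle_const_reg k s rho); [apply Hsm; lra|lra|].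
      intros w Hw. apply Hk; [lra|]. intros E'. rewrite E', E0 in Hw. lra.
    - assert (H0 := proj1 (Cmod_gt_0 _) Hn0).
      set (s := (Rmin d (Cmod w0) / 2)%R). assert (Hs : (0 < s)%R) by (unfold s; assert (0 < Rmin d (Cmod w0))%R by (apply Rmin_pos; lra); lra).
      assert (Hsd : (s < d)%R) by (unfold s in *; assert (A := Rmin_l d (Cmod w0)); lra).
      assert (Hsr : (s < Cmod w0)%R) by (unfold s in *; assert (A := Rmin_r d (Cmod w0)); lra).
      rewrite <- (circle_const k s rho w0 del K); auto; [apply Hsm; lra|].
      intros w Hw Hn. apply Hk; auto. lra. }
  assert (Kc : forall t, rcont (fun t => circ rho t / (circ rho t - w0)) t) by (intros; apply rcont_kernel; auto).
  rewrite (CInt_ext _ (fun t => k (circ rho t) + f w0 * (circ rho t / (circ rho t - w0)))); [|lra|].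
  - rewrite CInt_plus; [|lra|intros; apply Ck; lra|].
    + rewrite Z, CInt_scal; [|lra|auto]. rewrite circ_kernel by auto. ring.
    + intros t _. apply rcont_mult; [apply rcont_const|auto].
  - intros t _. unfold k. ring.
Qed.

Lemma rcont_bounded (f : R -> C) (a b : R) : (forall t, (a <= t <= b)%R -> rcont f t) ->
  exists M, forall t, (a <= t <= b)%R -> (Cmod (f t) <= M)%R.
Proof.
  intros H.
  destruct (bounded_continuity (V := R_NormedModule) (fun t => Re (f t)) a b) as [M1 H1]; [intros; apply H; auto|].
  destruct (bounded_continuity (V := R_NormedModule) (fun t => Im (f t)) a b) as [M2 H2]; [intros; apply H; auto|].
  exists (M1 + M2)%R. intros t Ht. eapply Rle_trans; [apply Cmod_le_abs|]. specialize (H1 t Ht). specialize (H2 t Ht).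
  unfold norm in H1, H2; simpl in H1, H2. unfold abs in H1, H2; simpl in H1, H2. lra.
Qed.

Lemma RtoC_neq0 (x : R) : x <> 0%R -> RtoC x <> 0.
Proof. intros H E. apply H. apply RtoC_inj. auto. Qed.

(** Expansion of Cauchy's kernel as a geometric series in w / zeta, with the remainder kept as an
    integral. *)
Lemma cauchy_taylor (f : C -> C) (rho M : R) : (0 < rho)%R -> cauchy_formula f rho ->
  (forall t, (Cmod (f (circ rho t)) <= M)%R) ->
  exists c, pbound c rho (2 * M) /\ forall w, (Cmod w < rho)%R -> f w = psum c w.
Proof.
  intros Hr [Cf HC] HM. assert (HPI := PI_RGT_0).
  assert (HM0 : (0 <= M)%R) by (eapply Rle_trans; [apply Cmod_ge_0|apply (HM 0%R)]).
  assert (H2 : RtoC (2 * PI) <> 0) by (apply RtoC_neq0; lra).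
  assert (Cn : forall t, circ rho t <> 0).
  { intros t E. apply (f_equal Cmod) in E. rewrite Cmod_circ, Cmod_0 in E; lra. }
  assert (Ci1 : forall n t, rcont (fun t => f (circ rho t) * / circ rho t ^ n) t).
  { intros n t. apply rcont_mult; auto. apply (rcont_circ_comp (fun w => / w ^ n)).
    eapply cder_cont. apply cder_inv; [apply cder_Cpow|]. apply Cpow_nz, Cn. }
  set (c := fun n => / RtoC (2 * PI) * CInt (fun t => f (circ rho t) * / circ rho t ^ n) 0 (2 * PI)).
  assert (Pb : pbound c rho (2 * M)).
  { intros n. unfold c. rewrite Cmod_mult, Cmod_inv, Cmod_R, Rabs_pos_eq by (auto; lra).
    assert (Hp : (0 < rho ^ n)%R) by (apply pow_lt; auto).
    assert (B : (Cmod (CInt (fun t => f (circ rho t) * / circ rho t ^ n)%C 0 (2 * PI)) <= 2 * (M / rho ^ n) * (2 * PI - 0))%R).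
    { apply CInt_bound; [lra|auto|]. intros t _. rewrite Cmod_mult, Cmod_inv, Cmod_pow, Cmod_circ by (try apply Cpow_nz; auto; lra).
      apply Rmult_le_compat_r; auto. left; apply Rinv_0_lt_compat; auto. }
    apply (Rmult_le_compat_l (/ (2 * PI))) in B; [|left; apply Rinv_0_lt_compat; lra].
    apply (Rmult_le_compat_r (rho ^ n)) in B; [|lra].
    eapply Rle_trans; [exact B|]. right. field. lra. }
  exists c. split; auto. intros w Hw. assert (Hw0 := Cmod_ge_0 w).
  apply (cser_unique (fun k => c k * w ^ k)); [|eapply psum_cser; eauto].
  assert (Hq := ratio_lt1 rho (Cmod w) ltac:(lra)). set (q := (Cmod w / rho)%R) in *.
  assert (Rem : forall n, (Cmod (csum (fun k => (c k * w ^ k)%C) n - f w) <= 2 * M * q ^ n / (1 - q))%R).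
  { intros n.
    (* Each induction step splits one term off the kernel: q^n zeta / (zeta - w) = q^n + q^(n+1)
       zeta / (zeta - w) with q = w / zeta. *)
    assert (E : forall n, RtoC (2 * PI) * (f w - csum (fun k => c k * w ^ k) n) =
       CInt (fun t => f (circ rho t) * ((w / circ rho t) ^ n * (circ rho t / (circ rho t - w)))) 0 (2 * PI)).
    { assert (Cg : forall n t, rcont (fun t => f (circ rho t) * ((w / circ rho t) ^ n * (circ rho t / (circ rho t - w)))) t).
      { intros j t. apply rcont_mult; auto. apply rcont_mult; [|apply rcont_kernel; auto].
        apply (rcont_circ_comp (fun z => (w / z) ^ j)). eapply cder_cont. apply (cder_pow (fun z => w / z)).
        apply cder_div; [apply cder_const|apply cder_id|apply Cn]. }
      clear n. induction n.
      - simpl csum. replace (f w - 0) with (f w) by ring. rewrite <- HC by auto. apply CInt_ext; [lra|]. intros t _. simpl. ring.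
      - cbn [csum].
        replace (RtoC (2 * PI) * (f w - (csum (fun k => c k * w ^ k) n + c n * w ^ n)))
          with (RtoC (2 * PI) * (f w - csum (fun k => c k * w ^ k) n) - RtoC (2 * PI) * c n * w ^ n) by ring.
        rewrite IHn. unfold c. rewrite Cmult_assoc, Cinv_r, Cmult_1_l by auto.
        replace (CInt (fun t => f (circ rho t) * / circ rho t ^ n) 0 (2 * PI) * w ^ n) with
          (- (- w ^ n * CInt (fun t => f (circ rho t) * / circ rho t ^ n) 0 (2 * PI))) by ring.
        rewrite <- CInt_scal by (auto; lra).
        match goal with |- ?A - - ?B = _ => replace (A - - B) with (A + B) by ring end.
        rewrite <- CInt_plus; [|lra|auto|intros; apply rcont_mult; [apply rcont_const|auto]].
        apply CInt_ext; [lra|]. intros t _. 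
        replace (- w ^ n * (f (circ rho t) * / circ rho t ^ n)) with (- (f (circ rho t) * (w / circ rho t) ^ n))
          by (unfold Cdiv; rewrite Cpow_mult_l, Cpow_inv by auto; ring).
        rewrite Cpow_S. generalize ((w / circ rho t) ^ n). intros X.
        field. split; auto. apply circ_minus_neq0; auto. }
    specialize (E n). rewrite Cmod_sym.
    assert (Hq1 : (0 < 1 - q)%R) by lra.
    assert (B : (Cmod (RtoC (2 * PI) * (f w - csum (fun k => (c k * w ^ k)%C) n)) <= 2 * (M * (q ^ n * / (1 - q))) * (2 * PI - 0))%R).
    { rewrite E. apply CInt_bound; [lra| |].
      - intros t _. apply rcont_mult; auto. apply rcont_mult; [|apply rcont_kernel; auto].
        apply (rcont_circ_comp (fun z => (w / z) ^ n)). eapply cder_cont. apply (cder_pow (fun z => w / z)).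
        apply cder_div; [apply cder_const|apply cder_id|apply Cn].
      - intros t _. rewrite !Cmod_mult, Cmod_pow, !Cmod_div, Cmod_circ by (auto; try lra; apply circ_minus_neq0; auto).
        fold q. assert (Hqn : (0 <= q ^ n)%R) by (apply pow_le; lra).
        assert (Hd : (rho - Cmod w <= Cmod (circ rho t - w))%R). { assert (A := Cmod_ge_sub (circ rho t) w). rewrite Cmod_circ in A; lra. }
        assert (Hf2 : (0 <= rho / Cmod (circ rho t - w) <= / (1 - q))%R).
        { split; [apply Rmult_le_pos; [lra|left; apply Rinv_0_lt_compat; lra]|].
          replace (/ (1 - q))%R with (rho / (rho - Cmod w))%R by (unfold q; field; lra).
          apply Rmult_le_compat_l; [lra|]. apply Rinv_le_contravar; lra. }
        apply Rmult_le_compat; auto; try apply Cmod_ge_0.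
        + apply Rmult_le_pos; lra.
        + apply Rmult_le_compat_l; lra. }
    rewrite Cmod_mult, Cmod_R, Rabs_pos_eq in B by lra.
    apply (Rmult_le_reg_l (2 * PI)); [lra|]. eapply Rle_trans; [exact B|]. right. field. lra. }
  intros eps He. destruct (small_pow q (eps * (1 - q) / (2 * M + 1)) Hq) as [N HN].
  { apply Rdiv_lt_0_compat; [apply Rmult_lt_0_compat; lra|lra]. }
  exists N. intros n Hn. eapply Rle_lt_trans; [apply Rem|]. specialize (HN n Hn).
  assert (Hqn : (0 <= q ^ n)%R) by (apply pow_le; lra).
  apply (Rmult_lt_compat_l (2 * M + 1)) in HN; [|lra].
  replace ((2 * M + 1) * (eps * (1 - q) / (2 * M + 1)))%R with (eps * (1 - q))%R in HN by (field; lra).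
  apply (Rmult_lt_reg_r (1 - q)); [lra|]. unfold Rdiv. rewrite Rmult_assoc, Rinv_l by lra. nra.
Qed.

(** Continuity bounds f on the compact interval [0, 2 PI] only; this extends the bound to all
    angles. *)
Lemma circ_in_period (rho : R) (t : R) : (0 <= rho)%R -> exists s, (0 <= s <= 2 * PI)%R /\ circ rho t = circ rho s.
Proof.
  intros Hr. assert (HPI := PI_RGT_0).
  destruct (Req_dec rho 0) as [E|Hn].
  - exists 0%R. split; [lra|]. subst. unfold circ. ring.
  - assert (G : forall n t, (0 <= t)%R -> (t < INR n * (2 * PI))%R -> exists s, (0 <= s <= 2 * PI)%R /\ circ rho t = circ rho s).
    { induction n; intros u H0 Hu; [simpl in Hu; lra|].
      destruct (Rle_dec u (2 * PI)); [exists u; split; auto; lra|].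
      destruct (IHn (u - 2 * PI)%R) as [s [Hs E]]; [lra|rewrite S_INR in Hu; lra|].
      exists s. split; auto. rewrite <- E, <- (circ_periodic rho (u - 2 * PI)). f_equal. ring. }
    assert (G' : forall n t, (- INR n * (2 * PI) <= t)%R -> exists s, (0 <= s)%R /\ circ rho t = circ rho s).
    { induction n; intros u Hu; [exists u; simpl in Hu; split; auto; lra|].
      destruct (IHn (u + 2 * PI)%R) as [s [Hs E]]; [rewrite S_INR in Hu; lra|].
      exists s. split; auto. rewrite <- E, circ_periodic. auto. }
    destruct (nfloor_ex (Rabs t)) as [n [Hn1 Hn2]]; [apply Rabs_pos|].
    destruct (G' (S n) t) as [s [Hs E]].
    { rewrite S_INR. assert (A := Rabs_pos t). assert (-t <= Rabs t)%R by (rewrite <- Rabs_Ropp; apply Rle_abs).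
      assert (P3 := PI2_1). assert (0 <= INR n)%R by apply pos_INR. nra. }
    destruct (nfloor_ex s) as [k [Hk1 Hk2]]; auto.
    destruct (G (S k) s) as [s' [Hs' E']]; auto.
    { rewrite S_INR. assert (P3 := PI2_1). nra. }
    exists s'. split; auto. congruence.
Qed.

(** One sequence must serve every radius below r. It is produced at r / 2 and identified with the
    sequence at any other radius by uniqueness of coefficients. *)
Lemma taylor_disc (f : C -> C) (r : R) : (0 < r)%R -> hol r f ->
  exists c, forall rho, (0 < rho < r)%R -> (exists M, pbound c rho M) /\ forall w, (Cmod w < rho)%R -> f w = psum c w.
Proof.
  intros Hr Hf. assert (HPI := PI_RGT_0).
  assert (L : forall rho, (0 < rho < r)%R -> exists c M, pbound c rho M /\ forall w, (Cmod w < rho)%R -> f w = psum c w).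
  { intros rho Hrho. assert (CF := hol_cauchy f r rho Hf Hrho).
    destruct (rcont_bounded (fun t => f (circ rho t)) 0 (2 * PI)) as [M HM]; [intros; apply (proj1 CF)|].
    destruct (cauchy_taylor f rho M) as [c [Hc1 Hc2]]; [lra|auto| |exists c, (2 * M)%R; auto].
    intros t. destruct (circ_in_period rho t) as [s [Hs E]]; [lra|]. rewrite E. apply HM; auto. }
  destruct (L (r / 2)%R) as [c [M [H1 H2]]]; [lra|]. exists c. intros rho Hrho.
  destruct (L rho Hrho) as [c' [M' [H1' H2']]].
  assert (E : forall k, c k = c' k).
  { set (m := Rmin (r / 2) rho). assert (Hm : (0 < m)%R) by (apply Rmin_pos; lra).
    assert (A := Rmin_l (r / 2) rho). assert (B := Rmin_r (r / 2) rho). fold m in A, B.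
    apply (psum_unique c c' m M M' m); auto; [apply (pbound_mono c (r / 2)); auto; lra|apply (pbound_mono c' rho); auto; lra|].
    intros t Ht. assert (Hmt : Cmod t = t) by (rewrite Cmod_R, Rabs_pos_eq; lra).
    rewrite <- H2, <- H2' by lra. auto. }
  split.
  - exists M'. intros k. rewrite E. apply H1'.
  - intros w Hw. rewrite (H2' w Hw). unfold psum. 
    unfold csum_val. f_equal; apply Series_ext; intros k; rewrite E; auto.
Qed.

Lemma psum_ext (c c' : nat -> C) (w : C) : (forall k, c k = c' k) -> psum c w = psum c' w.
Proof. intros E. unfold psum, csum_val. f_equal; apply Series_ext; intros k; rewrite E; auto. Qed.

(** Cauchy's estimate holds with 2 M at every rho < r; as |c_k| rho^k is continuous in rho, it
    persists at r itself. *)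
Lemma taylor_bounded (f : C -> C) (r M : R) : (0 < r)%R -> hol r f -> (forall w, (Cmod w < r)%R -> (Cmod (f w) <= M)%R) ->
  exists c, pbound c r (2 * M) /\ forall w, (Cmod w < r)%R -> f w = psum c w.
Proof.
  intros Hr Hf HM. destruct (taylor_disc f r Hr Hf) as [c Hc]. exists c. split.
  - assert (HM0 : (0 <= M)%R) by (eapply Rle_trans; [apply Cmod_ge_0|apply (HM 0); rewrite Cmod_0; auto]).
    assert (B : forall rho, (0 < rho < r)%R -> pbound c rho (2 * M)).
    { intros rho Hrho. destruct (cauchy_taylor f rho M) as [c' [Hc1 Hc2]]; [lra|eapply hol_cauchy; eauto|intros; apply HM; rewrite Cmod_circ; lra|].
      destruct (Hc rho Hrho) as [[M' HM'] H2]. intros k.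
      rewrite (psum_unique c c' rho M' (2 * M) rho); auto; try lra.
      intros t Ht. assert (Hmt : Cmod t = t) by (rewrite Cmod_R, Rabs_pos_eq; lra). rewrite <- H2, <- Hc2 by lra. auto. }
    intros k. apply Rnot_lt_le. intros Hlt.
    assert (Hck := Cmod_ge_0 (c k)).
    assert (Cp : continuous (fun x => Cmod (c k) * x ^ k)%R r).
    { apply (continuous_mult (K := R_AbsRing)); [apply continuous_const|]. apply (ex_derive_continuous (V := R_NormedModule)). auto_derive. auto. }
    rewrite continuous_R_eps in Cp. destruct (Cp (Cmod (c k) * r ^ k - 2 * M)%R) as [d [Hd H]]; [lra|].
    set (rho := (Rmax (r / 2) (r - d / 2))%R).
    assert (A1 := Rmax_l (r / 2) (r - d / 2)). assert (A2 := Rmax_r (r / 2) (r - d / 2)). fold rho in A1, A2.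
    assert (Hrho : (rho < r)%R) by (unfold rho; apply Rmax_lub_lt; lra).
    specialize (H rho). rewrite Rabs_left in H by lra. specialize (H ltac:(lra)).
    assert (B' := B rho ltac:(lra) k). rewrite Rabs_left1 in H by lra. lra.
  - intros w Hw. destruct (Hc ((Cmod w + r) / 2)%R) as [_ H]; [assert (A := Cmod_ge_0 w); lra|]. apply H. lra.
Qed.

Lemma hol_psum (c : nat -> C) (r M : R) : pbound c r M -> hol r (psum c).
Proof. intros H w Hw. eexists. eapply cder_psum; eauto. Qed.

Lemma hol_ext (r : R) (f g : C -> C) : (forall w, (Cmod w < r)%R -> f w = g w) -> hol r f -> hol r g.
Proof.
  intros E H w Hw. destruct (H w Hw) as [l Hl]. exists l. apply (cder_ext_loc f g w l (r - Cmod w)); auto; [lra|].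
  intros v Hv. apply E. assert (A := Cmod_triangle (v - w) w). replace (v - w + w) with v in A by ring. lra.
Qed.

(** Weierstrass: Cauchy's formula passes to the limit, and the formula alone yields a power series
    on a smaller disc. *)
Lemma hol_uniform_limit (f : nat -> C -> C) (g : C -> C) (r : R) : (0 < r)%R -> (forall n, hol r (f n)) ->
  (forall eps, (0 < eps)%R -> exists n, forall w, (Cmod w < r)%R -> (Cmod (f n w - g w) <= eps)%R) -> hol r g.
Proof.
  intros Hr Hf Hu. assert (HPI := PI_RGT_0).
  assert (Cg : forall w, (Cmod w < r)%R -> ccont g w).
  { intros w Hw eps He. destruct (Hu (eps / 4)%R) as [n Hn]; [lra|].
    destruct (hol_ccont (f n) r w (Hf n) Hw (eps / 4)%R) as [d [Hd H]]; [lra|].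
    exists (Rmin d (r - Cmod w)). split; [apply Rmin_pos; lra|]. intros v Hv.
    assert (L1 := Rlt_le_trans _ _ _ Hv (Rmin_l _ _)). assert (L2 := Rlt_le_trans _ _ _ Hv (Rmin_r _ _)).
    assert (Hvr : (Cmod v < r)%R). { assert (A := Cmod_triangle (v - w) w). replace (v - w + w) with v in A by ring. lra. }
    specialize (H v L1). assert (A1 := Hn v Hvr). assert (A2 := Hn w Hw). rewrite Cmod_sym in A1.
    replace (g v - g w) with ((g v - f n v) + (f n v - f n w) + (f n w - g w)) by ring.
    eapply Rle_lt_trans; [apply Cmod_triangle|]. assert (A3 := Cmod_triangle (g v - f n v) (f n v - f n w)). lra. }
  intros w Hw. assert (Hw0 := Cmod_ge_0 w). set (rho := ((Cmod w + r) / 2)%R).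
  assert (Hrho : (0 < rho < r)%R) by (unfold rho; lra).
  assert (Rc : forall t, rcont (fun t => g (circ rho t)) t).
  { intros t. apply rcont_circ_comp. apply Cg. rewrite Cmod_circ; lra. }
  assert (CF : cauchy_formula g rho).
  { split; auto. intros w0 Hw0'. 
    destruct (rcont_bounded (fun t => circ rho t / (circ rho t - w0)) 0 (2 * PI)) as [K HK]; [intros; apply rcont_kernel; auto|].
    set (K' := (Rabs K + 1)%R). assert (HKK : (K <= K')%R) by (unfold K'; assert (A := Rle_abs K); lra).
    assert (HK0 : (0 < K')%R) by (unfold K'; assert (A := Rabs_pos K); lra).
    match goal with |- ?A = ?B => assert (Z : A - B = 0); [|replace A with (A - B + B) by ring; rewrite Z; ring] end.
    apply Cmod_eq_0, Rle_antisym; [|apply Cmod_ge_0]. apply le_epsilon. intros e He. rewrite Rplus_0_l.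
    set (e' := (e / (4 * PI * K' + 2 * PI))%R). assert (He' : (0 < e')%R) by (apply Rdiv_lt_0_compat; [auto|nra]).
    destruct (Hu e' He') as [n Hn]. destruct (hol_cauchy (f n) r rho (Hf n) Hrho) as [Rf CFf].
    specialize (CFf w0 Hw0').
    assert (Rk : forall t, rcont (fun t => circ rho t / (circ rho t - w0)) t) by (intros; apply rcont_kernel; auto).
    assert (E : CInt (fun t => g (circ rho t) * (circ rho t / (circ rho t - w0))) 0 (2 * PI) - RtoC (2 * PI) * g w0
      = CInt (fun t => (g (circ rho t) + - (1) * f n (circ rho t)) * (circ rho t / (circ rho t - w0))) 0 (2 * PI) + RtoC (2 * PI) * (f n w0 - g w0)).
    { replace (RtoC (2 * PI) * (f n w0 - g w0)) with (RtoC (2 * PI) * f n w0 - RtoC (2 * PI) * g w0) by ring.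
      rewrite <- CFf. 
      rewrite (CInt_ext (fun t => (g (circ rho t) + - (1) * f n (circ rho t)) * (circ rho t / (circ rho t - w0)))
        (fun t => g (circ rho t) * (circ rho t / (circ rho t - w0)) + - (1) * (f n (circ rho t) * (circ rho t / (circ rho t - w0))))); [|lra|intros; ring].
      rewrite CInt_plus; [|lra|intros; apply rcont_mult; auto|intros; apply rcont_mult; [apply rcont_const|apply rcont_mult; auto]].
      rewrite (CInt_scal (- (1)) (fun t => f n (circ rho t) * (circ rho t / (circ rho t - w0)))); [ring|lra|intros; apply rcont_mult; auto]. }
    rewrite E. eapply Rle_trans; [apply Cmod_triangle|].
    assert (B1 : (Cmod (CInt (fun t => (g (circ rho t) + - (1) * f n (circ rho t)) * (circ rho t / (circ rho t - w0)))%C 0 (2 * PI)) <= 2 * (e' * K') * (2 * PI - 0))%R).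
    { apply CInt_bound; [lra| |].
      - intros t _. apply rcont_mult; auto. apply rcont_plus; auto. apply rcont_mult; [apply rcont_const|auto].
      - intros t Ht. rewrite Cmod_mult. apply Rmult_le_compat; try apply Cmod_ge_0; [|eapply Rle_trans; [apply HK; auto|auto]].
        replace (g (circ rho t) + - (1) * f n (circ rho t)) with (g (circ rho t) - f n (circ rho t)) by ring.
        rewrite Cmod_sym. apply Hn. rewrite Cmod_circ; lra. }
    rewrite Cmod_mult, Cmod_R, Rabs_pos_eq by lra.
    assert (B2 := Hn w0 ltac:(lra)).
    assert (2 * PI * Cmod (f n w0 - g w0) <= 2 * PI * e')%R by (apply Rmult_le_compat_l; lra).
    replace e with ((4 * PI * K' + 2 * PI) * e')%R by (unfold e'; field; nra). lra. }
  destruct (rcont_bounded (fun t => g (circ rho t)) 0 (2 * PI)) as [M HM]; [intros; apply Rc|].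
  destruct (cauchy_taylor g rho M) as [c [Hc1 Hc2]]; [lra|auto| |].
  - intros t. destruct (circ_in_period rho t) as [s [Hs E]]; [lra|]. rewrite E. apply HM; auto.
  - destruct (hol_ext rho (psum c) g) with (w := w) as [l Hl]; [intros; rewrite Hc2; auto|eapply hol_psum; eauto|unfold rho; lra|].
    exists l; auto.
Qed.

(** The constant 8 is the 2 of [taylor_bounded] times 1 / (1 - 1/2)^2 from [psum_lip] on the half
    disc. It fixes the constants of the contractions below. *)
Lemma hol_lip (f : C -> C) (r M : R) (a b : C) : (0 < r)%R -> hol r f -> (forall w, (Cmod w < r)%R -> (Cmod (f w) <= M)%R) ->
  (Cmod a <= r / 2)%R -> (Cmod b <= r / 2)%R -> (Cmod (f b - f a) <= 8 * M / r * Cmod (b - a))%R.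
Proof.
  intros Hr Hf HM Ha Hb. destruct (taylor_bounded f r M Hr Hf HM) as [c [Hc1 Hc2]].
  rewrite !Hc2 by lra. eapply Rle_trans; [apply (psum_lip c r (r / 2) (2 * M)); auto; lra|].
  right. field. lra.
Qed.

Lemma hol_const (r : R) (c : C) : hol r (fun _ => c).
Proof. intros w _. eexists. apply cder_const. Qed.
Lemma hol_id (r : R) : hol r (fun w => w).
Proof. intros w _. eexists. apply cder_id. Qed.
Lemma hol_plus (r : R) (f g : C -> C) : hol r f -> hol r g -> hol r (fun w => f w + g w).
Proof. intros Hf Hg w Hw. destruct (Hf w Hw), (Hg w Hw). eexists. apply cder_plus; eauto. Qed.
Lemma hol_mult (r : R) (f g : C -> C) : hol r f -> hol r g -> hol r (fun w => f w * g w).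
Proof. intros Hf Hg w Hw. destruct (Hf w Hw), (Hg w Hw). eexists. apply cder_mult; eauto. Qed.
Lemma hol_minus (r : R) (f g : C -> C) : hol r f -> hol r g -> hol r (fun w => f w - g w).
Proof. intros Hf Hg w Hw. destruct (Hf w Hw), (Hg w Hw). eexists. apply cder_minus; eauto. Qed.
Lemma hol_opp (r : R) (f : C -> C) : hol r f -> hol r (fun w => - f w).
Proof. intros Hf w Hw. destruct (Hf w Hw). eexists. apply cder_opp; eauto. Qed.
Lemma hol_pow (r : R) (f : C -> C) (n : nat) : hol r f -> hol r (fun w => f w ^ n).
Proof. intros Hf w Hw. destruct (Hf w Hw). eexists. apply (cder_pow f); eauto. Qed.
Lemma hol_inv (r : R) (f : C -> C) : hol r f -> (forall w, (Cmod w < r)%R -> f w <> 0) -> hol r (fun w => / f w).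
Proof. intros Hf Hn w Hw. destruct (Hf w Hw). eexists. apply cder_inv; eauto. Qed.
Lemma hol_comp (r s : R) (f g : C -> C) : hol s f -> hol r g -> (forall w, (Cmod w < r)%R -> (Cmod (g w) < s)%R) ->
  hol r (fun w => f (g w)).
Proof. intros Hf Hg Hs w Hw. destruct (Hg w Hw). destruct (Hf (g w) (Hs w Hw)). eexists. apply (cder_comp f g); eauto. Qed.
Lemma hol_mono (r s : R) (f : C -> C) : (s <= r)%R -> hol r f -> hol s f.
Proof. intros H Hf w Hw. apply Hf. lra. Qed.
Lemma hol_csum (r : R) (f : nat -> C -> C) (n : nat) : (forall k, hol r (f k)) -> hol r (fun w => csum (fun k => f k w) n).
Proof. intros H. induction n; simpl; [apply hol_const|apply hol_plus; auto]. Qed.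

Lemma hol_psum_param (c : nat -> C -> C) (R0 M rho : R) (x : C) : (0 < rho)%R -> (forall k, hol rho (c k)) ->
  (forall y, (Cmod y < rho)%R -> pbound (fun k => c k y) R0 M) -> (Cmod x < R0)%R -> hol rho (fun y => psum (fun k => c k y) x).
Proof.
  intros Hr Hc Hb Hx. assert (Hx0 := Cmod_ge_0 x).
  apply (hol_uniform_limit (fun n y => csum (fun k => c k y * x ^ k) n)); auto.
  - intros n. apply (hol_csum rho (fun k y => c k y * x ^ k)). intros k. apply hol_mult; auto. apply hol_const.
  - intros eps He. assert (Hq := ratio_lt1 R0 (Cmod x) ltac:(lra)). set (q := (Cmod x / R0)%R) in *.
    assert (HM : (0 <= M)%R) by (apply (pbound_pos (fun k => c k 0) R0), Hb; rewrite Cmod_0; auto).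
    destruct (small_pow q (eps * (1 - q) / (M + 1)) Hq) as [n Hn].
    { apply Rdiv_lt_0_compat; [apply Rmult_lt_0_compat; lra|lra]. }
    exists n. intros y Hy. rewrite Cmod_sym. eapply Rle_trans; [apply (psum_tail _ R0 M); auto|]. fold q.
    specialize (Hn n (Nat.le_refl _)).
    assert (Hqn : (0 <= q ^ n)%R) by (apply pow_le; lra).
    apply (Rmult_lt_compat_l (M + 1)) in Hn; [|lra].
    replace ((M + 1) * (eps * (1 - q) / (M + 1)))%R with (eps * (1 - q))%R in Hn by (field; lra).
    apply (Rmult_le_reg_r (1 - q)); [lra|]. unfold Rdiv. rewrite Rmult_assoc, Rinv_l by lra. nra.
Qed.

Lemma pbound_shift (c : nat -> C) (R0 M : R) (j : nat) : (0 < R0)%R -> pbound c R0 M -> pbound (fun k => c (j + k)%nat) R0 (M / R0 ^ j).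
Proof.
  intros HR H k. specialize (H (j + k)%nat). rewrite pow_add in H. assert (Hp : (0 < R0 ^ j)%R) by (apply pow_lt; auto).
  apply (Rmult_le_reg_r (R0 ^ j)); auto. unfold Rdiv. rewrite (Rmult_assoc M), Rinv_l by lra. lra.
Qed.

Lemma psum_shift (c : nat -> C) (R0 M : R) (x : C) : pbound c R0 M -> (Cmod x < R0)%R ->
  psum c x = c O + x * psum (fun k => c (S k)) x.
Proof.
  intros H Hx. assert (Hx0 := Cmod_ge_0 x).
  apply (cser_unique (fun k => c k * x ^ k)); [eapply psum_cser; eauto|].
  apply (cser_eq _ (c O * x ^ 0 + x * psum (fun k => c (S k)) x)); [|simpl; ring].
  apply (cser_Sl (fun k => c k * x ^ k)). apply (cser_ext (fun k => x * (c (S k) * x ^ k))); [intros; rewrite Cpow_S; ring|].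
  apply cser_scal. eapply psum_cser; [|eauto]. apply (pbound_shift c R0 M 1); auto. lra.
Qed.

(** * Functions of two complex variables *)

Definition cder2 (f : C -> C -> C) (x y a b : C) : Prop :=
  forall eps : R, (0 < eps)%R -> exists del : R, (0 < del)%R /\
    forall x' y', (Cmod (x' - x) < del)%R -> (Cmod (y' - y) < del)%R ->
      (Cmod (f x' y' - f x y - a * (x' - x) - b * (y' - y)) <= eps * (Cmod (x' - x) + Cmod (y' - y)))%R.

(** The hypothesis of Osgood's lemma: holomorphic in each variable separately, with a common bound
    on a bidisc (radius [R0] for the first variable, [rho] for the second). *)
Definition shol2 (f : C -> C -> C) (R0 rho M : R) : Prop :=
  (forall y, (Cmod y < rho)%R -> hol R0 (fun x => f x y)) /\
  (forall x, (Cmod x < R0)%R -> hol rho (f x)) /\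
  (forall x y, (Cmod x < R0)%R -> (Cmod y < rho)%R -> (Cmod (f x y) <= M)%R).

(** The coefficients in x are recovered one at a time: c_0 is f at x = 0, and subtracting it and
    dividing by x passes to the next series. Holomorphy in y survives the division for x <> 0 and
    reaches x = 0 as a uniform limit. *)
Lemma shol2_coef (f : C -> C -> C) (R0 rho M : R) : (0 < R0)%R -> (0 < rho)%R -> shol2 f R0 rho M ->
  exists c : nat -> C -> C, (forall k, hol rho (c k)) /\
    (forall y, (Cmod y < rho)%R -> pbound (fun k => c k y) R0 (2 * M)) /\
    (forall x y, (Cmod x < R0)%R -> (Cmod y < rho)%R -> f x y = psum (fun k => c k y) x).
Proof.
  intros HR Hr [Hx [Hy HM]].
  (* The coefficients are selected for each y separately, at first without any regularity in y. *)
  destruct (choice (fun (y : C) (c : nat -> C) => (Cmod y < rho)%R -> pbound c R0 (2 * M) /\ forall x, (Cmod x < R0)%R -> f x y = psum c x)) as [c Hc].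
  { intros y. destruct (Rlt_dec (Cmod y) rho) as [Hl|Hl].
    - destruct (taylor_bounded (fun x => f x y) R0 M HR (Hx y Hl)) as [c [H1 H2]]; [intros; apply HM; auto|]. exists c; auto.
    - exists (fun _ => 0). intros; contradiction. }
  exists (fun k y => c y k). split; [|split].
  2:{ intros y Hl. apply (Hc y Hl). }
  2:{ intros x y Hxl Hl. apply (proj2 (Hc y Hl)); auto. }
  assert (P : forall k x, (Cmod x < R0)%R -> hol rho (fun y => psum (fun j => c y (k + j)%nat) x)).
  { assert (P0 : forall k, (forall x, (Cmod x < R0)%R -> hol rho (fun y => psum (fun j => c y (k + j)%nat) x)) -> hol rho (fun y => c y k)).
    { intros k Hk. apply (hol_ext rho (fun y => psum (fun j => c y (k + j)%nat) 0)); [|apply Hk; rewrite Cmod_0; auto].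
      intros y Hl. erewrite psum_0; [|exact HR|apply pbound_shift; auto; apply (Hc y Hl)]. f_equal. lia. }
    induction k.
    - intros x Hxl. apply (hol_ext rho (f x)); [|auto]. intros y Hl. apply (proj2 (Hc y Hl)); auto.
    - assert (Hn : forall x, (Cmod x < R0)%R -> x <> 0 -> hol rho (fun y => psum (fun j => c y (S k + j)%nat) x)).
      { intros x Hxl Hx0. apply (hol_ext rho (fun y => (psum (fun j => c y (k + j)%nat) x - c y k) * / x)).
        - intros y Hl. erewrite (psum_shift (fun j => c y (k + j)%nat) R0 (2 * M / R0 ^ k)); [|apply pbound_shift; auto; apply (Hc y Hl)|auto].
          rewrite (psum_ext (fun j => c y (S k + j)%nat) (fun j => c y (k + S j)%nat)) by (intros; f_equal; lia).
          rewrite Nat.add_0_r. field; auto.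
        - apply hol_mult; [|apply hol_const]. apply hol_minus; auto. }
      intros x Hxl. destruct (Ceq_dec x 0) as [E|Hx0]; [|apply Hn; auto]. subst x.
      set (B := (2 * M / R0 ^ S k)%R).
      assert (HB : (0 <= B)%R).
      { assert (HM0 := pbound_pos _ _ _ (proj1 (Hc 0 ltac:(rewrite Cmod_0; auto)))). unfold B.
        apply Rmult_le_pos; auto. left. apply Rinv_0_lt_compat, pow_lt; auto. }
      (* The points x = R0 / (n + 2) stay inside the disc and tend to 0; the bound B on the shifted
         coefficients, the same for all y, makes the convergence uniform. *)
      apply (hol_uniform_limit (fun n y => psum (fun j => c y (S k + j)%nat) (RtoC (R0 / (INR n + 2))))); auto.
      + intros n. assert (Hn0 := pos_INR n). apply Hn.
        * rewrite Cmod_R, Rabs_pos_eq; [|left; apply Rdiv_lt_0_compat; lra].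
          apply (Rmult_lt_reg_r (INR n + 2)); [lra|]. unfold Rdiv. rewrite Rmult_assoc, Rinv_l by lra. nra.
        * apply RtoC_neq0. assert (0 < R0 / (INR n + 2))%R by (apply Rdiv_lt_0_compat; lra). lra.
      + intros eps He. destruct (nfloor_ex (2 * B / eps)) as [n [_ Hn2]].
        { apply Rmult_le_pos; [lra|]. left. apply Rinv_0_lt_compat; auto. }
        exists n. intros y Hl. assert (Hn0 := pos_INR n).
        assert (Pb := pbound_shift _ _ _ (S k) HR (proj1 (Hc y Hl))). fold B in Pb.
        erewrite (psum_0 (fun j => c y (S k + j)%nat)); [|exact HR|exact Pb].
        set (x := (R0 / (INR n + 2))%R). assert (Hx1 : (0 < x)%R) by (apply Rdiv_lt_0_compat; lra).
        assert (Hq : (x / R0 = / (INR n + 2))%R) by (unfold x; field; lra).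
        assert (Hq2 : (/ (INR n + 2) <= / 2)%R) by (apply Rinv_le_contravar; lra).
        assert (Hq3 : (0 < / (INR n + 2))%R) by (apply Rinv_0_lt_compat; lra).
        assert (T := psum_tail _ R0 B (RtoC x) 1 Pb). rewrite Cmod_R, Rabs_pos_eq in T by lra. rewrite Hq in T.
        assert (Hxr : (x < R0)%R). { replace x with (/ (INR n + 2) * R0)%R by (unfold x; field; lra).
          apply (Rle_lt_trans _ (/ 2 * R0)); [apply Rmult_le_compat_r; lra|lra]. }
        specialize (T Hxr). cbn [csum] in T.
        replace (0 + c y (S k + 0)%nat * RtoC x ^ 0) with (c y (S k + 0)%nat) in T by (simpl; ring).
        eapply Rle_trans; [exact T|]. rewrite pow_1.
        assert (G : (/ (1 - / (INR n + 2)) <= 2)%R). { apply (Rle_trans _ (/ (/ 2))); [apply Rinv_le_contravar; lra|right; field]. }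
        assert (H2 : (B * / (INR n + 2) * / (1 - / (INR n + 2)) <= B * / (INR n + 2) * 2)%R) by (apply Rmult_le_compat_l; nra).
        unfold Rdiv. eapply Rle_trans; [exact H2|].
        apply (Rmult_le_reg_r (INR n + 2)); [lra|]. replace (B * / (INR n + 2) * 2 * (INR n + 2))%R with (2 * B)%R by (field; lra).
        apply (Rmult_lt_compat_l eps) in Hn2; auto. replace (eps * (2 * B / eps))%R with (2 * B)%R in Hn2 by (field; lra). nra. }
  intros k. apply (hol_ext rho (fun y => psum (fun j => c y (k + j)%nat) 0)); [|apply P; rewrite Cmod_0; auto].
  intros y Hl. erewrite psum_0; [|exact HR|apply pbound_shift; auto; apply (Hc y Hl)]. f_equal. lia.
Qed.

Lemma shol2_psum (c : nat -> C -> C) (R0 R1 rho M : R) : (0 < R1 < R0)%R -> (0 < rho)%R -> (forall k, hol rho (c k)) ->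
  (forall y, (Cmod y < rho)%R -> pbound (fun k => c k y) R0 M) ->
  shol2 (fun x y => psum (fun k => c k y) x) R1 rho (M / (1 - R1 / R0)).
Proof.
  intros HR Hr Hc Hb. assert (HM : (0 <= M)%R) by (apply (pbound_pos (fun k => c k 0) R0), Hb; rewrite Cmod_0; auto).
  split; [|split].
  - intros y Hy. apply (hol_mono R0); [lra|]. eapply hol_psum; eauto.
  - intros x Hx. eapply hol_psum_param; eauto. lra.
  - intros x y Hx Hy. assert (Hx0 := Cmod_ge_0 x). eapply Rle_trans; [apply (psum_le _ R0 M); auto; lra|].
    apply Rmult_le_compat_l; auto. assert (Hq := ratio_lt1 R0 R1 ltac:(lra)). apply Rinv_le_contravar; [lra|].
    assert (Cmod x / R0 <= R1 / R0)%R; [|lra]. apply Rmult_le_compat_r; [left; apply Rinv_0_lt_compat; lra|lra].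
Qed.

Lemma shol2_mono (f : C -> C -> C) (R0 rho M R1 rho1 M1 : R) : (R1 <= R0)%R -> (rho1 <= rho)%R -> (M <= M1)%R ->
  shol2 f R0 rho M -> shol2 f R1 rho1 M1.
Proof.
  intros H1 H2 H3 [Hx [Hy HM]]. split; [|split].
  - intros y Hl. apply (hol_mono R0); auto. apply Hx; lra.
  - intros x Hl. apply (hol_mono rho); auto. apply Hy; lra.
  - intros x y Hl Hl'. eapply Rle_trans; [apply HM; lra|auto].
Qed.

(** Osgood's lemma. The increment splits into a quadratic remainder in x, uniform in y', the change
    of the x-derivative D with y, which is holomorphic and hence continuous, and the increment in y
    alone. *)
Lemma shol2_cder2 (f : C -> C -> C) (R0 rho M : R) (x y : C) : shol2 f R0 rho M -> (Cmod x < R0)%R -> (Cmod y < rho)%R ->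
  exists a b, cder2 f x y a b.
Proof.
  intros Hf Hx Hy. assert (Hx0 := Cmod_ge_0 x). assert (Hy0 := Cmod_ge_0 y).
  destruct (shol2_coef f R0 rho M ltac:(lra) ltac:(lra) Hf) as [c [Hc [Hb HE]]].
  set (R1 := ((Cmod x + R0) / 2)%R). set (R2 := ((R1 + R0) / 2)%R).
  set (D := fun y => psum (pderiv (fun j => c j y)) x).
  assert (HD : hol rho D).
  { apply (hol_psum_param (fun k y => pderiv (fun j => c j y) k) R2 (2 * M / R0 * (/ (1 - R2 / R0) * / (1 - R2 / R0))) rho x); [lra| | |unfold R2, R1; lra].
    - intros k. apply hol_mult; auto. apply hol_const.
    - intros y' Hy'. apply pbound_deriv; auto. unfold R2, R1; lra. }
  destruct Hf as [_ [Hfy _]]. destruct (Hfy x Hx y Hy) as [b Hbd].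
  exists (D y), b. intros eps He.
  set (K := (2 * M / R0 / R1 * (/ (1 - R1 / R0) * / (1 - R1 / R0) * / (1 - R1 / R0)))%R).
  set (K' := (Rabs K + 1)%R). assert (HKK : (K <= K')%R) by (unfold K'; assert (A := Rle_abs K); lra).
  assert (HK0 : (0 < K')%R) by (unfold K'; assert (A := Rabs_pos K); lra).
  destruct (hol_ccont D rho y HD Hy (eps / 3)%R) as [d1 [Hd1 H1]]; [lra|].
  destruct (Hbd (eps / 3)%R) as [d2 [Hd2 H2]]; [lra|].
  set (d := Rmin (Rmin d1 d2) (Rmin (Rmin (R1 - Cmod x) (rho - Cmod y)) (eps / 3 / K'))).
  assert (Hd : (0 < d)%R). { unfold d. repeat apply Rmin_pos; auto; try (unfold R1; lra). apply Rdiv_lt_0_compat; lra. }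
  assert (L1 := Rmin_l (Rmin d1 d2) (Rmin (Rmin (R1 - Cmod x) (rho - Cmod y)) (eps / 3 / K'))).
  assert (L2 := Rmin_r (Rmin d1 d2) (Rmin (Rmin (R1 - Cmod x) (rho - Cmod y)) (eps / 3 / K'))). fold d in L1, L2.
  assert (L3 := Rmin_l d1 d2). assert (L4 := Rmin_r d1 d2).
  assert (L5 := Rmin_l (Rmin (R1 - Cmod x) (rho - Cmod y)) (eps / 3 / K')). assert (L6 := Rmin_r (Rmin (R1 - Cmod x) (rho - Cmod y)) (eps / 3 / K')).
  assert (L7 := Rmin_l (R1 - Cmod x) (rho - Cmod y)). assert (L8 := Rmin_r (R1 - Cmod x) (rho - Cmod y)).
  exists d. split; auto. intros x' y' Hx' Hy'.
  assert (Hx'1 : (Cmod x' <= R1)%R). { assert (A := Cmod_triangle (x' - x) x). replace (x' - x + x) with x' in A by ring. lra. }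
  assert (Hy'1 : (Cmod y' < rho)%R). { assert (A := Cmod_triangle (y' - y) y). replace (y' - y + y) with y' in A by ring. lra. }
  assert (Q := psum_quad (fun k => c k y') R0 R1 (2 * M) x x' (Hb y' Hy'1) ltac:(unfold R1; lra) ltac:(unfold R1; lra) Hx'1).
  rewrite <- !HE in Q by (auto; unfold R1 in *; lra). fold (D y') in Q. fold K in Q.
  specialize (H1 y' ltac:(lra)). specialize (H2 y' ltac:(lra)).
  replace (f x' y' - f x y - D y * (x' - x) - b * (y' - y)) with
    ((f x' y' - f x y' - D y' * (x' - x)) + ((D y' - D y) * (x' - x) + (f x y' - f x y - b * (y' - y)))) by ring.
  assert (Ax := Cmod_ge_0 (x' - x)). assert (Ay := Cmod_ge_0 (y' - y)).
  eapply Rle_trans; [apply Cmod_triangle|].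
  assert (T := Cmod_triangle ((D y' - D y) * (x' - x)) (f x y' - f x y - b * (y' - y))). rewrite Cmod_mult in T.
  assert (Cmod (D y' - D y) * Cmod (x' - x) <= eps / 3 * Cmod (x' - x))%R by (apply Rmult_le_compat_r; lra).
  assert (K * (Cmod (x' - x) * Cmod (x' - x)) <= eps / 3 * Cmod (x' - x))%R.
  { rewrite <- Rmult_assoc. apply Rmult_le_compat_r; auto.
    assert (Cmod (x' - x) < eps / 3 / K')%R by lra. apply (Rmult_lt_compat_l K') in H0; auto.
    replace (K' * (eps / 3 / K'))%R with (eps / 3)%R in H0 by (field; lra).
    assert (K * Cmod (x' - x) <= K' * Cmod (x' - x))%R by (apply Rmult_le_compat_r; auto). lra. }
  assert (0 <= eps * Cmod (x' - x))%R by (apply Rmult_le_pos; lra).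
  assert (0 <= eps * Cmod (y' - y))%R by (apply Rmult_le_pos; lra). lra.
Qed.

Lemma cder2_comp (f : C -> C -> C) (g h : C -> C) (z a b g' h' : C) :
  cder2 f (g z) (h z) a b -> cder g z g' -> cder h z h' -> cder (fun z => f (g z) (h z)) z (a * g' + b * h').
Proof.
  intros Hf Hg Hh eps He.
  set (A := (Cmod a + Cmod b + Cmod g' + Cmod h' + 3)%R).
  assert (Ha := Cmod_ge_0 a). assert (Hb := Cmod_ge_0 b). assert (Hg' := Cmod_ge_0 g'). assert (Hh' := Cmod_ge_0 h').
  set (e := Rmin 1 (eps / (2 * A))). assert (He0 : (0 < e)%R). { apply Rmin_pos; [lra|]. apply Rdiv_lt_0_compat; unfold A; lra. }
  assert (He1 : (e <= 1)%R) by apply Rmin_l.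
  assert (He2 : (e * A <= eps / 2)%R).
  { assert (Q : (e <= eps / (2 * A))%R) by apply Rmin_r. apply (Rmult_le_compat_r A) in Q; [|unfold A; lra].
    replace (eps / (2 * A) * A)%R with (eps / 2)%R in Q by (field; unfold A; lra). auto. }
  destruct (Hf e He0) as [d [Hd H]]. destruct (Hg e He0) as [d1 [Hd1 H1]]. destruct (Hh e He0) as [d2 [Hd2 H2]].
  destruct (cder_cont _ _ _ Hg d Hd) as [d3 [Hd3 H3]]. destruct (cder_cont _ _ _ Hh d Hd) as [d4 [Hd4 H4]].
  exists (Rmin (Rmin d1 d2) (Rmin d3 d4)). split; [apply Rmin_pos; apply Rmin_pos; assumption|].
  intros w Hw. assert (L1 := Rlt_le_trans _ _ _ Hw (Rmin_l _ _)). assert (L2 := Rlt_le_trans _ _ _ Hw (Rmin_r _ _)).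
  assert (M1 := Rlt_le_trans _ _ _ L1 (Rmin_l _ _)). assert (M2 := Rlt_le_trans _ _ _ L1 (Rmin_r _ _)).
  assert (M3 := Rlt_le_trans _ _ _ L2 (Rmin_l _ _)). assert (M4 := Rlt_le_trans _ _ _ L2 (Rmin_r _ _)).
  specialize (H1 w M1). specialize (H2 w M2). specialize (H (g w) (h w) (H3 w M3) (H4 w M4)).
  set (m := Cmod (w - z)) in *. assert (Hm : (0 <= m)%R) by apply Cmod_ge_0.
  assert (G : (Cmod (g w - g z) <= (Cmod g' + 1) * m)%R).
  { replace (g w - g z) with ((g w - g z - g' * (w - z)) + g' * (w - z)) by ring. eapply Rle_trans; [apply Cmod_triangle|].
    rewrite Cmod_mult. fold m. nra. }
  assert (K : (Cmod (h w - h z) <= (Cmod h' + 1) * m)%R).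
  { replace (h w - h z) with ((h w - h z - h' * (w - z)) + h' * (w - z)) by ring. eapply Rle_trans; [apply Cmod_triangle|].
    rewrite Cmod_mult. fold m. nra. }
  replace (f (g w) (h w) - f (g z) (h z) - (a * g' + b * h') * (w - z)) with
   ((f (g w) (h w) - f (g z) (h z) - a * (g w - g z) - b * (h w - h z)) +
    (a * (g w - g z - g' * (w - z)) + b * (h w - h z - h' * (w - z)))) by ring.
  eapply Rle_trans; [apply Cmod_triangle|].
  assert (T := Cmod_triangle (a * (g w - g z - g' * (w - z))) (b * (h w - h z - h' * (w - z)))). rewrite !Cmod_mult in T.
  assert (Cmod a * Cmod (g w - g z - g' * (w - z)) <= Cmod a * (e * m))%R by (apply Rmult_le_compat_l; auto).
  assert (Cmod b * Cmod (h w - h z - h' * (w - z)) <= Cmod b * (e * m))%R by (apply Rmult_le_compat_l; auto).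
  assert (e * (Cmod (g w - g z) + Cmod (h w - h z)) <= e * ((Cmod g' + 1) * m + (Cmod h' + 1) * m))%R by (apply Rmult_le_compat_l; lra).
  assert (e * A * m <= eps / 2 * m)%R by (apply Rmult_le_compat_r; auto).
  replace (e * A * m)%R with (e * ((Cmod g' + 1) * m + (Cmod h' + 1) * m) + Cmod a * (e * m) + Cmod b * (e * m) + e * m)%R in * by (unfold A; ring).
  assert (0 <= e * m)%R by nra. assert (0 <= eps * m)%R by nra. lra.
Qed.

Lemma hol_comp2 (f : C -> C -> C) (R0 rho M r : R) (g h : C -> C) : shol2 f R0 rho M -> hol r g -> hol r h ->
  (forall z, (Cmod z < r)%R -> (Cmod (g z) < R0)%R /\ (Cmod (h z) < rho)%R) -> hol r (fun z => f (g z) (h z)).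
Proof.
  intros Hf Hg Hh H z Hz. destruct (Hg z Hz) as [g' Hg']. destruct (Hh z Hz) as [h' Hh']. destruct (H z Hz) as [H1 H2].
  destruct (shol2_cder2 f R0 rho M _ _ Hf H1 H2) as [a [b Hab]]. eexists. eapply (cder2_comp f g h); eauto.
Qed.

(** * Contractions *)

Fixpoint citer (N : C -> C) (n : nat) : C := match n with O => 0 | S n => N (citer N n) end.

(** The limit of the iteration from 0, written as a telescoping series so that it is a total
    function of N. *)
Definition fixpt (N : C -> C) : C := csum_val (fun n => citer N (S n) - citer N n).

(** The bound on N 0 and the factor 1 / 2 together keep the closed disc of radius tau invariant. *)
Definition contracts (tau : R) (N : C -> C) : Prop :=
  (Cmod (N 0) <= tau / 2)%R /\
  forall t t', (Cmod t <= tau)%R -> (Cmod t' <= tau)%R -> (Cmod (N t - N t') <= / 2 * Cmod (t - t'))%R.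

Lemma fixpt_spec (tau : R) (N : C -> C) : (0 <= tau)%R -> contracts tau N ->
  (Cmod (fixpt N) <= tau)%R /\ N (fixpt N) = fixpt N /\
  forall n, (Cmod (citer N n) <= tau)%R /\ (Cmod (citer N n - fixpt N) <= tau * (/ 2) ^ n)%R.
Proof.
  intros Ht [H0 Hc].
  assert (Hb : forall t, (Cmod t <= tau)%R -> (Cmod (N t) <= tau)%R).
  { intros t Hl. replace (N t) with ((N t - N 0) + N 0) by ring. eapply Rle_trans; [apply Cmod_triangle|].
    assert (A := Hc t 0 Hl ltac:(rewrite Cmod_0; auto)). replace (t - 0) with t in A by ring. lra. }
  assert (Hi : forall n, (Cmod (citer N n) <= tau)%R) by (induction n; simpl; [rewrite Cmod_0; auto|auto]).
  assert (Hd : forall n, (Cmod (citer N (S n) - citer N n) <= tau / 2 * (/ 2) ^ n)%R).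
  { induction n.
    - simpl. replace (N 0 - 0) with (N 0) by ring. lra.
    - change (citer N (S (S n))) with (N (citer N (S n))). change (citer N (S n)) with (N (citer N n)) at 2.
      eapply Rle_trans; [apply Hc; auto|]. simpl pow. lra. }
  assert (Hs : forall n, csum (fun n => citer N (S n) - citer N n) n = citer N n).
  { induction n; cbn [csum]; [reflexivity|]. rewrite IHn. ring. }
  assert (S := cser_geom_ex _ _ (/ 2) ltac:(lra) Hd). fold (fixpt N) in S.
  assert (Tl : forall n, (Cmod (citer N n - fixpt N) <= tau * (/ 2) ^ n)%R).
  { intros n. assert (A := cser_geom_tail _ _ (/ 2) _ n ltac:(lra) Hd S). rewrite Hs in A. rewrite Cmod_sym. lra. }
  assert (Hf : (Cmod (fixpt N) <= tau)%R).
  { apply (cser_le _ _ _ S). intros n. rewrite Hs. auto. }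
  split; auto. split; [|intros n; auto].
  assert (Z : N (fixpt N) - fixpt N = 0).
  { apply Cmod_eq_0, Rle_antisym; [|apply Cmod_ge_0]. apply le_epsilon. intros e He. rewrite Rplus_0_l.
    destruct (small_pow (/ 2) (e / (2 * tau + 1)) ltac:(lra)) as [n Hn]; [apply Rdiv_lt_0_compat; lra|].
    specialize (Hn n (Nat.le_refl _)). apply (Rmult_lt_compat_l (2 * tau + 1)) in Hn; [|lra].
    replace ((2 * tau + 1) * (e / (2 * tau + 1)))%R with e in Hn by (field; lra).
    assert (Hp : (0 < (/ 2) ^ n)%R) by (apply pow_lt; lra).
    replace (N (fixpt N) - fixpt N) with ((N (fixpt N) - N (citer N n)) + (citer N (Datatypes.S n) - fixpt N)) by (simpl; ring).
    eapply Rle_trans; [apply Cmod_triangle|].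
    assert (A1 := Hc _ _ Hf (Hi n)). assert (A2 := Tl n). assert (A3 := Tl (Datatypes.S n)). rewrite Cmod_sym in A2. simpl pow in A3. nra. }
  replace (N (fixpt N)) with (N (fixpt N) - fixpt N + fixpt N) by ring. rewrite Z. ring.
Qed.

Lemma fixpt_unique (tau : R) (N : C -> C) (t : C) : (0 <= tau)%R -> contracts tau N -> (Cmod t <= tau)%R -> N t = t -> t = fixpt N.
Proof.
  intros Ht Hc Hl E. destruct (fixpt_spec tau N Ht Hc) as [H1 [H2 _]].
  assert (A := proj2 Hc t (fixpt N) Hl H1). rewrite E, H2 in A.
  assert (Z : t - fixpt N = 0) by (apply Cmod_eq_0; assert (B := Cmod_ge_0 (t - fixpt N)); lra).
  replace t with (t - fixpt N + fixpt N) by ring. rewrite Z. ring.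
Qed.

(** The iterates are holomorphic in the parameter and converge uniformly. The hypothesis on N is
    phrased through composition with a bounded holomorphic phi, which is the form that [hol_comp2]
    supplies. *)
Lemma fixpt_hol (tau r : R) (N : C -> C -> C) : (0 <= tau)%R -> (0 < r)%R ->
  (forall s, (Cmod s < r)%R -> contracts tau (N s)) ->
  (forall phi, hol r phi -> (forall s, (Cmod s < r)%R -> (Cmod (phi s) <= tau)%R) -> hol r (fun s => N s (phi s))) ->
  hol r (fun s => fixpt (N s)).
Proof.
  intros Ht Hr Hc HN.
  assert (Hi : forall n, hol r (fun s => citer (N s) n)).
  { induction n; simpl; [apply hol_const|]. apply HN; auto. intros s Hs.
    apply (fixpt_spec tau (N s) Ht (Hc s Hs)). }
  apply (hol_uniform_limit (fun n s => citer (N s) n)); auto.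
  intros eps He. destruct (small_pow (/ 2) (eps / (tau + 1)) ltac:(lra)) as [n Hn]; [apply Rdiv_lt_0_compat; lra|].
  specialize (Hn n (Nat.le_refl _)). apply (Rmult_lt_compat_l (tau + 1)) in Hn; [|lra].
  replace ((tau + 1) * (eps / (tau + 1)))%R with eps in Hn by (field; lra).
  assert (Hp : (0 < (/ 2) ^ n)%R) by (apply pow_lt; lra).
  exists n. intros s Hs. destruct (fixpt_spec tau (N s) Ht (Hc s Hs)) as [_ [_ H]]. eapply Rle_trans; [apply H|]. nra.
Qed.

(** * Linear differential equations with holomorphic coefficients *)

Definition conv (a b : nat -> C) (n : nat) : C := csum (fun k => b k * a (n - k)%nat) (S n).

Lemma csum_conv (a b : nat -> C) (n : nat) :
  csum (conv a b) n = csum (fun k => b k * csum a (n - k)) n.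
Proof.
  induction n; [reflexivity|].
  change (csum (conv a b) (S n)) with (csum (conv a b) n + conv a b n). rewrite IHn. unfold conv.
  rewrite (csum_ext (fun k => b k * csum a (S n - k)) (fun k => b k * csum a (n - k) + b k * a (n - k)%nat)).
  - rewrite csum_plus. cbn [csum]. rewrite Nat.sub_diag. cbn [csum]. ring.
  - intros k Hk. replace (S n - k)%nat with (S (n - k)) by lia. cbn [csum]. ring.
Qed.

(** With r the square root of q, n r^n is bounded and the remaining r^n tends to 0. *)
Lemma geom_n_small (q eps : R) : (0 <= q < 1)%R -> (0 < eps)%R ->
  exists N, forall n, (N <= n)%nat -> (INR n * q ^ n < eps)%R.
Proof.
  intros Hq He. set (r := sqrt q).
  assert (Hr : (0 <= r < 1)%R).
  { split; [apply sqrt_pos|]. rewrite <- sqrt_1. apply sqrt_lt_1; lra. }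
  assert (Hrr : (r * r = q)%R) by (apply sqrt_sqrt; lra).
  set (K := (/ (1 - r) * / (1 - r))%R). assert (HK : (0 < K)%R) by (apply Rmult_lt_0_compat; apply Rinv_0_lt_compat; lra).
  destruct (small_pow r (eps / K) Hr) as [N HN]; [apply Rdiv_lt_0_compat; auto|].
  exists N. intros n Hn. specialize (HN n Hn).
  assert (B := pow_q_bound r n Hr). fold K in B. rewrite S_INR in B.
  assert (Hp : (0 <= r ^ n)%R) by (apply pow_le; lra).
  rewrite <- Hrr, Rpow_mult_distr, <- Rmult_assoc.
  apply (Rle_lt_trans _ (K * r ^ n)); [apply Rmult_le_compat_r; lra|].
  apply (Rmult_lt_compat_l K) in HN; auto. replace (K * (eps / K))%R with eps in HN by (field; lra). auto.
Qed.

(** A partial sum of the product is the sum of b_k times partial sums of a up to n - k. Replacing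
    those by A costs a multiple of q^k q^(n-k) for each k, in all n q^n. *)
Lemma cser_conv (a b : nat -> C) (A B : C) (K K' q : R) : (0 <= q < 1)%R ->
  (forall k, (Cmod (a k) <= K * q ^ k)%R) -> (forall k, (Cmod (b k) <= K' * q ^ k)%R) ->
  cser a A -> cser b B -> cser (conv a b) (A * B).
Proof.
  intros Hq Ha Hb HA HB eps He.
  assert (HK : (0 <= K)%R) by (specialize (Ha O); simpl in Ha; assert (X := Cmod_ge_0 (a O)); lra).
  assert (HK' : (0 <= K')%R) by (specialize (Hb O); simpl in Hb; assert (X := Cmod_ge_0 (b O)); lra).
  set (L := (K * K' / (1 - q))%R). assert (HL : (0 <= L)%R) by (apply Rmult_le_pos; [nra|left; apply Rinv_0_lt_compat; lra]).
  destruct (geom_n_small q (eps / 2 / (L + 1)) Hq) as [N1 HN1]; [apply Rdiv_lt_0_compat; lra|].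
  assert (HA0 := Cmod_ge_0 A).
  destruct (HB (eps / 2 / (Cmod A + 1))%R) as [N2 HN2]; [apply Rdiv_lt_0_compat; lra|].
  exists (max N1 N2). intros n Hn. specialize (HN1 n ltac:(lia)). specialize (HN2 n ltac:(lia)).
  rewrite csum_conv.
  replace (csum (fun k => b k * csum a (n - k)) n - A * B) with
    (csum (fun k => b k * (csum a (n - k) - A)) n + A * (csum b n - B)).
  2:{ rewrite (csum_ext (fun k => b k * (csum a (n - k) - A)) (fun k => b k * csum a (n - k) + - A * b k)) by (intros; ring).
      rewrite csum_plus, csum_scal. ring. }
  eapply Rle_lt_trans; [apply Cmod_triangle|].
  assert (B1 : (Cmod (csum (fun k => (b k * (csum a (n - k) - A))%C) n) <= rsum (fun k => L * q ^ n) n)%R).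
  { apply csum_bound. intros k Hk. rewrite Cmod_mult. rewrite (Cmod_sym (csum a (n - k))).
    assert (T := cser_geom_tail a K q A (n - k) Hq Ha HA).
    replace (L * q ^ n)%R with ((K' * q ^ k) * (K * q ^ (n - k) / (1 - q)))%R.
    - apply Rmult_le_compat; auto; apply Cmod_ge_0.
    - replace (q ^ n)%R with (q ^ k * q ^ (n - k))%R by (rewrite <- pow_add; f_equal; lia). unfold L. field. lra. }
  assert (E : forall c m, rsum (fun _ => c) m = (INR m * c)%R).
  { intros c m. induction m; [simpl; ring|]. cbn [rsum]. rewrite IHm, S_INR. ring. }
  rewrite E in B1. rewrite Cmod_mult.
  assert (B2 : (INR n * (L * q ^ n) < eps / 2)%R).
  { apply (Rmult_lt_compat_l (L + 1)) in HN1; [|lra]. replace ((L + 1) * (eps / 2 / (L + 1)))%R with (eps / 2)%R in HN1 by (field; lra).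
    assert (0 <= INR n * q ^ n)%R by (apply Rmult_le_pos; [apply pos_INR|apply pow_le; lra]). nra. }
  assert (B3 : (Cmod A * Cmod (csum b n - B) < eps / 2)%R).
  { apply (Rmult_lt_compat_l (Cmod A + 1)) in HN2; [|lra]. replace ((Cmod A + 1) * (eps / 2 / (Cmod A + 1)))%R with (eps / 2)%R in HN2 by (field; lra).
    assert (0 <= Cmod (csum b n - B))%R by apply Cmod_ge_0. nra. }
  lra.
Qed.

Lemma psum_conv (a b : nat -> C) (R0 M M' : R) (x : C) : pbound a R0 M -> pbound b R0 M' -> (Cmod x < R0)%R ->
  cser (fun n => conv a b n * x ^ n) (psum a x * psum b x).
Proof.
  intros Ha Hb Hx. assert (Hx0 := Cmod_ge_0 x).
  apply (cser_ext (conv (fun k => a k * x ^ k) (fun k => b k * x ^ k))).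
  - intros n. unfold conv. rewrite Cmult_comm, <- csum_scal. apply csum_ext. intros k Hk.
    replace (x ^ n) with (x ^ k * x ^ (n - k)) by (rewrite <- Cpow_add_r; f_equal; lia). ring.
  - apply (cser_conv _ _ _ _ M M' (Cmod x / R0)); [apply ratio_lt1; lra|apply pbound_term; auto; lra|apply pbound_term; auto; lra| |];
    eapply psum_cser; eauto.
Qed.

Definition lode_next (p q u : nat -> C) (n : nat) : C :=
  (conv p (fun k => INR (S k) * u (S k)) n + conv q u n) / (INR (S n) * INR (S (S n))).

(** Course-of-values recursion for the coefficients of u'' = p u' + q u: after n rounds the entries
    of index at most n + 1 are final, the others still 0. *)
Fixpoint lode_aux (p q : nat -> C) (a b : C) (n : nat) : nat -> C :=
  match n with
  | O => fun k => match k with O => a | S O => b | _ => 0 end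
  | S n => let u := lode_aux p q a b n in fun k => if Nat.eq_dec k (S (S n)) then lode_next p q u n else u k
  end.

Definition lode (p q : nat -> C) (a b : C) (n : nat) : C := lode_aux p q a b n n.

Lemma lode_aux_stable (p q : nat -> C) (a b : C) (n j k : nat) : (k <= S n)%nat ->
  lode_aux p q a b (n + j) k = lode_aux p q a b n k.
Proof.
  intros Hk. induction j; [rewrite Nat.add_0_r; auto|]. rewrite Nat.add_succ_r. simpl.
  destruct (Nat.eq_dec k (S (S (n + j)))); [lia|auto].
Qed.

Lemma lode_aux_eq (p q : nat -> C) (a b : C) (n k : nat) : (k <= S n)%nat -> lode_aux p q a b n k = lode p q a b k.
Proof.
  intros Hk. unfold lode. destruct (Nat.eq_dec k (S n)) as [->|Hn].
  - symmetry. replace (S n) with (n + 1)%nat at 1 by lia. apply lode_aux_stable. lia.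
  - replace n with (k + (n - k))%nat by lia. apply lode_aux_stable. lia.
Qed.

Lemma conv_ext (a b b' : nat -> C) (n : nat) : (forall k, (k <= n)%nat -> b k = b' k) -> conv a b n = conv a b' n.
Proof. intros H. unfold conv. apply csum_ext. intros k Hk. rewrite H; auto. lia. Qed.

Lemma lode_SS (p q : nat -> C) (a b : C) (n : nat) :
  lode p q a b (S (S n)) = lode_next p q (lode p q a b) n.
Proof.
  rewrite <- (lode_aux_eq p q a b (S n)) by lia. cbn [lode_aux].
  destruct (Nat.eq_dec (S (S n)) (S (S n))); [|lia]. unfold lode_next. f_equal. f_equal; apply conv_ext; intros k Hk.
  - rewrite lode_aux_eq by lia. auto.
  - rewrite lode_aux_eq by lia. auto.
Qed.

(** The condition 2 / R0 <= L makes the terms shrink by at least 1 / 2 as the index of a grows, so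
    the whole sum is at most twice its top term. *)
Lemma conv_bound (a b : nat -> C) (R0 M L K : R) (n : nat) : (0 < R0)%R -> (2 / R0 <= L)%R -> pbound a R0 M ->
  (forall k, (k <= n)%nat -> (Cmod (b k) <= K * L ^ k)%R) -> (Cmod (conv a b n) <= 2 * M * K * L ^ n)%R.
Proof.
  intros HR HL Ha Hb. assert (HM := pbound_pos _ _ _ Ha).
  assert (HK : (0 <= K)%R) by (specialize (Hb O ltac:(lia)); simpl in Hb; assert (X := Cmod_ge_0 (b O)); lra).
  assert (HL0 : (0 < L)%R) by (assert (0 < 2 / R0)%R by (apply Rdiv_lt_0_compat; lra); lra).
  assert (G : forall m, (m <= S n)%nat -> (Cmod (csum (fun k => (b k * a (n - k)%nat)%C) m) <= M * K * L ^ n * (2 * (/ 2) ^ (S n - m)))%R).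
  { induction m; intros Hm.
    - cbn [csum]. rewrite Cmod_0. repeat apply Rmult_le_pos; auto; try lra; apply pow_le; lra.
    - cbn [csum]. eapply Rle_trans; [apply Cmod_triangle|].
      specialize (IHm ltac:(lia)). replace (S n - m)%nat with (S (S n - S m)) in IHm by lia. simpl pow in IHm.
      replace (S n - S m)%nat with (n - m)%nat in * by lia.
      assert (T : (Cmod (b m * a (n - m)%nat) <= M * K * L ^ n * (/ 2) ^ (n - m))%R).
      { rewrite Cmod_mult. specialize (Hb m ltac:(lia)). specialize (Ha (n - m)%nat).
        assert (Hp : (0 < R0 ^ (n - m))%R) by (apply pow_lt; auto).
        assert (H2 : (/ R0 <= L * / 2)%R) by (unfold Rdiv in HL; lra).
        assert (Ha' : (Cmod (a (n - m)%nat) <= M * (L * / 2) ^ (n - m))%R).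
        { apply (Rle_trans _ (M * (/ R0) ^ (n - m))).
          - rewrite pow_inv. apply (Rmult_le_reg_r (R0 ^ (n - m))); auto. rewrite Rmult_assoc, Rinv_l; lra.
          - apply Rmult_le_compat_l; auto. apply pow_incr. split; auto. left; apply Rinv_0_lt_compat; auto. }
        rewrite Rpow_mult_distr in Ha'.
        replace (M * K * L ^ n * (/ 2) ^ (n - m))%R with ((K * L ^ m) * (M * (L ^ (n - m) * (/ 2) ^ (n - m))))%R.
        - apply Rmult_le_compat; auto; apply Cmod_ge_0.
        - replace (L ^ n)%R with (L ^ m * L ^ (n - m))%R by (rewrite <- pow_add; f_equal; lia). ring. }
      lra. }
  specialize (G (S n) (Nat.le_refl _)). rewrite Nat.sub_diag in G. unfold conv. simpl pow in G. lra.
Qed.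

(** A majorant argument: with 4 M <= L each of the two convolutions takes at most half of K L^(n+2)
    (n + 1), and the denominator (n + 1)(n + 2) absorbs the factor. L does not depend on the initial
    values, so one radius serves all solutions. *)
Lemma lode_bound (p q : nat -> C) (a b : C) (R0 M L K : R) : (0 < R0)%R -> (2 / R0 <= L)%R -> (1 <= L)%R -> (4 * M <= L)%R ->
  pbound p R0 M -> pbound q R0 M -> (Cmod a <= K)%R -> (Cmod b <= K)%R ->
  forall n, (Cmod (lode p q a b n) <= K * L ^ n)%R.
Proof.
  intros HR HL HL1 HLM Hp Hq Ha Hb n. assert (HM := pbound_pos _ _ _ Hp).
  assert (HK : (0 <= K)%R) by (assert (X := Cmod_ge_0 a); lra).
  induction n as [n IH] using Wf_nat.lt_wf_ind.
  destruct n as [|[|n]]; [unfold lode; simpl; lra|unfold lode; simpl; nra|].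
  rewrite lode_SS. unfold lode_next.
  assert (HS1 : (1 <= INR (S n))%R) by (rewrite S_INR; assert (X := pos_INR n); lra).
  assert (HS2 : (2 <= INR (S (S n)))%R) by (rewrite S_INR; lra).
  assert (Hn0 : (INR (S n) * INR (S (S n)))%R <> 0%R) by nra.
  assert (HLn : (0 < L ^ n)%R) by (apply pow_lt; lra).
  rewrite <- RtoC_mult, Cmod_div by (apply RtoC_neq0; auto).
  rewrite Cmod_R, Rabs_pos_eq by nra.
  apply (Rmult_le_reg_r (INR (S n) * INR (S (S n)))); [nra|]. unfold Rdiv. rewrite Rmult_assoc, Rinv_l, Rmult_1_r by auto.
  eapply Rle_trans; [apply Cmod_triangle|].
  assert (B1 : (Cmod (conv p (fun k => (INR (S k) * lode p q a b (S k))%C) n) <= 2 * M * (INR (S n) * K * L) * L ^ n)%R).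
  { apply (conv_bound _ _ R0); auto. intros k Hk. rewrite Cmod_mult, Cmod_R, Rabs_pos_eq by apply pos_INR.
    assert (A := IH (S k) ltac:(lia)). simpl pow in A.
    assert (INR (S k) <= INR (S n))%R by (apply le_INR; lia).
    replace (INR (S n) * K * L * L ^ k)%R with (INR (S n) * (K * (L * L ^ k)))%R by ring.
    apply Rmult_le_compat; auto; [apply pos_INR|apply Cmod_ge_0]. }
  assert (B2 : (Cmod (conv q (lode p q a b) n) <= 2 * M * K * L ^ n)%R).
  { apply (conv_bound _ _ R0); auto. intros k Hk. apply IH. lia. }
  simpl pow. set (s := INR (S n)) in *. set (t := INR (S (S n))) in *.
  assert (H1 : (2 * M * (s * K * L) * L ^ n <= / 2 * (K * (L * (L * L ^ n))) * s)%R).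
  { assert (0 <= K * L * L ^ n * s)%R by (repeat apply Rmult_le_pos; lra). nra. }
  assert (H2 : (2 * M * K * L ^ n <= / 2 * (K * (L * (L * L ^ n))) * s)%R).
  { assert (Q : (2 * M * K * L ^ n <= / 2 * L * (K * L ^ n))%R) by (assert (0 <= K * L ^ n)%R by nra; nra).
    assert (Q2 : (1 <= L * s)%R) by nra.
    assert (Q3 : (0 <= / 2 * L * (K * L ^ n))%R) by (assert (0 <= K * L ^ n)%R by nra; nra). nra. }
  assert (H3 : (0 <= K * (L * (L * L ^ n)) * s)%R) by (repeat apply Rmult_le_pos; lra).
  nra.
Qed.

Lemma hol_conv (r : R) (p u : nat -> C -> C) (n : nat) : (forall k, hol r (p k)) -> (forall k, (k <= n)%nat -> hol r (u k)) ->
  hol r (fun y => conv (fun k => p k y) (fun k => u k y) n).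
Proof.
  intros Hp Hu. unfold conv.
  assert (G : forall m, (m <= S n)%nat -> hol r (fun y => csum (fun k => u k y * p (n - k)%nat y) m)).
  { induction m; intros Hm; cbn [csum]; [apply hol_const|]. apply hol_plus; [apply IHm; lia|]. apply hol_mult; [apply Hu; lia|auto]. }
  apply G. lia.
Qed.

Lemma hol_lode (r : R) (p q : nat -> C -> C) (a b : C -> C) (n : nat) : (forall k, hol r (p k)) -> (forall k, hol r (q k)) ->
  hol r a -> hol r b -> hol r (fun y => lode (fun k => p k y) (fun k => q k y) (a y) (b y) n).
Proof.
  intros Hp Hq Ha Hb. induction n as [n IH] using Wf_nat.lt_wf_ind.
  destruct n as [|[|n]]; [exact Ha|exact Hb|].
  apply (hol_ext r (fun y => lode_next (fun k => p k y) (fun k => q k y) (lode (fun k => p k y) (fun k => q k y) (a y) (b y)) n)).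
  { intros y _. rewrite lode_SS. auto. }
  unfold lode_next. apply hol_mult; [|apply hol_const]. apply hol_plus.
  - apply (hol_conv r p (fun k y => INR (S k) * lode (fun k => p k y) (fun k => q k y) (a y) (b y) (S k))); auto.
    intros k Hk. apply hol_mult; [apply hol_const|]. apply IH. lia.
  - apply (hol_conv r q (fun k y => lode (fun k => p k y) (fun k => q k y) (a y) (b y) k)); auto.
    intros k Hk. apply IH. lia.
Qed.

Lemma lode_solves (p q : nat -> C) (a b : C) (R0 R1 M K : R) (x : C) : (0 < R1 <= R0)%R -> pbound p R0 M -> pbound q R0 M ->
  pbound (lode p q a b) R1 K -> (Cmod x < R1)%R ->
  psum (pderiv (pderiv (lode p q a b))) x = psum p x * psum (pderiv (lode p q a b)) x + psum q x * psum (lode p q a b) x.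
Proof.
  intros HR Hp Hq Hc Hx. assert (Hx0 := Cmod_ge_0 x).
  set (R2 := ((2 * R1 + Cmod x) / 3)%R). set (R3 := ((R1 + 2 * Cmod x) / 3)%R).
  assert (Hd := pbound_deriv _ R1 R2 K ltac:(unfold R2; lra) Hc).
  assert (Hd2 := pbound_deriv _ R2 R3 _ ltac:(unfold R2, R3; lra) Hd).
  apply (cser_unique (fun k => pderiv (pderiv (lode p q a b)) k * x ^ k)).
  - eapply psum_cser; [exact Hd2|unfold R3; lra].
  - apply (cser_ext (fun n => conv p (pderiv (lode p q a b)) n * x ^ n + conv q (lode p q a b) n * x ^ n)).
    + intros n. unfold pderiv at 2. unfold pderiv at 2. rewrite lode_SS. unfold lode_next.
      fold (pderiv (lode p q a b)). 
      assert (RtoC (INR (S n)) <> 0) by (apply RtoC_neq0, not_0_INR; lia).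
      assert (RtoC (INR (S (S n))) <> 0) by (apply RtoC_neq0, not_0_INR; lia).
      change (fun k => INR (S k) * lode p q a b (S k)) with (pderiv (lode p q a b)). field. auto.
    + apply cser_plus.
      * eapply (psum_conv _ _ R2); [eapply pbound_mono; [|exact Hp]; unfold R2; lra|exact Hd|unfold R2; lra].
      * eapply (psum_conv _ _ R1); [eapply pbound_mono; [|exact Hq]; lra|exact Hc|lra].
Qed.

(** The order of quantifiers matters: tau is found before the initial data a, b. The equation is
    solved by power series in s whose coefficients are holomorphic in y. *)
Lemma linear_ode_param (p q : C -> C -> C) (R0 rho M : R) : (0 < R0)%R -> (0 < rho)%R -> shol2 p R0 rho M -> shol2 q R0 rho M ->
  exists tau, (0 < tau <= R0)%R /\ forall (a b : C -> C) (K : R), hol rho a -> hol rho b ->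
    (forall y, (Cmod y < rho)%R -> (Cmod (a y) <= K)%R /\ (Cmod (b y) <= K)%R) ->
    exists (F D : C -> C -> C) (K1 : R), shol2 F tau rho K1 /\ shol2 D tau rho K1 /\
      forall y, (Cmod y < rho)%R -> F 0 y = a y /\ D 0 y = b y /\
        forall s, (Cmod s < tau)%R -> cder (fun s => F s y) s (D s y) /\
          cder (fun s => D s y) s (p s y * D s y + q s y * F s y).
Proof.
  intros HR Hrho Hp Hq.
  destruct (shol2_coef p R0 rho M HR Hrho Hp) as [cp [Cp1 [Cp2 Cp3]]].
  destruct (shol2_coef q R0 rho M HR Hrho Hq) as [cq [Cq1 [Cq2 Cq3]]].
  assert (HM : (0 <= 2 * M)%R) by (apply (pbound_pos (fun k => cp k 0) R0), Cp2; rewrite Cmod_0; auto).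
  (* The sum of the three lower bounds required by [lode_bound]; the coefficients of p and q are
     bounded with 2 M, hence 8 M. *)
  set (L := (2 / R0 + 1 + 8 * M)%R).
  assert (H2R : (0 < 2 / R0)%R) by (apply Rdiv_lt_0_compat; lra).
  assert (HL : (0 < L)%R) by (unfold L; lra).
  set (R1 := (/ L)%R). assert (HR1 : (0 < R1)%R) by (apply Rinv_0_lt_compat; auto).
  assert (HR10 : (R1 <= R0)%R).
  { unfold R1. replace R0 with (/ (/ R0))%R by (field; lra). apply Rinv_le_contravar; [apply Rinv_0_lt_compat; auto|]. unfold L, Rdiv in *. lra. }
  exists (R1 / 2)%R. split; [lra|]. intros a b K Ha Hb HK.
  set (c := fun k y => lode (fun k => cp k y) (fun k => cq k y) (a y) (b y) k).
  assert (Hc : forall k, hol rho (c k)) by (intros k; apply hol_lode; auto).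
  assert (Pc : forall y, (Cmod y < rho)%R -> pbound (fun k => c k y) R1 K).
  { intros y Hy k. destruct (HK y Hy) as [K1 K2].
    assert (B := lode_bound (fun k => cp k y) (fun k => cq k y) (a y) (b y) R0 (2 * M) L K HR ltac:(unfold L; lra) ltac:(unfold L; lra) ltac:(unfold L; lra) (Cp2 y Hy) (Cq2 y Hy) K1 K2 k).
    fold (c k y) in B. assert (HLk : (0 < L ^ k)%R) by (apply pow_lt; auto).
    unfold R1. rewrite pow_inv. apply (Rmult_le_compat_r (/ L ^ k)) in B; [|left; apply Rinv_0_lt_compat; auto].
    rewrite (Rmult_assoc K), Rinv_r, Rmult_1_r in B by lra. auto. }
  (* The derived series loses radius; its bound is taken strictly between R1 / 2, the final radius,
     and R1. *)
  set (R2 := (3 / 4 * R1)%R).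
  assert (Pd : forall y, (Cmod y < rho)%R -> pbound (pderiv (fun k => c k y)) R2 (K / R1 * (/ (1 - R2 / R1) * / (1 - R2 / R1)))).
  { intros y Hy. apply pbound_deriv; auto. unfold R2; lra. }
  set (F := fun s y => psum (fun k => c k y) s). set (D := fun s y => psum (pderiv (fun k => c k y)) s).
  set (KF := (K / (1 - R1 / 2 / R1))%R).
  set (KD := (K / R1 * (/ (1 - R2 / R1) * / (1 - R2 / R1)) / (1 - R1 / 2 / R2))%R).
  exists F, D, (Rmax KF KD). split; [|split].
  - apply (shol2_mono F (R1 / 2) rho KF); try lra; [apply Rmax_l|].
    apply (shol2_psum c R1 (R1 / 2) rho K); auto. lra.
  - apply (shol2_mono D (R1 / 2) rho KD); try lra; [apply Rmax_r|].
    apply (shol2_psum (fun k y => pderiv (fun k => c k y) k) R2 (R1 / 2) rho); auto.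
    + unfold R2; lra.
    + intros k. apply hol_mult; auto. apply hol_const.
  - intros y Hy. split; [|split].
    + unfold F. erewrite psum_0; [|exact HR1|apply Pc; auto]. reflexivity.
    + unfold D. erewrite psum_0; [|apply (Rmult_lt_0_compat (3 / 4) R1); lra|apply Pd; auto]. 
      unfold pderiv, c, lode. simpl. ring.
    + intros s Hs. split.
      * eapply cder_psum; [apply Pc; auto|lra].
      * eapply cder_eq; [eapply cder_psum; [apply Pd; auto|unfold R2; lra]|].
        unfold D, F. rewrite (Cp3 s y), (Cq3 s y) by (auto; lra).
        eapply (lode_solves (fun k => cp k y) (fun k => cq k y) (a y) (b y) R0 R1); [lra|apply Cp2; auto|apply Cq2; auto|apply Pc; auto|lra].
Qed.

(** * Frechet differentiability on products *)

Notation C2m := (prod_NormedModule C_AbsRing C_NormedModule C_NormedModule).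

Lemma norm_C2_fst (v : C * C) : (Cmod (fst v) <= norm (v : C2m))%R.
Proof. exact (norm_le_prod_norm_1 (U := C_NormedModule) (V := C_NormedModule) v). Qed.

Lemma norm_C2_snd (v : C * C) : (Cmod (snd v) <= norm (v : C2m))%R.
Proof. exact (norm_le_prod_norm_2 (U := C_NormedModule) (V := C_NormedModule) v). Qed.

Lemma norm_C2_le (v : C * C) : (norm (v : C2m) <= 2 * (Cmod (fst v) + Cmod (snd v)))%R.
Proof.
  destruct v as [a b]. destruct (norm_prod (U := C_NormedModule) (V := C_NormedModule) a b) as [_ H].
  eapply Rle_trans; [exact H|]. simpl.
  assert (A := Cmod_ge_0 a). assert (B := Cmod_ge_0 b).
  assert (S : (sqrt 2 <= 2)%R). { rewrite <- (sqrt_pow2 2) at 2 by lra. apply sqrt_le_1; lra. }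
  change (norm (a : C_NormedModule)) with (Cmod a). change (norm (b : C_NormedModule)) with (Cmod b).
  assert (M : (0 <= Rmax (Cmod a) (Cmod b) <= Cmod a + Cmod b)%R).
  { split; [eapply Rle_trans; [exact A|apply Rmax_l]|apply Rmax_lub; lra]. }
  apply Rmult_le_compat; try lra. apply sqrt_pos.
Qed.

Lemma ball_C2 (p q : C * C) (d : R) : (0 < d)%R -> (Cmod (fst q - fst p) < d)%R -> (Cmod (snd q - snd p) < d)%R ->
  ball (M := C2m) p d q.
Proof.
  intros Hd H1 H2. split; [apply (C_NormedModule_mixin_compat1 (fst p) (fst q) d)|apply (C_NormedModule_mixin_compat1 (snd p) (snd q) d)]; assumption.
Qed.

Lemma locally_C2 (p : C * C) (P : C * C -> Prop) :
  locally (T := C2m) p P <-> exists d, (0 < d)%R /\ forall q, (Cmod (fst q - fst p) < d)%R -> (Cmod (snd q - snd p) < d)%R -> P q.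
Proof.
  split.
  - intros [d H]. exists d. split; [apply cond_pos|]. intros q H1 H2. apply H. apply ball_C2; auto. apply cond_pos.
  - intros [d [Hd H]]. apply (locally_le_locally_norm (V := C2m)). exists (mkposreal d Hd). intros q Hq.
    apply H; eapply Rle_lt_trans; try exact Hq; [apply (norm_C2_fst (minus (G := C2m) q p))|apply (norm_C2_snd (minus (G := C2m) q p))].
Qed.

Lemma cder2_ex_filterdiff (f : C * C -> C) (x y a b : C) : cder2 (fun u v => f (u, v)) x y a b ->
  ex_filterdiff (K := C_AbsRing) (U := C2m) (V := C_NormedModule) f (locally (x, y)).
Proof.
  intros H. exists (fun v : C * C => fst v * a + snd v * b). split.
  - apply Build_is_linear.
    + intros [x1 y1] [x2 y2]. apply C_eq; simpl; ring.
    + intros k [x1 y1]. apply C_eq; simpl; ring.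
    + assert (A := Cmod_ge_0 a). assert (B := Cmod_ge_0 b). exists (Cmod a + Cmod b + 1)%R. split; [lra|]. intros v.
      assert (N1 := norm_C2_fst v). assert (N2 := norm_C2_snd v). assert (C1 := Cmod_ge_0 (fst v)). assert (C3 := Cmod_ge_0 (snd v)).
      change (Cmod (fst v * a + snd v * b) <= (Cmod a + Cmod b + 1) * norm (v : C2m))%R.
      eapply Rle_trans; [apply Cmod_triangle|]. rewrite !Cmod_mult.
      assert (P1 := Rmult_le_compat_r _ _ _ A N1). assert (P2 := Rmult_le_compat_r _ _ _ B N2). simpl in *. lra.
  - intros z Hz eps. apply (is_filter_lim_locally_unique (V := C2m)) in Hz. subst z.
    assert (X0 := cond_pos eps).
    destruct (H (eps / 2)%R ltac:(lra)) as [d [Hd H1]].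
    apply locally_C2. exists d. split; auto. intros q Hq1 Hq2. simpl in Hq1, Hq2.
    specialize (H1 _ _ Hq1 Hq2).
    assert (E : (Cmod (fst q - x) + Cmod (snd q - y) <= 2 * norm (minus (G := C2m) q (x, y)))%R).
    { assert (N1 := norm_C2_fst (minus (G := C2m) q (x, y))). assert (N2 := norm_C2_snd (minus (G := C2m) q (x, y))).
      change (Cmod (fst q - x) <= norm (minus (G := C2m) q (x, y)))%R in N1.
      change (Cmod (snd q - y) <= norm (minus (G := C2m) q (x, y)))%R in N2. lra. }
    change (Cmod (f q - f (x, y) - ((fst q - x) * a + (snd q - y) * b)) <= eps * norm (minus (G := C2m) q (x, y)))%R.
    assert (Q : f q = f (fst q, snd q)) by (destruct q; reflexivity). rewrite Q.
    replace (f (fst q, snd q) - f (x, y) - ((fst q - x) * a + (snd q - y) * b)) with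
      (f (fst q, snd q) - f (x, y) - a * (fst q - x) - b * (snd q - y)) by ring.
    eapply Rle_trans; [exact H1|].
    assert (X := cond_pos eps). apply (Rmult_le_compat_l (eps / 2)) in E; [|lra]. lra.
Qed.

(** The partial derivatives are the values of the linear map on the two basis vectors. The factor 2
    of [norm_C2_le] is why eps / 2 is used. *)
Lemma ex_filterdiff_cder2 (f : C * C -> C) (x y : C) :
  ex_filterdiff (K := C_AbsRing) (U := C2m) (V := C_NormedModule) f (locally (x, y)) ->
  exists a b, cder2 (fun u v => f (u, v)) x y a b.
Proof.
  intros [l [Hl H]].
  set (a := l (RtoC 1, RtoC 0) : C). set (b := l (RtoC 0, RtoC 1) : C). exists a, b.
  assert (L : forall u v : C, l (u, v) = u * a + v * b).
  { intros u v. unfold a, b.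
    change (l (u, v) = plus (scal u (l (RtoC 1, RtoC 0))) (scal v (l (RtoC 0, RtoC 1)))).
    rewrite <- !(linear_scal l Hl), <- (linear_plus l Hl). f_equal.
    change ((u, v) = (u * 1 + v * 0, u * 0 + v * 1)). f_equal; ring. }
  intros eps He.
  assert (He4 : (0 < eps / 2)%R) by lra.
  specialize (H (x, y) (fun P HP => HP) (mkposreal _ He4)).
  apply locally_C2 in H. destruct H as [d [Hd H]]. exists d. split; auto. intros x' y' Hx Hy.
  specialize (H (x', y') Hx Hy).
  change (Cmod (f (x', y') - f (x, y) - l (x' - x, y' - y)%C) <= eps / 2 * norm ((x' - x, y' - y)%C : C2m))%R in H.
  rewrite L in H.
  replace (f (x', y') - f (x, y) - a * (x' - x) - b * (y' - y)) with
      (f (x', y') - f (x, y) - ((x' - x) * a + (y' - y) * b)) by ring.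
  eapply Rle_trans; [exact H|]. assert (N := norm_C2_le (x' - x, y' - y)). simpl fst in N; simpl snd in N.
  apply (Rmult_le_compat_l (eps / 2)) in N; lra.
Qed.

Lemma cder2_ccont2 (f : C -> C -> C) (x y a b : C) : cder2 f x y a b ->
  forall eps, (0 < eps)%R -> exists d, (0 < d)%R /\ forall x' y', (Cmod (x' - x) < d)%R -> (Cmod (y' - y) < d)%R -> (Cmod (f x' y' - f x y) < eps)%R.
Proof.
  intros H eps He. destruct (H 1%R ltac:(lra)) as [d [Hd H1]].
  set (A := (Cmod a + Cmod b + 2)%R). assert (Ha := Cmod_ge_0 a). assert (Hb := Cmod_ge_0 b).
  exists (Rmin d (eps / (2 * A))). split; [apply Rmin_pos; auto; apply Rdiv_lt_0_compat; unfold A; lra|].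
  intros x' y' Hx Hy. assert (Hx1 := Rlt_le_trans _ _ _ Hx (Rmin_l _ _)). assert (Hx2 := Rlt_le_trans _ _ _ Hx (Rmin_r _ _)).
  assert (Hy1 := Rlt_le_trans _ _ _ Hy (Rmin_l _ _)). assert (Hy2 := Rlt_le_trans _ _ _ Hy (Rmin_r _ _)).
  specialize (H1 _ _ Hx1 Hy1).
  replace (f x' y' - f x y) with ((f x' y' - f x y - a * (x' - x) - b * (y' - y)) + (a * (x' - x) + b * (y' - y))) by ring.
  eapply Rle_lt_trans; [apply Cmod_triangle|].
  assert (T := Cmod_triangle (a * (x' - x)) (b * (y' - y))). rewrite !Cmod_mult in T.
  assert (Ux := Cmod_ge_0 (x' - x)). assert (Uy := Cmod_ge_0 (y' - y)).
  apply (Rmult_lt_compat_l (2 * A)) in Hx2; [|unfold A; lra]. apply (Rmult_lt_compat_l (2 * A)) in Hy2; [|unfold A; lra].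
  replace (2 * A * (eps / (2 * A)))%R with eps in * by (field; unfold A; lra).
  unfold A in *. nra.
Qed.

Lemma cder2_fst_mult (h : C -> C) (z w c : C) : cder h w c -> cder2 (fun z w => z * h w) z w (h w) (z * c).
Proof.
  intros H eps He. assert (Hz := Cmod_ge_0 z). assert (Hc := Cmod_ge_0 c).
  destruct (H (eps / 2 / (Cmod z + 1))%R) as [d [Hd H1]]; [apply Rdiv_lt_0_compat; lra|].
  exists (Rmin (Rmin d 1) (eps / 2 / (Cmod c + 1))). split.
  { apply Rmin_pos; [apply Rmin_pos; lra|apply Rdiv_lt_0_compat; lra]. }
  intros z' w' Hz' Hw'. assert (A1 := Rlt_le_trans _ _ _ Hz' (Rmin_l _ _)). assert (A2 := Rlt_le_trans _ _ _ Hw' (Rmin_l _ _)).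
  assert (A3 := Rlt_le_trans _ _ _ A1 (Rmin_r _ _)). assert (A4 := Rlt_le_trans _ _ _ A2 (Rmin_l _ _)).
  assert (A5 := Rlt_le_trans _ _ _ Hz' (Rmin_r _ _)). specialize (H1 w' A4).
  replace (z' * h w' - z * h w - h w * (z' - z) - z * c * (w' - w)) with (z' * (h w' - h w - c * (w' - w)) + (z' - z) * c * (w' - w)) by ring.
  eapply Rle_trans; [apply Cmod_triangle|]. rewrite !Cmod_mult.
  assert (Hzm : (Cmod z' <= Cmod z + 1)%R). { assert (A := Cmod_triangle (z' - z) z). replace (z' - z + z) with z' in A by ring. lra. }
  assert (Dw := Cmod_ge_0 (w' - w)). assert (Dz := Cmod_ge_0 (z' - z)).
  assert (B1 : (Cmod z' * Cmod (h w' - h w - c * (w' - w)) <= (Cmod z + 1) * (eps / 2 / (Cmod z + 1) * Cmod (w' - w)))%R).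
  { apply Rmult_le_compat; auto; apply Cmod_ge_0. }
  replace ((Cmod z + 1) * (eps / 2 / (Cmod z + 1) * Cmod (w' - w)))%R with (eps / 2 * Cmod (w' - w))%R in B1 by (field; lra).
  assert (B2 : (Cmod (z' - z) * Cmod c * Cmod (w' - w) <= eps / 2 * Cmod (w' - w))%R).
  { apply Rmult_le_compat_r; auto. apply (Rle_trans _ (eps / 2 / (Cmod c + 1) * (Cmod c + 1))); [apply Rmult_le_compat; lra|right; field; lra]. }
  assert (0 <= eps * Cmod (z' - z))%R by (apply Rmult_le_pos; lra). lra.
Qed.

Definition pcont (F : C * C -> C) (p : C * C) : Prop :=
  forall eps, (0 < eps)%R -> exists d, (0 < d)%R /\ forall q, (Cmod (fst q - fst p) < d)%R -> (Cmod (snd q - snd p) < d)%R -> (Cmod (F q - F p) < eps)%R.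

Lemma pcont_const (c : C) (p : C * C) : pcont (fun _ => c) p.
Proof. intros eps He. exists 1%R. split; [lra|]. intros. replace (c - c) with (RtoC 0) by ring. rewrite Cmod_0; auto. Qed.

Lemma pcont_fst (p : C * C) : pcont fst p.
Proof. intros eps He. exists eps. auto. Qed.

Lemma pcont_comp (h : C -> C) (F : C * C -> C) (p : C * C) : ccont h (F p) -> pcont F p -> pcont (fun q => h (F q)) p.
Proof.
  intros Hh HF eps He. destruct (Hh eps He) as [d [Hd H1]]. destruct (HF d Hd) as [d' [Hd' H2]]. exists d'. auto.
Qed.

Lemma pcont_snd (h : C -> C) (p : C * C) : ccont h (snd p) -> pcont (fun q => h (snd q)) p.
Proof. intros H. apply (pcont_comp h snd); auto. intros eps He. exists eps. auto. Qed.

Lemma pcont_conj (F : C * C -> C) (p : C * C) : pcont F p -> pcont (fun q => Cconj (F q)) p.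
Proof. intros H eps He. destruct (H eps He) as [d [Hd H1]]. exists d. split; auto. intros. rewrite <- Cminus_conj, Cmod_conj. auto. Qed.

Lemma pcont_comp2 (f : C -> C -> C) (F G : C * C -> C) (p : C * C) (a b : C) : cder2 f (F p) (G p) a b ->
  pcont F p -> pcont G p -> pcont (fun q => f (F q) (G q)) p.
Proof.
  intros Hf HF HG eps He. destruct (cder2_ccont2 f _ _ _ _ Hf eps He) as [d [Hd H]].
  destruct (HF d Hd) as [d1 [Hd1 H1]]. destruct (HG d Hd) as [d2 [Hd2 H2]]. exists (Rmin d1 d2). split; [apply Rmin_pos; auto|].
  assert (X := Rmin_l d1 d2). assert (Y := Rmin_r d1 d2). intros q Q1 Q2. apply H; [apply H1|apply H2]; lra.
Qed.

Lemma pcont_plus (F G : C * C -> C) (p : C * C) : pcont F p -> pcont G p -> pcont (fun q => F q + G q) p.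
Proof.
  apply (pcont_comp2 (fun x y => x + y) F G p 1 1). intros eps He. exists 1%R. split; [lra|]. intros x y _ _.
  match goal with |- (Cmod ?t <= _)%R => replace t with (RtoC 0) by ring end. rewrite Cmod_0.
  assert (X := Cmod_ge_0 (x - F p)). assert (Y := Cmod_ge_0 (y - G p)). apply Rmult_le_pos; lra.
Qed.

Lemma pcont_mult (F G : C * C -> C) (p : C * C) : pcont F p -> pcont G p -> pcont (fun q => F q * G q) p.
Proof. eapply (pcont_comp2 (fun x y => x * y)). apply (cder2_fst_mult (fun w => w)), cder_id. Qed.

Lemma ex_filterdiff_pair (f g : C * C -> C) (p : C * C) :
  ex_filterdiff (K := C_AbsRing) (U := C2m) (V := C_NormedModule) f (locally p) ->
  ex_filterdiff (K := C_AbsRing) (U := C2m) (V := C_NormedModule) g (locally p) ->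
  ex_filterdiff (K := C_AbsRing) (U := C2m) (V := C2m) (fun q => (f q, g q)) (locally p).
Proof.
  intros Hf Hg.
  apply (ex_filterdiff_comp'_2 (T := C2m) (U := C_NormedModule) (V := C_NormedModule) (W := C2m) f g (fun u v => (u, v)) p Hf Hg).
  apply (ex_filterdiff_ext (U := C2m) (V := C2m) (fun t => t)); [intros [? ?]; reflexivity|]. apply ex_filterdiff_id.
Qed.

Lemma hol_bounded_sub (f : C -> C) (r rho : R) : (0 < rho < r)%R -> hol r f ->
  exists M, forall w, (Cmod w < rho)%R -> (Cmod (f w) <= M)%R.
Proof.
  intros Hr Hf. destruct (taylor_disc f r ltac:(lra) Hf) as [c Hc].
  set (s := ((rho + r) / 2)%R). destruct (Hc s ltac:(unfold s; lra)) as [[M HM] H].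
  exists (M / (1 - rho / s))%R. intros w Hw. assert (Hw0 := Cmod_ge_0 w). rewrite H by (unfold s; lra).
  eapply Rle_trans; [apply (psum_le c s M); auto; unfold s; lra|].
  assert (HM0 := pbound_pos _ _ _ HM). assert (Hq := ratio_lt1 s rho ltac:(unfold s; lra)).
  apply Rmult_le_compat_l; auto. apply Rinv_le_contravar; [lra|].
  assert (Cmod w / s <= rho / s)%R; [|lra]. apply Rmult_le_compat_r; [left; apply Rinv_0_lt_compat; unfold s; lra|lra].
Qed.

Lemma pow_le_1 (x : R) (n : nat) : (0 <= x <= 1)%R -> (x ^ n <= 1)%R.
Proof. intros H. rewrite <- (pow1 n). apply pow_incr; auto. Qed.

(** * The equation near a point off the singular locus *)

(* In the coordinate [w = y + i y^m s] the equation is nonsingular, uniformly as [y -> 0]; [scl m y s] is [w / y]. *)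
Definition scl (m : nat) (y s : C) : C := 1 + Ci * y ^ (m - 1) * s.

Lemma scl_bounds (m : nat) (y s : C) : (Cmod y <= 1)%R -> (Cmod s <= / 2)%R ->
  (/ 2 <= Cmod (scl m y s) <= 3 / 2)%R.
Proof.
  intros Hy Hs. unfold scl.
  assert (B : (Cmod (Ci * y ^ (m - 1) * s) <= / 2)%R).
  { rewrite !Cmod_mult, Cmod_Ci, Cmod_pow, Rmult_1_l. assert (H0 := Cmod_ge_0 y). assert (H1 := Cmod_ge_0 s).
    assert (H := pow_le_1 (Cmod y) (m - 1) ltac:(lra)). assert (0 <= Cmod y ^ (m - 1))%R by (apply pow_le; auto). nra. }
  assert (T1 := Cmod_triangle 1 (Ci * y ^ (m - 1) * s)). rewrite Cmod_1 in T1.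
  assert (T2 := Cmod_ge_sub 1 (- (Ci * y ^ (m - 1) * s))). rewrite Cmod_1, Cmod_opp in T2.
  replace (1 - - (Ci * y ^ (m - 1) * s)) with (1 + Ci * y ^ (m - 1) * s) in T2 by ring. lra.
Qed.

Lemma scl_neq0 (m : nat) (y s : C) : (Cmod y <= 1)%R -> (Cmod s <= / 2)%R -> scl m y s <> 0.
Proof. intros Hy Hs. apply Cmod_gt_0. assert (A := scl_bounds m y s Hy Hs). lra. Qed.

Lemma Cpow_pred (w : C) (m : nat) : (1 <= m)%nat -> w ^ m = w * w ^ (m - 1).
Proof. intros H. rewrite <- Cpow_S. f_equal. lia. Qed.

Lemma Cpow_double (w : C) (m : nat) : w ^ (2 * m) = w ^ m * w ^ m.
Proof. rewrite <- Cpow_add_r. f_equal. lia. Qed.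

(** Since dw = i y^m ds and w = y [scl], the equation becomes F_ss = i P [scl]^(-m) F_s - Q
    [scl]^(-2 m) F: the powers of y cancel. It is applied with (n, k) = (m, i) for P and (2 m, -1)
    for Q. *)
Lemma scaled_coef_shol2 (m n : nat) (r rho : R) (f : C -> C) (k : C) : (0 < rho <= / 2)%R -> (2 * rho <= r)%R -> hol r f ->
  exists M, shol2 (fun s y => k * (f (y * scl m y s) * / scl m y s ^ n)) (/ 2) rho M.
Proof.
  intros Hrho Hr Hf. destruct (hol_bounded_sub f r (7 / 8 * r) ltac:(lra) Hf) as [M HM].
  assert (B : forall s y, (Cmod s < / 2)%R -> (Cmod y < rho)%R -> (Cmod (y * scl m y s) < 7 / 8 * r)%R).
  { intros s y Hs Hy. rewrite Cmod_mult. assert (A := scl_bounds m y s ltac:(lra) ltac:(lra)).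
    assert (Y := Cmod_ge_0 y). nra. }
  exists (Cmod k * (M * 2 ^ n))%R. split; [|split].
  - intros y Hy. apply hol_mult; [apply hol_const|]. apply hol_mult.
    + apply (hol_comp (/ 2) r f (fun s => y * scl m y s)); auto.
      * apply hol_mult; [apply hol_const|]. apply hol_plus; [apply hol_const|]. apply hol_mult; [apply hol_const|apply hol_id].
      * intros s Hs. specialize (B s y Hs Hy). lra.
    + apply hol_inv.
      * apply (hol_pow (/ 2) (fun s => scl m y s)). apply hol_plus; [apply hol_const|]. apply hol_mult; [apply hol_const|apply hol_id].
      * intros s Hs. apply Cpow_nz, scl_neq0; lra.
  - intros s Hs. assert (Hsc : hol rho (fun y => scl m y s)).
    { apply hol_plus; [apply hol_const|]. apply hol_mult; [|apply hol_const]. apply hol_mult; [apply hol_const|].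
      apply (hol_pow rho (fun y => y)), hol_id. }
    apply hol_mult; [apply hol_const|]. apply hol_mult.
    + apply (hol_comp rho r f (fun y => y * scl m y s)); auto.
      * apply hol_mult; [apply hol_id|auto].
      * intros y Hy. specialize (B s y Hs Hy). lra.
    + apply hol_inv; [apply (hol_pow rho (fun y => scl m y s)); auto|].
      intros y Hy. apply Cpow_nz, scl_neq0; lra.
  - intros s y Hs Hy. rewrite !Cmod_mult. apply Rmult_le_compat_l; [apply Cmod_ge_0|].
    apply Rmult_le_compat; try apply Cmod_ge_0; [apply HM; auto|].
    assert (A := scl_bounds m y s ltac:(lra) ltac:(lra)).
    rewrite Cmod_inv by (apply Cpow_nz, scl_neq0; lra). rewrite Cmod_pow, <- pow_inv. apply pow_incr.
    split; [left; apply Rinv_0_lt_compat; lra|]. rewrite <- (Rinv_inv 2). apply Rinv_le_contravar; lra.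
Qed.

(** The second order equation as a first order system at a single point, so that the points along a
    segment or a curve can be supplied one by one. *)
Definition lin_sol (m : nat) (P Q l l1 : C -> C) (w : C) : Prop :=
  cder l w (l1 w) /\ cder l1 w (P w / w ^ m * l1 w + Q w / w ^ (2 * m) * l w).

Lemma scaled_solutions (m : nat) (r : R) (P Q : C -> C) : (1 <= m)%nat -> (0 < r)%R -> hol r P -> hol r Q ->
  exists tau rho, (0 < tau <= / 2)%R /\ (0 < rho <= / 2)%R /\ (2 * rho <= r)%R /\
    forall (a b : C -> C) (K : R), hol rho a -> hol rho b ->
      (forall y, (Cmod y < rho)%R -> (Cmod (a y) <= K)%R /\ (Cmod (b y) <= K)%R) ->
      exists (F D : C -> C -> C) (K1 : R), shol2 F tau rho K1 /\ shol2 D tau rho K1 /\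
      forall y, (Cmod y < rho)%R -> F 0 y = a y /\ D 0 y = b y /\
        (forall s, (Cmod s < tau)%R -> cder (fun s => F s y) s (D s y)) /\
        (y <> 0 -> forall w, (Cmod (w - y) < tau * Cmod y ^ m)%R ->
          lin_sol m P Q (fun w => F ((w - y) / (Ci * y ^ m)) y) (fun w => D ((w - y) / (Ci * y ^ m)) y / (Ci * y ^ m)) w).
Proof.
  intros Hm Hr HP HQ. set (rho := Rmin (/ 2) (r / 2)).
  assert (R1 := Rmin_l (/ 2) (r / 2)). assert (R2 := Rmin_r (/ 2) (r / 2)). fold rho in R1, R2.
  assert (Hrho : (0 < rho)%R) by (apply Rmin_pos; lra).
  destruct (scaled_coef_shol2 m m r rho P Ci ltac:(lra) ltac:(lra) HP) as [M1 S1].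
  destruct (scaled_coef_shol2 m (2 * m) r rho Q (- (1)) ltac:(lra) ltac:(lra) HQ) as [M2 S2].
  apply (shol2_mono _ _ _ _ (/ 2) rho (Rmax M1 M2)) in S1; [|lra|lra|apply Rmax_l].
  apply (shol2_mono _ _ _ _ (/ 2) rho (Rmax M1 M2)) in S2; [|lra|lra|apply Rmax_r].
  destruct (linear_ode_param _ _ (/ 2) rho (Rmax M1 M2) ltac:(lra) Hrho S1 S2) as [tau [Htau Hsol]].
  exists tau, rho. split; [lra|]. split; [lra|]. split; [lra|].
  intros a b K Ha Hb HK. destruct (Hsol a b K Ha Hb HK) as [F [D [K1 [HF [HD H]]]]].
  exists F, D, K1. split; auto. split; auto. intros y Hy. destruct (H y Hy) as [H1 [H2 H3]].
  split; auto. split; auto. split; [intros s Hs; apply (H3 s Hs)|].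
  intros Hy0 w Hw. set (k := Ci * y ^ m).
  assert (Hk : k <> 0). { apply Cmult_neq_0; [apply Cmod_gt_0; rewrite Cmod_Ci; lra|apply Cpow_nz; auto]. }
  assert (Hyp : (0 < Cmod y ^ m)%R) by (apply pow_lt, Cmod_gt_0; auto).
  assert (Hkm : Cmod k = (Cmod y ^ m)%R) by (unfold k; rewrite Cmod_mult, Cmod_Ci, Cmod_pow; ring).
  set (s := (w - y) / k).
  assert (Hs : (Cmod s < tau)%R).
  { unfold s. rewrite Cmod_div, Hkm by auto. apply (Rmult_lt_reg_r (Cmod y ^ m)); auto. unfold Rdiv. rewrite Rmult_assoc, Rinv_l; lra. }
  destruct (H3 s Hs) as [D1 D2].
  assert (Ds : cder (fun w => (w - y) / k) w (/ k)).
  { eapply cder_eq; [apply cder_div; [apply cder_minus; [apply cder_id|apply cder_const]|apply cder_const|auto]|]. cbv beta. field; auto. }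
  assert (Hws : w = y * scl m y s).
  { unfold scl, s, k. rewrite (Cpow_pred y m Hm). field. split; [apply Cpow_nz; auto|]. split; auto. apply Cmod_gt_0; rewrite Cmod_Ci; lra. }
  assert (Hsc : scl m y s <> 0) by (apply scl_neq0; lra).
  split.
  - eapply cder_eq; [apply (cder_comp (fun s => F s y) (fun w => (w - y) / k)); [exact D1|exact Ds]|]. cbv beta; fold s; field; auto.
  - eapply cder_eq.
    + apply (cder_div (fun w => D ((w - y) / k) y) (fun _ => k)); [|apply cder_const|auto].
      apply (cder_comp (fun s => D s y) (fun w => (w - y) / k)); [exact D2|exact Ds].
    + cbv beta. fold s. rewrite <- Hws. rewrite !Cpow_double.
      replace (w ^ m) with (y ^ m * scl m y s ^ m) by (rewrite <- Cpow_mult_l, <- Hws; auto).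
      assert (Hsm : scl m y s ^ m <> 0) by (apply Cpow_nz; auto).
      assert (Hym : y ^ m <> 0) by (apply Cpow_nz; auto).
      assert (HCi : Ci <> 0) by (apply Cmod_gt_0; rewrite Cmod_Ci; lra).
      assert (E2 : k * k = - (y ^ m * y ^ m)). { unfold k. replace (Ci * y ^ m * (Ci * y ^ m)) with (Ci * Ci * (y ^ m * y ^ m)) by ring. replace (Ci * Ci) with (- (1)) by (apply C_eq; simpl; ring). ring. }
      assert (E3 : Ci = k / y ^ m) by (unfold k; field; auto).
      transitivity ((Ci * (P w * / scl m y s ^ m) * D s y + - (1) * (Q w * / (scl m y s ^ m * scl m y s ^ m)) * F s y) / (k * k)); [field; auto|].
      replace (D s y / k) with (D s y * (- k / (y ^ m * y ^ m))).
      2:{ replace (- k / (y ^ m * y ^ m)) with (k / (k * k)) by (rewrite E2; field; auto). field; auto. }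
      rewrite E2. unfold k. field. auto.
Qed.

(* For an equation with real structure, [E(f, g)] is a sesquilinear form on the solution space. *)
Definition real_form (m : nat) (r : R) (P Q A A' B : C -> C) : Prop :=
  forall w, (Cmod w < r)%R -> cder A w (A' w) /\ Cconj (A (Cconj w)) = A w /\ Cconj (A' (Cconj w)) = A' w /\
    Cconj (B (Cconj w)) = B w /\ P w = 2 * Ci * A w - INR m * w ^ (m - 1) /\ Q w = B w + Ci * w ^ m * A' w.

Definition ctilde (g : C -> C) (w : C) : C := Cconj (g (Cconj w)).

Definition Eform (m : nat) (A f f1 g g1 : C -> C) (w : C) : C :=
  w ^ m * (f w * ctilde g1 w - f1 w * ctilde g w) + 2 * Ci * A w * f w * ctilde g w.

Lemma Cconj_Ci : Cconj Ci = - Ci.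
Proof. apply C_eq; simpl; ring. Qed.

Lemma Cconj_neq0 (w : C) : w <> 0 -> Cconj w <> 0.
Proof. intros H. apply Cmod_gt_0. rewrite Cmod_conj. apply Cmod_gt_0; auto. Qed.

(** The reflected solution obeys the equation with -2 i A - m w^(m-1) and B - i w^m A'. In the
    derivative of w^m (f g~' - f' g~) the terms in m w^(m-1) and in B cancel, and what remains is -2
    i A (f g~)' - 2 i A' f g~, minus the derivative of the added term. *)
Lemma E_cder (m : nat) (r : R) (P Q A A' B f f1 g g1 : C -> C) (w : C) : (1 <= m)%nat -> real_form m r P Q A A' B ->
  (Cmod w < r)%R -> w <> 0 -> lin_sol m P Q f f1 w -> lin_sol m P Q g g1 (Cconj w) -> cder (Eform m A f f1 g g1) w 0.
Proof.
  intros Hm HR Hw Hw0 [F1 F2] [G1 G2].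
  destruct (HR w Hw) as [DA [CA [CA' [CB [EP EQ]]]]].
  destruct (HR (Cconj w) ltac:(rewrite Cmod_conj; auto)) as [_ [CA2 [CA2' [CB2 [EP2 EQ2]]]]].
  rewrite Cconj_conj in CA2, CA2', CB2.
  assert (Hcw := Cconj_neq0 w Hw0).
  assert (T1 := cder_conj g w _ G1). assert (T2 := cder_conj g1 w _ G2).
  fold (ctilde g) in T1. fold (ctilde g1) in T2.
  assert (T1' : cder (ctilde g) w (ctilde g1 w)) by exact T1.
  assert (T2' : cder (ctilde g1) w ((- (2 * Ci * A w) - INR m * w ^ (m - 1)) / w ^ m * ctilde g1 w + (B w - Ci * w ^ m * A' w) / w ^ (2 * m) * ctilde g w)).
  { eapply cder_eq; [exact T2|]. rewrite EP2, EQ2. rewrite Cplus_conj, !Cmult_conj.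
    rewrite !Cdiv_conj by (apply Cpow_nz; auto). rewrite !Cpow_conj, Cconj_conj, Cminus_conj, Cplus_conj, !Cmult_conj, !Cpow_conj, Cconj_conj, Cconj_Ci.
    rewrite CA, CA', CB. rewrite !Cconj_RtoC. unfold ctilde. f_equal. f_equal. f_equal. ring. f_equal. f_equal. ring. }
  assert (Hwm : w ^ (m - 1) <> 0) by (apply Cpow_nz; auto).
  eapply cder_eq.
  - apply cder_plus.
    + apply cder_mult; [apply cder_Cpow|]. apply cder_minus; (apply cder_mult; [|]); eassumption.
    + apply cder_mult; [|exact T1']. apply cder_mult; [|exact F1]. apply cder_scal. exact DA.
  - cbv beta. rewrite EP, EQ, !Cpow_double, !(Cpow_pred w m Hm). field. auto.
Qed.

Lemma E_const (m : nat) (r : R) (P Q A A' B f f1 g g1 : C -> C) (a b : C) : (1 <= m)%nat -> real_form m r P Q A A' B ->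
  (forall t : R, (0 <= t <= 1)%R -> let w := a + (b - a) * t in (Cmod w < r)%R /\ w <> 0 /\ lin_sol m P Q f f1 w /\ lin_sol m P Q g g1 (Cconj w)) ->
  Eform m A f f1 g g1 a = Eform m A f f1 g g1 b.
Proof.
  intros Hm HR H. apply cder_zero_segment. intros t Ht. destruct (H t Ht) as [H1 [H2 [H3 H4]]].
  eapply E_cder; eauto.
Qed.

(* Variation of constants: the coefficients of [z] and [1 / W'] in the basis [(l, k)] are constant along the curve. *)
Lemma variation_of_constants (m : nat) (P Q l l1 k k1 W W' W'' : C -> C) (z0 : C) :
  (forall t : R, (0 <= t <= 1)%R -> let z := z0 * t in
     cder W z (W' z) /\ cder W' z (W'' z) /\ W' z <> 0 /\ W z <> 0 /\
     W'' z = - (P (W z) / W z ^ m) * W' z ^ 2 - Q (W z) / W z ^ (2 * m) * W' z ^ 3 * z /\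
     lin_sol m P Q l l1 (W z) /\ lin_sol m P Q k k1 (W z) /\ l (W z) * k1 (W z) - l1 (W z) * k (W z) <> 0) ->
  let y := W 0 in let Wr := l y * k1 y - l1 y * k y in
  z0 * (W' 0 * Wr) = l y * k (W z0) - k y * l (W z0) /\
  W' 0 * Wr = W' z0 * (l y * k1 (W z0) - k y * l1 (W z0)).
Proof.
  intros H y Wr.
  set (wr := fun w => l w * k1 w - l1 w * k w).
  (* Cramer's rule for z = al l(W) + be k(W) and 1 / W' = al l1(W) + be k1(W): the inverse function
     of W behaves as a solution of the linear equation. *)
  set (al := fun z => (z * k1 (W z) - k (W z) / W' z) / wr (W z)).
  set (be := fun z => (l (W z) / W' z - z * l1 (W z)) / wr (W z)).
  assert (G : al 0 = al z0 /\ be 0 = be z0).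
  { assert (Q1 : forall f : C -> C, (forall t : R, (0 <= t <= 1)%R -> cder f (z0 * t) 0) -> f 0 = f z0).
    { intros f Hf. apply cder_zero_segment. intros t Ht. replace (0 + (z0 - 0) * t) with (z0 * t) by ring. auto. }
    split; apply Q1; intros t Ht; destruct (H t Ht) as [H1 [H2 [H3 [H4 [H5 [[L1 L2] [[K1 K2] H6]]]]]]]; set (z := z0 * RtoC t) in *;
    fold (wr (W z)) in H6.
    - assert (Dwr : cder wr (W z) (P (W z) / W z ^ m * wr (W z))).
      { eapply cder_eq; [apply cder_minus; (apply cder_mult; [|]); eassumption|]. unfold wr. cbv beta. field. split; apply Cpow_nz; auto. }
      eapply cder_eq.
      + apply cder_div; [apply cder_minus|apply (cder_comp wr W); eassumption|exact H6].
        * apply cder_mult; [apply cder_id|apply (cder_comp k1 W); eassumption].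
        * apply cder_div; [apply (cder_comp k W); eassumption|exact H2|exact H3].
      + cbv beta. rewrite H5, !Cpow_double. assert (W z ^ m <> 0) by (apply Cpow_nz; auto). field. auto.
    - assert (Dwr : cder wr (W z) (P (W z) / W z ^ m * wr (W z))).
      { eapply cder_eq; [apply cder_minus; (apply cder_mult; [|]); eassumption|]. unfold wr. cbv beta. field. split; apply Cpow_nz; auto. }
      eapply cder_eq.
      + apply cder_div; [apply cder_minus|apply (cder_comp wr W); eassumption|exact H6].
        * apply cder_div; [apply (cder_comp l W); eassumption|exact H2|exact H3].
        * apply cder_mult; [apply cder_id|apply (cder_comp l1 W); eassumption].
      + cbv beta. rewrite H5, !Cpow_double. assert (W z ^ m <> 0) by (apply Cpow_nz; auto). field. auto. }
  destruct G as [Ga Gb].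
  destruct (H 0%R ltac:(lra)) as [_ [_ [N0 [_ [_ [_ [_ N1]]]]]]]. destruct (H 1%R ltac:(lra)) as [_ [_ [N2 [_ [_ [_ [_ N3]]]]]]].
  cbv zeta in N0, N1, N2, N3. rewrite Cmult_0_r in N0, N1. rewrite Cmult_1_r in N2, N3.
  fold y in N1. fold Wr in N1.
  assert (E1 : z0 = al z0 * l (W z0) + be z0 * k (W z0)). { unfold al, be, wr. field. auto. }
  assert (E2 : / W' z0 = al z0 * l1 (W z0) + be z0 * k1 (W z0)). { unfold al, be, wr. field. auto. }
  rewrite <- Ga, <- Gb in E1, E2. unfold al, be, wr in E1, E2. fold y in E1, E2. fold Wr in E1, E2.
  split.
  - rewrite E1 at 1. field. auto.
  - replace (W' 0 * Wr) with (W' z0 * (/ W' z0) * (W' 0 * Wr)) by (field; auto). rewrite E2. field. auto.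
Qed.

(** * Local inverses *)

(** The remainder f(w0 + h) - f(w0) - c h is holomorphic and at most (eps / 8) d2 on a disc of
    radius d2; the constant 8 of [hol_lip] turns this size into the Lipschitz bound eps. *)
Lemma strict_diff (f : C -> C) (w0 c : C) (d eps : R) : (0 < d)%R -> (forall w, (Cmod (w - w0) < d)%R -> exists l, cder f w l) ->
  cder f w0 c -> (0 < eps)%R -> exists del, (0 < del <= d)%R /\
    forall w w', (Cmod (w - w0) < del)%R -> (Cmod (w' - w0) < del)%R -> (Cmod (f w - f w' - c * (w - w')) <= eps * Cmod (w - w'))%R.
Proof.
  intros Hd Hf Hc He. destruct (Hc (eps / 8)%R ltac:(lra)) as [d1 [Hd1 H1]].
  set (d2 := Rmin d d1). assert (L1 := Rmin_l d d1). assert (L2 := Rmin_r d d1). fold d2 in L1, L2.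
  assert (Hd2 : (0 < d2)%R) by (apply Rmin_pos; auto).
  exists (d2 / 2)%R. split; [lra|]. intros w w' Hw Hw'.
  set (g := fun h => f (w0 + h) - f w0 - c * h).
  assert (Hg : hol d2 g).
  { intros h Hh. destruct (Hf (w0 + h)) as [l Hl]; [replace (w0 + h - w0) with h by ring; lra|].
    eexists. apply cder_minus; [|apply cder_scal, cder_id]. apply cder_minus; [|apply cder_const].
    apply (cder_comp f (fun h => w0 + h)); [exact Hl|]. apply cder_plus; [apply cder_const|apply cder_id]. }
  assert (Hb : forall h, (Cmod h < d2)%R -> (Cmod (g h) <= eps / 8 * d2)%R).
  { intros h Hh. unfold g. assert (A := H1 (w0 + h)). replace (w0 + h - w0) with h in A by ring.
    eapply Rle_trans; [apply A; lra|]. apply Rmult_le_compat_l; lra. }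
  assert (L := hol_lip g d2 _ (w' - w0) (w - w0) Hd2 Hg Hb ltac:(lra) ltac:(lra)).
  unfold g in L. replace (w0 + (w - w0)) with w in L by ring. replace (w0 + (w' - w0)) with w' in L by ring.
  replace (f w - f w0 - c * (w - w0) - (f w' - f w0 - c * (w' - w0))) with (f w - f w' - c * (w - w')) in L by ring.
  replace (w - w0 - (w' - w0)) with (w - w') in L by ring. eapply Rle_trans; [exact L|]. right. field. lra.
Qed.

(** On a small disc f differs from its linear part by a Lipschitz error |c| / 2, hence it is
    injective with a Lipschitz inverse. V is the image of that disc, and its openness is stated
    pointwise for later use. *)
Lemma local_inverse (f : C -> C) (w0 c : C) (d : R) : (0 < d)%R -> (forall w, (Cmod (w - w0) < d)%R -> exists l, cder f w l) ->
  cder f w0 c -> c <> 0 -> exists (eta : R) (k : C -> C) (V : C -> Prop), (0 < eta <= d)%R /\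
    (forall w, (Cmod (w - w0) < eta)%R -> V (f w) /\ k (f w) = w) /\
    (forall v, V v -> (Cmod (k v - w0) < eta)%R /\ f (k v) = v /\ (exists l, cder k v l) /\
       exists del, (0 < del)%R /\ forall v', (Cmod (v' - v) < del)%R -> V v').
Proof.
  intros Hd Hf Hc Hc0. assert (Hcp := proj1 (Cmod_gt_0 _) Hc0).
  destruct (strict_diff f w0 c d (Cmod c / 2) Hd Hf Hc ltac:(lra)) as [eta [Heta Hs]].
  set (V := fun v => exists w, (Cmod (w - w0) < eta)%R /\ f w = v).
  destruct (choice (fun v w => V v -> (Cmod (w - w0) < eta)%R /\ f w = v)) as [k Hk].
  { intros v. destruct (Classical_Prop.classic (V v)) as [[w Hw]|Hn]; [exists w; auto|exists 0; intros; contradiction]. }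
  assert (Low : forall w w', (Cmod (w - w0) < eta)%R -> (Cmod (w' - w0) < eta)%R -> (Cmod c / 2 * Cmod (w - w') <= Cmod (f w - f w'))%R).
  { intros w w' Hw Hw'. specialize (Hs w w' Hw Hw').
    assert (T := Cmod_ge_sub (c * (w - w')) (f w - f w')). rewrite Cmod_sym in Hs.
    replace (c * (w - w') - (f w - f w')) with (- (f w - f w' - c * (w - w'))) in T by ring. rewrite Cmod_opp in T.
    rewrite (Cmod_sym (c * (w - w'))) in Hs. rewrite Cmod_mult in T. lra. }
  exists eta, k, V. split; auto. split.
  - intros w Hw. assert (Hv : V (f w)) by (exists w; auto). split; auto.
    destruct (Hk _ Hv) as [H1 H2]. assert (L := Low (k (f w)) w H1 Hw). rewrite H2 in L.
    replace (f w - f w) with (RtoC 0) in L by ring. rewrite Cmod_0 in L.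
    assert (Z : k (f w) - w = 0). { apply Cmod_eq_0. assert (A := Cmod_ge_0 (k (f w) - w)). nra. }
    replace (k (f w)) with (k (f w) - w + w) by ring. rewrite Z. ring.
  - intros v Hv. destruct (Hk v Hv) as [H1 H2]. split; auto. split; auto.
    assert (Op : exists del, (0 < del)%R /\ forall v', (Cmod (v' - v) < del)%R -> V v').
    { set (tau := ((eta - Cmod (k v - w0)) / 2)%R). assert (Ht : (0 < tau)%R) by (unfold tau; lra).
      exists (tau / 2 * Cmod c)%R. split; [apply Rmult_lt_0_compat; lra|]. intros v' Hv'.
      (* Newton's iteration with the derivative frozen at c; the Lipschitz error |c| / 2 makes it a
         contraction with factor 1 / 2. *)
      set (N := fun t => t - (f (k v + t) - v') / c).
      assert (In : forall t, (Cmod t <= tau)%R -> (Cmod (k v + t - w0) < eta)%R).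
      { intros t Ht'. replace (k v + t - w0) with ((k v - w0) + t) by ring. eapply Rle_lt_trans; [apply Cmod_triangle|]. unfold tau in *; lra. }
      assert (Co : contracts tau N).
      { split.
        - unfold N. replace (k v + 0) with (k v) by ring. rewrite H2.
          replace (0 - (v - v') / c) with ((v' - v) / c) by (field; auto). rewrite Cmod_div by auto.
          apply (Rmult_le_reg_r (Cmod c)); auto. unfold Rdiv at 1. rewrite Rmult_assoc, Rinv_l; lra.
        - intros t t' Ht1 Ht2. specialize (Hs _ _ (In t Ht1) (In t' Ht2)).
          replace (k v + t - (k v + t')) with (t - t') in Hs by ring.
          unfold N. replace (t - (f (k v + t) - v') / c - (t' - (f (k v + t') - v') / c)) with
            (- (f (k v + t) - f (k v + t') - c * (t - t')) / c) by (field; auto).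
          rewrite Cmod_div, Cmod_opp by auto. apply (Rmult_le_reg_r (Cmod c)); auto. unfold Rdiv at 1. rewrite Rmult_assoc, Rinv_l; lra. }
      destruct (fixpt_spec tau N ltac:(lra) Co) as [F1 [F2 _]]. set (t := fixpt N) in *.
      exists (k v + t). split; auto. unfold N in F2.
      assert (Z : (f (k v + t) - v') / c = 0). { replace ((f (k v + t) - v') / c) with (t - (t - (f (k v + t) - v') / c)) by ring. rewrite F2. ring. }
      replace (f (k v + t)) with ((f (k v + t) - v') / c * c + v') by (field; auto). rewrite Z. ring. }
    split; auto. destruct Op as [del [Hdel Hop]].
    destruct (Hf (k v) ltac:(lra)) as [l Hl].
    assert (Hl0 : l <> 0).
    (* A zero derivative would contradict the lower bound [Low], tested on one small real
       increment. *)
    { intros E. subst l. destruct (Hl (Cmod c / 4)%R ltac:(lra)) as [d1 [Hd1 HH]].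
      set (h := (Rmin d1 (eta - Cmod (k v - w0)) / 2)%R).
      assert (Hh : (0 < h)%R) by (unfold h; assert (0 < Rmin d1 (eta - Cmod (k v - w0)))%R by (apply Rmin_pos; lra); lra).
      assert (L1 := Rmin_l d1 (eta - Cmod (k v - w0))). assert (L2 := Rmin_r d1 (eta - Cmod (k v - w0))).
      assert (Hm : Cmod (k v + h - k v) = h). { replace (k v + h - k v) with (RtoC h) by ring. rewrite Cmod_R, Rabs_pos_eq; lra. }
      specialize (HH (k v + h)). rewrite Hm in HH. specialize (HH ltac:(unfold h in *; lra)).
      assert (Hin : (Cmod (k v + h - w0) < eta)%R).
      { replace (k v + h - w0) with ((k v - w0) + h) by ring. eapply Rle_lt_trans; [apply Cmod_triangle|]. rewrite (Cmod_R h), Rabs_pos_eq by lra. unfold h in *; lra. }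
      assert (L := Low _ _ Hin H1). rewrite Hm in L.
      replace (f (k v + h) - f (k v) - 0 * (k v + h - k v)) with (f (k v + h) - f (k v)) in HH by ring. nra. }
    assert (Ck : ccont k v).
    { intros e He. exists (Rmin del (e * (Cmod c / 2))). split; [apply Rmin_pos; auto; nra|]. intros v' Hv'.
      destruct (Hk v' (Hop v' (Rlt_le_trans _ _ _ Hv' (Rmin_l _ _)))) as [G1 G2].
      assert (L := Low _ _ G1 H1). rewrite G2, H2 in L.
      assert (L2 := Rlt_le_trans _ _ _ Hv' (Rmin_r _ _)). nra. }
    assert (Hl' := Hl). apply cder_slope in Hl'. destruct Hl' as [s [Cs [Es Hsl]]].
    assert (Csk : ccont (fun v => s (k v)) v) by (apply ccont_comp; auto).
    assert (Csn : exists d2, (0 < d2)%R /\ forall v', (Cmod (v' - v) < d2)%R -> s (k v') <> 0).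
    { destruct (Csk (Cmod l)) as [d2 [Hd2 HH]]; [apply Cmod_gt_0; auto|]. exists d2; split; auto. intros v' Hv' E.
      specialize (HH v' Hv'). cbv beta in HH. rewrite E, Es in HH. replace (0 - l) with (- l) in HH by ring. rewrite Cmod_opp in HH. lra. }
    destruct Csn as [d2 [Hd2 Hsn]].
    exists (/ l). apply (cder_ext_loc (fun v' => k v + / s (k v') * (v' - v)) _ v _ (Rmin del d2)); [apply Rmin_pos; auto| |].
    + intros v' Hv'. destruct (Hk v' (Hop v' (Rlt_le_trans _ _ _ Hv' (Rmin_l _ _)))) as [G1 G2].
      assert (N0 := Hsn v' (Rlt_le_trans _ _ _ Hv' (Rmin_r _ _))).
      assert (E := Hsl (k v')). rewrite G2, H2 in E.
      assert (E' : v' - v = s (k v') * (k v' - k v)) by (rewrite E at 1; ring). rewrite E'. field. auto.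
    + apply cder_slope. exists (fun v' => / s (k v')). split; [|split].
      * apply ccont_inv; auto. rewrite Es; auto.
      * rewrite Es; auto.
      * intros v'. ring.
Qed.

(** * Segre curves near the origin *)

(** Draws uniform estimates from the normalisation psi = x + O(x^2): linear size in x, and an
    x-derivative close to 1 on a small bidisc. *)
Lemma segre_psi_facts (S : positive_segre_family) : exists d K M, (0 < d <= 1)%R /\ (d <= sf_delta S ^ 2)%R /\ (d <= sf_eps S)%R /\ (0 < K)%R /\
  shol2 (fun x y => sf_psi S (x, y)) d d M /\
  forall x y, (Cmod x < d)%R -> (Cmod y < d)%R -> (Cmod (sf_psi S (x, y)) <= K * Cmod x)%R /\
    exists p1, cder (fun x => sf_psi S (x, y)) x p1 /\ p1 <> 0 /\ (x = 0 -> p1 = 1).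
Proof.
  assert (D0 := sf_delta_pos S). assert (E0 := sf_eps_pos S).
  assert (D2 : (0 < sf_delta S ^ 2)%R) by (apply pow_lt; auto).
  assert (HC : forall x y, (Cmod x < sf_delta S ^ 2)%R -> (Cmod y < sf_eps S)%R -> exists a b, cder2 (fun u v => sf_psi S (u, v)) x y a b).
  { intros x y Hx Hy. apply ex_filterdiff_cder2. apply (sf_psi_holomorphic S). split; auto. }
  destruct (HC 0 0) as [a0 [b0 Hab]]; try (rewrite Cmod_0; auto).
  destruct (cder2_ccont2 _ _ _ _ _ Hab 1%R ltac:(lra)) as [d1 [Hd1 H1]].
  set (d2 := Rmin (Rmin 1 d1) (Rmin (sf_delta S ^ 2) (sf_eps S))).
  assert (Hd2 : (0 < d2)%R) by (unfold d2; apply Rmin_pos; apply Rmin_pos; lra).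
  assert (L1 := Rmin_l (Rmin 1 d1) (Rmin (sf_delta S ^ 2) (sf_eps S))). assert (L2 := Rmin_r (Rmin 1 d1) (Rmin (sf_delta S ^ 2) (sf_eps S))).
  assert (L3 := Rmin_l 1 d1). assert (L4 := Rmin_r 1 d1). assert (L5 := Rmin_l (sf_delta S ^ 2) (sf_eps S)). assert (L6 := Rmin_r (sf_delta S ^ 2) (sf_eps S)).
  fold d2 in L1, L2.
  set (M := (Cmod (sf_psi S (RtoC 0, RtoC 0)) + 1)%R).
  assert (HM : forall x y, (Cmod x < d2)%R -> (Cmod y < d2)%R -> (Cmod (sf_psi S (x, y)) <= M)%R).
  { intros x y Hx Hy. specialize (H1 x y). replace (x - 0) with x in H1 by ring. replace (y - 0) with y in H1 by ring.
    specialize (H1 ltac:(lra) ltac:(lra)). assert (T := Cmod_ge_sub (sf_psi S (x, y)) (sf_psi S (RtoC 0, RtoC 0))). unfold M. lra. }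
  assert (SH : shol2 (fun x y => sf_psi S (x, y)) d2 d2 M).
  { split; [|split]; auto.
    - intros y Hy x Hx. destruct (HC x y ltac:(lra) ltac:(lra)) as [a [b Hq]]. eexists.
      apply (cder2_comp (fun u v => sf_psi S (u, v)) (fun x => x) (fun _ => y)); [exact Hq|apply cder_id|apply cder_const].
    - intros x Hx y Hy. destruct (HC x y ltac:(lra) ltac:(lra)) as [a [b Hq]]. eexists.
      apply (cder2_comp (fun u v => sf_psi S (u, v)) (fun _ => x) (fun y => y)); [exact Hq|apply cder_const|apply cder_id]. }
  (* The given expansion carries no bound uniform in y. Identifying its coefficients with the Taylor
     coefficients of the bounded function gives the common bound 2 M and keeps c_0 = 0, c_1 = 1. *)
  assert (PB : forall y, (Cmod y < d2)%R -> exists c : nat -> C, c O = 0 /\ c (Datatypes.S O) = 1 /\ pbound c d2 (2 * M) /\ forall x, (Cmod x < d2)%R -> sf_psi S (x, y) = psum c x).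
  { intros y Hy.
    destruct (taylor_bounded (fun x => sf_psi S (x, y)) d2 M Hd2 (proj1 SH y Hy)) as [c [Hc1 Hc2]]; [intros; apply HM; auto|].
    set (c' := fun k => match k with O => RtoC 0 | Datatypes.S O => RtoC 1 | _ => sf_psi_coef S k y end).
    assert (Hps : forall x, (Cmod x < d2)%R -> cser (fun k => c' k * x ^ k) (sf_psi S (x, y))).
    { intros x Hx. apply is_pseries_cser. apply (sf_psi_expansion S); unfold cdisc; lra. }
    assert (Hm : Cmod (RtoC (d2 / 2)) = (d2 / 2)%R) by (rewrite Cmod_R, Rabs_pos_eq; lra).
    destruct (cser_terms_bounded _ _ (Hps (RtoC (d2 / 2)) ltac:(lra))) as [M' HM'].
    assert (PB' : pbound c' (d2 / 2) M'). { intros k. specialize (HM' k). rewrite Cmod_mult, Cmod_pow, Hm in HM'. exact HM'. }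
    assert (E : forall k, c k = c' k).
    { apply (psum_unique c c' (d2 / 2) (2 * M) M' (d2 / 2)); try lra; auto.
      - apply (pbound_mono c d2); auto; lra.
      - intros t Ht. assert (Hmt : Cmod t = t) by (rewrite Cmod_R, Rabs_pos_eq; lra).
        rewrite <- Hc2 by lra. eapply cser_unique; [apply Hps; lra|]. eapply psum_cser; [exact PB'|lra]. }
    exists c. split; [apply E|]. split; [apply E|]. auto. }
  assert (HM0 : (0 < M)%R) by (unfold M; assert (A := Cmod_ge_0 (sf_psi S (RtoC 0, RtoC 0))); lra).
  set (K := (16 * M / d2)%R). assert (HK : (0 < K)%R) by (apply Rdiv_lt_0_compat; lra).
  (* M1 bounds the series of the x-derivative on radius d2 / 2, and K2 is its Lipschitz constant on
     d2 / 4; for |x| < 1 / (2 K2) the derivative stays within 1 / 2 of 1. *)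
  set (M1 := (2 * M / d2 * 4)%R). set (K2 := (M1 / (d2 / 2) * 4)%R).
  assert (HK2 : (0 < K2)%R) by (unfold K2, M1; apply Rmult_lt_0_compat; [|lra]; apply Rdiv_lt_0_compat; [|lra]; apply Rmult_lt_0_compat; [|lra]; apply Rdiv_lt_0_compat; lra).
  set (d := Rmin (d2 / 4) (/ (2 * K2))).
  assert (Hd : (0 < d)%R) by (apply Rmin_pos; [lra|apply Rinv_0_lt_compat; lra]).
  assert (L7 := Rmin_l (d2 / 4) (/ (2 * K2))). assert (L8 := Rmin_r (d2 / 4) (/ (2 * K2))). fold d in L7, L8.
  exists d, K, M. split; [lra|]. split; [lra|]. split; [lra|]. split; auto. split; [apply (shol2_mono _ d2 d2 M); auto; lra|].
  intros x y Hx Hy. destruct (PB y ltac:(lra)) as [c [C0 [C1 [Pc Ec]]]]. assert (Hx0 := Cmod_ge_0 x).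
  split.
  - rewrite Ec by lra. assert (L := psum_lip c d2 (d2 / 2) (2 * M) 0 x Pc ltac:(lra) ltac:(rewrite Cmod_0; lra) ltac:(lra)).
    rewrite (psum_0 c d2 (2 * M)) in L by auto. rewrite C0 in L. replace (psum c x - 0) with (psum c x) in L by ring. replace (x - 0) with x in L by ring.
    eapply Rle_trans; [exact L|]. apply Rmult_le_compat_r; auto. unfold K. apply (Rle_trans _ (8 * M / d2)). right; field; lra.
    apply Rmult_le_compat_r; [left; apply Rinv_0_lt_compat; lra|lra].
  - exists (psum (pderiv c) x).
    assert (Pd : pbound (pderiv c) (d2 / 2) M1).
    { unfold M1. replace (2 * M / d2 * 4)%R with (2 * M / d2 * (/ (1 - (d2 / 2) / d2) * / (1 - (d2 / 2) / d2)))%R by (field; lra).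
      apply pbound_deriv; auto; lra. }
    assert (P0 : psum (pderiv c) 0 = 1). { rewrite (psum_0 _ (d2 / 2) M1) by (auto; lra). unfold pderiv. rewrite C1. simpl. ring. }
    split; [|split].
    + apply (cder_ext_loc (psum c) _ x _ (d2 - Cmod x)); [lra| |eapply cder_psum; [exact Pc|lra]].
      intros w Hw. symmetry. apply Ec. assert (A := Cmod_triangle (w - x) x). replace (w - x + x) with w in A by ring. lra.
    + intros Z. assert (L := psum_lip (pderiv c) (d2 / 2) (d2 / 4) M1 0 x Pd ltac:(lra) ltac:(rewrite Cmod_0; lra) ltac:(lra)).
      rewrite Z, P0 in L. replace (0 - 1) with (- (1)) in L by ring. rewrite Cmod_opp, Cmod_1 in L. replace (x - 0) with x in L by ring.
      replace (M1 / (d2 / 2) * (/ (1 - d2 / 4 / (d2 / 2)) * / (1 - d2 / 4 / (d2 / 2))))%R with K2 in L by (unfold K2; field; lra).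
      assert (Hxk : (Cmod x < / (2 * K2))%R) by lra. apply (Rmult_lt_compat_l K2) in Hxk; auto.
      replace (K2 * / (2 * K2))%R with (/ 2)%R in Hxk by (field; lra). lra.
    + intros ->. exact P0.
Qed.

Lemma Cexp_minus1_bound : exists d, (0 < d)%R /\ forall h, (Cmod h < d)%R -> (Cmod (Cexp h - 1) <= 2 * Cmod h)%R.
Proof.
  destruct (Cexp_der0 1%R ltac:(lra)) as [d [Hd H]]. exists d. split; auto. intros h Hh. specialize (H h Hh).
  replace (Cexp h - 1) with ((Cexp h - 1 - h) + h) by ring. eapply Rle_trans; [apply Cmod_triangle|]. lra.
Qed.

(** A point of M lies on its own Segre curve, so the curve of (z0, w0) is studied over the segment
    from 0 to z0. The factor |w0|^m in the distance to conj w0 is decisive: it keeps the curve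
    inside a disc of radius tau |u|^m on which a basis of solutions exists, however small w0 is. *)
Lemma segre_curve_facts (m : nat) (r : R) (P Q : C -> C) (S : positive_segre_family) : (1 <= m)%nat -> (0 < r)%R ->
  associated_segre_family m r P Q S ->
  exists e0 K, (0 < e0 <= 1)%R /\ (0 < K)%R /\ (e0 <= sf_delta S)%R /\ (e0 <= sf_eps S)%R /\ (2 * e0 <= r)%R /\ (e0 * e0 * K <= / 16)%R /\
    forall z0 w0, (Cmod z0 < e0)%R -> (Cmod w0 < e0)%R ->
      (forall t : R, (0 <= t <= 1)%R -> (Cmod (segre_graph m S (z0, w0) (z0 * t)%C - Cconj w0) <= K * (Cmod w0 ^ m * Cmod z0 ^ 2))%R) /\
      segre_graph m S (z0, w0) 0 = Cconj w0 /\
      (forall eps, (0 < eps)%R -> exists d, (0 < d)%R /\ forall z w, (Cmod (z - z0) < d)%R -> (Cmod (w - w0) < d)%R ->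
         (Cmod (segre_graph m S (z, w) z - segre_graph m S (z0, w0) z0) < eps)%R) /\
      (z0 <> 0 -> w0 <> 0 -> exists W' W'' : C -> C, W' 0 = Ci * Cconj w0 ^ m * Cconj z0 /\
         forall t : R, (0 <= t <= 1)%R -> let z := z0 * t in let W := segre_graph m S (z0, w0) in
           cder W z (W' z) /\ cder W' z (W'' z) /\ W' z <> 0 /\ W z <> 0 /\
           W'' z = - (P (W z) / W z ^ m) * W' z ^ 2 - Q (W z) / W z ^ (2 * m) * W' z ^ 3 * z).
Proof.
  intros Hm Hr [d [e [Hd [He [Her HS]]]]].
  destruct (segre_psi_facts S) as [d1 [K1 [M1 [Hd1 [Hd1a [Hd1b [HK1 [SH HP]]]]]]]].
  destruct Cexp_minus1_bound as [d2 [Hd2 HE]].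
  set (B := (4 * (K1 + 1))%R).
  set (e0 := Rmin (Rmin (d1 / 2) (Rmin d (e / 4))) (Rmin (d2 / B) (/ (4 * B)))).
  assert (HB : (4 < B)%R) by (unfold B; lra).
  assert (Q1 : (0 < d2 / B)%R) by (apply Rdiv_lt_0_compat; lra). assert (Q2 : (0 < / (4 * B))%R) by (apply Rinv_0_lt_compat; lra).
  assert (He0 : (0 < e0)%R) by (unfold e0; apply Rmin_pos; apply Rmin_pos; try lra; apply Rmin_pos; lra).
  assert (L1 := Rmin_l (Rmin (d1 / 2) (Rmin d (e / 4))) (Rmin (d2 / B) (/ (4 * B)))).
  assert (L2 := Rmin_r (Rmin (d1 / 2) (Rmin d (e / 4))) (Rmin (d2 / B) (/ (4 * B)))). fold e0 in L1, L2.
  assert (L3 := Rmin_l (d1 / 2) (Rmin d (e / 4))). assert (L4 := Rmin_r (d1 / 2) (Rmin d (e / 4))).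
  assert (L5 := Rmin_l d (e / 4)). assert (L6 := Rmin_r d (e / 4)).
  assert (L7 := Rmin_l (d2 / B) (/ (4 * B))). assert (L8 := Rmin_r (d2 / B) (/ (4 * B))).
  assert (E1 : (e0 * B <= d2)%R). { apply (Rle_trans _ (d2 / B * B)); [apply Rmult_le_compat_r; lra|right; field; lra]. }
  assert (E2 : (e0 * (4 * B) <= 1)%R). { apply (Rle_trans _ (/ (4 * B) * (4 * B))); [apply Rmult_le_compat_r; lra|right; field; lra]. }
  exists e0, (2 * (K1 + 1))%R. split; [lra|]. split; [lra|]. split; [lra|]. split; [lra|]. split; [lra|].
  assert (E3 : (e0 * e0 * (2 * (K1 + 1)) <= / 16)%R).
  { unfold B in *. assert (e0 * (K1 + 1) <= / 16)%R by lra. assert (e0 <= / 16)%R by nra. nra. }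
  split; [exact E3|].
  intros z0 w0 Hz0 Hw0. set (y := Cconj w0). assert (Hy : Cmod y = Cmod w0) by apply Cmod_conj.
  assert (Zp := Cmod_ge_0 z0). assert (Wp := Cmod_ge_0 w0).
  set (xx := fun z => z * Cconj z0).
  assert (Hx : forall t : R, (0 <= t <= 1)%R -> (Cmod (xx (z0 * t)%C) <= Cmod z0 ^ 2)%R).
  { intros t Ht. unfold xx. rewrite !Cmod_mult, Cmod_conj, Cmod_R, Rabs_pos_eq by lra. simpl. nra. }
  assert (Hz2 : (Cmod z0 ^ 2 <= e0)%R) by (simpl; nra).
  assert (Cy : (Cmod w0 ^ (m - 1) <= 1)%R) by (apply pow_le_1; lra).
  assert (Cy0 : (0 <= Cmod w0 ^ (m - 1))%R) by (apply pow_le; auto).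
  set (th := fun z => Ci * y ^ (m - 1) * sf_psi S (xx z, y)).
  assert (Hth : forall t : R, (0 <= t <= 1)%R -> (Cmod (th (z0 * t)%C) <= Cmod w0 ^ (m - 1) * (K1 * Cmod z0 ^ 2))%R /\ (Cmod (th (z0 * t)%C) < d2)%R).
  { intros t Ht. assert (X := Hx t Ht).
    assert (A : (Cmod (th (z0 * t)%C) <= Cmod w0 ^ (m - 1) * (K1 * Cmod z0 ^ 2))%R).
    { unfold th. rewrite !Cmod_mult, Cmod_Ci, Cmod_pow, Hy, Rmult_1_l. apply Rmult_le_compat_l; auto.
      eapply Rle_trans; [apply HP; lra|]. apply Rmult_le_compat_l; lra. }
    split; auto. eapply Rle_lt_trans; [exact A|].
    assert (0 <= K1 * Cmod z0 ^ 2)%R by (apply Rmult_le_pos; [lra|apply pow_le; auto]).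
    apply (Rle_lt_trans _ (K1 * e0)); [|unfold B in *; nra].
    apply (Rle_trans _ (1 * (K1 * Cmod z0 ^ 2))); [apply Rmult_le_compat_r; auto|]. rewrite Rmult_1_l. apply Rmult_le_compat_l; lra. }
  assert (GE : forall z, segre_graph m S (z0, w0) z = y * Cexp (th z)) by (intros z; reflexivity).
  assert (Bd : forall t : R, (0 <= t <= 1)%R -> (Cmod (segre_graph m S (z0, w0) (z0 * t)%C - y) <= 2 * (K1 + 1) * (Cmod w0 ^ m * Cmod z0 ^ 2))%R).
  { intros t Ht. rewrite GE. replace (y * Cexp (th (z0 * t)%C) - y) with (y * (Cexp (th (z0 * t)%C) - 1)) by ring.
    destruct (Hth t Ht) as [A1 A2]. rewrite Cmod_mult, Hy. specialize (HE _ A2).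
    replace (Cmod w0 ^ m)%R with (Cmod w0 * Cmod w0 ^ (m - 1))%R by (rewrite tech_pow_Rmult; f_equal; lia).
    assert (0 <= Cmod w0 ^ (m - 1) * Cmod z0 ^ 2)%R by (apply Rmult_le_pos; auto; apply pow_le; auto).
    apply (Rle_trans _ (Cmod w0 * (2 * (Cmod w0 ^ (m - 1) * (K1 * Cmod z0 ^ 2))))).
    - apply Rmult_le_compat_l; auto. lra.
    - assert (0 <= Cmod w0 * (Cmod w0 ^ (m - 1) * Cmod z0 ^ 2))%R by (apply Rmult_le_pos; auto). nra. }
  assert (P00 : forall y, (Cmod y < d1)%R -> sf_psi S (RtoC 0, y) = 0).
  { intros y' Hy'. destruct (HP 0 y') as [A _]; try (rewrite Cmod_0; lra); auto. rewrite Cmod_0, Rmult_0_r in A.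
    apply Cmod_eq_0. apply Rle_antisym; auto. apply Cmod_ge_0. }
  assert (G0 : segre_graph m S (z0, w0) 0 = y).
  { rewrite GE. unfold th, xx. rewrite Cmult_0_l, P00 by lra. rewrite Cmult_0_r, Cexp_0. ring. }
  split; [exact Bd|]. split; [exact G0|]. split.
  - intros eps Heps.
    assert (Hx1 : (Cmod (z0 * Cconj z0) < d1)%R).
    { rewrite Cmod_mult, Cmod_conj. apply (Rle_lt_trans _ (1 * Cmod z0)); [apply Rmult_le_compat_r; lra|lra]. }
    destruct (shol2_cder2 _ d1 d1 M1 (z0 * Cconj z0) y SH Hx1 ltac:(lra)) as [a [b Hab]].
    assert (Pw : pcont (fun q => Cconj (snd q)) (z0, w0)) by (apply pcont_conj, (pcont_snd (fun w => w)), ccont_id).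
    assert (Pz : pcont (fun q => fst q * Cconj (fst q)) (z0, w0)) by (apply pcont_mult; [|apply pcont_conj]; apply pcont_fst).
    assert (C : pcont (fun q => segre_graph m S q (fst q)) (z0, w0)).
    { apply pcont_mult; auto. apply (pcont_comp Cexp); [eapply cder_cont, cder_Cexp|]. apply pcont_mult.
      - apply pcont_mult; [apply pcont_const|]. apply (pcont_comp (fun v => v ^ (m - 1))); auto. eapply cder_cont, cder_Cpow.
      - exact (pcont_comp2 (fun x y => sf_psi S (x, y)) _ _ _ _ _ Hab Pz Pw). }
    destruct (C eps Heps) as [dd [Hdd H]]. exists dd. split; [auto|]. intros z w Hz Hw. exact (H (z, w) Hz Hw).
  - intros Hzn Hwn. assert (Hyn : y <> 0) by (apply Cconj_neq0; auto).
    destruct (HS (z0, w0) ltac:(unfold cdisc; simpl; lra) ltac:(unfold cdisc; simpl; lra) Hwn) as [W' [W'' HW]].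
    exists W', W''.
    assert (In : forall t : R, (0 <= t <= 1)%R -> cdisc d (z0 * t) /\ cdisc e (segre_graph m S (z0, w0) (z0 * t)%C)).
    { intros t Ht. split; unfold cdisc.
      - rewrite Cmod_mult, Cmod_R, Rabs_pos_eq by lra. nra.
      - specialize (Bd t Ht). assert (T := Cmod_triangle (segre_graph m S (z0, w0) (z0 * t)%C - y) y).
        replace (segre_graph m S (z0, w0) (z0 * t)%C - y + y) with (segre_graph m S (z0, w0) (z0 * t)%C) in T by ring.
        assert (Cmod w0 ^ m <= 1)%R by (apply pow_le_1; lra). assert (0 <= Cmod w0 ^ m)%R by (apply pow_le; auto).
        assert (0 <= Cmod z0 ^ 2)%R by (apply pow_le; auto).
        assert (Cmod w0 ^ m * Cmod z0 ^ 2 <= 1 * (Cmod z0 * e0))%R by (apply Rmult_le_compat; auto; simpl; nra).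
        assert (2 * (K1 + 1) * (Cmod w0 ^ m * Cmod z0 ^ 2) <= 2 * (K1 + 1) * (e0 * e0))%R by (apply Rmult_le_compat_l; nra).
        unfold B in *. assert (2 * (K1 + 1) * (e0 * e0) <= e0)%R by nra. lra. }
    (* The derivative supplied by the association with the equation agrees with that of the explicit
       exponential formula, which shows that it does not vanish. *)
    assert (DW : forall t : R, (0 <= t <= 1)%R -> exists p1, W' (z0 * t) = y * Cexp (th (z0 * t)%C) * (Ci * y ^ (m - 1) * (p1 * Cconj z0)) /\ p1 <> 0 /\ (z0 * t = 0 -> p1 = 1)).
    { intros t Ht. assert (X := Hx t Ht). destruct (HP (xx (z0 * t)%C) y ltac:(lra) ltac:(lra)) as [_ [p1 [Hp1 [Hp2 Hp3]]]].
      exists p1. split; [|split; auto].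
      - destruct (HW _ (In t Ht)) as [D1 _]. apply is_derive_cder in D1.
        eapply cder_unique; [exact D1|].
        apply (cder_ext (fun z => y * Cexp (th z))); [intros; symmetry; apply GE|].
        eapply cder_eq.
        + apply cder_scal. apply (cder_comp Cexp th); [apply cder_Cexp|]. unfold th. apply cder_scal.
          apply (cder_comp (fun x => sf_psi S (x, y)) xx); [exact Hp1|]. unfold xx. apply cder_mult; [apply cder_id|apply cder_const].
        + cbv beta. ring.
      - intros Z. apply Hp3. unfold xx. rewrite Z. ring. }
    split.
    + destruct (DW 0%R ltac:(lra)) as [p1 [E [_ Ep]]]. rewrite Cmult_0_r in E, Ep. rewrite E, (Ep eq_refl).
      assert (T0 : th 0 = 0). { unfold th, xx. rewrite Cmult_0_l, P00 by lra. ring. }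
      rewrite T0, Cexp_0, (Cpow_pred y m Hm). ring.
    + intros t Ht z W. destruct (HW _ (In t Ht)) as [D1 [D2 D3]]. apply is_derive_cder in D1. apply is_derive_cder in D2.
      destruct (DW t Ht) as [p1 [E [Hp _]]].
      split; [exact D1|]. split; [exact D2|]. split; [|split; [|exact D3]].
      * unfold z. rewrite E. repeat apply Cmult_neq_0; auto; try apply Cexp_neq_0; try (apply Cpow_nz; auto); try (apply Cconj_neq0; auto).
        apply Cmod_gt_0; rewrite Cmod_Ci; lra.
      * unfold W, z. rewrite GE. apply Cmult_neq_0; auto. apply Cexp_neq_0.
Qed.

(** * The hermitian normal form of the hypersurface off the singular locus *)

Lemma Cmult_integral (a b : C) : a * b = 0 -> a = 0 \/ b = 0.
Proof.
  intros H. destruct (Ceq_dec a 0) as [|Ha]; auto. destruct (Ceq_dec b 0) as [|Hb]; auto.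
  exfalso. revert H. apply Cmult_neq_0; auto.
Qed.

Lemma Cmod_sq (z : C) : z * Cconj z = RtoC (Cmod z ^ 2).
Proof. symmetry. apply Cmod2_conj. Qed.

Lemma Re_minus_Cmod (w : C) : Cmod (w - Re w) = Rabs (Im w).
Proof.
  replace (w - Re w) with (Ci * RtoC (Im w)) by (apply C_eq; destruct w; simpl; ring).
  rewrite Cmod_mult, Cmod_Ci, Cmod_R. ring.
Qed.

Lemma Im_Cmod (w : C) : Cmod (w - Cconj w) = (2 * Rabs (Im w))%R.
Proof.
  replace (w - Cconj w) with (Ci * RtoC (2 * Im w)) by (apply C_eq; destruct w; simpl; ring).
  rewrite Cmod_mult, Cmod_Ci, Cmod_R, Rabs_mult, (Rabs_pos_eq 2) by lra. ring.
Qed.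

(* A basis of solutions on a disc centered at the real point [u], orthogonal for the form [E]. *)
Lemma hermitian_basis (m : nat) (r : R) (P Q A A' B : C -> C) : (1 <= m)%nat -> (0 < r)%R -> hol r P -> hol r Q -> real_form m r P Q A A' B ->
  exists tau rho, (0 < tau <= / 2)%R /\ (0 < rho <= / 2)%R /\ (2 * rho <= r)%R /\
    forall u : R, u <> 0%R -> (Rabs u < rho)%R -> exists l l1 k k1 : C -> C,
      forall w, (Cmod (w - u) < tau * Rabs u ^ m)%R ->
        w <> 0 /\ (Cmod w < r)%R /\ lin_sol m P Q l l1 w /\ lin_sol m P Q k k1 w /\
        let Wr := l w * k1 w - l1 w * k w in
        Wr <> 0 /\ w ^ m * Wr * ctilde l w = Ci * k w /\ w ^ m * Wr * ctilde k w = Ci * l w.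
Proof.
  intros Hm Hr HP HQ HR.
  destruct (scaled_solutions m r P Q Hm Hr HP HQ) as [tau [rho [Htau [Hrho [Hrr Hsol]]]]].
  exists tau, rho. split; auto. split; auto. split; auto. intros u Hu Hur.
  assert (Hmu : Cmod u = Rabs u) by apply Cmod_R.
  assert (Hau : (0 < Rabs u)%R) by (apply Rabs_pos_lt; auto).
  assert (Hup : (0 < Rabs u ^ m)%R) by (apply pow_lt; auto).
  assert (Hupm : (Rabs u ^ m <= Rabs u)%R).
  { replace m with (S (m - 1)) by lia. simpl. assert (Rabs u ^ (m - 1) <= 1)%R by (apply pow_le_1; lra). nra. }
  assert (Hcu : RtoC u <> 0) by (apply RtoC_neq0; auto).
  assert (HCi : Ci <> 0) by (apply Cmod_gt_0; rewrite Cmod_Ci; lra).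
  set (a := Re (A u)).
  assert (Ha : A u = RtoC a).
  { destruct (HR u ltac:(rewrite Hmu; lra)) as [_ [CA _]]. rewrite Cconj_RtoC in CA. unfold a. revert CA. generalize (A u). intros v E.
    apply C_eq; destruct v; simpl in *; auto. inversion E. lra. }
  assert (Sol : forall b : R, exists l l1 : C -> C, l u = 1 /\ l1 u = RtoC b / (Ci * RtoC u ^ m) /\
     forall w, (Cmod (w - u) < tau * Rabs u ^ m)%R -> lin_sol m P Q l l1 w).
  { intros b. destruct (Hsol (fun _ => 1) (fun _ => RtoC b) (Rmax 1 (Rabs b))) as [F [D [K1 [_ [_ H]]]]].
    - apply hol_const. - apply hol_const.
    - intros y _. rewrite Cmod_1, Cmod_R. split; [apply Rmax_l|apply Rmax_r].
    - destruct (H u ltac:(rewrite Hmu; lra)) as [H1 [H2 [_ H3]]]. specialize (H3 Hcu). rewrite Hmu in H3.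
      exists (fun w => F ((w - u) / (Ci * RtoC u ^ m)) u), (fun w => D ((w - u) / (Ci * RtoC u ^ m)) u / (Ci * RtoC u ^ m)).
      assert (E0 : (RtoC u - RtoC u) / (Ci * RtoC u ^ m) = 0) by (field; split; auto; apply Cpow_nz; auto).
      split; [cbv beta; rewrite E0; auto|]. split; [cbv beta; rewrite E0, H2; auto|]. auto. }
  destruct (Sol (/ 2 - a)%R) as [l [l1 [Hl0 [Hl1 Hl]]]]. destruct (Sol (- / 2 - a)%R) as [k [k1 [Hk0 [Hk1 Hk]]]].
  exists l, l1, k, k1.
  assert (Dom : forall w, (Cmod (w - u) < tau * Rabs u ^ m)%R -> w <> 0 /\ (Cmod w < r)%R).
  { intros w Hw. assert (B1 : (Cmod (w - u) < / 2 * Rabs u)%R) by nra. split.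
    - intros E. subst w. rewrite Cmod_sym in B1. replace (u - 0) with (RtoC u) in B1 by ring. rewrite Hmu in B1. lra.
    - assert (T := Cmod_triangle (w - u) u). replace (w - u + u) with w in T by ring. rewrite Hmu in T. lra. }
  assert (Cj : forall w, (Cmod (w - u) < tau * Rabs u ^ m)%R -> (Cmod (Cconj w - u) < tau * Rabs u ^ m)%R).
  { intros w Hw. rewrite <- (Cconj_RtoC u), <- Cminus_conj, Cmod_conj. auto. }
  assert (EC : forall f f1 g g1, (forall w, (Cmod (w - u) < tau * Rabs u ^ m)%R -> lin_sol m P Q f f1 w) ->
     (forall w, (Cmod (w - u) < tau * Rabs u ^ m)%R -> lin_sol m P Q g g1 w) ->
     forall w, (Cmod (w - u) < tau * Rabs u ^ m)%R -> Eform m A f f1 g g1 w = Eform m A f f1 g g1 u).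
  { intros f f1 g g1 Hf Hg w Hw. symmetry. apply (E_const m r P Q A A' B); auto. intros t Ht v.
    assert (Hv : (Cmod (v - u) < tau * Rabs u ^ m)%R).
    { unfold v. replace (u + (w - u) * t - u) with ((w - u) * t) by ring. rewrite Cmod_mult, Cmod_R, Rabs_pos_eq by lra.
      assert (0 <= Cmod (w - u))%R by apply Cmod_ge_0. nra. }
    destruct (Dom v Hv). split; [auto|]. split; [auto|]. split; auto. }
  assert (Hum : RtoC u ^ m <> 0) by (apply Cpow_nz; auto).
  assert (E0 : forall b1 b2 : R, forall f f1 g g1 : C -> C, f u = 1 -> f1 u = RtoC b1 / (Ci * RtoC u ^ m) -> g u = 1 -> g1 u = RtoC b2 / (Ci * RtoC u ^ m) ->
     Eform m A f f1 g g1 u = Ci * (RtoC b1 + RtoC b2 + 2 * RtoC a)).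
  { intros b1 b2 f f1 g g1 F0 F1 G0 G1. unfold Eform, ctilde. rewrite Cconj_RtoC, F0, F1, G0, G1, Ha.
    rewrite Cdiv_conj by (apply Cmult_neq_0; auto). rewrite Cmult_conj, Cpow_conj, !Cconj_RtoC, Cconj_Ci.
    assert (CC : Ci * Ci = - (1)) by (apply C_eq; simpl; ring).
    assert (Inv : / Ci = - Ci). { replace (/ Ci) with (- (Ci * Ci) / Ci) by (rewrite CC; field; auto). field; auto. }
    transitivity (- (RtoC b1 + RtoC b2) * / Ci + 2 * Ci * RtoC a); [field; auto|]. rewrite Inv. ring. }
  assert (H2i : RtoC (/ 2 - a) + RtoC (/ 2 - a) + 2 * RtoC a = 1) by (apply C_eq; simpl; field).
  assert (H2j : RtoC (/ 2 - a) + RtoC (- / 2 - a) + 2 * RtoC a = 0) by (apply C_eq; simpl; field).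
  assert (H2l : RtoC (- / 2 - a) + RtoC (/ 2 - a) + 2 * RtoC a = 0) by (apply C_eq; simpl; field).
  assert (H2k : RtoC (- / 2 - a) + RtoC (- / 2 - a) + 2 * RtoC a = - (1)) by (apply C_eq; simpl; field).
  intros w Hw. destruct (Dom w Hw) as [Hw0 Hwr]. split; auto. split; auto. split; auto. split; auto.
  assert (E1 := EC l l1 l l1 Hl Hl w Hw). rewrite (E0 _ _ _ _ _ _ Hl0 Hl1 Hl0 Hl1), H2i in E1.
  assert (E2 := EC k k1 l l1 Hk Hl w Hw). rewrite (E0 _ _ _ _ _ _ Hk0 Hk1 Hl0 Hl1), H2l in E2.
  assert (E3 := EC l l1 k k1 Hl Hk w Hw). rewrite (E0 _ _ _ _ _ _ Hl0 Hl1 Hk0 Hk1), H2j in E3.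
  assert (E4 := EC k k1 k k1 Hk Hk w Hw). rewrite (E0 _ _ _ _ _ _ Hk0 Hk1 Hk0 Hk1), H2k in E4.
  (* In k E(l, l) - l E(k, l) and k E(l, k) - l E(k, k) everything cancels except w^m times the
     Wronskian times l~ and k~ respectively. *)
  unfold Eform in E1, E2, E3, E4. cbv zeta.
  assert (I1 : w ^ m * (l w * k1 w - l1 w * k w) * ctilde l w = Ci * k w).
  { replace (Ci * k w) with (k w * (Ci * 1) - l w * (Ci * 0)) by ring. rewrite <- E1, <- E2. ring. }
  assert (I2 : w ^ m * (l w * k1 w - l1 w * k w) * ctilde k w = Ci * l w).
  { replace (Ci * l w) with (k w * (Ci * 0) - l w * (Ci * - (1))) by ring. rewrite <- E3, <- E4. ring. }
  split; [|split; auto].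
  (* A zero Wronskian forces l = k = 0 at w. Then E(l, l) = i and E(k, k) = -i make l1 and k~
     nonzero, against E(l, k) = 0. *)
  intros Z. rewrite Z, Cmult_0_r, Cmult_0_l in I1, I2.
  assert (K0 : k w = 0). { replace (k w) with (/ Ci * (Ci * k w)) by (field; auto). rewrite <- I1. ring. }
  assert (L0 : l w = 0). { replace (l w) with (/ Ci * (Ci * l w)) by (field; auto). rewrite <- I2. ring. }
  rewrite K0 in E4. rewrite L0 in E1, E3.
  assert (N1 : ctilde k w <> 0).
  { intros N. apply HCi. replace Ci with (- (Ci * - (1))) by ring. rewrite <- E4, N. ring. }
  assert (N2 : l1 w * (w ^ m * ctilde k w) = 0).
  { replace (l1 w * (w ^ m * ctilde k w)) with (- (w ^ m * (0 * ctilde k1 w - l1 w * ctilde k w) + 2 * Ci * A w * 0 * ctilde k w)) by ring.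
    rewrite E3. ring. }
  apply Cmult_integral in N2. destruct N2 as [N2|N2].
  - apply HCi. replace Ci with (Ci * 1) by ring. rewrite <- E1, N2. ring.
  - revert N2. apply Cmult_neq_0; auto. apply Cpow_nz; auto.
Qed.

(** With W the value at z of the Segre curve of (z, w), variation of constants and orthogonality
    give |z|^2 = conj (l w) l(W) - conj (k w) k(W). If W = w this is the normal form. Conversely the
    right side is injective in W near w0, because its derivative c0 there is nonzero, so the normal
    form forces W = w. *)
Lemma normal_form (m : nat) (r : R) (P Q A A' B : C -> C) (S : positive_segre_family) : (1 <= m)%nat -> (0 < r)%R -> hol r P -> hol r Q ->
  real_form m r P Q A A' B -> associated_segre_family m r P Q S ->
  exists e, (0 < e)%R /\ (e <= sf_delta S)%R /\ (e <= sf_eps S)%R /\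
    forall z0 w0, (Cmod z0 < e)%R -> (Cmod w0 < e)%R -> w0 <> 0 -> w0 = segre_graph m S (z0, w0) z0 ->
    exists (l l1 k k1 : C -> C) (eta : R), (0 < eta)%R /\
      (forall w, (Cmod (w - w0) < eta)%R -> w <> 0 /\ (Cmod w < r)%R /\ lin_sol m P Q l l1 w /\ lin_sol m P Q k k1 w /\ l w * k1 w - l1 w * k w <> 0) /\
      forall z w, (Cmod (z - z0) < eta)%R -> (Cmod (w - w0) < eta)%R ->
        (w = segre_graph m S (z, w) z <-> (Cmod z ^ 2 + Cmod (k w) ^ 2 = Cmod (l w) ^ 2)%R).
Proof.
  intros Hm Hr HP HQ HR HS.
  destruct (hermitian_basis m r P Q A A' B Hm Hr HP HQ HR) as [tau [rho [Htau [Hrho [Hrr Hbas]]]]].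
  destruct (segre_curve_facts m r P Q S Hm Hr HS) as [e0 [K [He0 [HK [He0d [He0e [He0r [HeK Hcur]]]]]]]].
  (* Nearby points satisfy |w| <= 4 |u| and |z| <= 2 e, so the curve moves by at most 4 K 4^m e^2
     |u|^m, four tenths of tau |u|^m; eta1 and Im w0 take at most one tenth each. *)
  set (T := (10 * K * 4 ^ m)%R). assert (H4 : (1 <= 4 ^ m)%R) by (apply pow_R1_Rle; lra).
  assert (HT : (0 < T)%R) by (unfold T; nra).
  set (e := Rmin (Rmin (e0 / 4) rho) (Rmin 1 (tau / T))).
  assert (L1 := Rmin_l (Rmin (e0 / 4) rho) (Rmin 1 (tau / T))). assert (L2 := Rmin_r (Rmin (e0 / 4) rho) (Rmin 1 (tau / T))). fold e in L1, L2.
  assert (L3 := Rmin_l (e0 / 4) rho). assert (L4 := Rmin_r (e0 / 4) rho). assert (L5 := Rmin_l 1 (tau / T)). assert (L6 := Rmin_r 1 (tau / T)).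
  assert (He : (0 < e)%R). { unfold e. apply Rmin_pos; apply Rmin_pos; try lra. apply Rdiv_lt_0_compat; lra. }
  assert (HeT : (e * e * T <= tau)%R).
  { assert (e * T <= tau)%R. { apply (Rle_trans _ (tau / T * T)); [apply Rmult_le_compat_r; lra|right; field; lra]. } 
    assert (e * (e * T) <= 1 * tau)%R by (apply Rmult_le_compat; nra). lra. }
  exists e. split; auto. split; [lra|]. split; [lra|]. intros z0 w0 Hz0 Hw0 Hw0n Heq.
  assert (Zp := Cmod_ge_0 z0). assert (Wp := proj1 (Cmod_gt_0 _) Hw0n).
  set (u := Re w0).
  destruct (Hcur z0 w0 ltac:(lra) ltac:(lra)) as [C1 [_ [C3 _]]].
  assert (HIm : (2 * Rabs (Im w0) <= K * (Cmod w0 ^ m * Cmod z0 ^ 2))%R).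
  { specialize (C1 1%R ltac:(lra)). rewrite Cmult_1_r, <- Heq, Im_Cmod in C1. auto. }
  assert (Wm1 : (Cmod w0 ^ m <= Cmod w0)%R).
  { replace m with (Datatypes.S (m - 1)) by lia. simpl. assert (Cmod w0 ^ (m - 1) <= 1)%R by (apply pow_le_1; lra). nra. }
  assert (Wm0 : (0 < Cmod w0 ^ m)%R) by (apply pow_lt; auto).
  assert (Z2 : (Cmod z0 ^ 2 <= e * e)%R) by (simpl; nra).
  assert (Z20 : (0 <= Cmod z0 ^ 2)%R) by (apply pow_le; auto).
  assert (HKe : (K * (e * e) <= / 16)%R) by nra.
  assert (Hv : (Rabs (Im w0) <= Cmod w0 / 4)%R).
  { assert (K * (Cmod w0 ^ m * Cmod z0 ^ 2) <= Cmod w0 * (K * (e * e)))%R.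
    { replace (K * (Cmod w0 ^ m * Cmod z0 ^ 2))%R with (Cmod w0 ^ m * (K * Cmod z0 ^ 2))%R by ring.
      apply Rmult_le_compat; try lra; [apply Rmult_le_pos; lra|]. apply Rmult_le_compat_l; lra. }
    nra. }
  assert (Hu : (Cmod w0 <= 2 * Rabs u)%R). { assert (X := Cmod_le_abs w0). fold u in X. lra. }
  assert (Hu1 : (Rabs u <= Cmod w0)%R) by apply re_le_Cmod.
  assert (Hu0 : u <> 0%R). { intros E. rewrite E, Rabs_R0 in Hu. lra. }
  assert (Hup : (0 < Rabs u)%R) by (apply Rabs_pos_lt; auto).
  assert (Hum : (0 < Rabs u ^ m)%R) by (apply pow_lt; auto).
  destruct (Hbas u Hu0 ltac:(lra)) as [l [l1 [k [k1 Hb]]]].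
  exists l, l1, k, k1.
  assert (HwD : (Cmod w0 ^ m <= 4 ^ m * Rabs u ^ m)%R). { rewrite <- Rpow_mult_distr. apply pow_incr. lra. }
  assert (Hv2 : (Rabs (Im w0) <= / 10 * (tau * Rabs u ^ m))%R).
  { assert (K * (Cmod w0 ^ m * Cmod z0 ^ 2) <= K * ((4 ^ m * Rabs u ^ m) * (e * e)))%R.
    { apply Rmult_le_compat_l; [lra|]. apply Rmult_le_compat; lra. }
    assert (e * e * T * Rabs u ^ m <= tau * Rabs u ^ m)%R by (apply Rmult_le_compat_r; lra). unfold T in *. nra. }
  set (eta1 := Rmin (Rmin (e0 / 4) (Cmod w0)) (Rmin e (/ 10 * (tau * Rabs u ^ m)))).
  assert (Htu : (0 < tau * Rabs u ^ m)%R) by nra.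
  assert (Heta1 : (0 < eta1)%R) by (unfold eta1; apply Rmin_pos; apply Rmin_pos; lra).
  assert (N1 := Rmin_l (Rmin (e0 / 4) (Cmod w0)) (Rmin e (/ 10 * (tau * Rabs u ^ m)))). assert (N2 := Rmin_r (Rmin (e0 / 4) (Cmod w0)) (Rmin e (/ 10 * (tau * Rabs u ^ m)))).
  fold eta1 in N1, N2.
  assert (N3 := Rmin_l (e0 / 4) (Cmod w0)). assert (N4 := Rmin_r (e0 / 4) (Cmod w0)). assert (N5 := Rmin_l e (/ 10 * (tau * Rabs u ^ m))). assert (N6 := Rmin_r e (/ 10 * (tau * Rabs u ^ m))).
  assert (InD : forall w, (Cmod (w - w0) < eta1)%R -> (Cmod (w - u) < tau * Rabs u ^ m)%R).
  { intros w Hw. replace (w - u) with ((w - w0) + (w0 - Re w0)) by (unfold u; ring). eapply Rle_lt_trans; [apply Cmod_triangle|].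
    rewrite Re_minus_Cmod. lra. }
  assert (Cj : forall w, (Cmod (w - u) < tau * Rabs u ^ m)%R -> (Cmod (Cconj w - u) < tau * Rabs u ^ m)%R).
  { intros w Hw. rewrite <- (Cconj_RtoC u), <- Cminus_conj, Cmod_conj. auto. }
  assert (HCi : Ci <> 0) by (apply Cmod_gt_0; rewrite Cmod_Ci; lra).
  (* the identity |z|^2 = conj (l w) l(W) - conj (k w) k(W), W the value at z of the Segre curve of (z, w) *)
  assert (Key : forall z w, (Cmod (z - z0) < eta1)%R -> (Cmod (w - w0) < eta1)%R ->
     let W := segre_graph m S (z, w) z in (Cmod (W - u) < tau * Rabs u ^ m)%R /\
     z * Cconj z = Cconj (l w) * l W - Cconj (k w) * k W /\ Cconj (l w) * l1 W - Cconj (k w) * k1 W <> 0).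
  { intros z w Hz Hw W.
    assert (Tz := Cmod_triangle (z - z0) z0). replace (z - z0 + z0) with z in Tz by ring.
    assert (Tw := Cmod_triangle (w - w0) w0). replace (w - w0 + w0) with w in Tw by ring.
    assert (Tw2 := Cmod_ge_sub w0 (w0 - w)). replace (w0 - (w0 - w)) with w in Tw2 by ring. rewrite (Cmod_sym w0) in Tw2.
    assert (Hwn : w <> 0). { intros E. apply (proj1 (Hb w (InD w Hw))). auto. }
    destruct (Hcur z w ltac:(lra) ltac:(lra)) as [D1 [D2 [_ D4]]].
    set (y := Cconj w) in *.
    assert (Hy : (Cmod (y - u) < tau * Rabs u ^ m)%R) by (apply Cj, InD; auto).
    assert (HzP := Cmod_ge_0 z). assert (HwP := Cmod_ge_0 w).
    assert (InW : forall t : R, (0 <= t <= 1)%R -> (Cmod (segre_graph m S (z, w) (z * t)%C - u) < tau * Rabs u ^ m)%R).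
    { intros t Ht. specialize (D1 t Ht).
      assert (Hwm : (Cmod w ^ m <= 4 ^ m * Rabs u ^ m)%R). { rewrite <- Rpow_mult_distr. apply pow_incr. lra. }
      assert (Hwm0 : (0 <= Cmod w ^ m)%R) by (apply pow_le; auto).
      assert (Hzz : (0 <= Cmod z ^ 2 <= 4 * (e * e))%R).
      { split; [apply pow_le; auto|]. apply (Rle_trans _ ((2 * e) ^ 2)); [apply pow_incr; lra|right; ring]. }
      assert (K * (Cmod w ^ m * Cmod z ^ 2) <= K * ((4 ^ m * Rabs u ^ m) * (4 * (e * e))))%R.
      { apply Rmult_le_compat_l; [lra|]. apply Rmult_le_compat; lra. }
      assert (e * e * T * Rabs u ^ m <= tau * Rabs u ^ m)%R by (apply Rmult_le_compat_r; lra).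
      replace (segre_graph m S (z, w) (z * t) - u) with ((segre_graph m S (z, w) (z * t) - y) + (y - u)) by ring.
      eapply Rle_lt_trans; [apply Cmod_triangle|].
      assert (Hyu : (Cmod (y - u) <= eta1 + / 10 * (tau * Rabs u ^ m))%R).
      { unfold y. rewrite <- (Cconj_RtoC u), <- Cminus_conj, Cmod_conj. replace (w - u) with ((w - w0) + (w0 - Re w0)) by (unfold u; ring).
        eapply Rle_trans; [apply Cmod_triangle|]. rewrite Re_minus_Cmod. lra. }
      unfold T in *. lra. }
    assert (HW1 : (Cmod (W - u) < tau * Rabs u ^ m)%R). { specialize (InW 1%R ltac:(lra)). rewrite Cmult_1_r in InW. exact InW. }
    split; auto.
    destruct (Hb y Hy) as [Hy0 [_ [_ [_ [B1 [B2 B3]]]]]]. fold y in Hy0. cbv zeta in B1, B2, B3.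
    set (Wr := l y * k1 y - l1 y * k y) in *.
    assert (Hym : y ^ m <> 0) by (apply Cpow_nz; auto).
    assert (CL : ctilde l y = Cconj (l w)) by (unfold ctilde, y; rewrite Cconj_conj; auto).
    assert (CK : ctilde k y = Cconj (k w)) by (unfold ctilde, y; rewrite Cconj_conj; auto).
    rewrite CL in B2. rewrite CK in B3.
    assert (Eq : z * Cconj z * (Ci * y ^ m * Wr) = l y * k W - k y * l W /\ l y * k1 W - k y * l1 W <> 0).
    { destruct (Ceq_dec z 0) as [Ez|Hzn].
      - assert (EW : W = y) by (unfold W; rewrite Ez; rewrite Ez in D2; exact D2). rewrite EW, Ez. split; [ring|].
        replace (l y * k1 y - k y * l1 y) with Wr by (unfold Wr; ring). auto.
      - destruct (D4 Hzn Hwn) as [W' [W'' [D5 D6]]].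
        destruct (variation_of_constants m P Q l l1 k k1 (segre_graph m S (z, w)) W' W'' z) as [V1 V2].
        { intros t Ht zz. destruct (D6 t Ht) as [X1 [X2 [X3 [X4 X5]]]].
          destruct (Hb _ (InW t Ht)) as [_ [_ [Y1 [Y2 [Y3 _]]]]]. repeat split; auto; try apply Y1; try apply Y2. }
        rewrite D2, D5 in V1, V2. fold Wr in V1, V2. fold W in V1, V2. split.
        + rewrite <- V1. ring.
        + intros Z. rewrite Z, Cmult_0_r in V2. revert V2. apply Cmult_neq_0; auto. apply Cmult_neq_0; [apply Cmult_neq_0; auto|apply Cconj_neq0; auto]. }
    destruct Eq as [Eq1 Eq2].
    assert (CC : Ci * Ci = - (1)) by (apply C_eq; simpl; ring).
    assert (Hyw : y ^ m * Wr <> 0) by (apply Cmult_neq_0; auto).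
    split.
    - assert (Z : (z * Cconj z - (Cconj (l w) * l W - Cconj (k w) * k W)) * (y ^ m * Wr) = 0).
      { replace ((z * Cconj z - (Cconj (l w) * l W - Cconj (k w) * k W)) * (y ^ m * Wr)) with
          (- (Ci * Ci) * (z * Cconj z * (y ^ m * Wr)) - (y ^ m * Wr * Cconj (l w) * l W - y ^ m * Wr * Cconj (k w) * k W)) by (rewrite CC; ring).
        rewrite B2, B3. replace (- (Ci * Ci) * (z * Cconj z * (y ^ m * Wr))) with (- Ci * (z * Cconj z * (Ci * y ^ m * Wr))) by ring.
        rewrite Eq1. ring. }
      apply Cmult_integral in Z. destruct Z as [Z|Z]; [|contradiction].
      replace (z * Cconj z) with (z * Cconj z - (Cconj (l w) * l W - Cconj (k w) * k W) + (Cconj (l w) * l W - Cconj (k w) * k W)) by ring.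
      rewrite Z. ring.
    - intros Z. apply Eq2.
      assert (Z2' : Ci * (l y * k1 W - k y * l1 W) = 0).
      { replace (Ci * (l y * k1 W - k y * l1 W)) with (Ci * l y * k1 W - Ci * k y * l1 W) by ring. rewrite <- B2, <- B3.
        replace (y ^ m * Wr * Cconj (k w) * k1 W - y ^ m * Wr * Cconj (l w) * l1 W) with (- (y ^ m * Wr) * (Cconj (l w) * l1 W - Cconj (k w) * k1 W)) by ring.
        rewrite Z. ring. }
      apply Cmult_integral in Z2'. destruct Z2'; [contradiction|auto]. }
  assert (Hw00 : (Cmod (w0 - w0) < eta1)%R) by (replace (w0 - w0) with (RtoC 0) by ring; rewrite Cmod_0; auto).
  assert (Hz00 : (Cmod (z0 - z0) < eta1)%R) by (replace (z0 - z0) with (RtoC 0) by ring; rewrite Cmod_0; auto).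
  destruct (Key z0 w0 Hz00 Hw00) as [_ [_ Hc0]]. rewrite <- Heq in Hc0.
  set (c0 := Cconj (l w0) * l1 w0 - Cconj (k w0) * k1 w0) in *. assert (Hc0p := proj1 (Cmod_gt_0 _) Hc0).
  assert (DL : forall w, (Cmod (w - w0) < eta1)%R -> cder l w (l1 w) /\ cder k w (k1 w)).
  { intros w Hw. destruct (Hb w (InD w Hw)) as [_ [_ [[X1 _] [[X2 _] _]]]]. auto. }
  destruct (ccont_bounded l w0 (cder_cont _ _ _ (proj1 (DL w0 Hw00)))) as [da [Ma [Hda [HMa Ha]]]].
  destruct (ccont_bounded k w0 (cder_cont _ _ _ (proj2 (DL w0 Hw00)))) as [db [Mb [Hdb [HMb Hb']]]].
  (* The nonlinear remainders then total at most |c0| / 4 times |W - w|, against at least 3/4 |c0|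
     |W - w| from the linear part. *)
  set (ep := (Cmod c0 / (4 * (Ma + Mb)))%R). assert (Hep : (0 < ep)%R) by (apply Rdiv_lt_0_compat; lra).
  destruct (strict_diff l w0 (l1 w0) eta1 ep Heta1 ltac:(intros w Hw; eexists; apply (DL w Hw)) (proj1 (DL w0 Hw00)) Hep) as [d1 [Hd1 S1]].
  destruct (strict_diff k w0 (k1 w0) eta1 ep Heta1 ltac:(intros w Hw; eexists; apply (DL w Hw)) (proj2 (DL w0 Hw00)) Hep) as [d2 [Hd2 S2]].
  assert (Cc : ccont (fun w => Cconj (l (Cconj (Cconj w))) * l1 w0 - Cconj (k (Cconj (Cconj w))) * k1 w0) w0).
  { assert (Cconjc : forall f v, ccont f v -> ccont (fun w => Cconj (f w)) v).
    { intros f v Hf eps Heps. destruct (Hf eps Heps) as [d [Hd H]]. exists d; split; auto. intros w Hw. rewrite <- Cminus_conj, Cmod_conj. auto. }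
    assert (Q1 : ccont (fun w => Cconj (l w) * l1 w0 + (- k1 w0) * Cconj (k w)) w0).
    { apply ccont_plus; apply ccont_mult; try apply ccont_const; apply Cconjc; eapply cder_cont; apply (DL w0 Hw00). }
    intros eps Heps. destruct (Q1 eps Heps) as [d [Hd H]]. exists d; split; auto. intros w Hw. rewrite !Cconj_conj.
    specialize (H w Hw). cbv beta in H.
    replace (Cconj (l w) * l1 w0 - Cconj (k w) * k1 w0 - (Cconj (l w0) * l1 w0 - Cconj (k w0) * k1 w0)) with
     (Cconj (l w) * l1 w0 + - k1 w0 * Cconj (k w) - (Cconj (l w0) * l1 w0 + - k1 w0 * Cconj (k w0))) by ring. auto. }
  destruct (Cc (Cmod c0 / 4)%R ltac:(lra)) as [d3 [Hd3 S3]].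
  set (d4 := Rmin d1 d2). assert (Hd4 : (0 < d4)%R) by (apply Rmin_pos; lra).
  assert (X1 := Rmin_l d1 d2). assert (X2 := Rmin_r d1 d2). fold d4 in X1, X2.
  destruct (C3 d4 Hd4) as [d5 [Hd5 S5]]. rewrite <- Heq in S5.
  set (eta := Rmin (Rmin (Rmin da db) (Rmin d3 d4)) (Rmin d5 eta1)).
  assert (Heta : (0 < eta)%R) by (unfold eta; apply Rmin_pos; [apply Rmin_pos; apply Rmin_pos; lra|apply Rmin_pos; lra]).
  assert (Y1 := Rmin_l (Rmin (Rmin da db) (Rmin d3 d4)) (Rmin d5 eta1)). assert (Y2 := Rmin_r (Rmin (Rmin da db) (Rmin d3 d4)) (Rmin d5 eta1)). fold eta in Y1, Y2.
  assert (Y3 := Rmin_l (Rmin da db) (Rmin d3 d4)). assert (Y4 := Rmin_r (Rmin da db) (Rmin d3 d4)).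
  assert (Y5 := Rmin_l da db). assert (Y6 := Rmin_r da db). assert (Y7 := Rmin_l d3 d4). assert (Y8 := Rmin_r d3 d4).
  assert (Y9 := Rmin_l d5 eta1). assert (Y10 := Rmin_r d5 eta1).
  exists eta. split; auto. split.
  { intros w Hw. destruct (Hb w (InD w ltac:(lra))) as [Z1 [Z3 [Z4 [Z5 [Z6 _]]]]]. auto. }
  intros z w Hz Hw. destruct (Key z w ltac:(lra) ltac:(lra)) as [_ [K1 _]].
  set (W := segre_graph m S (z, w) z) in *.
  assert (Tr : (Cmod z ^ 2 + Cmod (k w) ^ 2 = Cmod (l w) ^ 2)%R <-> z * Cconj z = Cconj (l w) * l w - Cconj (k w) * k w).
  { replace (Cconj (l w) * l w - Cconj (k w) * k w) with (l w * Cconj (l w) - k w * Cconj (k w)) by ring. rewrite !Cmod_sq. split.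
    - intros E. rewrite <- RtoC_minus. f_equal. lra.
    - intros E. rewrite <- RtoC_minus in E. apply RtoC_inj in E. lra. }
  rewrite Tr. split.
  - intros E. rewrite <- E in K1. exact K1.
  - intros E. rewrite E in K1.
    assert (WW : (Cmod (W - w0) < d4)%R) by (apply S5; lra).
    assert (A1 := S1 W w ltac:(lra) ltac:(lra)). assert (A2 := S2 W w ltac:(lra) ltac:(lra)).
    specialize (S3 w ltac:(lra)). cbv beta in S3. rewrite !Cconj_conj in S3. fold c0 in S3.
    specialize (Ha w ltac:(lra)). specialize (Hb' w ltac:(lra)).
    set (c := Cconj (l w) * l1 w0 - Cconj (k w) * k1 w0) in *.
    set (rl := l W - l w - l1 w0 * (W - w)) in *. set (rk := k W - k w - k1 w0 * (W - w)) in *.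
    assert (Z : c * (W - w) = Cconj (k w) * rk - Cconj (l w) * rl).
    { assert (Z0 : Cconj (l w) * (l W - l w) - Cconj (k w) * (k W - k w) = 0).
      { replace (Cconj (l w) * (l W - l w) - Cconj (k w) * (k W - k w)) with ((Cconj (l w) * l W - Cconj (k w) * k W) - (Cconj (l w) * l w - Cconj (k w) * k w)) by ring.
        rewrite <- K1. ring. }
      replace (c * (W - w)) with (Cconj (l w) * (l W - l w) - Cconj (k w) * (k W - k w) + (Cconj (k w) * rk - Cconj (l w) * rl)) by (unfold c, rl, rk; ring).
      rewrite Z0. ring. }
    apply (f_equal Cmod) in Z. rewrite Cmod_mult in Z.
    assert (T1 := Cmod_sub_triangle (Cconj (k w) * rk) (Cconj (l w) * rl)). rewrite !Cmod_mult, !Cmod_conj in T1.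
    set (h := Cmod (W - w)) in *. assert (Hh : (0 <= h)%R) by apply Cmod_ge_0.
    assert (Cl : (3 / 4 * Cmod c0 <= Cmod c)%R). { assert (G := Cmod_ge_sub c0 c). rewrite Cmod_sym in G. lra. }
    assert (G1 : (Cmod (k w) * Cmod rk <= Mb * (ep * h))%R) by (apply Rmult_le_compat; auto; apply Cmod_ge_0).
    assert (G2 : (Cmod (l w) * Cmod rl <= Ma * (ep * h))%R) by (apply Rmult_le_compat; auto; apply Cmod_ge_0).
    assert (G3 : ((Ma + Mb) * ep = Cmod c0 / 4)%R) by (unfold ep; field; lra).
    assert (G4 : (3 / 4 * Cmod c0 * h <= Cmod c * h)%R) by (apply Rmult_le_compat_r; auto).
    assert (G5 : ((Ma + Mb) * ep * h = Cmod c0 / 4 * h)%R) by (rewrite G3; auto).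
    assert (Hh0 : h = 0%R) by (apply Rle_antisym; auto; apply (Rmult_le_reg_l (Cmod c0)); lra).
    apply Cmod_eq_0 in Hh0. replace W with (W - w + w) by ring. rewrite Hh0. ring.
Qed.

Lemma cder2_snd (h : C -> C) (z w c : C) : cder h w c -> cder2 (fun _ w => h w) z w 0 c.
Proof.
  intros H eps He. destruct (H eps He) as [d [Hd H1]]. exists d. split; auto. intros z' w' _ Hw.
  replace (h w' - h w - 0 * (z' - z) - c * (w' - w)) with (h w' - h w - c * (w' - w)) by ring.
  eapply Rle_trans; [apply H1; auto|]. apply Rmult_le_compat_l; [lra|]. assert (0 <= Cmod (z' - z))%R by apply Cmod_ge_0. lra.
Qed.

Lemma open_C2 (U : C * C -> Prop) :
  (forall p, U p -> exists d, (0 < d)%R /\ forall q, (Cmod (fst q - fst p) < d)%R -> (Cmod (snd q - snd p) < d)%R -> U q) -> open U.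
Proof. intros H p Hp. apply (proj2 (locally_C2 p U)). auto. Qed.

Lemma bidisc_open (z0 w0 : C) (a b : R) : forall p : C * C, (Cmod (fst p - z0) < a)%R /\ (Cmod (snd p - w0) < b)%R ->
  exists d, (0 < d)%R /\ forall q : C * C, (Cmod (fst q - fst p) < d)%R -> (Cmod (snd q - snd p) < d)%R -> (Cmod (fst q - z0) < a)%R /\ (Cmod (snd q - w0) < b)%R.
Proof.
  intros p [H1 H2]. exists (Rmin (a - Cmod (fst p - z0)) (b - Cmod (snd p - w0))). split; [apply Rmin_pos; lra|].
  intros q Q1 Q2. assert (A1 := Rlt_le_trans _ _ _ Q1 (Rmin_l _ _)). assert (A2 := Rlt_le_trans _ _ _ Q2 (Rmin_r _ _)). split.
  - replace (fst q - z0) with ((fst q - fst p) + (fst p - z0)) by ring. eapply Rle_lt_trans; [apply Cmod_triangle|]. lra.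
  - replace (snd q - w0) with ((snd q - snd p) + (snd p - w0)) by ring. eapply Rle_lt_trans; [apply Cmod_triangle|]. lra.
Qed.

(** * Sphericity *)

(** If b = 0 the equation forces a = 0, and the Wronskian vanishes. It allows division by l near
    every point of M. *)
Lemma normal_form_nonvanishing (x a b a1 b1 : C) : (Cmod x ^ 2 + Cmod a ^ 2 = Cmod b ^ 2)%R -> b * a1 - b1 * a <> 0 -> b <> 0.
Proof.
  intros H Hw E. subst b. rewrite Cmod_0 in H.
  assert (A := Cmod_ge_0 a). assert (A2 : (0 <= Cmod x ^ 2)%R) by (apply pow_le, Cmod_ge_0).
  assert (Ha : Cmod a = 0%R) by nra. apply Cmod_eq_0 in Ha. apply Hw. rewrite Ha. ring.
Qed.

(** The second coordinate k / l depends on w alone and has derivative Wronskian / l^2, so it is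
    inverted in one variable; the first coordinate is then recovered by multiplication with l. V is
    described through this inverse. *)
Lemma spherical_of_normal_form (M : C * C -> Prop) (z0 w0 : C) (l l1 k k1 : C -> C) (eta : R) : (0 < eta)%R ->
  (forall w, (Cmod (w - w0) < eta)%R -> cder l w (l1 w) /\ cder k w (k1 w) /\ l w * k1 w - l1 w * k w <> 0) ->
  M (z0, w0) ->
  (forall z w, (Cmod (z - z0) < eta)%R -> (Cmod (w - w0) < eta)%R -> (M (z, w) <-> (Cmod z ^ 2 + Cmod (k w) ^ 2 = Cmod (l w) ^ 2)%R)) ->
  spherical_at M (z0, w0).
Proof.
  intros Heta Hlk HM0 HM.
  assert (Z0 : forall v : C, Cmod (v - v) = 0%R) by (intros v; replace (v - v) with (RtoC 0) by ring; apply Cmod_0).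
  assert (Hw00 : (Cmod (w0 - w0) < eta)%R) by (rewrite Z0; auto). assert (Hz00 : (Cmod (z0 - z0) < eta)%R) by (rewrite Z0; auto).
  destruct (Hlk w0 Hw00) as [Dl [Dk Wr0]].
  assert (Hl0 : l w0 <> 0) by (eapply normal_form_nonvanishing; [apply HM; eauto|exact Wr0]).
  destruct (cder_cont _ _ _ Dl (Cmod (l w0))) as [d1 [Hd1 H1]]; [apply Cmod_gt_0; auto|].
  set (eta1 := Rmin eta d1). assert (Heta1 : (0 < eta1)%R) by (apply Rmin_pos; auto).
  assert (L1 := Rmin_l eta d1). assert (L2 := Rmin_r eta d1). fold eta1 in L1, L2.
  assert (Hln : forall w, (Cmod (w - w0) < eta1)%R -> l w <> 0).
  { intros w Hw E. specialize (H1 w ltac:(lra)). rewrite E in H1. replace (0 - l w0) with (- l w0) in H1 by ring. rewrite Cmod_opp in H1. lra. }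
  set (q := fun w => k w / l w).
  assert (Dq : forall w, (Cmod (w - w0) < eta1)%R -> cder q w ((k1 w * l w - k w * l1 w) / (l w * l w))).
  { intros w Hw. destruct (Hlk w ltac:(lra)) as [A1 [A2 _]]. apply cder_div; auto. }
  destruct (local_inverse q w0 _ eta1 Heta1 ltac:(intros w Hw; eexists; apply Dq; auto) (Dq w0 ltac:(rewrite Z0; auto))) as [eta2 [inv [V2 [He2 [HV1 HV2]]]]].
  { intros E. apply Wr0. replace (l w0 * k1 w0 - l1 w0 * k w0) with ((k1 w0 * l w0 - k w0 * l1 w0) / (l w0 * l w0) * (l w0 * l w0)) by (field; auto). rewrite E. ring. }
  exists (fun p => (Cmod (fst p - z0) < eta)%R /\ (Cmod (snd p - w0) < eta2)%R).
  exists (fun p => V2 (snd p) /\ (Cmod (fst p * l (inv (snd p)) - z0) < eta)%R).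
  exists (fun p => (fst p / l (snd p), k (snd p) / l (snd p))).
  exists (fun p => (fst p * l (inv (snd p)), inv (snd p))).
  cbv zeta.
  assert (Dli : forall v, V2 v -> exists c, cder (fun v => l (inv v)) v c).
  { intros v Hv. destruct (HV2 v Hv) as [A1 [_ [[c Hc] _]]]. destruct (Hlk (inv v) ltac:(lra)) as [B1 _]. eexists. apply (cder_comp l inv); eauto. }
  split; [|split; [|split; [|split; [|split; [|split; [|split; [|split]]]]]]].
  - apply open_C2. apply bidisc_open.
  - apply open_C2. intros [Z v] [Hv Hz]. simpl fst in *; simpl snd in *.
    destruct (HV2 v Hv) as [_ [_ [_ [da [Hda Ha]]]]]. destruct (Dli v Hv) as [c Hc].
    destruct (cder2_ccont2 _ _ _ _ _ (cder2_fst_mult (fun v => l (inv v)) Z v c Hc) (eta - Cmod (Z * l (inv v) - z0))%R ltac:(lra)) as [db [Hdb Hb]].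
    exists (Rmin da db). split; [apply Rmin_pos; auto|]. intros [Z' v'] Q1 Q2. simpl fst in *; simpl snd in *. split.
    + apply Ha. eapply Rlt_le_trans; [exact Q2|apply Rmin_l].
    + specialize (Hb Z' v' (Rlt_le_trans _ _ _ Q1 (Rmin_r _ _)) (Rlt_le_trans _ _ _ Q2 (Rmin_r _ _))).
      replace (Z' * l (inv v') - z0) with ((Z' * l (inv v') - Z * l (inv v)) + (Z * l (inv v) - z0)) by ring.
      eapply Rle_lt_trans; [apply Cmod_triangle|]. lra.
  - simpl fst; simpl snd. rewrite !Z0. split; lra.
  - exact HM0.
  - intros [z w] [Hz Hw]. simpl in Hz, Hw. destruct (Hlk w ltac:(lra)) as [A1 [A2 _]]. assert (A3 := Hln w ltac:(lra)).
    apply (ex_filterdiff_pair (fun p => fst p / l (snd p)) (fun p => k (snd p) / l (snd p))).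
    + eapply cder2_ex_filterdiff. apply (cder2_fst_mult (fun w => / l w)). apply cder_inv; eauto.
    + eapply cder2_ex_filterdiff. apply (cder2_snd q). apply Dq. lra.
  - intros [Z v] [Hv _]. simpl in Hv. destruct (Dli v Hv) as [c Hc]. destruct (HV2 v Hv) as [_ [_ [[c' Hc'] _]]].
    apply (ex_filterdiff_pair (fun p => fst p * l (inv (snd p))) (fun p => inv (snd p))).
    + eapply cder2_ex_filterdiff. apply (cder2_fst_mult (fun v => l (inv v))). eauto.
    + eapply cder2_ex_filterdiff. apply (cder2_snd inv). eauto.
  - intros [z w] [Hz Hw]. simpl fst in *; simpl snd in *. destruct (HV1 w Hw) as [B1 B2]. fold (q w). rewrite B2.
    assert (A3 := Hln w ltac:(lra)).
    replace (z / l w * l w) with z by (field; auto). split; auto.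
  - intros [Z v] [Hv Hz]. simpl fst in *; simpl snd in *. destruct (HV2 v Hv) as [B1 [B2 _]].
    assert (A3 := Hln (inv v) ltac:(lra)). split; [split; auto|].
    fold (q (inv v)). rewrite B2. f_equal. field. auto.
  - intros [z w] [Hz Hw]. simpl fst in *; simpl snd in *. rewrite (HM z w) by lra. assert (A3 := Hln w ltac:(lra)).
    unfold unit_sphere. simpl fst; simpl snd. rewrite !Cmod_div by auto. assert (A4 := proj1 (Cmod_gt_0 _) A3).
    replace ((Cmod z / Cmod (l w)) ^ 2 + (Cmod (k w) / Cmod (l w)) ^ 2)%R with ((Cmod z ^ 2 + Cmod (k w) ^ 2) / Cmod (l w) ^ 2)%R by (field; lra).
    split.
    + intros ->. field. lra.
    + intros E. replace (Cmod z ^ 2 + Cmod (k w) ^ 2)%R with ((Cmod z ^ 2 + Cmod (k w) ^ 2) / Cmod (l w) ^ 2 * Cmod (l w) ^ 2)%R by (field; lra). rewrite E. ring.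
Qed.

(** * Levi form *)

Lemma pcont_Re_continuous (F : C * C -> C) (f : C * C -> R) (p : C * C) (d : R) : (0 < d)%R -> pcont F p ->
  (forall q, (Cmod (fst q - fst p) < d)%R -> (Cmod (snd q - snd p) < d)%R -> f q = Re (F q)) -> continuous f p.
Proof.
  intros Hd H E P [e He]. apply (proj2 (locally_C2 p (fun q => P (f q)))).
  destruct (H e (cond_pos e)) as [d' [Hd' H']]. exists (Rmin d d'). split; [apply Rmin_pos; auto|]. intros q Q1 Q2.
  apply He. rewrite (E q (Rlt_le_trans _ _ _ Q1 (Rmin_l _ _)) (Rlt_le_trans _ _ _ Q2 (Rmin_l _ _))).
  assert (Ep : f p = Re (F p)). { apply E; [replace (fst p - fst p) with (RtoC 0) by ring|replace (snd p - snd p) with (RtoC 0) by ring]; rewrite Cmod_0; auto. }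
  rewrite Ep.
  specialize (H' q (Rlt_le_trans _ _ _ Q1 (Rmin_r _ _)) (Rlt_le_trans _ _ _ Q2 (Rmin_r _ _))).
  eapply Rle_lt_trans; [|exact H']. eapply Rle_trans; [|apply re_le_Cmod]. right; reflexivity.
Qed.

Lemma rder_conj (f : R -> C) (t : R) (c : C) : rder f t c -> rder (fun s => Cconj (f s)) t (Cconj c).
Proof. intros [A B]. split; simpl; auto. apply (is_derive_opp (V := R_NormedModule)) in B. exact B. Qed.

Lemma rder_ext_loc (f g : R -> C) (t : R) (c : C) (d : R) : (0 < d)%R -> (forall s, (Rabs (s - t) < d)%R -> f s = g s) -> rder f t c -> rder g t c.
Proof.
  intros Hd E [A B]. split; (eapply is_derive_ext_loc; [|eassumption]); exists (mkposreal d Hd); intros s Hs; simpl; rewrite E; auto.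
Qed.

Lemma CDdir_rder (v : C * C) (f : C * C -> C) (p : C * C) (c : C) : rder (fun t => f (line p v t)) 0 c -> CDdir v f p = c.
Proof. intros [A B]. unfold CDdir, Ddir. apply C_eq; simpl; apply is_derive_unique; auto. Qed.

Lemma line_near (p v : C * C) (d : R) : (0 < d)%R -> exists e, (0 < e)%R /\ forall t, (Rabs (t - 0) < e)%R ->
  (Cmod (fst (line p v t) - fst p) < d)%R /\ (Cmod (snd (line p v t) - snd p) < d)%R.
Proof.
  intros Hd. assert (A := Cmod_ge_0 (fst v)). assert (B := Cmod_ge_0 (snd v)).
  set (N := (Cmod (fst v) + Cmod (snd v) + 1)%R). exists (d / N)%R. split; [apply Rdiv_lt_0_compat; unfold N; lra|].
  intros t Ht. rewrite Rminus_0_r in Ht. apply (Rmult_lt_compat_r N) in Ht; [|unfold N; lra].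
  replace (d / N * N)%R with d in Ht by (field; unfold N; lra). assert (T := Rabs_pos t). unfold line; simpl fst; simpl snd.
  replace (fst p + t * fst v - fst p) with (t * fst v) by ring. replace (snd p + t * snd v - snd p) with (t * snd v) by ring.
  rewrite !Cmod_mult, Cmod_R. unfold N in Ht. split; nra.
Qed.

Section Levi.
Variables (l l1 l2 k k1 k2 : C -> C) (z0 w0 : C) (eta : R).
Hypothesis Heta : (0 < eta)%R.
Hypothesis Hlk : forall w, (Cmod (w - w0) < eta)%R ->
  cder l w (l1 w) /\ cder l1 w (l2 w) /\ ccont l2 w /\ cder k w (k1 w) /\ cder k1 w (k2 w) /\ ccont k2 w.

Let U (q : C * C) : Prop := (Cmod (fst q - z0) < eta)%R /\ (Cmod (snd q - w0) < eta)%R.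
Let phi (q : C * C) : R := (Cmod (fst q) ^ 2 + Cmod (k (snd q)) ^ 2 - Cmod (l (snd q)) ^ 2)%R.
(** [G v q] is the (1,0)-derivative of phi at q in direction v (half of a real derivative is its
    real part's double: see [levi_D1] and [levi_del]), and [HG s t q] is the real derivative of
    [G s] in direction t. *)
Let G (v q : C * C) : C := Cconj (fst q) * fst v + (Cconj (k (snd q)) * k1 (snd q) - Cconj (l (snd q)) * l1 (snd q)) * snd v.
Let HG (s t q : C * C) : C := Cconj (fst t) * fst s +
  (Cconj (k1 (snd q) * snd t) * k1 (snd q) + Cconj (k (snd q)) * (k2 (snd q) * snd t)
   - (Cconj (l1 (snd q) * snd t) * l1 (snd q) + Cconj (l (snd q)) * (l2 (snd q) * snd t))) * snd s.

Lemma levi_U_open (p : C * C) : U p -> exists d, (0 < d)%R /\ forall q, (Cmod (fst q - fst p) < d)%R -> (Cmod (snd q - snd p) < d)%R -> U q.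
Proof. apply bidisc_open. Qed.

Lemma levi_phi_Re (q : C * C) : phi q = Re (fst q * Cconj (fst q) + k (snd q) * Cconj (k (snd q)) + - (1) * (l (snd q) * Cconj (l (snd q)))).
Proof. rewrite !Cmod_sq. unfold phi. simpl. unfold Re. simpl. ring. Qed.

Lemma levi_rder_comp (h h1 : C -> C) (p v : C * C) : cder h (snd p) (h1 (snd p)) -> rder (fun t => h (snd (line p v t))) 0 (h1 (snd p) * snd v).
Proof.
  intros H. apply (rder_comp h (fun t => snd (line p v t))).
  - unfold line; simpl. replace (snd p + 0 * snd v) with (snd p) by ring. exact H.
  - unfold line; simpl. eapply rder_eq; [apply rder_plus; [apply rder_const|apply rder_mult; [apply rder_id|apply rder_const]]|]. cbv beta. ring.
Qed.

Lemma levi_rder_fst (p v : C * C) : rder (fun t => fst (line p v t)) 0 (fst v).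
Proof. unfold line; simpl. eapply rder_eq; [apply rder_plus; [apply rder_const|apply rder_mult; [apply rder_id|apply rder_const]]|]. cbv beta. ring. Qed.

Lemma line_0 (p v : C * C) : line p v 0 = p.
Proof. unfold line. destruct p as [a b]; simpl. f_equal; ring. Qed.

Lemma levi_D1 (v q : C * C) : U q -> is_derive (fun t => phi (line q v t)) 0%R (2 * Re (G v q))%R.
Proof.
  intros [_ Hw]. destruct (Hlk _ Hw) as [A1 [_ [_ [A4 _]]]].
  apply (is_derive_ext (fun t => Re (fst (line q v t) * Cconj (fst (line q v t)) + k (snd (line q v t)) * Cconj (k (snd (line q v t))) + - (1) * (l (snd (line q v t)) * Cconj (l (snd (line q v t))))))).
  { intros t. symmetry. apply levi_phi_Re. }
  assert (R1 := levi_rder_fst q v). assert (R2 := levi_rder_comp k k1 q v A4). assert (R3 := levi_rder_comp l l1 q v A1).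
  assert (T := rder_plus _ _ _ _ _ (rder_plus _ _ _ _ _ (rder_mult _ _ _ _ _ R1 (rder_conj _ _ _ R1)) (rder_mult _ _ _ _ _ R2 (rder_conj _ _ _ R2)))
    (rder_mult _ _ _ _ _ (rder_const (- (1)) 0%R) (rder_mult _ _ _ _ _ R3 (rder_conj _ _ _ R3)))).
  destruct T as [T _]. evar_last; [exact T|]. rewrite !line_0. unfold G.
  generalize (k (snd q)), (k1 (snd q)), (l (snd q)), (l1 (snd q)). intros x y a b. destruct (fst q), (fst v), (snd v), x, y, a, b. unfold Re; simpl. ring.
Qed.

Lemma levi_D2 (s t q : C * C) : U q -> rder (fun x => G s (line q t x)) 0 (HG s t q).
Proof.
  intros [_ Hw]. destruct (Hlk _ Hw) as [A1 [A2 [_ [A4 [A5 _]]]]].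
  assert (R1 := levi_rder_fst q t). assert (R2 := levi_rder_comp k k1 q t A4). assert (R3 := levi_rder_comp l l1 q t A1).
  assert (R4 := levi_rder_comp k1 k2 q t A5). assert (R5 := levi_rder_comp l1 l2 q t A2).
  assert (T := rder_plus _ _ _ _ _ (rder_mult _ _ _ _ _ (rder_conj _ _ _ R1) (rder_const (fst s) 0%R))
    (rder_mult _ _ _ _ _ (rder_plus _ _ _ _ _ (rder_mult _ _ _ _ _ (rder_conj _ _ _ R2) R4)
       (rder_mult _ _ _ _ _ (rder_const (- (1)) 0%R) (rder_mult _ _ _ _ _ (rder_conj _ _ _ R3) R5))) (rder_const (snd s) 0%R))).
  eapply (rder_ext_loc _ _ _ _ 1); [lra| |eapply rder_eq; [exact T|]].
  - intros x _. unfold G. cbv beta. ring.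
  - cbv beta. rewrite !line_0. unfold HG. ring.
Qed.

Lemma levi_Ddir (v q : C * C) : U q -> Ddir v phi q = (2 * Re (G v q))%R.
Proof. intros H. apply is_derive_unique. apply levi_D1; auto. Qed.

Lemma levi_D2' (u v q : C * C) : U q -> is_derive (fun t => Ddir u phi (line q v t)) 0%R (2 * Re (HG u v q))%R.
Proof.
  intros H. destruct (levi_U_open q H) as [d [Hd Hq]]. destruct (line_near q v d Hd) as [e [He Hl]].
  apply (is_derive_ext_loc (fun t => 2 * Re (G u (line q v t)))%R).
  - exists (mkposreal e He). intros t Ht. symmetry. apply levi_Ddir. apply Hq; apply Hl; exact Ht.
  - apply (is_derive_scal (fun t => Re (G u (line q v t))) 0%R 2 (Re (HG u v q))). apply (levi_D2 u v q H).
Qed.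

Lemma levi_C2_on : C2_on U phi.
Proof.
  intros u v p Hp. destruct (levi_U_open p Hp) as [d [Hd Hq]]. destruct Hp as [Hpz Hpw].
  destruct (Hlk _ Hpw) as [A1 [A2 [A3 [A4 [A5 A6]]]]].
  assert (Ck := cder_cont _ _ _ A4). assert (Cl := cder_cont _ _ _ A1). assert (Ck1 := cder_cont _ _ _ A5). assert (Cl1 := cder_cont _ _ _ A2).
  assert (Pk := pcont_snd k p Ck). assert (Pl := pcont_snd l p Cl). assert (Pk1 := pcont_snd k1 p Ck1). assert (Pl1 := pcont_snd l1 p Cl1).
  assert (Pk2 := pcont_snd k2 p A6). assert (Pl2 := pcont_snd l2 p A3). assert (Pf := pcont_fst p).
  split; [|split; [|split; [|split]]].
  - apply (pcont_Re_continuous _ phi p 1 ltac:(lra)) with (2 := fun q _ _ => levi_phi_Re q).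
    apply pcont_plus; [apply pcont_plus; (apply pcont_mult; [|apply pcont_conj]; assumption)|].
    apply pcont_mult; [apply pcont_const|]. apply pcont_mult; [|apply pcont_conj]; assumption.
  - eexists. apply levi_D1. split; auto.
  - apply (pcont_Re_continuous (fun q => RtoC 2 * (Cconj (fst q) * fst u + (Cconj (k (snd q)) * k1 (snd q) + - (1) * (Cconj (l (snd q)) * l1 (snd q))) * snd u)) _ p d Hd).
    + apply pcont_mult; [apply pcont_const|]. apply pcont_plus; [apply pcont_mult; [apply pcont_conj; assumption|apply pcont_const]|].
      apply pcont_mult; [|apply pcont_const]. apply pcont_plus; [apply pcont_mult; [apply pcont_conj|]; assumption|].
      apply pcont_mult; [apply pcont_const|]. apply pcont_mult; [apply pcont_conj|]; assumption.
    + intros q Q1 Q2. rewrite levi_Ddir by auto. unfold G.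
      replace (Cconj (k (snd q)) * k1 (snd q) - Cconj (l (snd q)) * l1 (snd q)) with (Cconj (k (snd q)) * k1 (snd q) + - (1) * (Cconj (l (snd q)) * l1 (snd q))) by ring.
      match goal with |- (2 * Re ?X)%R = _ => generalize X end. intros X. destruct X; unfold Re; simpl. ring.
  - eexists. apply levi_D2'. split; auto.
  - apply (pcont_Re_continuous (fun q => RtoC 2 * (Cconj (fst v) * fst u +
       (Cconj (k1 (snd q) * snd v) * k1 (snd q) + Cconj (k (snd q)) * (k2 (snd q) * snd v)
        + - (1) * (Cconj (l1 (snd q) * snd v) * l1 (snd q) + Cconj (l (snd q)) * (l2 (snd q) * snd v))) * snd u)) _ p d Hd).
    + apply pcont_mult; [apply pcont_const|]. apply pcont_plus; [apply pcont_const|]. apply pcont_mult; [|apply pcont_const].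
      apply pcont_plus; [|apply pcont_mult; [apply pcont_const|]]; apply pcont_plus;
      repeat (first [apply pcont_const | assumption | apply pcont_mult | apply pcont_conj]).
    + intros q Q1 Q2. transitivity (2 * Re (HG u v q))%R; [exact (is_derive_unique _ _ _ (levi_D2' u v q (Hq q Q1 Q2)))|]. unfold HG.
      match goal with |- (2 * Re (?a + (?b - ?c) * ?d))%R = _ => replace (a + (b - c) * d) with (a + (b + - (1) * c) * d) by ring end.
      match goal with |- (2 * Re ?X)%R = _ => generalize X end. intros X. destruct X; unfold Re; simpl. ring.
Qed.

Lemma levi_CDdir (v q : C * C) : U q -> CDdir v (fun q => RtoC (phi q)) q = RtoC (2 * Re (G v q)).
Proof.
  intros H. apply CDdir_rder. split; simpl; [apply levi_D1; auto|apply @is_derive_const].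
Qed.

Lemma levi_G_imul (v q : C * C) : G (imul v) q = Ci * G v q.
Proof. unfold G, imul; simpl. ring. Qed.

Lemma levi_del (v q : C * C) : U q -> del v (fun q => RtoC (phi q)) q = G v q.
Proof.
  intros H. unfold del. rewrite !levi_CDdir, levi_G_imul by auto. generalize (G v q). intros x.
  assert (E : RtoC (2 * Re x) - Ci * RtoC (2 * Re (Ci * x)) = x * 2) by (apply C_eq; destruct x; unfold Re; simpl; ring).
  rewrite E. field.
Qed.

Lemma levi_delbar (v q : C * C) : U q -> delbar v (fun q => RtoC (phi q)) q = Cconj (G v q).
Proof.
  intros H. unfold delbar. rewrite !levi_CDdir, levi_G_imul by auto. generalize (G v q). intros x.
  assert (E : RtoC (2 * Re x) + Ci * RtoC (2 * Re (Ci * x)) = Cconj x * 2) by (apply C_eq; destruct x; unfold Re; simpl; ring).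
  rewrite E. field.
Qed.

(** Only the part of the conjugated [HG] that is complex linear in t survives the combination of
    directions t and i t; the terms with k2 and l2 are antilinear in t and drop out. *)
Lemma levi_form_eq (t s p : C * C) : U p -> levi_form (fun q => RtoC (phi q)) p t s =
  fst t * Cconj (fst s) + (k1 (snd p) * snd t * Cconj (k1 (snd p) * snd s) - l1 (snd p) * snd t * Cconj (l1 (snd p) * snd s)).
Proof.
  intros H. destruct (levi_U_open p H) as [d [Hd Hq]].
  assert (D : forall v, CDdir v (delbar s (fun q => RtoC (phi q))) p = Cconj (HG s v p)).
  { intros v. destruct (line_near p v d Hd) as [e [He Hl]]. apply CDdir_rder.
    apply (rder_ext_loc (fun t => Cconj (G s (line p v t))) _ _ _ e He); [|apply rder_conj, levi_D2; auto].
    intros x Hx. symmetry. apply levi_delbar. apply Hq; apply Hl; exact Hx. }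
  unfold levi_form. unfold del at 1. rewrite !D. unfold HG, imul; simpl fst; simpl snd.
  repeat rewrite ?Cplus_conj, ?Cminus_conj, ?Cmult_conj, ?Cconj_conj, ?Cconj_Ci.
  assert (CC : Ci * Ci = - (1)) by (apply C_eq; simpl; ring).
  replace (Cconj (- Ci)) with Ci by (apply C_eq; simpl; ring).
  match goal with |- (?a - ?b) / RtoC 2 = ?r => assert (E : a - b = r * 2); [|rewrite E; field] end.
  match goal with |- ?a - Ci * ?b = ?r * RtoC 2 => assert (E2 : Ci * b = a + - (1) * (r * 2)); [|rewrite E2; ring] end.
  generalize (fst t) (Cconj (fst s)) (k1 (snd p)) (Cconj (k1 (snd p))) (l1 (snd p)) (Cconj (l1 (snd p))) (snd t) (Cconj (snd t)) (Cconj (snd s)) (k (snd p)) (l (snd p)) (Cconj (k2 (snd p))) (Cconj (l2 (snd p))).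
  intros a b c c' e e' g g' h x y x2 y2.
  match goal with |- ?lhs = ?rhs => replace lhs with ((Ci * Ci) * (a * b + (c * g * c' * h - e * g * e' * h)) + (- (Ci * Ci)) * (x * x2 * g' * h - y * y2 * g' * h)) by ring end.
  rewrite CC. ring.
Qed.

(** Taking s = t, a tangent vector with zero Levi form is a case of equality in the Cauchy-Schwarz
    inequality. Proportionality then makes the Wronskian times the second component of t vanish, and
    t = 0 follows. *)
Lemma levi_nondegenerate_of_normal_form (M : C * C -> Prop) : M (z0, w0) -> l w0 * k1 w0 - l1 w0 * k w0 <> 0 ->
  (forall z w, (Cmod (z - z0) < eta)%R -> (Cmod (w - w0) < eta)%R -> (M (z, w) <-> (Cmod z ^ 2 + Cmod (k w) ^ 2 = Cmod (l w) ^ 2)%R)) ->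
  levi_nondegenerate_at M (z0, w0).
Proof.
  intros HM0 HW HM.
  assert (U0 : U (z0, w0)).
  { unfold U; simpl fst; simpl snd. replace (z0 - z0) with (RtoC 0) by ring. replace (w0 - w0) with (RtoC 0) by ring. rewrite Cmod_0. auto. }
  assert (E0 : (Cmod z0 ^ 2 + Cmod (k w0) ^ 2 = Cmod (l w0) ^ 2)%R) by (apply HM; try apply U0; auto).
  assert (Hl0 := normal_form_nonvanishing _ _ _ _ _ E0 HW).
  assert (E1 : z0 * Cconj z0 + k w0 * Cconj (k w0) = l w0 * Cconj (l w0)) by (rewrite !Cmod_sq, <- RtoC_plus, E0; auto).
  exists U, phi. cbv zeta. split; [|split; [|split; [|split; [|split; [|split]]]]].
  - apply open_C2, levi_U_open.
  - auto.
  - apply levi_C2_on.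
  - intros [z w] [Hz Hw]. simpl in Hz, Hw. rewrite HM by auto. unfold phi; simpl fst; simpl snd. split; intros; lra.
  (* The derivative of phi is 2 Re G and G is complex linear in v, so v or i v is a direction in
     which it does not vanish. *)
  - assert (Hv : exists v, G v (z0, w0) <> 0).
    { destruct (Ceq_dec z0 0) as [Ez|Hz].
      - exists (RtoC 0, RtoC 1). unfold G; simpl fst; simpl snd. intros Z.
        assert (Z' : Cconj (k w0) * k1 w0 = Cconj (l w0) * l1 w0).
        { replace (Cconj (k w0) * k1 w0) with (Cconj z0 * 0 + (Cconj (k w0) * k1 w0 - Cconj (l w0) * l1 w0) * 1 + Cconj (l w0) * l1 w0) by ring. rewrite Z. ring. }
        rewrite Ez in E1. 
        assert (X : Cconj (k w0) * (l w0 * k1 w0 - l1 w0 * k w0) = 0).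
        { replace (Cconj (k w0) * (l w0 * k1 w0 - l1 w0 * k w0)) with (l w0 * (Cconj (k w0) * k1 w0) - l1 w0 * (0 * Cconj 0 + k w0 * Cconj (k w0))) by ring.
          rewrite Z', E1. ring. }
        apply Cmult_integral in X. destruct X as [X|X]; [|contradiction].
        rewrite X in E1. assert (Y : l w0 * Cconj (l w0) = 0) by (rewrite <- E1; ring).
        apply Cmult_integral in Y. destruct Y as [Y|Y]; [contradiction|]. apply (Cconj_neq0 _ Hl0); auto.
      - exists (RtoC 1, RtoC 0). unfold G; simpl fst; simpl snd. intros Z. apply (Cconj_neq0 _ Hz). rewrite <- Z. ring. }
    destruct Hv as [v Hv]. destruct (Req_dec (Re (G v (z0, w0))) 0) as [Er|Hr].
    + exists (imul v). rewrite levi_Ddir, levi_G_imul by auto. intros Z. apply Hv.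
      revert Er Z. generalize (G v (z0, w0)). intros x. destruct x as [a b]. unfold Re; simpl. intros -> Z. apply C_eq; simpl; lra.
    + exists v. rewrite levi_Ddir by auto. lra.
  - auto.
  - intros t Ht HG0. rewrite levi_del in HG0 by auto. exists t. split; [rewrite levi_del; auto|].
    rewrite levi_form_eq by auto. simpl fst; simpl snd.
    unfold G in HG0; simpl fst in HG0; simpl snd in HG0.
    set (x' := fst t) in *. set (a' := k1 w0 * snd t). set (b' := l1 w0 * snd t).
    assert (T1 : Cconj z0 * x' + Cconj (k w0) * a' = Cconj (l w0) * b').
    { replace (Cconj (l w0) * b') with (Cconj z0 * x' + (Cconj (k w0) * k1 w0 - Cconj (l w0) * l1 w0) * snd t + Cconj (l w0) * b' - 0) by (rewrite HG0; ring).
      unfold a', b'. ring. }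
    intros L0.
    assert (T1c : z0 * Cconj x' + k w0 * Cconj a' = l w0 * Cconj b').
    { apply (f_equal Cconj) in T1. rewrite Cplus_conj, !Cmult_conj, !Cconj_conj in T1. exact T1. }
    set (D := z0 * a' - k w0 * x').
    assert (DD : D * Cconj D = 0).
    { unfold D. rewrite Cminus_conj, !Cmult_conj.
      (* Lagrange's identity *)
      replace ((z0 * a' - k w0 * x') * (Cconj z0 * Cconj a' - Cconj (k w0) * Cconj x')) with
       ((z0 * Cconj z0 + k w0 * Cconj (k w0)) * (x' * Cconj x' + (a' * Cconj a' - b' * Cconj b') + b' * Cconj b') -
        (Cconj z0 * x' + Cconj (k w0) * a') * (z0 * Cconj x' + k w0 * Cconj a')) by ring.
      fold a' b' in L0. rewrite L0, E1, T1, T1c. ring. }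
    assert (D0 : D = 0). { apply Cmult_integral in DD. destruct DD as [|DD]; auto. rewrite <- (Cconj_conj D), DD. apply C_eq; simpl; ring. }
    assert (K0 : l w0 * a' = b' * k w0).
    { assert (X : Cconj (l w0) * (l w0 * a' - b' * k w0) = 0).
      { replace (Cconj (l w0) * (l w0 * a' - b' * k w0)) with (l w0 * Cconj (l w0) * a' - k w0 * (Cconj (l w0) * b')) by ring.
        rewrite <- E1, <- T1. replace ((z0 * Cconj z0 + k w0 * Cconj (k w0)) * a' - k w0 * (Cconj z0 * x' + Cconj (k w0) * a')) with (Cconj z0 * D) by (unfold D; ring).
        rewrite D0. ring. }
      apply Cmult_integral in X. destruct X as [X|X]; [exfalso; apply (Cconj_neq0 _ Hl0); auto|].
      replace (l w0 * a') with (l w0 * a' - b' * k w0 + b' * k w0) by ring. rewrite X. ring. }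
    assert (S0 : snd t = 0).
    { assert (X : (l w0 * k1 w0 - l1 w0 * k w0) * snd t = 0).
      { replace ((l w0 * k1 w0 - l1 w0 * k w0) * snd t) with (l w0 * a' - b' * k w0) by (unfold a', b'; ring). rewrite K0. ring. }
      apply Cmult_integral in X. destruct X; [contradiction|auto]. }
    apply Ht. destruct t as [t1 t2]. simpl in S0, x'. f_equal; auto.
    assert (A0 : a' = 0) by (unfold a'; simpl; rewrite S0; ring). assert (B0 : b' = 0) by (unfold b'; simpl; rewrite S0; ring).
    fold a' b' in L0. rewrite A0, B0 in L0.
    assert (X : x' * Cconj x' = 0) by (rewrite <- L0; ring).
    apply Cmult_integral in X. destruct X as [X|X]; [exact X|]. change (x' = 0). rewrite <- (Cconj_conj x'), X. apply C_eq; simpl; ring.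
Qed.
End Levi.

(** * Nondegeneracy and sphericity of an associated hypersurface *)

(** On the diagonal (xi, eta) = (z, w) the two descriptions by [rho] coincide, so [rho] disappears
    and M is the set of points lying on their own Segre curve. *)
Lemma segre_family_hypersurface (m : nat) (M : C * C -> Prop) (S : positive_segre_family) : is_segre_family_of M (segre_variety m S) ->
  exists e, (0 < e)%R /\ forall z w, (Cmod z < e)%R -> (Cmod w < e)%R -> (M (z, w) <-> w = segre_graph m S (z, w) z).
Proof.
  intros [rho [e [He [_ [H1 H2]]]]]. assert (D0 := sf_delta_pos S). assert (E0 := sf_eps_pos S).
  exists (Rmin e (Rmin (sf_delta S) (sf_eps S))). split; [apply Rmin_pos; auto; apply Rmin_pos; auto|].
  intros z w Hz Hw. assert (A1 := Rlt_le_trans _ _ _ Hz (Rmin_l _ _)). assert (A2 := Rlt_le_trans _ _ _ Hw (Rmin_l _ _)).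
  assert (A3 := Rlt_le_trans _ _ _ Hz (Rmin_r _ _)). assert (A4 := Rlt_le_trans _ _ _ Hw (Rmin_r _ _)).
  assert (A5 := Rlt_le_trans _ _ _ A3 (Rmin_l _ _)). assert (A6 := Rlt_le_trans _ _ _ A4 (Rmin_r _ _)).
  rewrite (H1 z w A1 A2), <- (H2 z w z w A1 A2 A1 A2). unfold segre_variety, cdisc; simpl. tauto.
Qed.

(** Supplies the continuity of the second derivatives of l and k, which [C2_on] demands. *)
Lemma ode_coef_cont (m : nat) (r : R) (P Q l l1 : C -> C) (w : C) : hol r P -> hol r Q -> (Cmod w < r)%R -> w <> 0 -> lin_sol m P Q l l1 w ->
  ccont (fun w => P w / w ^ m * l1 w + Q w / w ^ (2 * m) * l w) w.
Proof.
  intros HP HQ Hw Hw0 [L1 L2].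
  assert (CP := hol_ccont P r w HP Hw). assert (CQ := hol_ccont Q r w HQ Hw).
  assert (Cp : forall n, ccont (fun w => / w ^ n) w).
  { intros n. apply ccont_inv; [eapply cder_cont, cder_Cpow|apply Cpow_nz; auto]. }
  apply ccont_plus; apply ccont_mult; try (eapply cder_cont; eassumption); apply ccont_mult; auto.
Qed.

Lemma nondegenerate_and_spherical (m : nat) (r : R) (P Q A A' B : C -> C) (M : C * C -> Prop) : (1 <= m)%nat -> (0 < r)%R -> hol r P -> hol r Q ->
  real_form m r P Q A A' B -> associated_hypersurface m r P Q M ->
  exists e : R, (0 < e)%R /\
       forall z w : C, cdisc e z -> cdisc e w -> M (z, w) -> w <> RtoC 0 ->
         levi_nondegenerate_at M (z, w) /\ spherical_at M (z, w).
Proof.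
  intros Hm Hr HP HQ HR [_ [S [HS HF]]].
  destruct (segre_family_hypersurface m M S HF) as [e1 [He1 HM]].
  destruct (normal_form m r P Q A A' B S Hm Hr HP HQ HR HS) as [e2 [He2 [_ [_ HN]]]].
  exists (Rmin e1 e2). split; [apply Rmin_pos; auto|]. unfold cdisc. intros z0 w0 Hz Hw HM0 Hw0.
  assert (A1 := Rlt_le_trans _ _ _ Hz (Rmin_l _ _)). assert (A2 := Rlt_le_trans _ _ _ Hw (Rmin_l _ _)).
  assert (A3 := Rlt_le_trans _ _ _ Hz (Rmin_r _ _)). assert (A4 := Rlt_le_trans _ _ _ Hw (Rmin_r _ _)).
  destruct (HN z0 w0 A3 A4 Hw0) as [l [l1 [k [k1 [eta [Heta [Hb Heq]]]]]]]; [apply HM; auto|].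
  set (eta' := Rmin eta (Rmin (e1 - Cmod z0) (e1 - Cmod w0))).
  assert (Heta' : (0 < eta')%R) by (apply Rmin_pos; auto; apply Rmin_pos; lra).
  assert (B1 := Rmin_l eta (Rmin (e1 - Cmod z0) (e1 - Cmod w0))). assert (B2 := Rmin_r eta (Rmin (e1 - Cmod z0) (e1 - Cmod w0))). fold eta' in B1, B2.
  assert (B3 := Rmin_l (e1 - Cmod z0) (e1 - Cmod w0)). assert (B4 := Rmin_r (e1 - Cmod z0) (e1 - Cmod w0)).
  assert (HM' : forall z w, (Cmod (z - z0) < eta')%R -> (Cmod (w - w0) < eta')%R -> (M (z, w) <-> (Cmod z ^ 2 + Cmod (k w) ^ 2 = Cmod (l w) ^ 2)%R)).
  { intros z w Hz' Hw'. rewrite HM; [apply Heq; lra| |].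
    - assert (T := Cmod_triangle (z - z0) z0). replace (z - z0 + z0) with z in T by ring. lra.
    - assert (T := Cmod_triangle (w - w0) w0). replace (w - w0 + w0) with w in T by ring. lra. }
  assert (W0 : (Cmod (w0 - w0) < eta)%R) by (replace (w0 - w0) with (RtoC 0) by ring; rewrite Cmod_0; auto).
  split.
  - apply (levi_nondegenerate_of_normal_form l l1 (fun w => P w / w ^ m * l1 w + Q w / w ^ (2 * m) * l w) k k1 (fun w => P w / w ^ m * k1 w + Q w / w ^ (2 * m) * k w) z0 w0 eta' Heta'); auto.
    + intros w Hw'. destruct (Hb w ltac:(lra)) as [D1 [D2 [D3 [D4 D5]]]].
      assert (C1 := ode_coef_cont m r P Q l l1 w HP HQ D2 D1 D3). assert (C2 := ode_coef_cont m r P Q k k1 w HP HQ D2 D1 D4).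
      destruct D3, D4. repeat (split; auto).
    + apply (Hb w0 W0).
  - apply (spherical_of_normal_form M z0 w0 l l1 k k1 eta'); auto.
    intros w Hw'. destruct (Hb w ltac:(lra)) as [D1 [D2 [[D3 _] [[D4 _] D5]]]]. auto.
Qed.

(** * Necessity of the reality conditions *)

(** The argument of [psum_zero_coef], with zeros known only to accumulate at 0 and of either sign.
    Points of M over Re w = u are obtained in just this form. *)
Lemma psum_zero_seq (c : nat -> C) (rho M : R) : (0 < rho)%R -> pbound c rho M ->
  (forall d, (0 < d)%R -> exists t : R, (0 < Rabs t < d)%R /\ psum c t = 0) -> forall k, c k = 0.
Proof.
  intros HR H H0 k. assert (HM := pbound_pos _ _ _ H).
  induction k as [k IH] using Wf_nat.lt_wf_ind.
  assert (Z : csum (fun j => 0) k = 0) by (clear; induction k; simpl; [auto|rewrite IHk; ring]).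
  apply Cmod_eq_0. apply Rle_antisym; [|apply Cmod_ge_0]. apply Rnot_lt_le. intros Hlt.
  assert (HRk : (0 < rho ^ S k)%R) by (apply pow_lt; auto).
  set (B := (2 * M / rho ^ S k)%R). assert (HB : (0 <= B)%R).
  { unfold B. apply Rmult_le_pos; [lra|]. left; apply Rinv_0_lt_compat; auto. }
  destruct (H0 (Rmin (rho / 2) (Cmod (c k) / 2 / (B + 1)))) as [t0 [Ht0 Hz]].
  { apply Rmin_pos; [lra|]. apply Rdiv_lt_0_compat; lra. }
  set (t := Rabs t0) in *. assert (Ht1 := Rlt_le_trans _ _ _ (proj2 Ht0) (Rmin_l _ _)). assert (Ht3 := Rlt_le_trans _ _ _ (proj2 Ht0) (Rmin_r _ _)).
  assert (Hm : Cmod t0 = t) by (rewrite Cmod_R; auto).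
  assert (A := psum_tail c rho M t0 (S k) H ltac:(lra)). rewrite Hz in A. cbn [csum] in A.
  rewrite (csum_ext _ (fun j => 0)) in A by (intros j Hj; rewrite (IH j Hj); ring).
  rewrite Z in A.
  replace (0 - (0 + c k * RtoC t0 ^ k)) with (- (c k * RtoC t0 ^ k)) in A by ring.
  rewrite Cmod_opp, Cmod_mult, Cmod_pow, Hm in A.
  assert (Hq : (t / rho <= 1 / 2)%R).
  { apply (Rmult_le_reg_r rho); auto. unfold Rdiv at 1. rewrite Rmult_assoc, Rinv_l; lra. }
  assert (Htk : (0 < t ^ k)%R) by (apply pow_lt; lra).
  assert (A2 : (M * (t / rho) ^ S k / (1 - t / rho) <= M * (t / rho) ^ S k * 2)%R).
  { apply Rmult_le_compat_l.
    - apply Rmult_le_pos; auto. apply pow_le. apply Rmult_le_pos; [lra|left; apply Rinv_0_lt_compat; auto].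
    - rewrite <- (Rinv_inv 2). apply Rinv_le_contravar; lra. }
  assert (A3 : (M * (t / rho) ^ S k * 2 = B * t * t ^ k)%R).
  { unfold B, Rdiv. rewrite Rpow_mult_distr, pow_inv. simpl. field. split; [|lra]. assert (0 < rho ^ k)%R by (apply pow_lt; auto). lra. }
  assert (A4 : (Cmod (c k) <= B * t)%R) by (apply (Rmult_le_reg_r (t ^ k)); auto; lra).
  apply (Rmult_lt_compat_l (B + 1)) in Ht3; [|lra].
  replace ((B + 1) * (Cmod (c k) / 2 / (B + 1)))%R with (Cmod (c k) / 2)%R in Ht3 by (field; lra).
  nra.
Qed.

Lemma Im_zero_conj (x : C) : Im x = 0%R <-> Cconj x = x.
Proof.
  split; intros H; [apply C_eq; destruct x; simpl in *; lra|]. apply (f_equal Im) in H. destruct x; simpl in *; lra.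
Qed.

Lemma frequently_real_coef (c : nat -> C) (rho M : R) : (0 < rho)%R -> pbound c rho M ->
  (forall d, (0 < d)%R -> exists t : R, (0 < Rabs t < d)%R /\ Im (psum c t) = 0%R) -> forall k, Im (c k) = 0%R.
Proof.
  intros HR H H0 k. apply Im_zero_conj.
  assert (B := pbound_scal (- (1)) _ _ _ H).
  assert (Z : Cconj (c k) + - (1) * c k = 0).
  { apply (psum_zero_seq (fun k => Cconj (c k) + - (1) * c k) rho _ HR (pbound_plus _ _ _ _ _ (Rlt_le _ _ HR) (pbound_conj _ _ _ H) B)).
    intros d Hd. destruct (H0 (Rmin d rho) (Rmin_pos _ _ Hd HR)) as [t [Ht Hi]]. exists t.
    assert (A1 := Rlt_le_trans _ _ _ (proj2 Ht) (Rmin_l _ _)). assert (A2 := Rlt_le_trans _ _ _ (proj2 Ht) (Rmin_r _ _)). split; [lra|].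
    assert (Hm : (Cmod t < rho)%R) by (rewrite Cmod_R; auto).
    rewrite (psum_plus (fun k => Cconj (c k)) (fun k => - (1) * c k) rho _ _ _ (pbound_conj _ _ _ H) B Hm).
    rewrite (psum_scal _ _ rho M _ H Hm).
    assert (E := psum_conj c rho M t H Hm). rewrite Cconj_RtoC in E. rewrite E. apply Im_zero_conj in Hi. rewrite Hi. ring. }
  replace (Cconj (c k)) with (Cconj (c k) + - (1) * c k + c k) by ring. rewrite Z. ring.
Qed.

(** All Taylor coefficients of g at 0 are real. The derivatives enter as given functions so that
    explicit formulas can be inserted; the radii d/2, d/3, d/4, d/5 pay for the loss in each
    differentiation. *)
Lemma frequently_real_derivs (g g1 g2 : C -> C) (g3 : C) (d : R) : (0 < d)%R ->
  (forall v, (Cmod v < d)%R -> cder g v (g1 v)) -> (forall v, (Cmod v < d)%R -> cder g1 v (g2 v)) -> cder g2 0 g3 ->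
  (forall e, (0 < e)%R -> exists t : R, (0 < Rabs t < e)%R /\ Im (g t) = 0%R) -> Im (g2 0) = 0%R /\ Im g3 = 0%R.
Proof.
  intros Hd H1 H2 H3 HF.
  destruct (taylor_disc g d Hd ltac:(intros v Hv; eexists; apply H1; auto)) as [c Hc].
  destruct (Hc (d / 2)%R ltac:(lra)) as [[M HM] E].
  set (M1 := (M / (d / 2) * (/ (1 - d / 3 / (d / 2)) * / (1 - d / 3 / (d / 2))))%R).
  assert (HM1 : pbound (pderiv c) (d / 3) M1) by (apply pbound_deriv; auto; lra).
  set (M2 := (M1 / (d / 3) * (/ (1 - d / 4 / (d / 3)) * / (1 - d / 4 / (d / 3))))%R).
  assert (HM2 : pbound (pderiv (pderiv c)) (d / 4) M2) by (apply pbound_deriv; auto; lra).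
  set (M3 := (M2 / (d / 4) * (/ (1 - d / 5 / (d / 4)) * / (1 - d / 5 / (d / 4))))%R).
  assert (HM3 : pbound (pderiv (pderiv (pderiv c))) (d / 5) M3) by (apply pbound_deriv; auto; lra).
  assert (CR : forall k, Im (c k) = 0%R).
  { apply (frequently_real_coef c (d / 2) M); auto; [lra|]. intros e He.
    destruct (HF (Rmin e (d / 2)) ltac:(apply Rmin_pos; lra)) as [t [Ht Hi]].
    assert (A1 := Rlt_le_trans _ _ _ (proj2 Ht) (Rmin_l _ _)). assert (A2 := Rlt_le_trans _ _ _ (proj2 Ht) (Rmin_r _ _)).
    exists t. split; [lra|]. rewrite <- E by (rewrite Cmod_R; auto). auto. }
  assert (Near : forall (a b : R) (v w : C), (Cmod (w - v) < a - Cmod v)%R -> (Cmod w < a)%R).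
  { intros a _ v w Hw. assert (T := Cmod_triangle (w - v) v). replace (w - v + v) with w in T by ring. lra. }
  assert (E1 : forall v, (Cmod v < d / 3)%R -> g1 v = psum (pderiv c) v).
  { intros v Hv. eapply cder_unique; [apply H1; lra|].
    apply (cder_ext_loc (psum c) _ v _ (d / 3 - Cmod v)); [lra| |eapply cder_psum; [exact HM|lra]].
    intros w Hw. symmetry. apply E. apply (Near (d / 3)%R 0%R) in Hw. lra. }
  assert (E2 : forall v, (Cmod v < d / 4)%R -> g2 v = psum (pderiv (pderiv c)) v).
  { intros v Hv. eapply cder_unique; [apply H2; lra|].
    apply (cder_ext_loc (psum (pderiv c)) _ v _ (d / 4 - Cmod v)); [lra| |eapply cder_psum; [exact HM1|lra]].
    intros w Hw. symmetry. apply E1. apply (Near (d / 4)%R 0%R) in Hw. lra. }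
  assert (E3 : g3 = psum (pderiv (pderiv (pderiv c))) 0).
  { eapply cder_unique; [apply H3|].
    apply (cder_ext_loc (psum (pderiv (pderiv c))) _ 0 _ (d / 5)); [lra| |eapply cder_psum; [exact HM2|rewrite Cmod_0; lra]].
    intros w Hw. symmetry. apply E2. replace (w - 0) with w in Hw by ring. lra. }
  assert (PR : forall a : nat -> C, (forall k, Im (a k) = 0%R) -> forall k, Im (pderiv a k) = 0%R).
  { intros a Ha k. unfold pderiv. specialize (Ha (S k)). revert Ha. generalize (a (S k)), (INR (S k)). intros x y Hx. destruct x; simpl in *. rewrite Hx. ring. }
  split.
  - rewrite E2 by (rewrite Cmod_0; lra). rewrite (psum_0 _ (d / 4) M2) by (auto; lra). apply PR, PR, CR.
  - rewrite E3. rewrite (psum_0 _ (d / 5) M3) by (auto; lra). apply PR, PR, PR, CR.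
Qed.

(* Points of [M] over [Re w = u]: [x = |z|^2] tends to [0], [v = Im w] tends to [0] without vanishing. *)
Lemma hypersurface_points (m : nat) (M : C * C -> Prop) : admissible_hypersurface m M ->
  exists rho, (0 < rho)%R /\ forall u : R, (0 < u < rho)%R -> forall d, (0 < d)%R ->
    exists z v : R, (0 < z < d)%R /\ (0 < Rabs v < d)%R /\ M (RtoC z, (u, v)).
Proof.
  intros [s [c [rho [Hs [Hrho [HA HM]]]]]]. exists (rho / 2)%R. split; [lra|]. intros u Hu d Hd.
  destruct (HA (rho / 2)%R u ltac:(rewrite Rabs_pos_eq; lra) ltac:(rewrite Rabs_pos_eq; lra)) as [HA1 HA2].
  set (a := fun k => PSeries (c (k + 2)%nat) u).
  assert (Ha : forall k, (Rabs (a k) <= Series (fun j => Rabs (c (k + 2)%nat j * u ^ j)))%R).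
  { intros k. unfold a, PSeries. apply Series_Rabs. apply HA1. lia. }
  assert (Bd : exists K, forall k, (Rabs (a k) * (rho / 2) ^ (k + 2) <= K)%R).
  { set (f := fun k => (Series (fun j => Rabs (c (k + 2)%nat j * u ^ j)) * Rabs (rho / 2) ^ (k + 2))%R) in *.
    destruct (cser_terms_bounded (fun k => RtoC (f k)) (RtoC (Series f))) as [K HK].
    { apply cser_Re_Im. split; simpl; [apply Series_correct; auto|].
      apply (is_series_ext (fun _ => 0%R)); [intros; reflexivity|]. apply is_series_eps. intros eps He. exists O. intros n _.
      replace (rsum (fun _ => 0%R) n) with 0%R; [rewrite Rminus_0_r, Rabs_R0; auto|]. induction n; simpl; [auto|rewrite <- IHn; ring]. }
    exists K. intros k. specialize (HK k). rewrite Cmod_R in HK. eapply Rle_trans; [|eapply Rle_trans; [apply Rle_abs|exact HK]].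
    unfold f. rewrite (Rabs_pos_eq (rho / 2)) by lra. apply Rmult_le_compat_r; [apply pow_le; lra|auto]. }
  destruct Bd as [K HK].
  assert (HK0 : (0 <= K)%R). { eapply Rle_trans; [|apply (HK O)]. apply Rmult_le_pos; [apply Rabs_pos|apply pow_le; lra]. }
  set (rr := (rho / 2)%R) in *.
  set (K' := (2 * K / (rr * rr))%R). assert (HK' : (0 <= K')%R) by (apply Rmult_le_pos; [lra|left; apply Rinv_0_lt_compat; unfold rr; nra]).
  (* The terms of order at least 2 in x = |z|^2 contribute O(x^2), so v is close to u^m s x / 2 and
     cannot vanish. *)
  assert (Tail : forall x : R, (0 <= x <= rr / 2)%R -> (Rabs (Series (fun k => a k * x ^ (k + 2))) <= K' * (x * x))%R).
  { intros x Hx.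
    assert (Hq : (0 <= x / rr <= / 2)%R).
    { split; [apply Rmult_le_pos; [lra|left; apply Rinv_0_lt_compat; unfold rr; lra]|].
      apply (Rmult_le_reg_r rr); [unfold rr; lra|]. unfold Rdiv. rewrite Rmult_assoc, Rinv_l by (unfold rr; lra). lra. }
    assert (Tm : forall k, (Cmod (RtoC (a k * x ^ (k + 2))) <= (K * (x * x) / (rr * rr)) * (/ 2) ^ k)%R).
    { intros k. rewrite Cmod_R, Rabs_mult, (Rabs_pos_eq (x ^ _)) by (apply pow_le; lra).
      replace (x ^ (k + 2))%R with (rr ^ (k + 2) * ((x / rr) ^ k * (x * x) / (rr * rr)))%R.
      2:{ rewrite !pow_add. unfold Rdiv. rewrite Rpow_mult_distr, pow_inv. assert (rr ^ k <> 0)%R by (apply pow_nonzero; unfold rr; lra). simpl. field. split; auto. unfold rr; lra. }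
      rewrite <- Rmult_assoc. replace (K * (x * x) / (rr * rr) * (/ 2) ^ k)%R with (K * ((/ 2) ^ k * (x * x) / (rr * rr)))%R by (field; unfold rr; lra).
      assert (Hp : (0 <= (x / rr) ^ k <= (/ 2) ^ k)%R) by (split; [apply pow_le; lra|apply pow_incr; lra]).
      assert (Hr2 : (0 < / (rr * rr))%R) by (apply Rinv_0_lt_compat; unfold rr; nra).
      apply Rmult_le_compat; auto.
      - apply Rmult_le_pos; [apply Rabs_pos|apply pow_le; unfold rr; lra].
      - apply Rmult_le_pos; [|lra]. apply Rmult_le_pos; nra.
      - apply Rmult_le_compat_r; [lra|]. apply Rmult_le_compat_r; [nra|lra]. }
    assert (Hhalf : (0 <= / 2 < 1)%R) by lra. assert (Sm := cser_geom_ex _ _ _ Hhalf Tm). assert (L := cser_geom_le _ _ _ _ Hhalf Tm Sm).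
    eapply Rle_trans; [|eapply Rle_trans; [exact L|]].
    - eapply Rle_trans; [|apply re_le_Cmod]. right. reflexivity.
    - right. unfold K'. field. unfold rr; lra. }
  assert (Hup : (0 < u ^ m)%R) by (apply pow_lt; lra).
  (* 1 / (4 (K' + 1)) makes the tail at most x / 4, hence x / 4 <= |h| <= x; the quotients by 4 u^m
     keep |v| = u^m |h| below d and inside the domain. *)
  set (z := Rmin (Rmin (d / 2) (Rmin (/ 2) (rr / 2))) (Rmin (/ (4 * (K' + 1))) (Rmin (d / (4 * u ^ m)) (rr / (4 * u ^ m))))).
  assert (Hz : (0 < z)%R).
  { unfold z. apply Rmin_pos; apply Rmin_pos; try (unfold rr; lra); try (apply Rmin_pos; unfold rr; try lra; apply Rdiv_lt_0_compat; lra).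
    apply Rinv_0_lt_compat; lra. }
  assert (X1 := Rmin_l (Rmin (d / 2) (Rmin (/ 2) (rr / 2))) (Rmin (/ (4 * (K' + 1))) (Rmin (d / (4 * u ^ m)) (rr / (4 * u ^ m))))).
  assert (X2 := Rmin_r (Rmin (d / 2) (Rmin (/ 2) (rr / 2))) (Rmin (/ (4 * (K' + 1))) (Rmin (d / (4 * u ^ m)) (rr / (4 * u ^ m))))). fold z in X1, X2.
  assert (X3 := Rmin_l (d / 2) (Rmin (/ 2) (rr / 2))). assert (X4 := Rmin_r (d / 2) (Rmin (/ 2) (rr / 2))).
  assert (X5 := Rmin_l (/ 2) (rr / 2)). assert (X6 := Rmin_r (/ 2) (rr / 2)).
  assert (X7 := Rmin_l (/ (4 * (K' + 1))) (Rmin (d / (4 * u ^ m)) (rr / (4 * u ^ m)))). assert (X8 := Rmin_r (/ (4 * (K' + 1))) (Rmin (d / (4 * u ^ m)) (rr / (4 * u ^ m)))).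
  assert (X9 := Rmin_l (d / (4 * u ^ m)) (rr / (4 * u ^ m))). assert (X10 := Rmin_r (d / (4 * u ^ m)) (rr / (4 * u ^ m))).
  set (x := (z * z)%R). assert (Hx : (0 < x <= z)%R) by (unfold x; nra).
  set (h := (s / 2 * x + Series (fun k => a k * x ^ (k + 2)))%R).
  assert (Tx := Tail x ltac:(lra)).
  assert (Hh1 : (K' * (x * x) <= x / 4)%R).
  { assert (HKx : (4 * (K' + 1) * x <= 1)%R).
    { apply (Rle_trans _ (4 * (K' + 1) * / (4 * (K' + 1)))); [apply Rmult_le_compat_l; lra|right; field; lra]. }
    nra. }
  assert (Hh : (x / 4 <= Rabs h <= x)%R).
  { unfold h. assert (Y := Rabs_le_between (Series (fun k => (a k * x ^ (k + 2))%R)) (x / 4)). destruct Y as [Y _]. specialize (Y ltac:(lra)).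
    destruct Hs as [-> | ->]; [rewrite Rabs_pos_eq by lra; lra|rewrite Rabs_left by lra; lra]. }
  set (v := (u ^ m * h)%R).
  assert (Hv : (0 < Rabs v < Rmin d rr)%R).
  { unfold v. rewrite Rabs_mult, (Rabs_pos_eq (u ^ m)) by lra. split; [apply Rmult_lt_0_compat; lra|].
    assert (V1 : (u ^ m * x <= d / 4)%R). { apply (Rle_trans _ (u ^ m * (d / (4 * u ^ m)))); [apply Rmult_le_compat_l; lra|right; field; lra]. }
    assert (V2 : (u ^ m * x <= rr / 4)%R). { apply (Rle_trans _ (u ^ m * (rr / (4 * u ^ m)))); [apply Rmult_le_compat_l; lra|right; field; lra]. }
    assert (u ^ m * Rabs h <= u ^ m * x)%R by (apply Rmult_le_compat_l; lra).
    apply Rmin_glb_lt; unfold rr in *; lra. }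
  assert (V1 := Rmin_l d rr). assert (V2 := Rmin_r d rr).
  exists z, v. split; [lra|]. split; [lra|].
  assert (Hmz : (Cmod z ^ 2 = x)%R) by (rewrite Cmod_R, Rabs_pos_eq by lra; unfold x; ring).
  apply HM.
  - rewrite Hmz. unfold rr in *. lra.
  - eapply Rle_lt_trans; [apply Cmod_le_abs|]. simpl. rewrite (Rabs_pos_eq u) by lra. unfold rr in *. lra.
  - rewrite Hmz. simpl Im. simpl Re. unfold v, h. f_equal. f_equal. apply Series_ext. intros k. unfold a. f_equal. rewrite pow_mult. f_equal. symmetry. exact Hmz.
Qed.

(** With w = u + i v and y = u - i v, variation of constants expresses |z|^2 on M as g(v) = [Lf] v
    times [N0] v, holomorphic near v = 0. The second derivative at 0 is 4 i a / u^m with a = P / u^m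
    + m / u, and the third brings in Q. *)
Lemma reality_at_point (m : nat) (r : R) (P P1 Q : C -> C) (M : C * C -> Prop) (S : positive_segre_family) : (1 <= m)%nat -> (0 < r)%R ->
  hol r P -> hol r Q -> (forall w, (Cmod w < r)%R -> cder P w (P1 w)) -> hol r P1 ->
  admissible_hypersurface m M -> associated_segre_family m r P Q S -> is_segre_family_of M (segre_variety m S) ->
  exists e, (0 < e)%R /\ forall u : R, (0 < u < e)%R ->
    Re (P u) = (- INR m * u ^ (m - 1))%R /\ (2 * Im (Q u) = u ^ m * Im (P1 u))%R.
Proof.
  intros Hm Hr HP HQ HP1 HP2 HA HS HF.
  destruct (scaled_solutions m r P Q Hm Hr HP HQ) as [tau [rho [Htau [Hrho [Hrr Hsol]]]]].
  destruct (segre_family_hypersurface m M S HF) as [e1 [He1 HM]].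
  destruct (segre_curve_facts m r P Q S Hm Hr HS) as [e0 [K [He0 [HK [He0d [He0e [He0r [HeK Hcur]]]]]]]].
  destruct (hypersurface_points m M HA) as [e2 [He2 Hpts]].
  set (e := Rmin (Rmin (e1 / 2) (e0 / 2)) (Rmin e2 rho)).
  assert (He : (0 < e)%R) by (unfold e; apply Rmin_pos; apply Rmin_pos; lra).
  assert (X1 := Rmin_l (Rmin (e1 / 2) (e0 / 2)) (Rmin e2 rho)). assert (X2 := Rmin_r (Rmin (e1 / 2) (e0 / 2)) (Rmin e2 rho)). fold e in X1, X2.
  assert (X3 := Rmin_l (e1 / 2) (e0 / 2)). assert (X4 := Rmin_r (e1 / 2) (e0 / 2)). assert (X5 := Rmin_l e2 rho). assert (X6 := Rmin_r e2 rho).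
  exists e. split; auto. intros u Hu.
  assert (Hmu : Cmod u = u) by (rewrite Cmod_R, Rabs_pos_eq; lra).
  assert (Hcu : RtoC u <> 0) by (apply RtoC_neq0; lra).
  assert (HCi : Ci <> 0) by (apply Cmod_gt_0; rewrite Cmod_Ci; lra).
  assert (CC : Ci * Ci = - (1)) by (apply C_eq; simpl; ring).
  assert (Hup : (0 < u ^ m)%R) by (apply pow_lt; lra).
  assert (Hum : RtoC u ^ m <> 0) by (apply Cpow_nz; auto).
  assert (Sol : forall b0 b1 : C, exists l l1 : C -> C, l u = b0 /\ l1 u = b1 / (Ci * RtoC u ^ m) /\
     forall w, (Cmod (w - u) < tau * u ^ m)%R -> lin_sol m P Q l l1 w).
  { intros b0 b1. destruct (Hsol (fun _ => b0) (fun _ => b1) (Rmax (Cmod b0) (Cmod b1))) as [F [D [K1 [_ [_ H]]]]].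
    - apply hol_const. - apply hol_const.
    - intros y _. split; [apply Rmax_l|apply Rmax_r].
    - destruct (H u ltac:(rewrite Hmu; lra)) as [H1 [H2 [_ H3]]]. specialize (H3 Hcu). rewrite Hmu in H3.
      exists (fun w => F ((w - u) / (Ci * RtoC u ^ m)) u), (fun w => D ((w - u) / (Ci * RtoC u ^ m)) u / (Ci * RtoC u ^ m)).
      assert (E0 : (RtoC u - RtoC u) / (Ci * RtoC u ^ m) = 0) by (field; split; auto).
      split; [cbv beta; rewrite E0; auto|]. split; [cbv beta; rewrite E0, H2; auto|]. auto. }
  destruct (Sol 1 0) as [l [l1 [Hl0 [Hl1 Hl]]]]. destruct (Sol 0 1) as [k [k1 [Hk0 [Hk1 Hk]]]].
  set (wr := fun w => l w * k1 w - l1 w * k w).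
  assert (Tu : (0 < tau * u ^ m)%R) by nra.
  assert (Z0 : forall v : C, Cmod (v - v) = 0%R) by (intros v; replace (v - v) with (RtoC 0) by ring; apply Cmod_0).
  assert (Wr0 : wr u <> 0).
  { unfold wr. rewrite Hl0, Hk0, Hk1, Hl1. replace (1 * (1 / (Ci * RtoC u ^ m)) - 0 / (Ci * RtoC u ^ m) * 0) with (/ (Ci * RtoC u ^ m)) by (field; auto).
    intros Z. assert (Y : / (Ci * RtoC u ^ m) * (Ci * RtoC u ^ m) = 1) by (field; auto). rewrite Z in Y. 
    apply (f_equal Cmod) in Y. rewrite Cmult_0_l, Cmod_0, Cmod_1 in Y. lra. }
  assert (Dwr : forall w, (Cmod (w - u) < tau * u ^ m)%R -> w <> 0 -> cder wr w (P w / w ^ m * wr w)).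
  { intros w Hw Hw0. destruct (Hl w Hw) as [L1 L2]. destruct (Hk w Hw) as [K1 K2].
    eapply cder_eq; [apply cder_minus; (apply cder_mult; [|]); eassumption|]. unfold wr. cbv beta. field. split; apply Cpow_nz; auto. }
  destruct (cder_cont _ _ _ (Dwr u ltac:(rewrite Z0; auto) Hcu) (Cmod (wr u))) as [d1 [Hd1 H1]]; [apply Cmod_gt_0; auto|].
  set (eta := Rmin (Rmin (tau * u ^ m) d1) (Rmin (u / 2) (rho / 2))).
  assert (Heta : (0 < eta)%R) by (unfold eta; apply Rmin_pos; apply Rmin_pos; lra).
  assert (Y1 := Rmin_l (Rmin (tau * u ^ m) d1) (Rmin (u / 2) (rho / 2))). assert (Y2 := Rmin_r (Rmin (tau * u ^ m) d1) (Rmin (u / 2) (rho / 2))). fold eta in Y1, Y2.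
  assert (Y3 := Rmin_l (tau * u ^ m) d1). assert (Y4 := Rmin_r (tau * u ^ m) d1). assert (Y5 := Rmin_l (u / 2) (rho / 2)). assert (Y6 := Rmin_r (u / 2) (rho / 2)).
  assert (Dom : forall w, (Cmod (w - u) < eta)%R -> w <> 0 /\ (Cmod w < r)%R /\ lin_sol m P Q l l1 w /\ lin_sol m P Q k k1 w /\ wr w <> 0).
  { intros w Hw. split; [|split; [|split; [|split]]].
    - intros E. subst w. replace (0 - u) with (- RtoC u) in Hw by ring. rewrite Cmod_opp, Hmu in Hw. lra.
    - assert (T := Cmod_triangle (w - u) u). replace (w - u + u) with w in T by ring. lra.
    - apply Hl. lra.
    - apply Hk. lra.
    - intros E. specialize (H1 w ltac:(lra)). rewrite E in H1. replace (0 - wr u) with (- wr u) in H1 by ring. rewrite Cmod_opp in H1. lra. }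
  set (pw := fun w => P w / w ^ m). set (qw := fun w => Q w / w ^ (2 * m)).
  set (pd := fun w => (P1 w * w ^ m - P w * (INR m * w ^ (m - 1))) / (w ^ m * w ^ m)).
  assert (Dpw : forall w, (Cmod (w - u) < eta)%R -> cder pw w (pd w)).
  { intros w Hw. destruct (Dom w Hw) as [W0 [W1 _]]. apply cder_div; [apply HP1; auto|apply cder_Cpow|apply Cpow_nz; auto]. }
  assert (Dqw : forall w, (Cmod (w - u) < eta)%R -> exists c, cder qw w c).
  { intros w Hw. destruct (Dom w Hw) as [W0 [W1 _]]. destruct (HQ w W1) as [c Hc]. eexists. apply cder_div; [exact Hc|apply cder_Cpow|apply Cpow_nz; auto]. }
  assert (Dpd : exists c, cder pd u c).
  { destruct (Dom u ltac:(rewrite Z0; auto)) as [W0 [W1 _]]. destruct (HP2 u W1) as [c Hc]. eexists. apply cder_div.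
    - apply cder_minus; [apply cder_mult; [exact Hc|apply cder_Cpow]|]. apply cder_mult; [apply HP1; auto|]. apply cder_scal, cder_Cpow.
    - apply cder_mult; apply cder_Cpow. - apply Cmult_neq_0; auto. }
  set (W := fun v => u + Ci * v). set (y := fun v => u - Ci * v).
  assert (NW : forall v, (Cmod v < eta)%R -> (Cmod (W v - u) < eta)%R).
  { intros v Hv. unfold W. replace (u + Ci * v - u) with (Ci * v) by ring. rewrite Cmod_mult, Cmod_Ci. lra. }
  assert (Ny : forall v, (Cmod v < eta)%R -> (Cmod (y v - u) < eta)%R).
  { intros v Hv. unfold y. replace (u - Ci * v - u) with (- (Ci * v)) by ring. rewrite Cmod_opp, Cmod_mult, Cmod_Ci. lra. }
  assert (DW : forall v, cder W v Ci). { intros v. unfold W. eapply cder_eq; [apply cder_plus; [apply cder_const|apply cder_scal, cder_id]|ring]. }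
  assert (Dy : forall v, cder y v (- Ci)). { intros v. unfold y. eapply cder_eq; [apply cder_minus; [apply cder_const|apply cder_scal, cder_id]|ring]. }
  (* The four products of a solution or its derivative at y with one at W, antisymmetrised in (l,
     k). They form a closed linear system under d/dv, so all derivatives of g are mechanical. *)
  set (N0 := fun v => l (y v) * k (W v) - k (y v) * l (W v)).
  set (N1 := fun v => l (y v) * k1 (W v) - k (y v) * l1 (W v)).
  set (N2 := fun v => l1 (y v) * k (W v) - k1 (y v) * l (W v)).
  set (N3 := fun v => l1 (y v) * k1 (W v) - k1 (y v) * l1 (W v)).
  assert (DN : forall v, (Cmod v < eta)%R -> 
     cder N0 v (Ci * (N1 v - N2 v)) /\
     cder N1 v (Ci * (pw (W v) * N1 v + qw (W v) * N0 v - N3 v)) /\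
     cder N2 v (Ci * (N3 v - pw (y v) * N2 v - qw (y v) * N0 v)) /\
     cder N3 v (Ci * (pw (W v) * N3 v + qw (W v) * N2 v - pw (y v) * N3 v - qw (y v) * N1 v))).
  { intros v Hv. destruct (Dom _ (NW v Hv)) as [_ [_ [[LW1 LW2] [[KW1 KW2] _]]]]. destruct (Dom _ (Ny v Hv)) as [_ [_ [[Ly1 Ly2] [[Ky1 Ky2] _]]]].
    fold (pw (W v)) (qw (W v)) in LW2, KW2. fold (pw (y v)) (qw (y v)) in Ly2, Ky2.
    assert (A1 := cder_comp l W v _ _ LW1 (DW v)). assert (A2 := cder_comp l1 W v _ _ LW2 (DW v)).
    assert (A3 := cder_comp k W v _ _ KW1 (DW v)). assert (A4 := cder_comp k1 W v _ _ KW2 (DW v)).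
    assert (B1 := cder_comp l y v _ _ Ly1 (Dy v)). assert (B2 := cder_comp l1 y v _ _ Ly2 (Dy v)).
    assert (B3 := cder_comp k y v _ _ Ky1 (Dy v)). assert (B4 := cder_comp k1 y v _ _ Ky2 (Dy v)).
    split; [|split; [|split]];
    (eapply cder_eq; [apply cder_minus; (apply cder_mult; [|]); eassumption|]); unfold N0, N1, N2, N3; cbv beta; ring. }
  (* [aw] is the logarithmic derivative of w^m times the Wronskian; as dy/dv = -i, [Lf] is
     multiplied by i [aw](y) under differentiation. *)
  set (aw := fun w => pw w + INR m / w). set (ad := fun w => pd w - INR m / (w * w)).
  assert (Daw : forall w, (Cmod (w - u) < eta)%R -> cder aw w (ad w)).
  { intros w Hw. destruct (Dom w Hw) as [W0 _]. eapply cder_eq; [apply cder_plus; [apply Dpw; auto|apply cder_div; [apply cder_const|apply cder_id|auto]]|].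
    unfold ad. cbv beta. field. auto. }
  assert (Dad : exists c, cder ad u c).
  { destruct Dpd as [c Hc]. eexists. apply cder_minus; [exact Hc|]. apply cder_div; [apply cder_const|apply cder_mult; apply cder_id|]. apply Cmult_neq_0; auto. }
  set (Lf := fun v => / (Ci * (y v ^ m * wr (y v)))).
  assert (DLf : forall v, (Cmod v < eta)%R -> cder Lf v (Ci * aw (y v) * Lf v)).
  { intros v Hv. destruct (Dom _ (Ny v Hv)) as [V0 [_ [_ [_ V1]]]].
    assert (Dwy := cder_comp wr y v _ _ (Dwr (y v) ltac:(specialize (Ny v Hv); lra) V0) (Dy v)).
    assert (Hym1 : y v ^ (m - 1) <> 0) by (apply Cpow_nz; auto).
    eapply cder_eq; [apply cder_inv; [apply cder_scal; apply cder_mult; [apply (cder_pow y), Dy|exact Dwy]|]|].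
    - apply Cmult_neq_0; auto. apply Cmult_neq_0; auto. apply Cpow_nz; auto.
    - unfold Lf, aw, pw. cbv beta. rewrite !(Cpow_pred (y v) m Hm).
      match goal with |- ?a / ?b = ?c => replace a with ((Ci * Ci) * ((P (y v) / (y v * y v ^ (m - 1)) + INR m / y v) * (y v * y v ^ (m - 1) * wr (y v)))) by (field; auto) end.
      field. auto. }
  set (T1 := fun v => aw (y v) * N0 v + N1 v - N2 v).
  set (T2 := fun v => - ad (y v) * N0 v + aw (y v) * (N1 v - N2 v) + pw (W v) * N1 v + qw (W v) * N0 v - 2 * N3 v + pw (y v) * N2 v + qw (y v) * N0 v).
  assert (Dg : forall v, (Cmod v < eta)%R -> cder (fun v => Lf v * N0 v) v (Ci * (Lf v * T1 v))).
  { intros v Hv. destruct (DN v Hv) as [D0 _]. eapply cder_eq; [apply cder_mult; [apply DLf; auto|exact D0]|]. unfold T1. ring. }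
  assert (DT1 : forall v, (Cmod v < eta)%R -> cder T1 v (Ci * T2 v)).
  { intros v Hv. destruct (DN v Hv) as [D0 [D1 [D2 _]]].
    assert (Day := cder_comp aw y v _ _ (Daw _ (Ny v Hv)) (Dy v)).
    eapply cder_eq; [apply cder_minus; [apply cder_plus; [apply cder_mult; [exact Day|exact D0]|exact D1]|exact D2]|]. unfold T2. cbv beta. ring. }
  assert (Dg1 : forall v, (Cmod v < eta)%R -> cder (fun v => Ci * (Lf v * T1 v)) v (- (Lf v * (aw (y v) * T1 v + T2 v)))).
  { intros v Hv. eapply cder_eq; [apply cder_scal, cder_mult; [apply DLf; auto|apply DT1; auto]|]. transitivity ((Ci * Ci) * (Lf v * (aw (y v) * T1 v + T2 v))); [ring|rewrite CC; ring]. }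
  assert (V0 : (Cmod 0 < eta)%R) by (rewrite Cmod_0; auto).
  destruct Dad as [a2 Ha2]. destruct (Dqw u ltac:(rewrite Z0; auto)) as [q1 Hq1].
  assert (W0 : W 0 = u) by (unfold W; ring). assert (y0 : y 0 = u) by (unfold y; ring).
  (* At v = 0 both W and y equal u, so N0 = N3 = 0 and N2 = -N1: every surviving term is a multiple
     of N1, the Wronskian at u. *)
  assert (DT2 : exists g, cder T2 0 g /\ g = Ci * N1 0 * (- (4) * ad u + 2 * pd u + 2 * pw u * pw u + 8 * qw u)).
  { destruct (DN 0 V0) as [D0 [D1 [D2 D3]]].
    assert (Day := cder_comp aw y 0 _ _ (Daw _ (Ny 0 V0)) (Dy 0)).
    assert (Dady : cder (fun v => ad (y v)) 0 (a2 * - Ci)) by (apply (cder_comp ad y); [rewrite y0; auto|apply Dy]).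
    assert (Dpy := cder_comp pw y 0 _ _ (Dpw _ (Ny 0 V0)) (Dy 0)). assert (DpW := cder_comp pw W 0 _ _ (Dpw _ (NW 0 V0)) (DW 0)).
    assert (Dqy : cder (fun v => qw (y v)) 0 (q1 * - Ci)) by (apply (cder_comp qw y); [rewrite y0; auto|apply Dy]).
    assert (DqW : cder (fun v => qw (W v)) 0 (q1 * Ci)) by (apply (cder_comp qw W); [rewrite W0; auto|apply DW]).
    eexists. split.
    - unfold T2. apply cder_plus; [|apply cder_mult; [exact Dqy|exact D0]]. apply cder_plus; [|apply cder_mult; [exact Dpy|exact D2]].
      apply cder_minus; [|apply cder_scal, D3]. apply cder_plus; [|apply cder_mult; [exact DqW|exact D0]].
      apply cder_plus; [|apply cder_mult; [exact DpW|exact D1]]. apply cder_plus; [apply cder_mult; [apply cder_opp, Dady|exact D0]|].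
      apply cder_mult; [exact Day|apply cder_minus; [exact D1|exact D2]].
    - cbv beta. rewrite W0, y0.
      assert (E0 : N0 0 = 0) by (unfold N0; rewrite W0, y0; ring). assert (E2 : N2 0 = - N1 0) by (unfold N2, N1; rewrite W0, y0; ring).
      assert (E3 : N3 0 = 0) by (unfold N3; rewrite W0, y0; ring). rewrite E0, E2, E3. ring. }
  destruct DT2 as [t2 [DT2 Et2]].
  assert (Dg2 : cder (fun v => - (Lf v * (aw (y v) * T1 v + T2 v))) 0
    (- (Ci * aw (y 0) * Lf 0 * (aw (y 0) * T1 0 + T2 0) + Lf 0 * (ad (y 0) * - Ci * T1 0 + aw (y 0) * (Ci * T2 0) + t2)))).
  { assert (Day := cder_comp aw y 0 _ _ (Daw _ (Ny 0 V0)) (Dy 0)).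
    exact (cder_opp _ _ _ (cder_mult _ _ _ _ _ (DLf 0 V0) (cder_plus _ _ _ _ _ (cder_mult _ _ _ _ _ Day (DT1 0 V0)) DT2))). }
  destruct (frequently_real_derivs _ _ _ _ eta Heta Dg Dg1 Dg2) as [R2 R3].
  { intros d Hd.
    (* Since |v| < eta / 4 and K d' <= eta / 4, the whole arc of the Segre curve over [0, z] stays
       in the disc of radius eta about u, where the basis is defined. *)
    set (d' := Rmin (Rmin d (eta / 4)) (Rmin (Rmin (e1 / 2) (e0 / 2)) (eta / (4 * (K + 1))))).
    assert (Hd' : (0 < d')%R). { unfold d'. apply Rmin_pos; [apply Rmin_pos; lra|]. apply Rmin_pos; [apply Rmin_pos; lra|apply Rdiv_lt_0_compat; lra]. }
    assert (U1 := Rmin_l (Rmin d (eta / 4)) (Rmin (Rmin (e1 / 2) (e0 / 2)) (eta / (4 * (K + 1))))). assert (U2 := Rmin_r (Rmin d (eta / 4)) (Rmin (Rmin (e1 / 2) (e0 / 2)) (eta / (4 * (K + 1))))). fold d' in U1, U2.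
    assert (U3 := Rmin_l d (eta / 4)). assert (U4 := Rmin_r d (eta / 4)). assert (U5 := Rmin_l (Rmin (e1 / 2) (e0 / 2)) (eta / (4 * (K + 1)))). assert (U6 := Rmin_r (Rmin (e1 / 2) (e0 / 2)) (eta / (4 * (K + 1)))).
    destruct (Hpts u ltac:(lra) d' Hd') as [z [v [Hz [Hv HMp]]]].
    exists v. split; [lra|].
    set (w := (u, v) : C). assert (Ew : w = W v) by (unfold w, W; apply C_eq; simpl; ring).
    assert (Ewy : Cconj w = y v) by (unfold w, y; apply C_eq; simpl; ring).
    assert (Hvm : Cmod v = Rabs v) by apply Cmod_R. assert (Hzm : Cmod z = z) by (rewrite Cmod_R, Rabs_pos_eq; lra).
    assert (Hwm : (Cmod w <= u + Rabs v)%R). { eapply Rle_trans; [apply Cmod_le_abs|]. unfold w; simpl. rewrite (Rabs_pos_eq u); lra. }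
    assert (Hwn : w <> 0). { intros E. apply (f_equal Re) in E. unfold w in E. simpl in E. lra. }
    assert (Hz0 : RtoC z <> 0) by (apply RtoC_neq0; lra).
    assert (Seg : w = segre_graph m S (RtoC z, w) z) by (apply HM; auto; lra).
    destruct (Hcur z w ltac:(lra) ltac:(lra)) as [C1 [C2 [_ C4]]]. destruct (C4 Hz0 Hwn) as [W' [W'' [C5 C6]]].
    assert (HetaK : (K * d' <= eta / 4)%R).
    { apply (Rle_trans _ ((K + 1) * (eta / (4 * (K + 1))))); [apply Rmult_le_compat; lra|right; field; lra]. }
    assert (InD : forall t : R, (0 <= t <= 1)%R -> (Cmod (segre_graph m S (RtoC z, w) (z * t)%C - u) < eta)%R).
    { intros t Ht. specialize (C1 t Ht). rewrite Ewy in C1.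
      assert (Yv := Ny v ltac:(rewrite Hvm; lra)). 
      assert (Yv2 : Cmod (y v - u) = Rabs v). { unfold y. replace (u - Ci * v - u) with (- (Ci * v)) by ring. rewrite Cmod_opp, Cmod_mult, Cmod_Ci, Hvm. ring. }
      replace (segre_graph m S (RtoC z, w) (z * t) - u) with ((segre_graph m S (RtoC z, w) (z * t) - y v) + (y v - u)) by ring.
      eapply Rle_lt_trans; [apply Cmod_triangle|]. rewrite Yv2.
      assert (Hw1 : (Cmod w ^ m <= 1)%R) by (apply pow_le_1; assert (X := Cmod_ge_0 w); lra).
      assert (Hw2 : (0 <= Cmod w ^ m)%R) by (apply pow_le, Cmod_ge_0).
      rewrite Hzm in C1.
      assert (K * (Cmod w ^ m * z ^ 2) <= K * d')%R.
      { apply Rmult_le_compat_l; [lra|]. apply (Rle_trans _ (1 * d')); [|lra]. apply Rmult_le_compat; auto; [apply pow_le; lra|].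
        apply (Rle_trans _ (z * 1)); [simpl; apply Rmult_le_compat_l; lra|lra]. }
      lra. }
    destruct (variation_of_constants m P Q l l1 k k1 (segre_graph m S (RtoC z, w)) W' W'' z) as [V1 _].
    { intros t Ht zz. destruct (C6 t Ht) as [G1 [G2 [G3 [G4 G5]]]].
      destruct (Dom _ (InD t Ht)) as [_ [_ [F1 [F2 F3]]]]. repeat split; auto; try apply F1; try apply F2. }
    (* The initial slope of the curve is i y^m z, so the formula reads z^2 i y^m wr(y) = N0 v, that
       is, g(v) = z^2, a real number. *)
    rewrite C2, <- Seg, C5, Ewy, Cconj_RtoC, Ew in V1.
    fold (wr (y v)) in V1. fold (N0 v) in V1. rewrite <- V1.
    destruct (Dom _ (Ny v ltac:(rewrite Hvm; lra))) as [F0 [_ [_ [_ F1]]]].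
    unfold Lf. replace (/ (Ci * (y v ^ m * wr (y v))) * (z * (Ci * y v ^ m * z * wr (y v)))) with (RtoC (z * z)).
    - reflexivity.
    - rewrite RtoC_mult. field. split; auto. split; auto. apply Cpow_nz; auto. }
  cbv beta in R2. 
  assert (E0 : N0 0 = 0) by (unfold N0; rewrite W0, y0; ring). assert (E2 : N2 0 = - N1 0) by (unfold N2, N1; rewrite W0, y0; ring).
  assert (E3 : N3 0 = 0) by (unfold N3; rewrite W0, y0; ring).
  assert (EN1 : N1 0 = wr u) by (unfold N1, wr; rewrite W0, y0; ring).
  assert (ET1 : T1 0 = 2 * wr u) by (unfold T1; rewrite E0, E2, EN1; ring).
  assert (ET2 : T2 0 = 2 * aw u * wr u) by (unfold T2; rewrite E0, E2, E3, EN1, W0, y0; ring).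
  assert (EL : Lf 0 = / (Ci * (RtoC u ^ m * wr u))) by (unfold Lf; rewrite y0; auto).
  assert (Inv : / Ci = - Ci). { replace (/ Ci) with (- (Ci * Ci) / Ci) by (rewrite CC; field; auto). field; auto. }
  set (a := aw u) in *.
  (* The left side is the second derivative of g at 0; that 4 i a / u^m is real means Re a = 0, the
     condition on P. *)
  assert (ER2 : - (Lf 0 * (aw (y 0) * T1 0 + T2 0)) = RtoC (4 / u ^ m) * (Ci * a)).
  { rewrite EL, ET1, ET2, y0. fold a. transitivity (- (4) * a / (RtoC u ^ m) * / Ci); [field; auto|]. rewrite Inv.
    replace (RtoC (4 / u ^ m)) with (4 / RtoC u ^ m) by (rewrite RtoC_div, RtoC_pow by lra; auto). field. auto. }
  rewrite ER2 in R2.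
  assert (Ra : Re a = 0%R).
  { revert R2. destruct a as [a1 a2']. simpl. intros R2. assert (H4 : (4 / u ^ m <> 0)%R) by (apply Rgt_not_eq; apply Rdiv_lt_0_compat; lra).
    apply (Rmult_eq_reg_l (4 / u ^ m)); auto. rewrite Rmult_0_r. rewrite <- R2. ring. }
  assert (Eum1 : (u ^ m = u * u ^ (m - 1))%R) by (rewrite tech_pow_Rmult; f_equal; lia).
  assert (Hum1 : (0 < u ^ (m - 1))%R) by (apply pow_lt; lra).
  assert (Ea : a = (P u + RtoC (INR m * u ^ (m - 1))) * RtoC (/ u ^ m)).
  { unfold a, aw, pw. rewrite RtoC_mult, RtoC_inv, !RtoC_pow by lra. rewrite !(Cpow_pred u m Hm). field. split; auto. apply Cpow_nz; auto. }
  split.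
  - assert (Y : Re a = ((Re (P u) + INR m * u ^ (m - 1)) * / u ^ m)%R) by (rewrite Ea; generalize (P u); intros x; destruct x; simpl; ring).
    rewrite Ra in Y. symmetry in Y. apply Rmult_integral in Y. destruct Y as [Y|Y]; [lra|]. exfalso. revert Y. apply Rgt_not_eq, Rinv_0_lt_compat; lra.
  (* In terms of a and its derivative the third derivative is -8 q - 8 a^2 + 4 (a' + a m / u) up to
     a real factor and a real summand. As a is imaginary, a^2 is real, and a' + a m / u is P' / u^m
     plus a real number. *)
  - assert (Epd : pd u = ad u + INR m / (RtoC u * RtoC u)) by (unfold ad; field; auto).
    assert (Epw : pw u = a - INR m / RtoC u) by (unfold a, aw; field; auto).
    rewrite y0, Et2, ET1, ET2, EN1, EL, Epd, Epw in R3. fold a in R3.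
    match type of R3 with Im ?X = _ => assert (EX : X = RtoC (/ u ^ m) * (- (8) * qw u + - (8) * (a * a) + 4 * (ad u + a * RtoC (INR m / u)) + RtoC (- (2 * INR m + 2 * (INR m * INR m)) / (u * u)))) end.
    { rewrite RtoC_inv, RtoC_pow by lra. rewrite !RtoC_div by nra. rewrite RtoC_opp, !RtoC_plus, !RtoC_mult. field. auto. }
    rewrite EX in R3.
    assert (Eq : qw u = Q u * RtoC (/ (u ^ m * u ^ m))).
    { unfold qw. rewrite Cpow_double, RtoC_inv, RtoC_mult, RtoC_pow by nra. field. auto. }
    assert (Ead : ad u + a * RtoC (INR m / u) = P1 u * RtoC (/ u ^ m) + RtoC ((INR m * INR m - INR m) / (u * u))).
    { rewrite Ea. unfold ad, pd. rewrite !RtoC_div, !RtoC_inv, RtoC_minus, !RtoC_mult, !RtoC_pow by (try lra; nra).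
      rewrite !(Cpow_pred u m Hm). field. split; auto. apply Cpow_nz; auto. }
    rewrite Eq, Ead in R3.
    assert (Fin : Im (RtoC (/ u ^ m) * (- (8) * (Q u * RtoC (/ (u ^ m * u ^ m))) + - (8) * (a * a) + 4 * (P1 u * RtoC (/ u ^ m) + RtoC ((INR m * INR m - INR m) / (u * u))) + RtoC (- (2 * INR m + 2 * (INR m * INR m)) / (u * u))))
       = (/ u ^ m * (- 8 * (Im (Q u) * / (u ^ m * u ^ m)) + 4 * (Im (P1 u) * / u ^ m)))%R).
    { generalize (Q u) (P1 u). intros x x1. revert Ra. clear. intros Ra. destruct a as [b c], x, x1. simpl in Ra. subst b. simpl. ring. }
    rewrite Fin in R3. apply Rmult_integral in R3. destruct R3 as [R3|R3].
    + exfalso. revert R3. apply Rgt_not_eq, Rinv_0_lt_compat; lra.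
    + apply (Rmult_eq_reg_r (4 * / (u ^ m * u ^ m))).
      * replace (u ^ m * Im (P1 u) * (4 * / (u ^ m * u ^ m)))%R with (4 * (Im (P1 u) * / u ^ m))%R by (field; lra).
        replace (2 * Im (Q u) * (4 * / (u ^ m * u ^ m)))%R with (8 * (Im (Q u) * / (u ^ m * u ^ m)))%R by ring. lra.
      * assert (0 < / (u ^ m * u ^ m))%R by (apply Rinv_0_lt_compat; nra). lra.
Qed.

(** * Real Taylor coefficients from reality on an interval *)

Lemma hol_deriv (f : C -> C) (r : R) : (0 < r)%R -> hol r f -> exists f1, hol r f1 /\ forall w, (Cmod w < r)%R -> cder f w (f1 w).
Proof.
  intros Hr Hf. destruct (taylor_disc f r Hr Hf) as [c Hc].
  assert (Main : forall w rho, (Cmod w < rho)%R -> (rho < r)%R -> cder f w (psum (pderiv c) w) /\ exists l, cder (psum (pderiv c)) w l).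
  { intros w rho Hw Hrho. assert (X := Cmod_ge_0 w). destruct (Hc rho ltac:(lra)) as [[M HM] Hs]. split.
    - apply (cder_ext_loc (psum c) f w _ (rho - Cmod w)); [lra| |apply (cder_psum c rho M); auto].
      intros v Hv. symmetry. apply Hs. assert (Y := Cmod_ge_sub v w). lra.
    - assert (HM' := pbound_deriv c rho ((Cmod w + rho) / 2) M ltac:(lra) HM). eexists. eapply cder_psum; [exact HM'|lra]. }
  exists (psum (pderiv c)). split; intros w Hw; apply (Main w ((Cmod w + r) / 2)%R); lra.
Qed.

Lemma taylor_real (f : C -> C) (r d : R) : (0 < r)%R -> (0 < d)%R -> hol r f -> (forall t : R, (0 < t < d)%R -> Im (f t) = 0%R) ->
  exists a : nat -> R, forall w, (Cmod w < r)%R ->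
    is_pseries (K := C_AbsRing) (V := C_NormedModule) (fun j => RtoC (a j)) w (f w).
Proof.
  intros Hr Hd Hf HI. destruct (taylor_disc f r Hr Hf) as [c Hc]. exists (fun j => Re (c j)).
  assert (Hre : forall k, Im (c k) = 0%R).
  { destruct (Hc (r / 2)%R ltac:(lra)) as [[M HM] Hs].
    apply (psum_real_coef c (r / 2) M (Rmin d (r / 2)) ltac:(lra) ltac:(apply Rmin_pos; lra) HM).
    intros t Ht. assert (Z := Rmin_l d (r / 2)). assert (Z' := Rmin_r d (r / 2)).
    rewrite <- Hs by (rewrite Cmod_R, Rabs_pos_eq; lra). apply HI. lra. }
  intros w Hw. apply is_pseries_cser. assert (X := Cmod_ge_0 w).
  destruct (Hc ((Cmod w + r) / 2)%R ltac:(lra)) as [[M HM] Hs]. rewrite Hs by lra.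
  apply (cser_ext (fun k => c k * w ^ k)); [|eapply psum_cser; [exact HM|lra]].
  intros k. f_equal. apply C_eq; simpl; auto.
Qed.

Lemma pseries_real_conj (a : nat -> R) (w l l' : C) :
  is_pseries (K := C_AbsRing) (V := C_NormedModule) (fun j => RtoC (a j)) w l ->
  is_pseries (K := C_AbsRing) (V := C_NormedModule) (fun j => RtoC (a j)) (Cconj w) l' -> Cconj l' = l.
Proof.
  rewrite !is_pseries_cser. intros H1 H2. apply cser_conj in H2. eapply cser_unique; [|exact H1].
  eapply cser_ext; [|exact H2]. intros k. cbv beta. rewrite Cmult_conj, Cpow_conj, Cconj_conj, Cconj_RtoC. reflexivity.
Qed.

(** Real coefficients mean invariance under Schwarz reflection. For A', known only as the derivative
    of A, the invariance follows from uniqueness of derivatives. *)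
Lemma real_form_of_series (m : nat) (r : R) (P Q A A' B : C -> C) (a b : nat -> R) :
  (forall w : C, cdisc r w ->
       is_pseries (K := C_AbsRing) (V := C_NormedModule) (fun j => RtoC (a j)) w (A w) /\
       is_pseries (K := C_AbsRing) (V := C_NormedModule) (fun j => RtoC (b j)) w (B w) /\
       is_derive (K := C_AbsRing) (V := C_NormedModule) A w (A' w) /\
       P w = (2 * Ci * A w - INR m * w ^ (m - 1))%C /\
       Q w = (B w + Ci * w ^ m * A' w)%C) ->
  real_form m r P Q A A' B.
Proof.
  unfold cdisc. intros H w Hw. assert (Hw' : (Cmod (Cconj w) < r)%R) by (rewrite Cmod_conj; auto).
  destruct (H w Hw) as [H1 [H2 [H3 [H4 H5]]]]. destruct (H _ Hw') as [G1 [G2 [G3 _]]].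
  apply is_derive_cder in H3, G3. repeat split; auto.
  - eapply pseries_real_conj; eauto.
  - eapply cder_unique; [|exact H3]. apply (cder_ext_loc (fun w => Cconj (A (Cconj w))) A w _ (r - Cmod w)); [lra| |apply cder_conj; auto].
    intros v Hv. assert (Hv' : (Cmod v < r)%R) by (assert (Y := Cmod_ge_sub v w); lra).
    apply (pseries_real_conj a v); [exact (proj1 (H v Hv'))|]. refine (proj1 (H (Cconj v) _)). rewrite Cmod_conj; exact Hv'.
  - eapply pseries_real_conj; eauto.
Qed.

(** A and B are forced: solve P = 2 i A - m w^(m-1) for A, then Q for B. The two relations of
    [reality_at_point] say exactly that A and B are real at small positive u. *)
Lemma real_coefficients (m : nat) (r : R) (P Q : C -> C) (M : C * C -> Prop) : (1 <= m)%nat -> (0 < r)%R ->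
  hol r P -> hol r Q -> associated_hypersurface m r P Q M ->
  exists (a b : nat -> R) (A A' B : C -> C),
     forall w : C, cdisc r w ->
       is_pseries (K := C_AbsRing) (V := C_NormedModule) (fun j => RtoC (a j)) w (A w) /\
       is_pseries (K := C_AbsRing) (V := C_NormedModule) (fun j => RtoC (b j)) w (B w) /\
       is_derive (K := C_AbsRing) (V := C_NormedModule) A w (A' w) /\
       P w = (2 * Ci * A w - INR m * w ^ (m - 1))%C /\
       Q w = (B w + Ci * w ^ m * A' w)%C.
Proof.
  intros Hm Hr HP HQ [HA [S [HS HF]]].
  destruct (hol_deriv P r Hr HP) as [P1 [HP1 DP]].
  destruct (reality_at_point m r P P1 Q M S Hm Hr HP HQ DP HP1 HA HS HF) as [e [He Hre]].
  assert (HCi : Ci <> 0) by (apply Cmod_gt_0; rewrite Cmod_Ci; lra).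
  set (A := fun w => - Ci / 2 * (P w + INR m * w ^ (m - 1))).
  assert (HA' : hol r A) by (unfold A; apply hol_mult; [apply hol_const|apply hol_plus; [auto|apply hol_mult; [apply hol_const|apply hol_pow, hol_id]]]).
  set (A1 := fun w => - Ci / 2 * (P1 w + INR m * (INR (m - 1) * w ^ (m - 1 - 1)))).
  assert (DA : forall w, (Cmod w < r)%R -> cder A w (A1 w)).
  { intros w Hw. apply cder_scal, cder_plus; [auto|apply cder_scal, cder_Cpow]. }
  set (B := fun w => Q w - Ci * w ^ m * A1 w).
  assert (HB : hol r B).
  { unfold B, A1. apply hol_minus; auto. apply hol_mult; [apply hol_mult; [apply hol_const|apply hol_pow, hol_id]|].
    apply hol_mult; [apply hol_const|]. apply hol_plus; auto. apply hol_mult; [apply hol_const|]. apply hol_mult; [apply hol_const|apply hol_pow, hol_id]. }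
  assert (Half : - Ci / 2 = Ci * RtoC (- / 2)) by (apply C_eq; simpl; field).
  destruct (taylor_real A r e Hr He HA') as [a Ha].
  { intros t Ht. destruct (Hre t Ht) as [R1 _]. unfold A. rewrite Half, <- RtoC_pow, <- RtoC_mult.
    revert R1. generalize (P t) (INR m) (t ^ (m - 1))%R. intros [x y] u v. simpl. lra. }
  destruct (taylor_real B r e Hr He HB) as [b Hb].
  { intros t Ht. destruct (Hre t Ht) as [_ R2]. unfold B, A1. rewrite Half, <- !RtoC_pow, <- !RtoC_mult.
    revert R2. generalize (P1 t) (Q t) (t ^ m)%R (INR m * (INR (m - 1) * t ^ (m - 1 - 1)))%R. intros [x y] [x' y'] u v. simpl. lra. }
  exists a, b, A, A1, B. intros w Hw. split; [auto|]. split; [auto|]. split; [|split].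
  - apply is_derive_cder; auto.
  - unfold A. transitivity (- (Ci * Ci) * (P w + INR m * w ^ (m - 1)) - INR m * w ^ (m - 1)); [|field].
    replace (Ci * Ci) with (- RtoC 1) by (apply C_eq; simpl; ring). ring.
  - unfold B. ring.
Qed.

(** * The Segre family of an equation *)

(** D equals 1 at s = 0, so s - F is a contraction on a small disc. The radius is uniform in y
    because the quadratic remainder of F and the Lipschitz constant of D depend only on K and
    tau. *)
Lemma near_identity (F D : C -> C -> C) (tau rho K : R) : (0 < tau)%R -> (0 < rho)%R -> shol2 F tau rho K -> shol2 D tau rho K ->
  (forall y, (Cmod y < rho)%R -> D 0 y = 1 /\ forall s, (Cmod s < tau)%R -> cder (fun s => F s y) s (D s y)) ->
  exists t1, (0 < t1 <= tau / 2)%R /\ forall y t t', (Cmod y < rho)%R -> (Cmod t <= t1)%R -> (Cmod t' <= t1)%R ->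
    (Cmod (F t y - F t' y - (t - t')) <= / 2 * Cmod (t - t'))%R.
Proof.
  intros Ht Hr HF HD HFD. assert (HK : (0 <= K)%R).
  { destruct HF as [_ [_ HF]]. eapply Rle_trans; [apply Cmod_ge_0|apply (HF 0 0); rewrite Cmod_0; auto]. }
  destruct (shol2_coef F tau rho K Ht Hr HF) as [c [_ [Hc2 Hc3]]].
  set (L := (2 * K / tau / (tau / 2) * (/ (1 - tau / 2 / tau) * / (1 - tau / 2 / tau) * / (1 - tau / 2 / tau)))%R).
  assert (HL : (0 <= L)%R).
  { unfold L. replace (tau / 2 / tau)%R with (/ 2)%R by (field; lra). apply Rmult_le_pos; [|lra].
    apply Rdiv_le_0_compat; [|lra]. apply Rdiv_le_0_compat; lra. }
  assert (HK' : (0 <= 8 * K / tau)%R) by (apply Rdiv_le_0_compat; lra).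
  set (t1 := Rmin (tau / 2) (/ 2 / (2 * L + 8 * K / tau + 1))).
  assert (X1 := Rmin_l (tau / 2) (/ 2 / (2 * L + 8 * K / tau + 1))). assert (X2 := Rmin_r (tau / 2) (/ 2 / (2 * L + 8 * K / tau + 1))). fold t1 in X1, X2.
  assert (Hp : (0 < t1)%R) by (apply Rmin_pos; [lra|apply Rdiv_lt_0_compat; lra]).
  exists t1. split; [lra|]. intros y t t' Hy H1 H2. destruct (HFD y Hy) as [D0 FD].
  assert (Q := psum_quad (fun k => c k y) tau (tau / 2) (2 * K) t' t (Hc2 y Hy) ltac:(lra) ltac:(lra) ltac:(lra)). fold L in Q.
  rewrite <- !Hc3 in Q by (auto; lra).
  assert (E : psum (pderiv (fun k => c k y)) t' = D t' y).
  { eapply cder_unique; [|apply FD; lra]. apply (cder_ext_loc (psum (fun k => c k y)) _ _ _ (tau - Cmod t')); [lra| |eapply cder_psum; [apply Hc2; auto|lra]].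
    intros w Hw. symmetry. apply Hc3; auto. assert (Y := Cmod_ge_sub w t'). lra. }
  rewrite E in Q.
  assert (B := hol_lip (fun s => D s y) tau K 0 t' Ht (proj1 HD y Hy) (fun w Hw => proj2 (proj2 HD) w y Hw Hy) ltac:(rewrite Cmod_0; lra) ltac:(lra)).
  cbv beta in B. rewrite D0 in B. replace (t' - 0) with t' in B by ring.
  replace (F t y - F t' y - (t - t')) with ((F t y - F t' y - D t' y * (t - t')) + (D t' y - 1) * (t - t')) by ring.
  eapply Rle_trans; [apply Cmod_triangle|]. rewrite Cmod_mult.
  assert (Y : (Cmod (t - t') <= 2 * t1)%R) by (eapply Rle_trans; [apply Cmod_sub_triangle|lra]).
  assert (Z := Cmod_ge_0 (t - t')).
  assert (T : (t1 * (2 * L + 8 * K / tau + 1) <= / 2)%R).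
  { apply (Rle_trans _ (/ 2 / (2 * L + 8 * K / tau + 1) * (2 * L + 8 * K / tau + 1))); [apply Rmult_le_compat_r; lra|right; field; repeat split; try lra].
    assert (0 < 2 * L * tau + 8 * K + tau)%R by nra. lra. }
  assert (L * (Cmod (t - t') * Cmod (t - t')) <= L * (2 * t1) * Cmod (t - t'))%R by (rewrite Rmult_assoc; apply Rmult_le_compat_l, Rmult_le_compat_r; auto).
  assert (Cmod (D t' y - 1) * Cmod (t - t') <= (8 * K / tau * t1) * Cmod (t - t'))%R.
  { apply Rmult_le_compat_r; auto. eapply Rle_trans; [exact B|]. apply Rmult_le_compat_l; auto. }
  nra.
Qed.

(** F is the solution with value 0 and scaled derivative 1 at w = y, and [sg] is its inverse in the
    scaled variable. The Segre curve will be w = y + i y^m sg(z conj xi, y) with y = conj eta, that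
    is, F = z conj xi along it. *)
Lemma inverse_family (m : nat) (r : R) (P Q : C -> C) : (1 <= m)%nat -> (0 < r)%R -> hol r P -> hol r Q ->
  exists (F D sg : C -> C -> C) (tau rho t1 R1 : R), (0 < t1 <= tau / 2)%R /\ (tau <= / 2)%R /\ (0 < rho <= / 2)%R /\ (2 * rho <= r)%R /\ (R1 = t1 / 2)%R /\
    shol2 sg R1 rho t1 /\ forall y, (Cmod y < rho)%R -> F 0 y = 0 /\ D 0 y = 1 /\ sg 0 y = 0 /\
      (y <> 0 -> forall w, (Cmod (w - y) < tau * Cmod y ^ m)%R ->
          lin_sol m P Q (fun w => F ((w - y) / (Ci * y ^ m)) y) (fun w => D ((w - y) / (Ci * y ^ m)) y / (Ci * y ^ m)) w) /\
      forall x, (Cmod x < R1)%R -> F (sg x y) y = x /\ D (sg x y) y <> 0 /\ cder (fun x => sg x y) x (/ D (sg x y) y) /\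
        forall t, (Cmod t <= t1)%R -> F t y = x -> t = sg x y.
Proof.
  intros Hm Hr HP HQ. destruct (scaled_solutions m r P Q Hm Hr HP HQ) as [tau [rho [Ht [Hrho [Hrr Hs]]]]].
  destruct (Hs (fun _ => 0) (fun _ => 1) 1%R (hol_const _ _) (hol_const _ _)) as [F [D [K [HF [HD HFD]]]]].
  { intros. rewrite Cmod_0, Cmod_1. lra. }
  destruct (near_identity F D tau rho K ltac:(lra) ltac:(lra) HF HD) as [t1 [Ht1 HL]].
  { intros y Hy. split; apply (HFD y Hy). }
  set (N := fun x y t => x + (t - F t y)). set (sg := fun x y => fixpt (N x y)).
  assert (HN : forall x y, (Cmod x < t1 / 2)%R -> (Cmod y < rho)%R -> contracts t1 (N x y)).
  { intros x y Hx Hy. split.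
    - unfold N. rewrite (proj1 (HFD y Hy)). replace (x + (0 - 0)) with x by ring. lra.
    - intros t t' H1 H2. unfold N. replace (x + (t - F t y) - (x + (t' - F t' y))) with (- (F t y - F t' y - (t - t'))) by ring.
      rewrite Cmod_opp. auto. }
  assert (Hsg : shol2 sg (t1 / 2) rho t1).
  { split; [|split].
    - intros y Hy. apply (fixpt_hol t1 (t1 / 2) (fun x => N x y)); try lra; auto. intros phi Hphi Hb. unfold N. apply hol_plus; [apply hol_id|].
      apply hol_minus; auto. apply (hol_comp2 F tau rho K); auto; [apply hol_const|]. intros z Hz. split; auto. specialize (Hb z Hz). lra.
    - intros x Hx. apply (fixpt_hol t1 rho (N x)); try lra; auto. intros phi Hphi Hb. unfold N. apply hol_plus; [apply hol_const|].
      apply hol_minus; auto. apply (hol_comp2 F tau rho K); auto; [apply hol_id|]. intros z Hz. split; auto. specialize (Hb z Hz). lra.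
    - intros x y Hx Hy. apply (fixpt_spec t1 (N x y)); auto; lra. }
  exists F, D, sg, tau, rho, t1, (t1 / 2)%R. do 5 (split; [lra|]). split; [auto|]. intros y Hy.
  assert (U : forall x t, (Cmod x < t1 / 2)%R -> (Cmod t <= t1)%R -> F t y = x -> t = sg x y).
  { intros x t Hx Htt E. apply (fixpt_unique t1); auto; [lra|]. unfold N. rewrite E. ring. }
  destruct (HFD y Hy) as [F0 [D0 [FD LS]]].
  split; auto. split; auto. split. { symmetry. apply U; auto; rewrite Cmod_0; lra. } split; auto.
  intros x Hx. destruct (fixpt_spec t1 (N x y) ltac:(lra) (HN x y Hx Hy)) as [B [E _]]. fold (sg x y) in B, E.
  assert (EF : forall x, (Cmod x < t1 / 2)%R -> F (sg x y) y = x).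
  { intros x' Hx'. destruct (fixpt_spec t1 (N x' y) ltac:(lra) (HN x' y Hx' Hy)) as [_ [E' _]]. fold (sg x' y) in E'. unfold N in E'.
    transitivity (x' + (sg x' y - F (sg x' y) y) - sg x' y + F (sg x' y) y); [rewrite E' at 1|]; ring. }
  split; [auto|]. destruct (proj1 Hsg y Hy x Hx) as [s' Hs'].
  (* Differentiating F(sg x y, y) = x gives the derivative of [sg], and the nonvanishing of D at the
     same time. *)
  assert (One : D (sg x y) y * s' = 1).
  { apply (cder_unique (fun x => x) x); [|apply cder_id]. apply (cder_ext_loc (fun x => F (sg x y) y) _ _ _ (t1 / 2 - Cmod x)); [lra| |].
    - intros w Hw. apply EF. assert (Y := Cmod_ge_sub w x). lra.
    - apply (cder_comp (fun s => F s y) (fun x => sg x y)); auto. apply FD. lra. }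
  assert (Dn : D (sg x y) y <> 0). { intros Z. apply (RtoC_neq0 1); [lra|]. rewrite <- One, Z. ring. }
  split; auto. split; [|intros t Htt Et; apply U; auto].
  eapply cder_eq; [exact Hs'|]. transitivity (D (sg x y) y * s' / D (sg x y) y); [field; auto|]. rewrite One. field; auto.
Qed.

(* [log1p q] is log(1 + q) / q, extended by 1 at [q = 0]. *)
Definition log1p (q : C) : C := psum (fun n => (- RtoC 1) ^ n / INR (S n)) q.

Lemma INR_S_neq0 (n : nat) : RtoC (INR (S n)) <> 0.
Proof. apply RtoC_neq0. rewrite S_INR. assert (X := pos_INR n). lra. Qed.

Lemma log1p_pbound : pbound (fun n => (- RtoC 1) ^ n / INR (S n)) 1 1.
Proof.
  intros k. rewrite Cmod_div by apply INR_S_neq0. rewrite Cmod_pow, Cmod_opp, Cmod_1, !pow1, Cmod_R, Rabs_pos_eq by apply pos_INR.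
  rewrite Rmult_1_r. rewrite <- (Rinv_1) at 2. unfold Rdiv. rewrite Rmult_1_l. apply Rinv_le_contravar; [lra|]. rewrite S_INR. assert (X := pos_INR k). lra.
Qed.

Lemma hol_log1p : hol 1 log1p.
Proof. exact (hol_psum _ _ _ log1p_pbound). Qed.

(** With b(q) = q [log1p] q one has b' (1 + q) = 1 by the geometric series, so exp(-b) (1 + q) has
    zero derivative and keeps its value 1 at q = 0. *)
Lemma Cexp_log1p (q : C) : (Cmod q < 1)%R -> Cexp (q * log1p q) = 1 + q.
Proof.
  set (c := fun n => (- RtoC 1) ^ n). set (b := fun n => match n with O => RtoC 0 | S n => c n / INR (S n) end).
  assert (Hb : pbound b 1 1).
  { intros [|k]; [simpl; rewrite Cmod_0; lra|]. assert (X := log1p_pbound k). rewrite !pow1 in *. exact X. }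
  assert (Hc : pbound c 1 1). { intros k. unfold c. rewrite Cmod_pow, Cmod_opp, Cmod_1, !pow1. lra. }
  assert (E1 : forall q, (Cmod q < 1)%R -> psum b q = q * log1p q).
  { intros x Hx. rewrite (psum_shift b 1 1 x Hb Hx). change (0 + x * log1p x = x * log1p x). ring. }
  assert (E2 : forall q, (Cmod q < 1)%R -> psum (pderiv b) q * (1 + q) = 1).
  { intros x Hx. rewrite (psum_ext _ c) by (intros k; unfold pderiv, b; field; apply INR_S_neq0).
    assert (X := psum_shift c 1 1 x Hc Hx). rewrite (psum_ext (fun k => c (S k)) (fun k => - RtoC 1 * c k)) in X by reflexivity.
    rewrite (psum_scal _ c 1 1) in X by auto. unfold c at 2 in X. simpl in X.
    transitivity (psum c x + x * psum c x); [ring|]. rewrite X at 1. ring. }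
  intros Hq. rewrite <- (E1 q Hq).
  assert (Z : Cexp (- psum b 0) * (1 + 0) = Cexp (- psum b q) * (1 + q)).
  { apply (cder_zero_segment (fun q => Cexp (- psum b q) * (1 + q))). intros t Ht.
    assert (Hx : (Cmod (0 + (q - 0) * t) < 1)%R).
    { replace (0 + (q - 0) * t) with (q * t) by ring. rewrite Cmod_mult, Cmod_R, Rabs_pos_eq by lra. assert (X := Cmod_ge_0 q). nra. }
    set (x := 0 + (q - 0) * t) in *.
    eapply cder_eq; [apply cder_mult; [apply (cder_comp Cexp); [apply cder_Cexp|apply cder_opp, (cder_psum b 1 1); auto]|apply cder_plus; [apply cder_const|apply cder_id]]|].
    cbv beta. transitivity (Cexp (- psum b x) * (1 - psum (pderiv b) x * (1 + x))); [ring|]. rewrite (E2 x Hx). ring. }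
  rewrite (psum_0 b 1 1) in Z by (auto; lra). unfold b at 1 in Z. replace (- RtoC 0) with (RtoC 0) in Z by ring. rewrite Cexp_0 in Z.
  transitivity (Cexp (psum b q) * (1 * (1 + 0))); [ring|]. rewrite Z.
  transitivity (Cexp (psum b q + - psum b q) * (1 + q)); [rewrite Cexp_plus; ring|]. replace (psum b q + - psum b q) with (RtoC 0) by ring. rewrite Cexp_0. ring.
Qed.

(** The choice psi = sg [log1p](i y^(m-1) sg) makes i y^(m-1) psi the logarithm of [scl], which
    turns y [scl] into the exponential form required of a Segre family, without dividing by y. The
    normalisation psi = x + O(x^2) comes from sg = x + O(x^2). *)
Lemma segre_family_of_inverse (m : nat) (sg D : C -> C -> C) (t1 rho R1 : R) : (0 < t1 <= / 4)%R -> (0 < rho <= / 2)%R -> (0 < R1 <= / 2)%R ->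
  shol2 sg R1 rho t1 ->
  (forall y, (Cmod y < rho)%R -> sg 0 y = 0 /\ D 0 y = 1 /\ forall x, (Cmod x < R1)%R -> cder (fun x => sg x y) x (/ D (sg x y) y)) ->
  exists S : positive_segre_family, sf_delta S = R1 /\ sf_eps S = rho /\
    forall p z, (Cmod (fst p) < R1)%R -> (Cmod (snd p) < rho)%R -> (Cmod z < R1)%R ->
      segre_graph m S p z = Cconj (snd p) * scl m (Cconj (snd p)) (sg (z * Cconj (fst p)) (Cconj (snd p))).
Proof.
  intros Ht Hrho HR Hsg Hy0.
  assert (Q1 : forall x y, (Cmod x < R1)%R -> (Cmod y < rho)%R -> (Cmod (Ci * y ^ (m - 1) * sg x y) <= / 4)%R).
  { intros x y Hx Hy. rewrite !Cmod_mult, Cmod_Ci, Cmod_pow. assert (A := proj2 (proj2 Hsg) x y Hx Hy).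
    assert (B := pow_le_1 (Cmod y) (m - 1) ltac:(assert (T := Cmod_ge_0 y); lra)). assert (T := Cmod_ge_0 (sg x y)). nra. }
  set (psi := fun x y => sg x y * log1p (Ci * y ^ (m - 1) * sg x y)).
  assert (Hpsi : shol2 psi R1 rho (t1 * (1 / (1 - / 4)))).
  { split; [|split].
    - intros y Hy. unfold psi. assert (A := proj1 Hsg y Hy). apply hol_mult; auto.
      apply (hol_comp R1 1 log1p); [apply hol_log1p|apply hol_mult; auto; apply hol_const|]. intros x Hx. specialize (Q1 x y Hx Hy). lra.
    - intros x Hx. unfold psi. assert (A := proj1 (proj2 Hsg) x Hx). apply hol_mult; auto.
      apply (hol_comp rho 1 log1p); [apply hol_log1p|apply hol_mult; auto; apply hol_mult; [apply hol_const|apply hol_pow, hol_id]|]. intros y Hy. specialize (Q1 x y Hx Hy). lra.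
    - intros x y Hx Hy. specialize (Q1 x y Hx Hy). unfold psi. rewrite Cmod_mult. apply Rmult_le_compat; try apply Cmod_ge_0; [apply Hsg; auto|].
      eapply Rle_trans; [apply (psum_le _ _ _ _ log1p_pbound); lra|]. rewrite Rdiv_1_r. unfold Rdiv. rewrite !Rmult_1_l. apply Rinv_le_contravar; lra. }
  destruct (shol2_coef psi R1 rho _ ltac:(lra) ltac:(lra) Hpsi) as [c [Hc1 [Hc2 Hc3]]].
  assert (C0 : forall y, (Cmod y < rho)%R -> c 0%nat y = 0 /\ c 1%nat y = 1).
  { intros y Hy. destruct (Hy0 y Hy) as [S0 [D0 DS]]. assert (Z : (Cmod 0 < R1)%R) by (rewrite Cmod_0; lra).
    rewrite <- (psum_0 (fun k => c k y) R1 _ ltac:(lra) (Hc2 y Hy)). rewrite <- Hc3 by auto. split; [unfold psi; rewrite S0; ring|].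
    assert (A : cder (fun x => psi x y) 0 (psum (pderiv (fun k => c k y)) 0)).
    { apply (cder_ext_loc (psum (fun k => c k y)) _ _ _ R1); [lra| |apply (cder_psum _ _ _ _ (Hc2 y Hy) Z)].
      intros w Hw. symmetry. apply Hc3; auto. replace w with (w - 0) by ring. auto. }
    assert (HB := pbound_deriv _ R1 (R1 / 2) _ ltac:(lra) (Hc2 y Hy)). rewrite (psum_0 _ (R1 / 2) _ ltac:(lra) HB) in A. unfold pderiv in A.
    destruct (hol_log1p 0 ltac:(rewrite Cmod_0; lra)) as [l' Hl'].
    assert (A' : cder (fun x => psi x y) 0 1).
    { assert (DS0 := DS 0 Z). eapply cder_eq; [apply cder_mult; [exact DS0|]|].
      - apply (cder_comp log1p (fun x => Ci * y ^ (m - 1) * sg x y)); [|apply cder_scal, DS0].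
        rewrite S0. replace (Ci * y ^ (m - 1) * 0) with (RtoC 0) by ring. exact Hl'.
      - cbv beta. rewrite S0, D0. replace (Ci * y ^ (m - 1) * 0) with (RtoC 0) by ring. unfold log1p. rewrite (psum_0 _ 1 1 ltac:(lra) log1p_pbound). simpl. field. }
    assert (E := cder_unique _ _ _ _ A A'). rewrite <- E. simpl. ring. }
  (* The record wants psi on |x| < delta^2; with delta = R1 <= 1 / 2 this lies inside the disc of
     radius R1. *)
  assert (Hsq : (R1 ^ 2 <= R1)%R) by (simpl; nra).
  unshelve eexists (Build_positive_segre_family R1 rho (fun q => psi (fst q) (snd q)) c _ _ _ _); try lra.
  - intros [x y] [Hx Hy]. simpl fst in Hx. simpl snd in Hy. unfold cdisc in Hx, Hy.
    destruct (shol2_cder2 psi R1 rho _ x y Hpsi ltac:(lra) Hy) as [a [b Hab]]. eapply cder2_ex_filterdiff. exact Hab.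
  - intros x y Hx Hy. unfold cdisc in Hx, Hy. apply is_pseries_cser. destruct (C0 y Hy) as [C00 C01].
    apply (cser_ext (fun k => c k y * x ^ k)); [intros [|[|k]]; [rewrite C00|rewrite C01|]; reflexivity|].
    cbv beta. simpl fst. simpl snd. rewrite Hc3 by lra. apply (psum_cser _ R1 _ x (Hc2 y Hy)). lra.
  - split; [reflexivity|]. split; [reflexivity|]. intros p z Hp1 Hp2 Hz. unfold segre_graph. simpl sf_psi. cbv beta. simpl fst. simpl snd.
    set (y := Cconj (snd p)). set (x := z * Cconj (fst p)).
    assert (Hy : (Cmod y < rho)%R) by (unfold y; rewrite Cmod_conj; auto).
    assert (Hx : (Cmod x < R1)%R). { unfold x. rewrite Cmod_mult, Cmod_conj. assert (T1 := Cmod_ge_0 z). assert (T2 := Cmod_ge_0 (fst p)). nra. }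
    unfold scl. specialize (Q1 x y Hx Hy). rewrite <- (Cexp_log1p (Ci * y ^ (m - 1) * sg x y)) by lra. unfold psi. f_equal. f_equal. ring.
Qed.

(** Along the curve l(W(z)) = z conj xi with l a solution of the linear equation, so W' = conj xi /
    l1(W), and differentiating once more gives the inverse equation. The formula also covers conj xi
    = 0, where W is constant. *)
Lemma associated_of_inverse (m : nat) (r : R) (P Q : C -> C) (F D sg : C -> C -> C) (tau rho t1 R1 : R) (S : positive_segre_family) :
  (1 <= m)%nat -> (0 < t1 <= tau / 2)%R -> (2 * rho <= r)%R -> (0 < R1 <= / 2)%R -> shol2 sg R1 rho t1 ->
  (forall y, (Cmod y < rho)%R -> 
      (y <> 0 -> forall w, (Cmod (w - y) < tau * Cmod y ^ m)%R ->
          lin_sol m P Q (fun w => F ((w - y) / (Ci * y ^ m)) y) (fun w => D ((w - y) / (Ci * y ^ m)) y / (Ci * y ^ m)) w) /\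
      forall x, (Cmod x < R1)%R -> F (sg x y) y = x /\ D (sg x y) y <> 0 /\ cder (fun x => sg x y) x (/ D (sg x y) y)) ->
  sf_delta S = R1 -> sf_eps S = rho ->
  (forall p z, (Cmod (fst p) < R1)%R -> (Cmod (snd p) < rho)%R -> (Cmod z < R1)%R ->
      segre_graph m S p z = Cconj (snd p) * scl m (Cconj (snd p)) (sg (z * Cconj (fst p)) (Cconj (snd p)))) ->
  associated_segre_family m r P Q S.
Proof.
  intros Hm Ht Hrr HR Hsg HF Ed Ee HG. assert (Hde := sf_eps_pos S). exists R1, rho. rewrite Ed, Ee. rewrite Ee in Hde.
  split; [lra|]. split; [lra|]. split; [lra|]. intros p Hp1 Hp2 Hp3. unfold cdisc in Hp1, Hp2.
  specialize (fun z => HG p z Hp1 Hp2). set (y := Cconj (snd p)) in *. set (k := Cconj (fst p)) in *.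
  assert (Hy : (Cmod y < rho)%R) by (unfold y; rewrite Cmod_conj; auto).
  assert (Hk : (Cmod k < R1)%R) by (unfold k; rewrite Cmod_conj; auto).
  assert (y0 : y <> 0) by (apply Cconj_neq0; auto).
  assert (HCi : Ci <> 0) by (apply Cmod_gt_0; rewrite Cmod_Ci; lra).
  assert (ym : y ^ m <> 0) by (apply Cpow_nz; auto).
  destruct (HF y Hy) as [LS Hx]. specialize (LS y0).
  set (l := fun w => F ((w - y) / (Ci * y ^ m)) y) in LS. set (l1 := fun w => D ((w - y) / (Ci * y ^ m)) y / (Ci * y ^ m)) in LS.
  set (W := segre_graph m S p) in *.
  assert (EW : forall z, (Cmod z < R1)%R -> W z = y + Ci * y ^ m * sg (z * k) y).
  { intros z Hz. rewrite HG by auto. unfold scl. rewrite (Cpow_pred y m Hm). ring. }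
  assert (Bd : forall z, (Cmod z < R1)%R -> (Cmod (z * k) < R1)%R).
  { intros z Hz. rewrite Cmod_mult. assert (T1 := Cmod_ge_0 z). assert (T2 := Cmod_ge_0 k). nra. }
  exists (fun z => k / l1 (W z)). 
  exists (fun z => - (P (W z) / W z ^ m) * (k / l1 (W z)) ^ 2 - Q (W z) / W z ^ (2 * m) * (k / l1 (W z)) ^ 3 * z).
  intros z [Hz _]. unfold cdisc in Hz. destruct (Hx (z * k) (Bd z Hz)) as [E1 [E2 E3]].
  assert (Es : (W z - y) / (Ci * y ^ m) = sg (z * k) y) by (rewrite EW by auto; field; auto).
  assert (El1 : l1 (W z) = D (sg (z * k) y) y / (Ci * y ^ m)) by (unfold l1; rewrite Es; auto).
  assert (l1n : l1 (W z) <> 0).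
  { rewrite El1. intros Z. apply E2. transitivity (D (sg (z * k) y) y / (Ci * y ^ m) * (Ci * y ^ m)); [field; auto|]. rewrite Z. ring. }
  destruct (LS (W z)) as [L1 L2].
  { rewrite EW by auto. replace (y + Ci * y ^ m * sg (z * k) y - y) with (Ci * y ^ m * sg (z * k) y) by ring.
    rewrite !Cmod_mult, Cmod_Ci, Cmod_pow. assert (A := proj2 (proj2 Hsg) (z * k) y (Bd z Hz) Hy).
    assert (B : (0 < Cmod y ^ m)%R) by (apply pow_lt, Cmod_gt_0; auto). nra. }
  assert (DW : cder W z (k / l1 (W z))).
  { apply (cder_ext_loc (fun z => y + Ci * y ^ m * sg (z * k) y) _ _ _ (R1 - Cmod z)); [lra| |].
    - intros w Hw. symmetry. apply EW. assert (Y := Cmod_ge_sub w z). lra.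
    - eapply cder_eq; [apply cder_plus; [apply cder_const|]; apply cder_scal; apply (cder_comp (fun x => sg x y) (fun z => z * k)); [exact E3|apply cder_mult; [apply cder_id|apply cder_const]]|].
      cbv beta. rewrite El1. field. auto. }
  rewrite !is_derive_cder. split; [auto|]. split; [|reflexivity].
  eapply cder_eq; [apply cder_div; [apply cder_const|apply (cder_comp l1 W); [exact L2|exact DW]|exact l1n]|].
  cbv beta. replace (l (W z)) with (z * k) by (unfold l; rewrite Es; auto).
  generalize (P (W z) / W z ^ m) (Q (W z) / W z ^ (2 * m)). intros u v. field. auto.
Qed.

(** * Sufficiency of the reality conditions *)

(* For real [h], the point [w = u + i u^m h] lies on the hypersurface iff
   [w = y + i y^m sg x y] with [y] its conjugate, i.e. iff [h] is fixed by [hstep]. *)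
Definition hstep (m : nat) (sg : C -> C -> C) (x u h : C) : C := / 2 * scl m u (- h) ^ m * sg x (u * scl m u (- h)).

(** As sg vanishes at x = 0, [hstep] is at most K |x| on |h| <= 1/2. By [hol_lip] its Lipschitz
    constant in h is 16 K |x| <= 16 cap, so cap <= 1/32 makes it a contraction with factor 1 / 2.
    The derivative 1 / 2 in x is the leading coefficient of the hypersurface. *)
Lemma hypersurface_function (m : nat) (sg : C -> C -> C) (t1 rho R1 cap : R) : (0 < t1)%R -> (0 < rho <= / 2)%R -> (R1 = t1 / 2)%R ->
  shol2 sg R1 rho t1 -> (forall y, (Cmod y < rho)%R -> sg 0 y = 0 /\ cder (fun x => sg x y) 0 1) -> (0 < cap <= / 32)%R ->
  exists (H : C -> C -> C) (R2 : R), (0 < R2 <= R1)%R /\ shol2 H R2 (rho / 2) (/ 4) /\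
    forall x u, (Cmod x < R2)%R -> (Cmod u < rho / 2)%R -> (Cmod (H x u) <= cap)%R /\ H x u = hstep m sg x u (H x u) /\
      (forall h, (Cmod h <= / 4)%R -> h = hstep m sg x u h -> h = H x u) /\
      (forall y, (Cmod y < rho)%R -> (Cmod (sg x y) * (3 / 2) ^ m <= 2 * cap)%R) /\
      H 0 u = 0 /\ cder (fun x => H x u) 0 (/ 2).
Proof.
  (* Here 8 = 16 / 2: [hol_lip] gives |sg| <= (8 t1 / R1) |x| = 16 |x|, and [hstep] carries the
     factor 1 / 2; |[scl]| <= 3/2 gives the power. *)
  intros Ht Hrho HR Hsg Hy0 Hcap. set (K := (8 * (3 / 2) ^ m)%R).
  assert (Hpw : (0 < (3 / 2) ^ m)%R) by (apply pow_lt; lra).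
  assert (HK : (0 < K)%R) by (unfold K; lra).
  set (R2 := Rmin (R1 / 2) (cap / K)). assert (X1 := Rmin_l (R1 / 2) (cap / K)). assert (X2 := Rmin_r (R1 / 2) (cap / K)). fold R2 in X1, X2.
  assert (HR2 : (0 < R2)%R) by (apply Rmin_pos; [lra|apply Rdiv_lt_0_compat; lra]).
  assert (KR2 : (K * R2 <= cap)%R). { apply (Rle_trans _ (K * (cap / K))); [apply Rmult_le_compat_l; lra|right; field; lra]. }
  assert (Sb : forall x y, (Cmod x < R2)%R -> (Cmod y < rho)%R -> (Cmod (sg x y) <= 16 * Cmod x)%R).
  { intros x y Hx Hy. assert (B := hol_lip (fun x => sg x y) R1 t1 0 x ltac:(lra) (proj1 Hsg y Hy) (fun w Hw => proj2 (proj2 Hsg) w y Hw Hy) ltac:(rewrite Cmod_0; lra) ltac:(lra)).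
    cbv beta in B. rewrite (proj1 (Hy0 y Hy)) in B. replace (sg x y - 0) with (sg x y) in B by ring. replace (x - 0) with x in B by ring.
    replace (8 * t1 / R1)%R with 16%R in B by (subst R1; field; lra). auto. }
  assert (Ub : forall u h, (Cmod u < rho / 2)%R -> (Cmod h <= / 2)%R -> (Cmod (scl m u (- h)) <= 3 / 2)%R /\ (Cmod (u * scl m u (- h)) < rho)%R).
  { intros u h Hu Hh. assert (A := scl_bounds m u (- h) ltac:(lra) ltac:(rewrite Cmod_opp; auto)). split; [lra|]. rewrite Cmod_mult.
    assert (T := Cmod_ge_0 u). nra. }
  assert (Tb : forall x u h, (Cmod x < R2)%R -> (Cmod u < rho / 2)%R -> (Cmod h <= / 2)%R -> (Cmod (hstep m sg x u h) <= K * Cmod x)%R).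
  { intros x u h Hx Hu Hh. destruct (Ub u h Hu Hh) as [A B]. unfold hstep. rewrite !Cmod_mult, Cmod_pow.
    replace (Cmod (/ 2)) with (/ 2)%R by (rewrite <- RtoC_inv, Cmod_R, Rabs_pos_eq; lra).
    apply (Rle_trans _ (/ 2 * (3 / 2) ^ m * (16 * Cmod x))); [|unfold K; lra].
    apply Rmult_le_compat; [apply Rmult_le_pos; [lra|apply pow_le, Cmod_ge_0]|apply Cmod_ge_0| |apply Sb; auto].
    apply Rmult_le_compat_l; [lra|]. apply pow_incr. split; [apply Cmod_ge_0|auto]. }
  assert (Hh_scl : forall r f g, hol r f -> hol r g -> hol r (fun w => scl m (f w) (- g w))).
  { intros. unfold scl. apply hol_plus; [apply hol_const|]. apply hol_mult; [apply hol_mult; [apply hol_const|apply hol_pow; auto]|apply hol_opp; auto]. }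
  assert (Hh_T : forall r f g k, hol r f -> hol r g -> hol r k -> (forall w, (Cmod w < r)%R -> (Cmod (f w) < R2)%R /\ (Cmod (g w) < rho / 2)%R /\ (Cmod (k w) <= / 2)%R) ->
    hol r (fun w => hstep m sg (f w) (g w) (k w))).
  { intros r f g k Hf Hg Hk Hb. unfold hstep. apply hol_mult; [apply hol_mult; [apply hol_const|apply hol_pow; auto]|].
    apply (hol_comp2 sg R1 rho t1); auto; [apply hol_mult; auto|]. intros w Hw. destruct (Hb w Hw) as [B1 [B2 B3]].
    split; [lra|apply Ub; auto]. }
  assert (HN : forall x u, (Cmod x < R2)%R -> (Cmod u < rho / 2)%R -> contracts (/ 4) (hstep m sg x u)).
  { intros x u Hx Hu. assert (KX : (K * Cmod x <= cap)%R) by (apply (Rle_trans _ (K * R2)); auto; apply Rmult_le_compat_l; lra). split.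
    - eapply Rle_trans; [apply Tb; auto; rewrite Cmod_0; lra|lra].
    - intros t t' H1 H2. eapply Rle_trans; [apply (hol_lip (hstep m sg x u) (/ 2)%R (K * Cmod x)%R t' t); try lra|].
      + apply (Hh_T (/ 2)%R (fun _ => x) (fun _ => u) (fun h => h)); [apply hol_const|apply hol_const|apply hol_id|]. intros w Hw. repeat split; auto; lra.
      + intros w Hw. apply Tb; auto; lra.
      + apply Rmult_le_compat_r; [apply Cmod_ge_0|]. replace (8 * (K * Cmod x) / / 2)%R with (16 * (K * Cmod x))%R by field. lra. }
  set (H := fun x u => fixpt (hstep m sg x u)).
  assert (HF : forall x u, (Cmod x < R2)%R -> (Cmod u < rho / 2)%R -> (Cmod (H x u) <= / 4)%R /\ hstep m sg x u (H x u) = H x u).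
  { intros x u Hx Hu. destruct (fixpt_spec (/ 4)%R _ ltac:(lra) (HN x u Hx Hu)) as [A [B _]]. auto. }
  assert (HH : shol2 H R2 (rho / 2) (/ 4)).
  { split; [|split].
    - intros u Hu. apply (fixpt_hol (/ 4)%R R2 (fun x => hstep m sg x u)); try lra; auto. intros phi Hphi Hb.
      apply (Hh_T R2 (fun x => x) (fun _ => u) phi); auto; [apply hol_id|apply hol_const|]. intros w Hw. specialize (Hb w Hw). repeat split; auto; lra.
    - intros x Hx. apply (fixpt_hol (/ 4)%R (rho / 2)%R (hstep m sg x)); try lra; auto. intros phi Hphi Hb.
      apply (Hh_T (rho / 2)%R (fun _ => x) (fun u => u) phi); auto; [apply hol_const|apply hol_id|]. intros w Hw. specialize (Hb w Hw). repeat split; auto; lra.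
    - intros x u Hx Hu. apply HF; auto. }
  exists H, R2. split; [lra|]. split; [auto|]. intros x u Hx Hu. destruct (HF x u Hx Hu) as [F1 F2].
  assert (KX : (K * Cmod x <= cap)%R) by (apply (Rle_trans _ (K * R2)); auto; apply Rmult_le_compat_l; lra).
  split. { rewrite <- F2. eapply Rle_trans; [apply Tb; auto; lra|lra]. }
  split; [auto|]. split. { intros h Hh E. apply (fixpt_unique (/ 4)%R); auto; lra. }
  split. { intros y Hy. assert (A := Sb x y Hx Hy). apply (Rle_trans _ (16 * Cmod x * (3 / 2) ^ m)); [apply Rmult_le_compat_r; lra|unfold K in KX; lra]. }
  assert (Z : (Cmod 0 < R2)%R) by (rewrite Cmod_0; lra).
  assert (H0 : H 0 u = 0).
  { symmetry. apply (fixpt_unique (/ 4)%R); auto; [lra|rewrite Cmod_0; lra|]. unfold hstep. destruct (Ub u 0 Hu ltac:(rewrite Cmod_0; lra)) as [_ B].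
    rewrite (proj1 (Hy0 _ B)). ring. }
  split; auto.
  destruct (proj1 HH u Hu 0 Z) as [h' Hh'].
  assert (Hu' : (Cmod u < rho)%R) by lra.
  destruct (shol2_cder2 sg R1 rho t1 0 u Hsg ltac:(lra) Hu') as [a [b Hab]].
  assert (Sc : scl m u (- H 0 u) = 1) by (rewrite H0; unfold scl; ring).
  assert (Us : u * scl m u (- H 0 u) = u) by (rewrite Sc; ring).
  (* sg(0, v) = 0 for all v kills the y-derivative, so only the x-derivative 1 of sg and the factor
     1 / 2 contribute. *)
  assert (Db : b = 0).
  { assert (A := cder2_comp sg (fun _ => 0) (fun v => v) u a b 0 1 Hab (cder_const 0 u) (cder_id u)).
    assert (B : cder (fun v => sg 0 v) u 0).
    { apply (cder_ext_loc (fun _ => 0) _ _ _ (rho - Cmod u)); [lra| |apply cder_const]. intros w Hw. symmetry. apply Hy0. assert (Y := Cmod_ge_sub w u). lra. }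
    assert (E := cder_unique _ _ _ _ A B). rewrite <- E. ring. }
  assert (Da : a = 1).
  { assert (A := cder2_comp sg (fun x => x) (fun _ => u) 0 a b 1 0 Hab (cder_id 0) (cder_const u 0)).
    assert (E := cder_unique _ _ _ _ A (proj2 (Hy0 u Hu'))). rewrite <- E. ring. }
  assert (Ds : cder (fun x => scl m u (- H x u)) 0 (0 + Ci * u ^ (m - 1) * - h')).
  { apply cder_plus; [apply cder_const|apply cder_scal, cder_opp, Hh']. }
  apply (cder_ext_loc (fun x => hstep m sg x u (H x u)) _ _ _ R2); [lra| |].
  - intros w Hw. apply HF; auto. replace w with (w - 0) by ring. auto.
  - unfold hstep. eapply cder_eq; [apply cder_mult; [apply cder_scal, (cder_pow (fun x => scl m u (- H x u))), Ds|apply (cder2_comp sg (fun x => x) (fun x => u * scl m u (- H x u)))]|].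
    + rewrite Us. exact Hab. + apply cder_id. + apply cder_scal, Ds.
    + cbv beta. rewrite Us, Sc, (proj1 (Hy0 u Hu')), Da, Db. 
      assert (P1 : (RtoC 1) ^ m = 1) by (rewrite <- RtoC_pow, pow1; auto). rewrite P1. field.
Qed.

(** This is the reality of the Segre family. The fixed point equation says that W lies on the curve
    of y at parameter x; constancy of E from y to W shows that conj y lies on the curve of conj W at
    the same real x, which is the fixed point equation for conj h. *)
Lemma hstep_conj (m : nat) (r : R) (P Q A A' B : C -> C) (F D sg : C -> C -> C) (tau t1 rho R1 : R) (x u : R) (h : C) :
  (1 <= m)%nat -> real_form m r P Q A A' B -> (0 < t1 <= tau / 2)%R -> (0 < rho <= / 2)%R -> (2 * rho <= r)%R ->
  (forall y, (Cmod y < rho)%R -> F 0 y = 0 /\ D 0 y = 1 /\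
      (y <> 0 -> forall w, (Cmod (w - y) < tau * Cmod y ^ m)%R ->
          lin_sol m P Q (fun w => F ((w - y) / (Ci * y ^ m)) y) (fun w => D ((w - y) / (Ci * y ^ m)) y / (Ci * y ^ m)) w) /\
      forall x, (Cmod x < R1)%R -> F (sg x y) y = x /\ forall t, (Cmod t <= t1)%R -> F t y = x -> t = sg x y) ->
  (Rabs x < R1)%R -> (0 < u < rho / 2)%R -> (Cmod h <= / 4)%R -> (2 * 2 ^ m * Cmod h <= t1)%R -> h = hstep m sg x u h -> Cconj h = hstep m sg x u (Cconj h).
Proof.
  intros Hm HRF Ht Hrho Hrr HF Hx Hu Hh Hh2 Hfix.
  assert (HCi : Ci <> 0) by (apply Cmod_gt_0; rewrite Cmod_Ci; lra).
  assert (Hcu : RtoC u <> 0) by (apply RtoC_neq0; lra).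
  assert (Hmu : Cmod u = u) by (rewrite Cmod_R, Rabs_pos_eq; lra).
  assert (Hum : (0 < u ^ m)%R) by (apply pow_lt; lra).
  assert (Sb : forall s, (Cmod s <= / 4)%R -> u * scl m u s <> 0 /\ (u / 2 <= Cmod (u * scl m u s) < rho)%R /\ u * scl m u s = u + Ci * RtoC u ^ m * s).
  { intros s Hs. assert (B1 := scl_bounds m u s ltac:(lra) ltac:(lra)). split; [|split].
    - apply Cmult_neq_0; auto. apply scl_neq0; lra.
    - rewrite Cmod_mult, Hmu. nra.
    - unfold scl. rewrite (Cpow_pred u m Hm). ring. }
  (* |u [scl]| >= u / 2 costs the factor 2^m, so the bound on h keeps W and y within t1 |y|^m of
     each other, inside the discs where the solutions are defined. *)
  assert (Pw : forall s, (Cmod s <= / 4)%R -> (2 * u ^ m * Cmod h <= t1 * Cmod (u * scl m u s) ^ m)%R).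
  { intros s Hs. destruct (Sb s Hs) as [_ [B1 _]]. assert (B2 : ((u / 2) ^ m <= Cmod (u * scl m u s) ^ m)%R) by (apply pow_incr; lra).
    unfold Rdiv in B2. rewrite Rpow_mult_distr, pow_inv in B2. assert (B3 : (0 < 2 ^ m)%R) by (apply pow_lt; lra).
    apply (Rle_trans _ (t1 * (u ^ m * / 2 ^ m))); [|apply Rmult_le_compat_l; lra].
    replace (2 * u ^ m * Cmod h)%R with (2 * 2 ^ m * Cmod h * (u ^ m * / 2 ^ m))%R by (field; lra).
    apply Rmult_le_compat_r; auto. apply Rlt_le, Rmult_lt_0_compat; auto. apply Rinv_0_lt_compat; auto. }
  (* For real h the points y and W are conjugate to each other; for complex h they are only the two
     entries of the relation. *)
  set (y := u * scl m u (- h)). set (W := u * scl m u h).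
  destruct (Sb (- h) ltac:(rewrite Cmod_opp; auto)) as [y0 [yb ye]]. destruct (Sb h Hh) as [W0 [Wb We]]. fold y in y0, yb, ye. fold W in W0, Wb, We.
  assert (ycj : Cconj y = u + Ci * RtoC u ^ m * Cconj h). { rewrite ye, Cplus_conj, !Cmult_conj, Copp_conj, Cpow_conj, Cconj_Ci, Cconj_RtoC. ring. }
  assert (Wcj : Cconj W = u * scl m u (- Cconj h)).
  { rewrite We, Cplus_conj, !Cmult_conj, Cpow_conj, Cconj_Ci, Cconj_RtoC. unfold scl. rewrite (Cpow_pred u m Hm). ring. }
  destruct (Sb (- Cconj h) ltac:(rewrite Cmod_opp, Cmod_conj; auto)) as [V0 [Vb Ve]]. rewrite <- Wcj in V0, Vb, Ve.
  assert (P1 := Pw (- h) ltac:(rewrite Cmod_opp; auto)). assert (P2 := Pw (- Cconj h) ltac:(rewrite Cmod_opp, Cmod_conj; auto)). fold y in P1. rewrite <- Wcj in P2.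
  assert (Yp : y ^ m <> 0) by (apply Cpow_nz; auto). assert (Vp : Cconj W ^ m <> 0) by (apply Cpow_nz; auto). assert (Wp : W ^ m <> 0) by (apply Cpow_nz; auto).
  assert (Ym : (0 < Cmod y ^ m)%R) by (apply pow_lt; lra). assert (Vm : (0 < Cmod (Cconj W) ^ m)%R) by (apply pow_lt; lra).
  assert (WY : W - y = 2 * Ci * RtoC u ^ m * h) by (rewrite We, ye; ring).
  assert (WYn : Cmod (W - y) = (2 * u ^ m * Cmod h)%R).
  { rewrite WY, !Cmod_mult, Cmod_Ci, Cmod_pow, Hmu, Cmod_R, Rabs_pos_eq by lra. ring. }
  assert (Sg : (W - y) / (Ci * y ^ m) = sg x y).
  { rewrite WY, Hfix at 1. unfold hstep. fold y. unfold y at 2. rewrite Cpow_mult_l. field. split; [apply Cpow_nz, scl_neq0; rewrite ?Cmod_opp; lra|]. split; [apply Cpow_nz; auto|auto]. }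
  destruct (HF y ltac:(lra)) as [Fy [Dy [Ly Ey]]]. destruct (HF (Cconj W) ltac:(lra)) as [Fv [Dv [Lv Ev]]].
  specialize (Ly y0). specialize (Lv V0). destruct (Ey x ltac:(rewrite Cmod_R; auto)) as [Ey1 _]. destruct (Ev x ltac:(rewrite Cmod_R; auto)) as [_ Ev2].
  set (f := fun w => F ((w - y) / (Ci * y ^ m)) y) in Ly. set (f1 := fun w => D ((w - y) / (Ci * y ^ m)) y / (Ci * y ^ m)) in Ly.
  set (g := fun w => F ((w - Cconj W) / (Ci * Cconj W ^ m)) (Cconj W)) in Lv. set (g1 := fun w => D ((w - Cconj W) / (Ci * Cconj W ^ m)) (Cconj W) / (Ci * Cconj W ^ m)) in Lv.
  assert (E := E_const m r P Q A A' B f f1 g g1 y W Hm HRF).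
  assert (T0 : forall z, (z - z) / (Ci * z ^ m) = 0) by (intros z; unfold Cdiv; ring).
  (* f vanishes at y with slope 1 / (i y^m), and g likewise at conj W. Hence E(f, g) is i conj (g
     (conj y)) at y and i x at W. *)
  assert (G : g (Cconj y) = x).
  { unfold Eform, ctilde in E. replace (f y) with (RtoC 0) in E by (unfold f; rewrite T0; auto).
    replace (f1 y) with (1 / (Ci * y ^ m)) in E by (unfold f1; rewrite T0, Dy; auto).
    replace (f W) with (RtoC x) in E by (unfold f; rewrite Sg; auto).
    replace (g (Cconj W)) with (RtoC 0) in E by (unfold g; rewrite T0; auto).
    replace (g1 (Cconj W)) with (1 / (Ci * Cconj W ^ m)) in E by (unfold g1; rewrite T0, Dv; auto).
    rewrite Cdiv_conj in E by (apply Cmult_neq_0; auto). rewrite Cmult_conj, Cpow_conj, Cconj_conj, Cconj_Ci, !Cconj_RtoC in E.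
    assert (G0 : Cconj (g (Cconj y)) = x).
    { transitivity (- Ci * (y ^ m * (0 * Cconj (g1 (Cconj y)) - 1 / (Ci * y ^ m) * Cconj (g (Cconj y))) + 2 * Ci * A y * 0 * Cconj (g (Cconj y)))); [field; auto|].
      rewrite E; [field; repeat split; auto|]. 
      intros t Htt. set (w := y + (W - y) * t).
      assert (Ew : w = u * scl m u (h * RtoC (2 * t - 1))).
      { unfold w. rewrite WY, ye. unfold scl. rewrite (Cpow_pred u m Hm), RtoC_minus, RtoC_mult. ring. }
      assert (Hw : (Cmod (h * RtoC (2 * t - 1)) <= / 4)%R).
      { rewrite Cmod_mult, Cmod_R. assert (Rabs (2 * t - 1) <= 1)%R by (apply Rabs_le; lra). assert (T := Cmod_ge_0 h). assert (T' := Rabs_pos (2 * t - 1)). nra. }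
      destruct (Sb _ Hw) as [w0 [wb _]]. rewrite <- Ew in w0, wb.
      assert (Tn : forall s : R, (0 <= s <= 1)%R -> (Cmod ((W - y) * s) <= 2 * u ^ m * Cmod h)%R).
      { intros s Hs. rewrite Cmod_mult, WYn, Cmod_R, Rabs_pos_eq by lra. assert (0 <= 2 * u ^ m * Cmod h)%R by (rewrite <- WYn; apply Cmod_ge_0). nra. }
      split; [lra|]. split; [auto|]. split; [apply Ly|apply Lv].
      - unfold w. replace (y + (W - y) * t - y) with ((W - y) * t) by ring. specialize (Tn t Htt). nra.
      - rewrite <- Cminus_conj, Cmod_conj. unfold w. replace (y + (W - y) * t - W) with (- ((W - y) * RtoC (1 - t))) by (rewrite RtoC_minus; ring).
        rewrite Cmod_opp. specialize (Tn (1 - t)%R ltac:(lra)). nra. }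
    rewrite <- (Cconj_conj (g (Cconj y))), G0. apply Cconj_RtoC. }
  assert (S2 : (Cconj y - Cconj W) / (Ci * Cconj W ^ m) = sg x (Cconj W)).
  { apply Ev2; [|exact G]. rewrite Cmod_div by (apply Cmult_neq_0; auto). rewrite <- Cminus_conj, Cmod_conj, Cmod_sym, WYn, Cmod_mult, Cmod_Ci, Rmult_1_l, Cmod_pow.
    apply (Rmult_le_reg_r (Cmod (Cconj W) ^ m)); auto. unfold Rdiv. rewrite Rmult_assoc, Rinv_l, Rmult_1_r by lra. auto. }
  unfold hstep. rewrite <- Wcj, <- S2.
  replace (Cconj y - Cconj W) with (2 * Ci * RtoC u ^ m * Cconj h) by (rewrite ycj, Ve; ring). rewrite Wcj at 1. rewrite Cpow_mult_l. field.
  split; [apply Cpow_nz, scl_neq0; rewrite ?Cmod_opp, ?Cmod_conj; lra|]. split; [apply Cpow_nz; auto|auto].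
Qed.

(** H is known to be real only for small positive x and u. Reality of the coefficients is obtained
    first in x for fixed u, then in u; the factor 4 M comes from two successive Cauchy estimates. *)
Lemma real_double_series (H : C -> C -> C) (R2 rho M d : R) : (0 < R2)%R -> (0 < rho)%R -> (0 < d)%R -> shol2 H R2 rho M ->
  (forall x u : R, (0 < x < d)%R -> (0 < u < d)%R -> Im (H x u) = 0%R) ->
  exists c : nat -> nat -> R, (forall k j, (Rabs (c k j) * rho ^ j <= 4 * M / R2 ^ k)%R) /\
    forall u, (Cmod u < rho)%R -> exists h : nat -> C, pbound h R2 (2 * M) /\ (forall k, h k = psum (fun j => RtoC (c k j)) u) /\
      forall x, (Cmod x < R2)%R -> H x u = psum h x.
Proof.
  intros HR Hr Hd HH Him. destruct (shol2_coef H R2 rho M HR Hr HH) as [a [Ha1 [Ha2 Ha3]]].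
  destruct (choice (fun k (cc : nat -> C) => pbound cc rho (2 * (2 * M / R2 ^ k)) /\ forall w, (Cmod w < rho)%R -> a k w = psum cc w)) as [cc Hcc].
  { intros k. apply taylor_bounded; auto. intros w Hw. assert (X := Ha2 w Hw k). assert (Y : (0 < R2 ^ k)%R) by (apply pow_lt; auto).
    apply (Rmult_le_reg_r (R2 ^ k)); auto. unfold Rdiv. rewrite Rmult_assoc, Rinv_l, Rmult_1_r by lra. exact X. }
  assert (Re_ : forall k j, Im (cc k j) = 0%R).
  { intros k. apply (psum_real_coef (cc k) rho _ (Rmin d rho) Hr ltac:(apply Rmin_pos; auto) (proj1 (Hcc k))).
    intros u Hu. assert (Z := Rmin_l d rho). assert (Z' := Rmin_r d rho). assert (Hu' : (Cmod u < rho)%R) by (rewrite Cmod_R, Rabs_pos_eq; lra).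
    rewrite <- (proj2 (Hcc k)) by auto. revert k.
    apply (psum_real_coef _ R2 _ (Rmin d R2) HR ltac:(apply Rmin_pos; auto) (Ha2 u Hu')).
    intros x Hx. assert (Y := Rmin_l d R2). assert (Y' := Rmin_r d R2). rewrite <- Ha3; [apply Him; lra| |auto]. rewrite Cmod_R, Rabs_pos_eq; lra. }
  assert (E : forall k j, cc k j = RtoC (Re (cc k j))) by (intros k j; apply C_eq; simpl; auto).
  exists (fun k j => Re (cc k j)). split.
  - intros k j. assert (X := proj1 (Hcc k) j). rewrite E, Cmod_R in X. eapply Rle_trans; [exact X|right; field; apply pow_nonzero; lra].
  - intros u Hu. exists (fun k => a k u). split; [auto|]. split; [|auto]. intros k. rewrite (proj2 (Hcc k)) by auto. apply psum_ext. auto.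
Qed.

Lemma ex_series_geom_bound (a : nat -> R) (K q : R) : (0 <= q < 1)%R -> (forall k, (0 <= a k <= K * q ^ k)%R) ->
  ex_series a /\ (Series a <= K * / (1 - q))%R.
Proof.
  intros Hq Ha. assert (G : is_series (fun k => K * q ^ k)%R (K * / (1 - q))%R).
  { apply (is_series_scal_l (V := R_NormedModule) K (fun k => q ^ k)%R). apply is_series_geom. rewrite Rabs_pos_eq; lra. }
  split.
  - apply (ex_series_le (V := R_CompleteNormedModule) a (fun k => K * q ^ k)%R); [|eexists; exact G].
    intros n. change (Rabs (a n) <= K * q ^ n)%R. rewrite Rabs_pos_eq; apply Ha.
  - rewrite <- (is_series_unique _ _ G). apply Series_le; auto. eexists. exact G.
Qed.

Lemma Series_zero (a : nat -> R) : (forall n, a n = 0%R) -> Series a = 0%R.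
Proof. intros H. rewrite (Series_ext a (fun n => 0 * 0)%R) by (intros n; rewrite H; ring). rewrite Series_scal_l. ring. Qed.

Lemma psum_RtoC (a : nat -> R) (x : R) : psum (fun k => RtoC (a k)) x = RtoC (PSeries a x).
Proof.
  unfold psum, csum_val. apply C_eq; simpl.
  - apply Series_ext. intros n. rewrite <- RtoC_pow. simpl. ring.
  - apply Series_zero. intros n. rewrite <- RtoC_pow. simpl. ring.
Qed.

Lemma real_section (H : C) (h : nat -> C) (c : nat -> nat -> R) (R2 M u x : R) : pbound h R2 M -> (Rabs x < R2)%R ->
  (forall k, h k = psum (fun j => RtoC (c k j)) u) -> h 0%nat = 0 -> h 1%nat = / 2 -> H = psum h x ->
  H = RtoC (1 / 2 * x + Series (fun k => PSeries (c (k + 2)%nat) u * x ^ (k + 2)))%R.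
Proof.
  intros Hh Hx Hk H0 H1 E. assert (Hx' : (Cmod x < R2)%R) by (rewrite Cmod_R; auto). assert (HR : (0 < R2)%R) by (assert (T := Rabs_pos x); lra).
  assert (Hh1 := pbound_shift h R2 M 1 HR Hh). change (pbound (fun k => h (S k)) R2 (M / R2 ^ 1)) in Hh1.
  rewrite E, (psum_shift h R2 M x Hh Hx'), (psum_shift (fun k => h (S k)) R2 _ x Hh1 Hx'), H0, H1.
  rewrite (psum_ext _ (fun k => RtoC (PSeries (c (k + 2)%nat) u))).
  2:{ intros k. rewrite Hk, psum_RtoC. do 3 f_equal. lia. }
  rewrite psum_RtoC. unfold PSeries at 1.
  rewrite (Series_ext (fun k => PSeries (c (k + 2)%nat) u * x ^ (k + 2))%R (fun k => (x * x) * (PSeries (c (k + 2)%nat) u * x ^ k))%R).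
  2:{ intros k. rewrite pow_add. simpl. ring. }
  rewrite Series_scal_l. unfold Rdiv. rewrite !RtoC_plus, !RtoC_mult, RtoC_inv by lra. field.
Qed.

(** Halving both radii turns the Cauchy bounds into geometric series of ratio 1 / 2 in each
    index. *)
Lemma admissible_of_bound (m : nat) (c : nat -> nat -> R) (R2 rho K : R) (M : C * C -> Prop) : (0 < R2)%R -> (0 < rho)%R ->
  (forall k j, (Rabs (c k j) * rho ^ j <= K / R2 ^ k)%R) ->
  (forall z w, M (z, w) <-> Im w = (Re w ^ m * (1 / 2 * Cmod z ^ 2 + Series (fun k => PSeries (c (k + 2)%nat) (Re w) * Cmod z ^ (2 * (k + 2)))))%R) ->
  admissible_hypersurface m M.
Proof.
  intros HR Hr Hc HM. exists 1%R, c, (Rmin (R2 / 2) (rho / 2)).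
  split; [auto|]. split; [apply Rmin_pos; lra|]. split; [|intros z w _ _; apply HM].
  assert (Z1 := Rmin_l (R2 / 2) (rho / 2)). assert (Z2 := Rmin_r (R2 / 2) (rho / 2)).
  intros x u Hx Hu. assert (U0 := Rabs_pos u). assert (X0 := Rabs_pos x).
  assert (B : forall k, ex_series (fun j => Rabs (c k j * u ^ j)%R) /\ (Series (fun j => Rabs (c k j * u ^ j)) <= K / R2 ^ k * / (1 - / 2))%R).
  { intros k. apply ex_series_geom_bound; [lra|]. intros j. split; [apply Rabs_pos|]. rewrite Rabs_mult, <- RPow_abs.
    apply (Rle_trans _ (Rabs (c k j) * (rho * / 2) ^ j)); [apply Rmult_le_compat_l; [apply Rabs_pos|apply pow_incr; lra]|].
    rewrite Rpow_mult_distr, <- Rmult_assoc. apply Rmult_le_compat_r; [apply pow_le; lra|auto]. }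
  split; [intros k _; apply B|].
  apply (ex_series_geom_bound _ (K * 2) (/ 2)); [lra|]. intros k.
  set (T := Series (fun j => Rabs (c (k + 2)%nat j * u ^ j))).
  assert (T0 : (0 <= T)%R).
  { rewrite <- (Series_zero (fun _ => 0%R)) by auto. apply Series_le; [intros n; split; [lra|apply Rabs_pos]|apply B]. }
  assert (Xp : (0 <= Rabs x ^ (k + 2))%R) by (apply pow_le; auto).
  split; [apply Rmult_le_pos; auto|]. assert (Rp : (0 < R2 ^ (k + 2))%R) by (apply pow_lt; auto).
  assert (HK : (0 <= K)%R). { assert (Y := Hc 0%nat 0%nat). simpl in Y. assert (Y' := Rabs_pos (c 0%nat 0%nat)). lra. }
  assert (Xq : (Rabs x ^ (k + 2) <= R2 ^ (k + 2) * (/ 2) ^ k)%R).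
  { apply (Rle_trans _ ((R2 * / 2) ^ (k + 2))); [apply pow_incr; lra|]. rewrite Rpow_mult_distr. apply Rmult_le_compat_l; [lra|].
    rewrite pow_add. assert (0 <= (/ 2) ^ k)%R by (apply pow_le; lra). simpl. nra. }
  assert (HB := proj2 (B (k + 2)%nat)). fold T in HB.
  apply (Rle_trans _ (K / R2 ^ (k + 2) * / (1 - / 2) * (R2 ^ (k + 2) * (/ 2) ^ k))); [apply Rmult_le_compat; auto|right; field; lra].
Qed.

(** The map depends on three variables only through (z k, y), so two-variable differentiability and
    the chain rule suffice. *)
Lemma segre_map_holomorphic (m : nat) (sg : C -> C -> C) (t1 rho R1 e : R) : (0 < t1 <= / 4)%R -> (0 < rho <= / 2)%R -> (0 < R1 <= 1)%R ->
  (e <= R1)%R -> (e <= rho)%R -> shol2 sg R1 rho t1 ->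
  holomorphic_on (V := prod_NormedModule C_AbsRing C2m C_NormedModule) (W := C_NormedModule)
      (fun q => cdisc e (fst (fst q)) /\ cdisc e (snd (fst q)) /\ cdisc e (snd q))
      (fun q => snd q * scl m (snd q) (sg (fst (fst q) * snd (fst q)) (snd q))).
Proof.
  intros Ht Hrho HR He1 He2 Hsg [[z k] y] [Hz [Hk Hy]]. simpl fst in *. simpl snd in *. unfold cdisc in *.
  set (f := fun x y => y * scl m y (sg x y)).
  assert (Hf : shol2 f R1 rho (/ 2 * (3 / 2))).
  { split; [|split].
    - intros v Hv. unfold f, scl. apply hol_mult; [apply hol_const|]. apply hol_plus; [apply hol_const|]. apply hol_mult; [apply hol_const|]. apply Hsg; auto.
    - intros x Hx. unfold f, scl. apply hol_mult; [apply hol_id|]. apply hol_plus; [apply hol_const|].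
      apply hol_mult; [apply hol_mult; [apply hol_const|apply hol_pow, hol_id]|]. apply Hsg; auto.
    - intros x v Hx Hv. unfold f. rewrite Cmod_mult. assert (A := proj2 (proj2 Hsg) x v Hx Hv).
      apply Rmult_le_compat; try apply Cmod_ge_0; [lra|apply scl_bounds; lra]. }
  assert (Hzk : (Cmod (z * k) < R1)%R). { rewrite Cmod_mult. assert (A := Cmod_ge_0 z). assert (B := Cmod_ge_0 k). nra. }
  destruct (shol2_cder2 f R1 rho _ (z * k) y Hf Hzk ltac:(lra)) as [a [b Hab]].
  set (V3 := prod_NormedModule C_AbsRing C2m C_NormedModule).
  apply (ex_filterdiff_comp'_2 (T := V3) (U := C_NormedModule) (V := C_NormedModule) (W := C_NormedModule)
    (fun q : V3 => fst (fst q) * snd (fst q)) (fun q : V3 => snd q) f (z, k, y)).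
  - apply (ex_filterdiff_comp' (U := V3) (V := C2m) (W := C_NormedModule) (fun q : V3 => fst q) (fun q : C2m => fst q * snd q)).
    + apply ex_filterdiff_linear, is_linear_fst.
    + simpl fst. eapply cder2_ex_filterdiff. simpl fst. simpl snd. apply (cder2_fst_mult (fun w => w)). apply cder_id.
  - apply ex_filterdiff_linear, is_linear_snd.
  - simpl fst. simpl snd. eapply (cder2_ex_filterdiff (fun q => f (fst q) (snd q))). exact Hab.
Qed.

(** Links the real equation v = u^m h with the complex one, w on its own Segre curve. Both amount to
    y^m sg(x, y) = 2 i v / i with y = conj w; the passage back to h uses uniqueness of the fixed
    point. *)
Lemma hypersurface_equation (m : nat) (sg : C -> C -> C) (H : C) (x hr cap rho : R) (w : C) : (1 <= m)%nat ->
  (0 < cap <= / 32)%R -> (Cmod w < rho)%R -> (rho <= / 2)%R -> H = RtoC hr -> 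
  H = hstep m sg x (Re w) H -> (forall h, (Cmod h <= / 4)%R -> h = hstep m sg x (Re w) h -> h = H) ->
  (Cmod (sg x (Cconj w)) * (3 / 2) ^ m <= 2 * cap)%R ->
  (Im w = (Re w ^ m * hr)%R <-> w = Cconj w * scl m (Cconj w) (sg x (Cconj w))).
Proof.
  intros Hm Hcap Hw Hrho EH HS HU Hb. set (y := Cconj w) in *.
  set (u := Re w) in *. set (v := Im w).
  assert (Ew : w = u + Ci * v) by (apply C_eq; unfold u, v, Re, Im; simpl; ring).
  assert (Ey : y = u - Ci * v) by (apply C_eq; unfold u, v, y, Re, Im; simpl; ring).
  assert (HCi : Ci <> 0) by (apply Cmod_gt_0; rewrite Cmod_Ci; lra).
  assert (Sc : forall h : R, u * scl m u (- h) = u - Ci * RtoC (u ^ m * h)).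
  { intros h. rewrite RtoC_mult, RtoC_pow. unfold scl. rewrite (Cpow_pred u m Hm). ring. }
  assert (Ys : y * scl m y (sg x y) = y + Ci * (y ^ m * sg x y)) by (unfold scl; rewrite (Cpow_pred y m Hm); ring).
  rewrite Ys. split.
  - intros E. assert (Yu : u * scl m u (- H) = y) by (rewrite EH, Sc, <- E, Ey; ring).
    assert (E2 : y ^ m * sg x y = 2 * RtoC v).
    { rewrite E, RtoC_mult, RtoC_pow, <- EH. rewrite HS at 1. unfold hstep. rewrite Yu. rewrite <- Yu at 1. rewrite Cpow_mult_l. field. }
    rewrite E2, Ew, Ey. ring.
  - intros E. assert (E2 : y ^ m * sg x y = 2 * RtoC v).
    { assert (Ci * (y ^ m * sg x y) = Ci * (2 * v)) by (transitivity (w - y); [rewrite E at 1; ring|rewrite Ew, Ey; ring]).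
      transitivity (Ci * (y ^ m * sg x y) / Ci); [field; auto|]. rewrite H0. field. auto. }
    assert (N2 := f_equal Cmod E2). rewrite !Cmod_mult, Cmod_pow, !Cmod_R, (Rabs_pos_eq 2) in N2 by lra.
    assert (S0 := Cmod_ge_0 (sg x y)). assert (Y0 := Cmod_ge_0 y). assert (Y1 : Cmod y = Cmod w) by apply Cmod_conj.
    assert (Pm : (1 <= (3 / 2) ^ m)%R) by (apply pow_R1_Rle; lra).
    assert (S1 : (Cmod (sg x y) <= / 16)%R) by nra.
    assert (Ym : (Cmod y ^ m <= Cmod y)%R).
    { replace m with (Datatypes.S (m - 1)) by lia. simpl. assert (A := pow_le_1 (Cmod y) (m - 1) ltac:(lra)). assert (B := pow_le (Cmod y) (m - 1) Y0). nra. }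
    assert (Yuv : (Cmod y <= Rabs u + Rabs v)%R) by (rewrite Y1; eapply Rle_trans; [apply Cmod_le_abs|unfold u, v; lra]).
    assert (V0 := Rabs_pos v). assert (U0 := Rabs_pos u).
    assert (V1 : (2 * Rabs v <= Cmod y * / 16)%R) by (rewrite <- N2; apply Rmult_le_compat; auto; apply pow_le; auto).
    (* On u = 0 the quotient v / u^m makes no sense; there |y| <= |v| while 2 |v| <= |y| / 16, so v
       = 0. *)
    destruct (Req_dec u 0) as [Z|Z].
    + rewrite Z in Yuv |- *. rewrite Rabs_R0 in Yuv. rewrite pow_i by lia. rewrite Rmult_0_l. 
      destruct (Req_dec v 0) as [Zv|Zv]; auto. apply Rabs_pos_lt in Zv. lra.
    + assert (Up : (0 < Rabs u)%R) by (apply Rabs_pos_lt; auto). assert (Um : (u ^ m <> 0)%R) by (apply pow_nonzero; auto).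
      assert (Yb : (Cmod y <= 3 / 2 * Rabs u)%R) by lra.
      (* |y| <= 3/2 |u| and the bound on sg give |h| <= cap, inside the disc |h| <= 1/4 of
         uniqueness. *)
      set (h := (v / u ^ m)%R). assert (Hh : (u ^ m * h = v)%R) by (unfold h; field; auto).
      assert (Yu : u * scl m u (- h) = y) by (rewrite Sc, Hh, Ey; ring).
      assert (Fix : RtoC h = H).
      { apply HU.
        - rewrite Cmod_R. unfold h, Rdiv. rewrite Rabs_mult, Rabs_inv, <- RPow_abs.
          assert (Pu : (0 < Rabs u ^ m)%R) by (apply pow_lt; auto).
          apply (Rmult_le_reg_r (Rabs u ^ m)); auto. rewrite Rmult_assoc, Rinv_l, Rmult_1_r by lra.
          assert (A : (Cmod y ^ m <= (3 / 2) ^ m * Rabs u ^ m)%R) by (rewrite <- Rpow_mult_distr; apply pow_incr; lra).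
          assert (B : (2 * Rabs v <= (3 / 2) ^ m * Rabs u ^ m * Cmod (sg x y))%R) by (rewrite <- N2; apply Rmult_le_compat_r; auto).
          nra.
        - unfold hstep. rewrite Yu. unfold Rdiv in h. 
          assert (Su : scl m u (- h) ^ m * RtoC u ^ m = y ^ m) by (rewrite <- Cpow_mult_l; f_equal; rewrite <- Yu; ring).
          assert (Cu : RtoC u ^ m <> 0) by (apply Cpow_nz, RtoC_neq0; auto).
          transitivity (/ 2 * (scl m u (- h) ^ m * RtoC u ^ m) * sg x y / RtoC u ^ m); [|field; auto].
          rewrite Su. transitivity (/ 2 * (y ^ m * sg x y) / RtoC u ^ m); [rewrite E2, <- Hh, RtoC_mult, RtoC_pow; field; auto|field; auto]. }
      rewrite EH in Fix. apply RtoC_inj in Fix. rewrite <- Fix. auto.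
Qed.

(** The family built from [sg] exists for every admissible equation; the real form is used only to
    show that the fixed point H is real for small positive x and u, so that it is given by a real
    double series. *)
Lemma real_structure_of_real_form (m : nat) (r : R) (P Q A A' B : C -> C) : (1 <= m)%nat -> (0 < r)%R -> hol r P -> hol r Q ->
  real_form m r P Q A A' B -> has_positive_real_structure m r P Q.
Proof.
  intros Hm Hr HP HQ HRF.
  destruct (inverse_family m r P Q Hm Hr HP HQ) as [F [D [sg [tau [rho [t1 [R1 [Ht1 [Htau [Hrho [Hrr [ER [Hsg HF]]]]]]]]]]]]].
  assert (HR1 : (0 < R1 <= / 2)%R) by lra.
  destruct (segre_family_of_inverse m sg D t1 rho R1 ltac:(lra) Hrho HR1 Hsg) as [S [ES1 [ES2 HG]]].
  { intros y Hy. destruct (HF y Hy) as [F1 [F2 [F3 [F4 F5]]]]. split; [auto|]. split; [auto|]. intros x Hx. apply F5; auto. }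
  assert (HS : associated_segre_family m r P Q S).
  { apply (associated_of_inverse m r P Q F D sg tau rho t1 R1 S); auto. intros y Hy. destruct (HF y Hy) as [F1 [F2 [F3 [F4 F5]]]].
    split; [exact F4|]. intros x Hx. destruct (F5 x Hx) as [G1 [G2 [G3 _]]]. auto. }
  assert (P2 : (0 < 2 * 2 ^ m)%R) by (assert (0 < 2 ^ m)%R by (apply pow_lt; lra); lra).
  (* 1 / 32 is required for the contraction, t1 / (2 2^m) for the hypothesis on h in
     [hstep_conj]. *)
  set (cap := Rmin (/ 32) (t1 / (2 * 2 ^ m))).
  assert (C1 := Rmin_l (/ 32) (t1 / (2 * 2 ^ m))). assert (C2 := Rmin_r (/ 32) (t1 / (2 * 2 ^ m))). fold cap in C1, C2.
  assert (Hcap : (0 < cap <= / 32)%R) by (split; auto; apply Rmin_pos; [lra|apply Rdiv_lt_0_compat; lra]).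
  destruct (hypersurface_function m sg t1 rho R1 cap ltac:(lra) Hrho ER Hsg) as [H [R2 [HR2 [HH Hspec]]]]; auto.
  { intros y Hy. destruct (HF y Hy) as [F1 [F2 [F3 [F4 F5]]]]. split; auto. destruct (F5 0 ltac:(rewrite Cmod_0; lra)) as [_ [_ [G _]]].
    eapply cder_eq; [exact G|]. rewrite F3, F2. field. }
  assert (Him : forall x u : R, (0 < x < Rmin R2 (rho / 2))%R -> (0 < u < Rmin R2 (rho / 2))%R -> Im (H x u) = 0%R).
  { intros x u Hx Hu. assert (Z1 := Rmin_l R2 (rho / 2)). assert (Z2 := Rmin_r R2 (rho / 2)).
    destruct (Hspec x u ltac:(rewrite Cmod_R, Rabs_pos_eq; lra) ltac:(rewrite Cmod_R, Rabs_pos_eq; lra)) as [G1 [G2 [G3 _]]].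
    apply Im_zero_conj, G3; [rewrite Cmod_conj; lra|].
    apply (hstep_conj m r P Q A A' B F D sg tau t1 rho R1); auto; try lra.
    - intros y Hy. destruct (HF y Hy) as [F1 [F2 [F3 [F4 F5]]]]. repeat (split; [assumption|]). intros x' Hx'. destruct (F5 x' Hx') as [K1 [_ [_ K2]]]. auto.
    - rewrite Rabs_pos_eq; lra.
    - apply (Rle_trans _ (2 * 2 ^ m * (t1 / (2 * 2 ^ m)))); [apply Rmult_le_compat_l; lra|right; field; lra]. }
  destruct (real_double_series H R2 (rho / 2) (/ 4) (Rmin R2 (rho / 2)) ltac:(lra) ltac:(lra) ltac:(apply Rmin_pos; lra) HH Him) as [c [Hc1 Hc2]].
  set (hr := fun z u : R => (1 / 2 * z ^ 2 + Series (fun k => PSeries (c (k + 2)%nat) u * z ^ (2 * (k + 2))))%R).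
  assert (Hhr : forall (z : C) (u : R), (Cmod z ^ 2 < R2)%R -> (Rabs u < rho / 2)%R -> H (RtoC (Cmod z ^ 2)) u = RtoC (hr (Cmod z) u)).
  { intros z u Hz Hu. assert (Hu' : (Cmod u < rho / 2)%R) by (rewrite Cmod_R; auto). destruct (Hc2 u Hu') as [h [K1 [K2 K3]]].
    assert (Z0 : (Cmod 0 < R2)%R) by (rewrite Cmod_0; lra). assert (P0 := pow2_ge_0 (Cmod z)).
    destruct (Hspec 0 u Z0 Hu') as [_ [_ [_ [_ [H0 H1]]]]].
    unfold hr. rewrite (real_section (H (RtoC (Cmod z ^ 2)) u) h c R2 (2 * / 4) u (Cmod z ^ 2)); auto.
    - do 2 f_equal. apply Series_ext. intros k. rewrite <- pow_mult. auto.
    - rewrite Rabs_pos_eq; auto.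
    - rewrite <- (psum_0 h R2 _ ltac:(lra) K1), <- K3; auto.
    - apply (cder_unique (fun x => H x u) 0); auto. eapply cder_eq.
      + apply (cder_ext_loc (psum h) _ _ _ R2); [lra| |apply (cder_psum _ _ _ _ K1 Z0)]. intros w Hw. symmetry. apply K3. replace w with (w - 0) by ring. auto.
      + assert (HB := pbound_deriv h R2 (R2 / 2) _ ltac:(lra) K1). rewrite (psum_0 _ (R2 / 2) _ ltac:(lra) HB). unfold pderiv. simpl. ring.
    - apply K3. rewrite Cmod_R, Rabs_pos_eq; auto. }
  (* Only the germ matters: [Series] and [PSeries] are total, so the formula defines a set
     everywhere, and the comparison with the Segre family is made on the bidisc of radius e. *)
  exists (fun q => Im (snd q) = (Re (snd q) ^ m * hr (Cmod (fst q)) (Re (snd q)))%R). split.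
  { eapply (admissible_of_bound m c R2 (rho / 2)); [lra|lra|exact Hc1|]. intros z w. reflexivity. }
  exists S. split; [auto|].
  exists (fun q => snd q * scl m (snd q) (sg (fst (fst q) * snd (fst q)) (snd q))), (Rmin R2 (rho / 2)).
  assert (Z1 := Rmin_l R2 (rho / 2)). assert (Z2 := Rmin_r R2 (rho / 2)). set (e := Rmin R2 (rho / 2)) in *.
  split; [apply Rmin_pos; lra|]. split; [apply (segre_map_holomorphic m sg t1 rho R1 e); auto; lra|]. split.
  - intros z w Hz Hw. unfold cdisc in Hz, Hw. simpl fst. simpl snd. rewrite (Cmod_sq z).
    assert (P0 := pow2_ge_0 (Cmod z)). assert (Q0 := Cmod_ge_0 z).
    assert (Hz2 : (Cmod z ^ 2 < R2)%R) by (simpl; nra). assert (Hu : (Rabs (Re w) < rho / 2)%R) by (eapply Rle_lt_trans; [apply re_le_Cmod|lra]).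
    destruct (Hspec (RtoC (Cmod z ^ 2)) (Re w) ltac:(rewrite Cmod_R, Rabs_pos_eq; auto) ltac:(rewrite Cmod_R; auto)) as [_ [G2 [G3 [G4 _]]]].
    apply (hypersurface_equation m sg (H (RtoC (Cmod z ^ 2)) (Re w)) (Cmod z ^ 2) _ cap rho); auto; try lra.
    apply G4. rewrite Cmod_conj. lra.
  - intros z w xi eta Hz Hw Hxi Heta. unfold cdisc in *. unfold segre_variety, cdisc. simpl fst. simpl snd. rewrite ES1, ES2.
    rewrite HG by (simpl; lra). simpl fst. simpl snd. split; [intros [_ [_ [_ [_ E]]]]; exact E|]. intros E. repeat split; try lra. exact E.
Qed.

Theorem theorem3p15 (m : nat) (r : R) (P Q : C -> C)
    (hm : (1 <= m)%nat) (hr : (0 < r)%R)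
    (hE : admissible_ODE r P Q) :
  (has_positive_real_structure m r P Q <->
   exists (a b : nat -> R) (A A' B : C -> C),
     forall w : C, cdisc r w ->
       is_pseries (K := C_AbsRing) (V := C_NormedModule)
         (fun j => RtoC (a j)) w (A w) /\
       is_pseries (K := C_AbsRing) (V := C_NormedModule)
         (fun j => RtoC (b j)) w (B w) /\
       is_derive (K := C_AbsRing) (V := C_NormedModule) A w (A' w) /\
       P w = (2 * Ci * A w - INR m * w ^ (m - 1))%C /\
       Q w = (B w + Ci * w ^ m * A' w)%C) /\
  (forall M : C * C -> Prop,
     associated_hypersurface m r P Q M ->
     exists e : R, (0 < e)%R /\
       forall z w : C, cdisc e z -> cdisc e w -> M (z, w) -> w <> RtoC 0 ->
         levi_nondegenerate_at M (z, w) /\ spherical_at M (z, w)).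
Proof.
  assert (HP : hol r P) by (intros w Hw; destruct (hE w Hw) as [[l Hl] _]; exists l; apply is_derive_cder, Hl).
  assert (HQ : hol r Q) by (intros w Hw; destruct (hE w Hw) as [_ [l Hl]]; exists l; apply is_derive_cder, Hl).
  split; [split|].
  - intros [M HM]. exact (real_coefficients m r P Q M hm hr HP HQ HM).
  - intros [a [b [A [A' [B H]]]]]. apply real_form_of_series in H. exact (real_structure_of_real_form m r P Q A A' B hm hr HP HQ H).
  - intros M HM. destruct (real_coefficients m r P Q M hm hr HP HQ HM) as [a [b [A [A' [B H]]]]]. apply real_form_of_series in H.
    exact (nondegenerate_and_spherical m r P Q A A' B M hm hr HP HQ H HM).
Qed.
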